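(* Let $q\in\,]-1,1[\,\setminus\{0\}$ and let $\Gamma=\widehat{\mathrm{SU}_q(2)}$ be the discrete quantum group dual to $\mathbb{G}=\mathrm{SU}_q(2)$, with $\mathrm{Irr}(\Gamma)=\{\psi^{1,\rho}\,|\,\rho\in\mathbb{T}\}\sqcup\{\psi^{2,\lambda}\,|\,\lambda\in\mathbb{T}\}$. The Plancherel measure $\mu$ of $\Gamma$ equals $0$ on $\{\psi^{1,\rho}\,|\,\rho\in\mathbb{T}\}$ and the normalized Lebesgue measure on the second circle $\{\psi^{2,\lambda}\,|\,\lambda\in\mathbb{T}\}$; consequently $\mathrm{Irr}(\Gamma)$ is identified with $\mathbb{T}$. The operators $D_\lambda$ $(\lambda\in\mathbb{T})$ are given by \[ D_\lambda=(1-q^2)^{-\frac12}\,\mathrm{diag}(1,|q|^{-1},|q|^{-2},\dots)\qquad(\lambda\in\mathbb{T}) \] with respect to the basis $\{\phi_k\,|\,k\in\mathbb{Z}_+\}$ of $\mathsf{H}_\lambda=\ell^2(\mathbb{Z}_+)$. The operator $\mathcal{Q}_L$ is given by \[ \mathcal{Q}_L:L^2(\mathbb{G})\ni\Lambda_h(a)\mapsto\int^\oplus_{\mathrm{Irr}(\Gamma)}\psi^{2,\lambda}(a)D_\lambda^{-1}\,d\mu(\lambda)\in\int^\oplus_{\mathrm{Irr}(\Gamma)}\mathrm{HS}(\mathsf{H}_\lambda)\,d\mu(\lambda)\qquad(a\in C(\mathrm{SU}_q(2))). \] That is, these objects form Plancherel data for $\Gamma$.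
   Context: $\mathrm{SU}_q(2)$ is Woronowicz's compact quantum group: $C(\mathrm{SU}_q(2))$ is the universal unital $C^*$-algebra generated by $\alpha,\gamma$ with $\alpha^*\alpha+\gamma^*\gamma=\mathbb{1}$, $\alpha\alpha^*+q^2\gamma\gamma^*=\mathbb{1}$, $\gamma\gamma^*=\gamma^*\gamma$, $\alpha\gamma=q\gamma\alpha$, $\alpha\gamma^*=q\gamma^*\alpha$, with comultiplication $\Delta(\alpha)=\alpha\otimes\alpha-q\gamma^*\otimes\gamma$, $\Delta(\gamma)=\gamma\otimes\alpha+\alpha^*\otimes\gamma$. It is coamenable, its Haar state is denoted $h$ (GNS map $\Lambda_h$ into $L^2(\mathbb{G})$, modular conjugation $J_h$). $\Gamma=\widehat{\mathrm{SU}_q(2)}$ is its dual in the Kustermans–Vaes sense; it is second countable and type I, $\hat\Gamma=\mathbb{G}$, $L^2(\Gamma)=L^2(\mathbb{G})$, the Haar integrals of $\hat\Gamma$ are $h$, and $C_0^u(\hat\Gamma)=C(\mathrm{SU}_q(2))$. $\mathrm{Irr}(\Gamma)$ is the spectrum of $C(\mathrm{SU}_q(2))$. It consists of: one-dimensional representations $\psi^{1,\rho}$ $(\rho\in\mathbb{T})$, $\psi^{1,\rho}(\alpha)=\rho$, $\psi^{1,\rho}(\gamma)=0$; and representations $\psi^{2,\lambda}$ $(\lambda\in\mathbb{T})$ on $\mathsf{H}_\lambda=\ell^2(\mathbb{Z}_+)$ ($\mathbb{Z}_+=\{0,1,2,\dots\}$) with orthonormal basis $(\phi_k)_{k\in\mathbb{Z}_+}$: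 $\psi^{2,\lambda}(\alpha)\phi_k=\sqrt{1-q^{2k}}\,\phi_{k-1}$, $\psi^{2,\lambda}(\gamma)\phi_k=\lambda q^k\phi_k$ (with $\phi_{-n}=0$ for $n\geq1$); as a measurable space it is the disjoint union of two circles. Plancherel data (left version of Desmedt's theorem) for $\Gamma$: a standard measure $\mu$ on $\mathrm{Irr}(\Gamma)$, measurable fields of Hilbert spaces $\mathsf{H}_\pi$, of representations $\pi$ representing the classes, and of strictly positive selfadjoint operators $D_\pi$, and a unitary $\mathcal{Q}_L:L^2(\Gamma)\to\int^\oplus\mathrm{HS}(\mathsf{H}_\pi)d\mu(\pi)$, such that with $\mathrm{W}^\Gamma\in M(c_0(\Gamma)\otimes C(\mathrm{SU}_q(2)))$ the Kac–Takesaki operator of $\Gamma$, $\lambda^\Gamma(\omega)=(\omega\otimes\mathrm{id})\mathrm{W}^\Gamma$ and $U^\pi=(\mathrm{id}\otimes\pi)\mathrm{W}^\Gamma$: for all $\omega\in\ell^1(\Gamma)$ with $\Lambda_h(\lambda^\Gamma(\omega))$ defined (automatic since $h$ is a state), $(\omega\otimes\mathrm{id})(U^\pi)D_\pi^{-1}$ is Hilbert–Schmidt a.e. and $\mathcal{Q}_L\Lambda_h(\lambda^\Gamma(\omega))=\int^\oplus(\omega\otimes\mathrm{id})(U^\pi)D_\pi^{-1}d\mu(\pi)$; $\mathcal{Q}_L\lambda^\Gamma(\omega)=\big(\int^\oplus\pi(\lambda^\Gamma(\omega))\otimes\mathbb{1}_{\overline{\mathsf{H}_\pi}}d\mu(\pi)\big)\mathcal{Q}_L$;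 $\mathcal{Q}_L(\omega\otimes\mathrm{id})\big((J_h\otimes J_h)\mathrm{W}^{\Gamma*}(J_h\otimes J_h)\big)=\big(\int^\oplus\mathbb{1}_{\mathsf{H}_\pi}\otimes\pi^c(\lambda^\Gamma(\omega))d\mu(\pi)\big)\mathcal{Q}_L$, where $\pi^c(a)=\pi(R^{\mathbb{G}}(a))^{\mathsf T}$, $R^{\mathbb{G}}$ is the unitary antipode of $\mathrm{SU}_q(2)$ and $A^{\mathsf T}\overline\xi=\overline{A^*\xi}$; and $\mathcal{Q}_L$ maps the center of $L^\infty(\mathbb{G})$ into the diagonalisable operators. *)

(* Defs.v *)
From HB Require Import structures.
From mathcomp Require Import all_boot all_order all_algebra.
From mathcomp Require Import all_classical all_reals all_analysis.
From mathcomp Require Import measurable_realfun.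
From mathcomp Require Import complex.

Set Implicit Arguments.
Unset Strict Implicit.
Unset Printing Implicit Defensive.

Import Order.TTheory GRing.Theory Num.Theory numFieldNormedType.Exports.
Local Open Scope classical_set_scope.
Local Open Scope ring_scope.
Local Open Scope complex_scope.

(** * Hilbert spaces and C*-algebras *)

(* The inner product is linear in its second argument. *)
HB.mixin Record CompleteNormed_isHilbert (R : realType) H
    of CompleteNormedModule R[i] H := {
  dotp : H -> H -> R[i] ;
  dotp_linear : forall x, linear (dotp x : H -> R[i]^o) ;
  dotp_conj : forall x y, dotp y x = Num.conj (dotp x y) ;
  dotp_norm : forall x, dotp x x = `|x| ^+ 2
}.

#[short(type="hilbertType")]
HB.structure Definition Hilbert (R : realType) :=
  {H of CompleteNormedModule R[i] H & CompleteNormed_isHilbert R H}.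

(* Unital C*-algebras.  The product is not inherited from mathcomp's ring
   structures because Hierarchy-Builder cannot join these with the normed
   modules after the fact. *)
HB.mixin Record CompleteNormed_isCStar (R : realType) A
    of CompleteNormedModule R[i] A := {
  cone : A ;
  cmul : A -> A -> A ;
  adj : A -> A ;
  cmulA : associative cmul ;
  cmul1l : left_id cone cmul ;
  cmul1r : right_id cone cmul ;
  cmul_linear_r : forall x, linear (cmul x) ;
  cmul_linear_l : forall y, linear (cmul ^~ y) ;
  adj_semilinear : forall (k : R[i]) x y,
    adj (k *: x + y) = Num.conj k *: adj x + adj y ;
  adjK : involutive adj ;
  adjM : forall x y, adj (cmul x y) = cmul (adj y) (adj x) ;
  cmul_norm : forall x y, `|cmul x y| <= `|x| * `|y| ;
  cstar_norm : forall x, `|cmul (adj x) x| = `|x| ^+ 2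
}.

#[short(type="cstarType")]
HB.structure Definition CStar (R : realType) :=
  {A of CompleteNormedModule R[i] A & CompleteNormed_isCStar R A}.

Arguments cone {R s}.
Notation "a ** b" := (cmul a b) (at level 40, left associativity) : ring_scope.

Definition bounded_linear (R : realType) (V W : completeNormedModType R[i])
  (T : V -> W) : Prop := linear T /\ continuous T.

Definition lspan (R : realType) (V : lmodType R[i]) (S : set V) : set V :=
  [set x | exists (n : nat) (c : 'I_n -> R[i]) (v : 'I_n -> V),
     (forall i, S (v i)) /\ x = \sum_(i < n) c i *: v i].

Definition total_set (R : realType) (V : completeNormedModType R[i])
  (S : set V) : Prop := closure (lspan S) = setT.

Definition orthonormal_basis (R : realType) (H : hilbertType R)
    (b : nat -> H) : Prop :=
  (forall i j, dotp (b i) (b j) = (i == j)%:R) /\ total_set (range b).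

Definition unitary_map (R : realType) (H K : hilbertType R)
    (U : H -> K) : Prop :=
  [/\ linear U,
      forall x y, dotp (U x) (U y) = dotp x y &
      forall y, exists x, U x = y].

Definition antiunitary_involution (R : realType) (H : hilbertType R)
    (J : H -> H) : Prop :=
  [/\ forall (k : R[i]) x y, J (k *: x + y) = Num.conj k *: J x + J y,
      forall x y, dotp (J x) (J y) = dotp y x &
      involutive J].

(* [t] exhibits [L] as the Hilbert space tensor product of [H] and [K]. *)
Definition hilbert_tensor (R : realType) (H K L : hilbertType R)
    (t : H -> K -> L) : Prop :=
  [/\ forall x, linear (t x),
      forall y, linear (t ^~ y),
      forall x x' y y', dotp (t x y) (t x' y') = dotp x x' * dotp y y' &
      total_set [set z | exists x y, z = t x y]].

Definition commutant (R : realType) (H : hilbertType R)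
    (S : set (H -> H)) : set (H -> H) :=
  [set T | bounded_linear T /\
     forall s, S s -> forall v, T (s v) = s (T v)].

(* Unbounded operators are given by their graphs.  The second clause says
   that the graph of [D] is the graph of its adjoint. *)
Definition strictly_positive_selfadjoint (R : realType) (H : hilbertType R)
    (D : set (H * H)) : Prop :=
  [/\ forall x y y', D (x, y) -> D (x, y') -> y = y',
      forall u v, D (u, v) <->
        (forall x y, D (x, y) -> dotp u y = dotp v x),
      closure [set x | exists y, D (x, y)] = setT &
      forall x y, D (x, y) -> x != 0 -> 0 < dotp x y].

(* [diag(d 0, d 1, ...)] with respect to [b], on its maximal domain. *)
Definition diag_operator (R : realType) (H : hilbertType R) (b : nat -> H)
    (d : nat -> R) : set (H * H) :=
  [set p | forall k, dotp (b k) p.2 = (d k)%:C * dotp (b k) p.1].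

(** * Homomorphisms, representations, tensor products *)

Definition star_hom (R : realType) (A B : cstarType R) (f : A -> B) : Prop :=
  [/\ linear f, f cone = cone,
      forall a b, f (a ** b) = f a ** f b &
      forall a, f (adj a) = adj (f a)].

Definition representation (R : realType) (A : cstarType R)
    (H : hilbertType R) (p : A -> H -> H) : Prop :=
  [/\ forall a, bounded_linear (p a),
      forall (k : R[i]) a b v, p (k *: a + b) v = k *: p a v + p b v,
      forall v, p cone v = v,
      forall a b v, p (a ** b) v = p a (p b v) &
      forall a v w, dotp v (p (adj a) w) = dotp (p a v) w].

Definition faithful_representation (R : realType) (A : cstarType R)
    (H : hilbertType R) (p : A -> H -> H) : Prop :=
  representation p /\ injective p.

Definition irreducible_representation (R : realType) (A : cstarType R)
    (H : hilbertType R) (p : A -> H -> H) : Prop :=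
  [/\ representation p,
      exists v : H, v != 0 &
      forall V : set H, closed V -> lspan V `<=` V ->
        (forall a v, V v -> V (p a v)) -> V = [set 0] \/ V = setT].

Definition unitarily_equivalent (R : realType) (A : cstarType R)
    (H K : hilbertType R) (p : A -> H -> H) (p' : A -> K -> K) : Prop :=
  exists U : H -> K, unitary_map U /\ forall a v, U (p a v) = p' a (U v).

(* The family [rep] contains exactly one representative of each class in the
   spectrum of [A]. *)
Definition represents_spectrum (R : realType) (A : cstarType R) (X : Type)
    (H : X -> hilbertType R) (rep : forall x, A -> H x -> H x) : Prop :=
  [/\ forall x, irreducible_representation (rep x),
      forall x y, unitarily_equivalent (rep x) (rep y) -> x = y &
      forall (K : hilbertType R) (p : A -> K -> K),
        irreducible_representation p ->
        exists x, unitarily_equivalent (rep x) p].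

(* [T], with [i a = a (x) 1] and [j b = 1 (x) b], is the minimal (spatial)
   C*-tensor product of [A] and [B]. *)
Definition min_tensor (R : realType) (A B T : cstarType R)
    (i : A -> T) (j : B -> T) : Prop :=
  [/\ star_hom i, star_hom j,
      forall a b, i a ** j b = j b ** i a,
      total_set [set x | exists a b, x = i a ** j b] &
      exists (H K L : hilbertType R) (t : H -> K -> L)
             (p : A -> H -> H) (p' : B -> K -> K) (P : T -> L -> L),
        [/\ hilbert_tensor t,
            faithful_representation p, faithful_representation p',
            faithful_representation P &
            forall a b v w, P (i a ** j b) (t v w) = t (p a v) (p' b w)]].

(** * The compact quantum group SU_q(2) *)

Definition SUq2_relations (R : realType) (q : R) (A : cstarType R)
    (a c : A) : Prop :=
  [/\ adj a ** a + adj c ** c = cone,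
      a ** adj a + (q ^+ 2)%:C *: (c ** adj c) = cone,
      c ** adj c = adj c ** c,
      a ** c = q%:C *: (c ** a) &
      a ** adj c = q%:C *: (adj c ** a)].

Definition SUq2_universal (R : realType) (q : R) (A : cstarType R)
    (a c : A) : Prop :=
  SUq2_relations q a c /\
  forall (B : cstarType R) (a' c' : B), SUq2_relations q a' c' ->
    exists! f : A -> B, [/\ star_hom f, f a = a' & f c = c'].

(* The comultiplication takes values in [tens_alg], the tensor square of
   [fun_alg]; [leg1 a = a (x) 1] and [leg2 a = 1 (x) a]. *)
Record SUq2 (R : realType) (q : R) := {
  fun_alg :> cstarType R ;
  al : fun_alg ;
  ga : fun_alg ;
  fun_alg_universal : SUq2_universal q al ga ;
  tens_alg : cstarType R ;
  leg1 : fun_alg -> tens_alg ;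
  leg2 : fun_alg -> tens_alg ;
  tens_algP : min_tensor leg1 leg2 ;
  comult : fun_alg -> tens_alg ;
  comult_hom : star_hom comult ;
  comult_al : comult al =
    leg1 al ** leg2 al - q%:C *: (leg1 (adj ga) ** leg2 ga) ;
  comult_ga : comult ga = leg1 ga ** leg2 al + leg1 (adj al) ** leg2 ga
}.

Arguments al {R q G} : rename.
Arguments ga {R q G} : rename.
Arguments leg1 {R q G} : rename.
Arguments leg2 {R q G} : rename.
Arguments comult {R q G} : rename.

(* [E] and [E'] below are the slice maps [id (x) h] and [h (x) id]. *)
Definition haar_state (R : realType) (q : R) (G : SUq2 q)
    (h : G -> R[i]) : Prop :=
  [/\ linear (h : G -> R[i]^o),
      forall a, 0 <= h (adj a ** a),
      h cone = 1,
      exists E : tens_alg G -> G,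
        [/\ bounded_linear E,
            forall a b, E (leg1 a ** leg2 b) = h b *: a &
            forall a, E (comult a) = h a *: cone] &
      exists E' : tens_alg G -> G,
        [/\ bounded_linear E',
            forall a b, E' (leg1 a ** leg2 b) = h a *: b &
            forall a, E' (comult a) = h a *: cone]].

Definition gns (R : realType) (A : cstarType R) (h : A -> R[i])
    (H : hilbertType R) (Lam : A -> H) (p : A -> H -> H) : Prop :=
  [/\ linear Lam,
      forall a b, dotp (Lam a) (Lam b) = h (adj a ** b),
      closure (range Lam) = setT,
      representation p &
      forall a b, p a (Lam b) = Lam (a ** b)].

(* Polar decomposition [S = J P] of the closure [S] of
   [Lam a |-> Lam (adj a)], where [P] is the square root of the modular
   operator. *)
Definition modular_conjugation (R : realType) (A : cstarType R)
    (H : hilbertType R) (Lam : A -> H) (J : H -> H) : Prop :=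
  antiunitary_involution J /\
  exists P : set (H * H),
    strictly_positive_selfadjoint P /\
    closure [set p : H * H | exists a, p = (Lam a, Lam (adj a))]
      = [set p | exists y, P (p.1, y) /\ p.2 = J y].

(* Finite-dimensional unitary corepresentations. *)
Definition unitary_corep (R : realType) (q : R) (G : SUq2 q) (n : nat)
    (u : 'I_n -> 'I_n -> G) : Prop :=
  [/\ forall i j, comult (u i j) = \sum_k leg1 (u i k) ** leg2 (u k j),
      forall i j, \sum_k adj (u k i) ** u k j = (i == j)%:R *: cone &
      forall i j, \sum_k u i k ** adj (u j k) = (i == j)%:R *: cone].

Definition entire_function (R : realType) (A : cstarType R)
    (F : R[i] -> A) : Prop :=
  exists c : nat -> A, forall z, series (fun n => z ^+ n *: c n) @ \oo --> F z.

(* The antipode [S] is determined by [S (u i j) = adj (u j i)] for every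
   unitary corepresentation [u]; [Ra] is the unitary antipode when
   [S = Ra \o tau_(-i/2)] for a one-parameter group of automorphisms [tau]
   (the scaling group) commuting with [Ra].  [F] is the entire extension of
   [t |-> tau t (u i j)]. *)
Definition unitary_antipode (R : realType) (q : R) (G : SUq2 q)
    (Ra : G -> G) : Prop :=
  [/\ bounded_linear Ra,
      Ra cone = cone /\ forall a b, Ra (a ** b) = Ra b ** Ra a,
      forall a, Ra (adj a) = adj (Ra a),
      involutive Ra &
      exists tau : R -> G -> G,
        [/\ forall t, star_hom (tau t),
            (forall a, tau 0 a = a) /\
            forall s t a, tau (s + t) a = tau s (tau t a),
            forall a, continuous (fun t => tau t a),
            forall t a, tau t (Ra a) = Ra (tau t a) &
            forall (n : nat) (u : 'I_n -> 'I_n -> G), unitary_corep u ->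
              forall i j, exists F : R[i] -> G,
                [/\ entire_function F,
                    forall t : R, F t%:C = tau t (u i j) &
                    Ra (F (Complex 0 (- 2^-1))) = adj (u j i)]]].

(** * Normal functionals, the Kac-Takesaki operator *)

(* The functional [x |-> \sum_n <bra n, x (ket n)>].  Restrictions of these
   to a von Neumann algebra on [H] are exactly its normal functionals. *)
Record normal_functional (R : realType) (H : hilbertType R) := {
  bra : nat -> H ;
  ket : nat -> H ;
  bra_summable : (\sum_(0 <= n <oo) (complex.Re (`|bra n| ^+ 2))%:E < +oo)%E ;
  ket_summable : (\sum_(0 <= n <oo) (complex.Re (`|ket n| ^+ 2))%:E < +oo)%E
}.

(* [Y = (om (x) id) X]. *)
Definition is_slice (R : realType) (H L : hilbertType R) (t : H -> H -> L)
    (om : normal_functional H) (X : L -> L) (Y : H -> H) : Prop :=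
  bounded_linear Y /\
  forall v w,
    series (fun n => dotp (t (bra om n) v) (X (t (ket om n) w)) : R[i]^o)
      @ \oo --> (dotp v (Y w) : R[i]^o).

(* With [W] the left Kac-Takesaki operator of SU_q(2),
     W^* (Lam x (x) Lam y) = (Lam (x) Lam)(comult y (x (x) 1)),
   the operator of the dual is [V = fl W^* fl], [fl] being the flip.  [LL] is
   the GNS map [Lam (x) Lam]. *)
Definition dual_kac_takesaki (R : realType) (q : R) (G : SUq2 q)
    (H L : hilbertType R) (Lam : G -> H) (t : H -> H -> L)
    (V : L -> L) : Prop :=
  unitary_map V /\
  exists (LL : tens_alg G -> L) (fl : L -> L),
    [/\ bounded_linear LL,
        forall a b, LL (leg1 a ** leg2 b) = t (Lam a) (Lam b),
        unitary_map fl,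
        forall v w, fl (t v w) = t w v &
        forall x y, V (t (Lam y) (Lam x)) = fl (LL (comult y ** leg1 x))].

(* The objects attached to the dual of SU_q(2) on the GNS space [L2] of the
   Haar state: [WG] is the Kac-Takesaki operator of the dual, [WGadj] its
   adjoint, [modJJ] is [modJ (x) modJ].  [lamG om] is the element
   [(om (x) id) WG] of C(SU_q(2)), identified with the operator
   [lreg (lamG om)]. *)
Record dual_data (R : realType) (q : R) (G : SUq2 q) := {
  haar : G -> R[i] ;
  haarP : haar_state haar ;
  L2 : hilbertType R ;
  Lam : G -> L2 ;
  lreg : G -> L2 -> L2 ;
  gnsP : gns haar Lam lreg ;
  modJ : L2 -> L2 ;
  modJP : modular_conjugation Lam modJ ;
  uantip : G -> G ;
  uantipP : unitary_antipode uantip ;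
  L2L2 : hilbertType R ;
  tens : L2 -> L2 -> L2L2 ;
  tensP : hilbert_tensor tens ;
  modJJ : L2L2 -> L2L2 ;
  modJJP : antiunitary_involution modJJ /\
           forall v w, modJJ (tens v w) = tens (modJ v) (modJ w) ;
  WG : L2L2 -> L2L2 ;
  WGP : dual_kac_takesaki Lam tens WG ;
  WGadj : L2L2 -> L2L2 ;
  WGadjP : forall v w, dotp v (WG w) = dotp (WGadj v) w ;
  lamG : normal_functional L2 -> G ;
  lamGP : forall om, is_slice tens om WG (lreg (lamG om))
}.

Arguments lreg {R q G} d.
Arguments Lam {R q G} d.
Arguments uantip {R q G} d.
Arguments tens {R q G} d.
Arguments modJJ {R q G} d.
Arguments WGadj {R q G} d.
Arguments lamG {R q G} d.

Definition Linfty (R : realType) (q : R) (G : SUq2 q) (L : dual_data G) :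
    set (L2 L -> L2 L) := commutant (commutant (range (lreg L))).

Arguments Linfty {R q G} L.

(** * Direct integrals *)

Definition cmeasurable (R : realType) (d : measure_display)
    (X : measurableType d) (f : X -> R[i]) : Prop :=
  measurable_fun [set: X] (fun x => complex.Re (f x) : measurableTypeR R) /\
  measurable_fun [set: X] (fun x => complex.Im (f x) : measurableTypeR R).

(* [mu] is sigma-finite and, off a null set [N], the space [X] is Borel
   isomorphic to a Borel subset of the line. *)
Definition standard_measure (R : realType) (d : measure_display)
    (X : measurableType d) (mu : {measure set X -> \bar R}) : Prop :=
  sigma_finite [set: X] mu /\
  exists (N : set X) (f : X -> measurableTypeR R),
    [/\ measurable N, mu N = 0%E, measurable_fun [set: X] f,
        (forall x y, ~ N x -> ~ N y -> f x = f y -> x = y) &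
        forall B, measurable B -> measurable (f @` (B `\` N))].

(* A measurable field of Hilbert spaces, its measurable structure being given
   by a measurable field of orthonormal bases: the nonzero [e n x] form an
   orthonormal basis of [H x]. *)
Definition measurable_hilbert_field (R : realType) (d : measure_display)
    (X : measurableType d) (H : X -> hilbertType R)
    (e : nat -> forall x, H x) : Prop :=
  [/\ forall n m, cmeasurable (fun x => dotp (e n x) (e m x)),
      forall x n m, n != m -> dotp (e n x) (e m x) = 0,
      forall x n, e n x = 0 \/ `|e n x| = 1 &
      forall x, total_set (range (fun n => e n x))].

Definition measurable_operator_field (R : realType) (d : measure_display)
    (X : measurableType d) (H : X -> hilbertType R)
    (e : nat -> forall x, H x) (T : forall x, H x -> H x) : Prop :=
  forall n m, cmeasurable (fun x => dotp (e n x) (T x (e m x))).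

(* Measurability of a field of positive selfadjoint operators; [r x] is
   [(1 + D x)^-1]. *)
Definition measurable_positive_field (R : realType) (d : measure_display)
    (X : measurableType d) (H : X -> hilbertType R)
    (e : nat -> forall x, H x) (D : forall x, set (H x * H x)) : Prop :=
  exists r : forall x, H x -> H x,
    (forall x v, D x (r x v, v - r x v)) /\ measurable_operator_field e r.

(* Squared Hilbert-Schmidt norm, [b] being an orthonormal basis possibly
   padded with zero vectors. *)
Definition hs_norm2 (R : realType) (H : hilbertType R) (b : nat -> H)
    (T : H -> H) : \bar R :=
  (\sum_(0 <= n <oo) (complex.Re (`|T (b n)| ^+ 2))%:E)%E.

Definition hilbert_schmidt (R : realType) (H : hilbertType R) (b : nat -> H)
    (T : H -> H) : Prop :=
  bounded_linear T /\ (hs_norm2 b T < +oo)%E.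

(* Square integrable fields of Hilbert-Schmidt operators.  Vectors of the
   direct integral of the HS(H x) are such fields up to equality a.e. *)
Definition hs_direct_integral (R : realType) (d : measure_display)
    (X : measurableType d) (mu : {measure set X -> \bar R})
    (H : X -> hilbertType R) (e : nat -> forall x, H x) :
    set (forall x, H x -> H x) :=
  [set T | [/\ forall x, hilbert_schmidt (fun n => e n x) (T x),
               measurable_operator_field e T &
               (\int[mu]_x hs_norm2 (fun n => e n x) (T x) < +oo)%E]].

Definition ae_eq_field (R : realType) (d : measure_display)
    (X : measurableType d) (mu : {measure set X -> \bar R})
    (H : X -> hilbertType R) (T T' : forall x, H x -> H x) : Prop :=
  {ae mu, forall x, forall v, T x v = T' x v}.

(* [Q] is a unitary onto the direct integral, given by representatives. *)
Definition unitary_onto_direct_integral (R : realType) (d : measure_display)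
    (X : measurableType d) (mu : {measure set X -> \bar R})
    (H : X -> hilbertType R) (e : nat -> forall x, H x)
    (K : hilbertType R) (Q : K -> forall x, H x -> H x) : Prop :=
  [/\ forall xi, hs_direct_integral mu e (Q xi),
      forall (k : R[i]) xi eta, ae_eq_field mu (Q (k *: xi + eta))
        (fun x v => k *: Q xi x v + Q eta x v),
      forall xi, (\int[mu]_x hs_norm2 (fun n => e n x) (Q xi x)
        = (complex.Re (`|xi| ^+ 2))%:E)%E &
      forall T, hs_direct_integral mu e T ->
        exists xi, ae_eq_field mu (Q xi) T].

(* [T] is the Hilbert-Schmidt operator [B D^-1]: it agrees with it on the
   domain of [D^-1], which is the dense range of [D]. *)
Definition hs_mul_inv (R : realType) (H : hilbertType R) (b : nat -> H)
    (D : set (H * H)) (B T : H -> H) : Prop :=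
  hilbert_schmidt b T /\ forall v w, D (v, w) -> T w = B v.

(** * Plancherel data for the dual of SU_q(2) *)

(* HS(H) is the tensor product of [H] with its conjugate: [a (x) 1] is left
   multiplication by [a], and [1 (x) B^T] is right multiplication by [B].
   [(om (x) id) U^pi] is [pi (lamG om)]. *)
Record plancherel_data (R : realType) (q : R) (G : SUq2 q) (L : dual_data G)
    (d : measure_display) (X : measurableType d)
    (mu : {measure set X -> \bar R}) (H : X -> hilbertType R)
    (e : nat -> forall x, H x) (rep : forall x, G -> H x -> H x)
    (D : forall x, set (H x * H x)) (Q : L2 L -> forall x, H x -> H x) :
    Prop := {
  pd_standard : standard_measure mu ;
  pd_spectrum : represents_spectrum rep ;
  pd_field : measurable_hilbert_field e ;
  pd_rep : forall a, measurable_operator_field e (fun x => rep x a) ;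
  pd_positive : forall x, strictly_positive_selfadjoint (D x) ;
  pd_measurable : measurable_positive_field e D ;
  pd_unitary : unitary_onto_direct_integral mu e Q ;
  pd_formula : forall om, {ae mu, forall x,
    hs_mul_inv (fun n => e n x) (D x) (rep x (lamG L om))
      (Q (Lam L (lamG L om)) x)} ;
  pd_left : forall om xi,
    ae_eq_field mu (Q (lreg L (lamG L om) xi))
      (fun x v => rep x (lamG L om) (Q xi x v)) ;
  pd_right : forall om Y,
    is_slice (tens L) om (fun z => modJJ L (WGadj L (modJJ L z))) Y ->
    forall xi, ae_eq_field mu (Q (Y xi))
      (fun x v => Q xi x (rep x (uantip L (lamG L om)) v)) ;
  pd_center : forall z, Linfty L z -> commutant (Linfty L) z ->
    exists f : X -> R[i],
      [/\ cmeasurable f, exists M, forall x, `|f x| <= M &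
          forall xi, ae_eq_field mu (Q (z xi)) (fun x v => f x *: Q xi x v)]
}.

(** * The circle and the spectrum of C(SU_q(2)) *)

Record circle (R : realType) := Circle {
  circle_val :> R[i] ;
  circle_norm : `|circle_val| == 1
}.

Definition circle_coord (R : realType) (z : circle R) :
    measurableTypeR R * measurableTypeR R := (complex.Re z, complex.Im z).

Fact circle_display : measure_display. Proof. exact: default_measure_display. Qed.

Section circle.
Context (R : realType).

Fact circle1 : `|1 : R[i]| == 1. Proof. by rewrite normr1. Qed.

HB.instance Definition _ := [isSub for @circle_val R].
HB.instance Definition _ := [Choice of circle R by <:].
HB.instance Definition _ := isPointed.Build (circle R) (Circle circle1).

(* The Borel subsets of the circle are the traces of those of the plane. *)
Let circle_measurable := preimage_set_system setT (@circle_coord R) measurable.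

Let circle_sigma : sigma_algebra setT circle_measurable.
Proof. exact/sigma_algebra_preimage/sigma_algebra_measurable. Qed.

Let circle0 : circle_measurable set0. Proof. by case: circle_sigma. Qed.

Let circleC B : circle_measurable B -> circle_measurable (~` B).
Proof. by case: circle_sigma => _ + _ => /[apply]; rewrite setTD. Qed.

Let circle_bigcup (F : (set (circle R))^nat) :
  (forall i, circle_measurable (F i)) ->
  circle_measurable (\bigcup_i (F i)).
Proof. by case: circle_sigma => _ _; apply. Qed.

HB.instance Definition _ := @isMeasurable.Build circle_display (circle R)
  circle_measurable circle0 circleC circle_bigcup.

End circle.

(* The two circles of one-dimensional ([inl]) and infinite-dimensional
   ([inr]) irreducible representations. *)
Definition Irr (R : realType) : Type := (circle R + circle R)%type.

Fact Irr_display : measure_display. Proof. exact: default_measure_display. Qed.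

Section Irr.
Context (R : realType).

HB.instance Definition _ := Choice.copy (Irr R) (circle R + circle R)%type.
HB.instance Definition _ := isPointed.Build (Irr R) (inl point).

(* The sigma-algebra of the disjoint union. *)
Let Irr_measurable : set (set (Irr R)) :=
  [set B | measurable ((inl : circle R -> Irr R) @^-1` B) /\
           measurable ((inr : circle R -> Irr R) @^-1` B)].

Let Irr0 : Irr_measurable set0.
Proof. by split; rewrite preimage_set0. Qed.

Let IrrC B : Irr_measurable B -> Irr_measurable (~` B).
Proof. by move=> [? ?]; split; rewrite -preimage_setC; exact: measurableC. Qed.

Let Irr_bigcup (F : (set (Irr R))^nat) :
  (forall i, Irr_measurable (F i)) -> Irr_measurable (\bigcup_i (F i)).
Proof.
by move=> mF; split; rewrite preimage_bigcup; apply: bigcup_measurable => i _;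
  case: (mF i).
Qed.

HB.instance Definition _ := @isMeasurable.Build Irr_display (Irr R)
  Irr_measurable Irr0 IrrC Irr_bigcup.

End Irr.

(** * Plancherel data of the dual of SU_q(2) *)

Section Plancherel_measure.
Context (R : realType).

Fact circle_exp_subproof (t : R) :
  `|Complex (cos (2 * pi * t)) (sin (2 * pi * t))| == 1.
Proof. by rewrite normc_def /= cos2Dsin2 sqrtr1. Qed.

Definition circle_exp (t : measurableTypeR R) : circle R :=
  Circle (circle_exp_subproof t).

Fact measurable_circle_exp : measurable_fun [set: measurableTypeR R] circle_exp.
Proof.
move=> _ B [C mC <-]; rewrite !setTI -[X in measurable X]setTI -comp_preimage.
suff mf : measurable_fun [set: measurableTypeR R] (@circle_coord R \o circle_exp).
  exact: mf.
have ml : measurable_fun [set: measurableTypeR R]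
    (fun t : measurableTypeR R => 2 * pi * t : measurableTypeR R).
  by apply: continuous_measurable_fun; exact: mulrl_continuous.
apply: measurable_fun_pair.
- apply: (measurableT_comp _ ml).
  by apply: continuous_measurable_fun; exact: continuous_cos.
- apply: (measurableT_comp _ ml).
  by apply: continuous_measurable_fun; exact: continuous_sin.
Qed.

HB.instance Definition _ :=
  isMeasurableFun.Build _ _ _ _ circle_exp measurable_circle_exp.

Definition Irr2 (la : circle R) : Irr R := inr la.

Fact measurable_Irr2 : measurable_fun [set: circle R] Irr2.
Proof. by move=> _ B [_ mB]; rewrite setTI. Qed.

HB.instance Definition _ :=
  isMeasurableFun.Build _ _ _ _ Irr2 measurable_Irr2.

(* Normalized Lebesgue measure: the law of [exp (2 i pi t)] for [t] uniform on
   [[0, 1]]. *)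
Definition circle_lebesgue : probability (circle R) R :=
  distribution (uniform_prob (@ltr01 R)) circle_exp.

(* Zero on the first circle, normalized Lebesgue measure on the second. *)
Definition Plancherel_measure : probability (Irr R) R :=
  distribution circle_lebesgue Irr2.

End Plancherel_measure.

Definition is_psi1 (R : realType) (q : R) (G : SUq2 q) (H : hilbertType R)
    (rho : circle R) (p : G -> H -> H) : Prop :=
  representation p /\
  forall v, p al v = (rho : R[i]) *: v /\ p ga v = 0.

Definition is_psi2 (R : realType) (q : R) (G : SUq2 q) (H : hilbertType R)
    (phi : nat -> H) (la : circle R) (p : G -> H -> H) : Prop :=
  representation p /\
  forall k,
    p al (phi k) = (Num.sqrt (1 - q ^+ (2 * k)))%:C *:
                     (if k is j.+1 then phi j else 0) /\
    p ga (phi k) = ((la : R[i]) * (q ^+ k)%:C) *: phi k.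

Definition Irr_space (R : realType) (H1 H2 : hilbertType R) (x : Irr R) :
    hilbertType R :=
  match x with inl _ => H1 | inr _ => H2 end.

Definition Irr_basis (R : realType) (H1 H2 : hilbertType R) (one : H1)
    (phi : nat -> H2) (n : nat) (x : Irr R) : Irr_space H1 H2 x :=
  match x with
  | inl _ => if n == 0%N then one else 0
  | inr _ => phi n
  end.

Definition Irr_rep (R : realType) (q : R) (G : SUq2 q)
    (H1 H2 : hilbertType R) (psi1 : circle R -> G -> H1 -> H1)
    (psi2 : circle R -> G -> H2 -> H2) (x : Irr R) :
    G -> Irr_space H1 H2 x -> Irr_space H1 H2 x :=
  match x with inl rho => psi1 rho | inr la => psi2 la end.

(* The value on the first circle, which is a null set, is irrelevant; the
   identity is taken there. *)
Definition Irr_D (R : realType) (q : R) (H1 H2 : hilbertType R)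
    (phi : nat -> H2) (x : Irr R) :
    set (Irr_space H1 H2 x * Irr_space H1 H2 x) :=
  match x with
  | inl _ => [set p | p.2 = p.1]
  | inr _ => diag_operator phi
               (fun k => (Num.sqrt (1 - q ^+ 2))^-1 * `|q| ^- k)
  end.

Arguments Irr_basis {R H1 H2} one phi n x.
Arguments Irr_rep {R q G H1 H2} psi1 psi2 x _ _.
Arguments Irr_D {R} q {H1 H2} phi x _.

(* Main.v *)
Require Import Defs.
From mathcomp Require Import all_boot all_order all_algebra.
From mathcomp Require Import all_classical all_reals all_analysis.
From mathcomp Require Import complex.
From HB Require Import structures.
From mathcomp Require Import measurable_realfun.
From mathcomp Require Import ring lra zify.

Set Implicit Arguments.
Unset Strict Implicit.
Unset Printing Implicit Defensive.

Import Order.TTheory GRing.Theory Num.Theory numFieldNormedType.Exports.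
Local Open Scope classical_set_scope.
Local Open Scope ring_scope.

(* Let [x = gamma (adj gamma)] and let [S] be the operator with eigenvalues
   [(1 - q^2)^(1/2) |q|^k] on [phi_k], that is, [D^-1].  The Haar state is
     [h(y) = int Tr(S psi_la(y) S) dla].
   Indeed the one-dimensional representations show that [h] kills the
   coefficients of nonzero weight, so [h] is determined by the moments [h(x^n)];
   slicing [comult (gamma^n gamma^*n)] gives [h(x^n) = h(alpha^n alpha^*n)], and
   expanding [alpha^n alpha^*n] in powers of [x] makes this a recursion, which
   the right-hand side also satisfies by telescoping.  Hence
   [Lam y |-> psi_la(y) D^-1] is isometric.  It is onto: [x^n] tends to the
   projection onto [phi_0], from which multiplication by [alpha], [gamma] and
   their adjoints produces all matrix units with coefficients [la^m], and
   trigonometric polynomials are dense in L2 of the circle.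

   Left multiplication by [y] becomes left multiplication by [psi_la(y)].  On
   coefficients [u_ij] of tensor powers of the fundamental corepresentation, the
   trace formula gives the KMS relation
     [h(y u_ij) = |q|^(w_i + w_j) h(u_ij y)],
   so [J Lam(u_ij)] is a multiple of [Lam(adj u_ij)], and [J (adj y) J] becomes right
   multiplication by [psi_la(y)].  The unitary antipode is computed on [u_ij]
   from the scaling group with Liouville's theorem, and intertwines the
   Kac-Takesaki operator with the conjugations, which gives the right-handed
   formula.  A central operator commutes with both multiplications, hence acts
   on the matrix unit at [phi_0] as a scalar function of [la], and therefore
   everywhere. *)

(** The Haar state, the modular conjugation and the unitary antipode are given only by
    characterising properties, so their values have to be derived. The computations are made on the
    matrix coefficients of tensor powers of the fundamental corepresentation because their span is
    dense by the universal property, the comultiplication is a finite sum on them, and their row and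
    column weights under the circle of one-dimensional representations turn every modular object
    into a scalar. These scalars dictate the eigenvalues of D^-1 up to a constant, and 1 - q^2
    normalises the sum of their squares to 1. Analytic continuation to -i/2 selects the positive
    root |q| of q^2, which is how the sign of q enters the unitary antipode of gamma. Vectors of the
    direct integral are fields up to null sets and do not form a given Hilbert space. The transform
    is therefore first a relation [rel], the closure of the graph of the isometry; representatives
    are chosen only at the end. Completeness of the space of fields is proved for rapidly convergent
    sequences, which converge fibre by fibre. *)

Section LinearProp.
Variables (K : nzRingType) (V W : lmodType K) (T : V -> W).
Hypothesis lT : linear T.

Lemma lin0 : T 0 = 0.
Proof.
have := lT 1 0 0; rewrite !scale1r addr0 => /eqP.
by rewrite -subr_eq subrr eq_sym => /eqP.
Qed.

Lemma linD x y : T (x + y) = T x + T y.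
Proof. by have := lT 1 x y; rewrite !scale1r. Qed.

Lemma linZ k x : T (k *: x) = k *: T x.
Proof. by have := lT k x 0; rewrite !addr0 lin0 addr0. Qed.

Lemma linN x : T (- x) = - T x.
Proof. by rewrite -scaleN1r linZ scaleN1r. Qed.

Lemma linB x y : T (x - y) = T x - T y.
Proof. by rewrite linD linN. Qed.

Lemma lin_sum (I : Type) (r : seq I) (P : pred I) (F : I -> V) :
  T (\sum_(i <- r | P i) F i) = \sum_(i <- r | P i) T (F i).
Proof. by apply: (big_morph T linD lin0). Qed.

End LinearProp.

(** * Real-valued norms, limits and bounded linear maps *)

Section NormBasics.
Variable R : realType.
Local Notation C := R[i].

(** Norms take values in [R[i]]; passing to the real part makes square roots, real limits and order
    arguments available. *)
Definition nm (V : normedZmodType C) (x : V) : R := complex.Re `|x|.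

Lemma nmE (V : normedZmodType C) (x : V) : `|x| = ((nm x)%:C)%C.
Proof. by rewrite /nm RRe_real// normr_real. Qed.

Lemma nm_ge0 (V : normedZmodType C) (x : V) : 0 <= nm x.
Proof. by rewrite -ler0c -nmE. Qed.

Lemma nm0 (V : normedZmodType C) : nm (0 : V) = 0.
Proof. by rewrite /nm normr0. Qed.

Lemma nm_eq0 (V : normedZmodType C) (x : V) : (nm x == 0) = (x == 0).
Proof.
rewrite -(normr_eq0 x) nmE; apply/eqP/eqP => [->//|h].
by have := congr1 (@complex.Re R) h.
Qed.

Lemma nmN (V : normedZmodType C) (x : V) : nm (- x) = nm x.
Proof. by rewrite /nm normrN. Qed.

Lemma nmB (V : normedZmodType C) (x y : V) : nm (x - y) = nm (y - x).
Proof. by rewrite -nmN opprB. Qed.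

Lemma nmD (V : normedZmodType C) (x y : V) : nm (x + y) <= nm x + nm y.
Proof. by rewrite -lecR rmorphD /= -!nmE ler_normD. Qed.

Lemma nmBD (V : normedZmodType C) (z x y : V) : nm (x - y) <= nm (x - z) + nm (z - y).
Proof. by apply: le_trans (nmD _ _); rewrite addrA subrK. Qed.

Lemma nmZ (V : normedModType C) (k : C) (x : V) : nm (k *: x) = nm k * nm x.
Proof. by apply: (@complexI R); rewrite rmorphM /= -!nmE normrZ. Qed.

Lemma nmM (k l : C) : nm (k * l) = nm k * nm l.
Proof. by apply: (@complexI R); rewrite rmorphM /= -!nmE normrM. Qed.

Lemma nmX (k : C) n : nm (k ^+ n) = nm k ^+ n.
Proof.
elim: n => [|n IH]; last by rewrite !exprS nmM IH.
by rewrite !expr0 /nm normr1.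
Qed.

Lemma nmV (k : C) : nm k^-1 = (nm k)^-1.
Proof. by apply: (@complexI R); rewrite -nmE normfV nmE fmorphV. Qed.

Lemma nm1 : nm (1 : C) = 1. Proof. by rewrite /nm normr1. Qed.

Lemma nmR (a : R) : nm (a%:C)%C = `|a|.
Proof. by rewrite /nm normc_def /= expr0n addr0 sqrtr_sqr. Qed.

Lemma nmJ (k : C) : nm (Num.conj k) = nm k.
Proof. by rewrite /nm norm_conjC. Qed.

Lemma nm_sum (V : normedZmodType C) (I : Type) (r : seq I) (P : pred I) (F : I -> V) :
  nm (\sum_(i <- r | P i) F i) <= \sum_(i <- r | P i) nm (F i).
Proof.
elim/big_rec2: _ => [|i y1 y2 _ h]; first by rewrite nm0.
by apply: le_trans (nmD _ _) _; rewrite lerD2l.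
Qed.

Lemma nmRe (k : C) : `|complex.Re k| <= nm k.
Proof. by rewrite -lecR -nmE normc_ge_Re. Qed.

Lemma nm_sqr (k : C) : nm k ^+ 2 = complex.Re k ^+ 2 + complex.Im k ^+ 2.
Proof. by apply: (@complexI R); rewrite rmorphXn /= -nmE add_Re2_Im2. Qed.

Lemma nmIm (k : C) : `|complex.Im k| <= nm k.
Proof.
rewrite -(@ler_pXn2r _ 2)// ?nnegrE ?nm_ge0// nm_sqr real_normK ?num_real//.
by rewrite lerDr sqr_ge0.
Qed.

Lemma nm_ReIm (k : C) : nm k <= `|complex.Re k| + `|complex.Im k|.
Proof.
rewrite -(@ler_pXn2r _ 2)// ?nnegrE ?nm_ge0 ?addr_ge0// nm_sqr sqrrD.
by rewrite !real_normK ?num_real// -addrA lerD2l lerDr mulrn_wge0.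
Qed.

Lemma cvg_nm (V : normedModType C) (x : nat -> V) l :
  x @ \oo --> l <-> (fun n => nm (x n - l)) @ \oo --> (0 : R).
Proof.
split=> [/cvgrPdist_lt xl | /cvgrPdist_lt xl].
- apply/cvgrPdist_lt => e e0.
  have /xl : (0 : C) < (e%:C)%C by rewrite ltcR.
  apply: filterS => n; rewrite sub0r normrN ger0_norm ?nm_ge0// nmE ltcR.
  by rewrite nmB.
- apply/cvgrPdist_lt => e e0.
  have eR : e = ((complex.Re e)%:C)%C by rewrite RRe_real// gtr0_real.
  have /xl : 0 < complex.Re e by rewrite -ltcR -eR.
  apply: filterS => n; rewrite sub0r normrN ger0_norm ?nm_ge0// nmB => h.
  by rewrite nmE eR ltcR.
Qed.

Lemma cvg_nmP (V : normedModType C) (x : nat -> V) l :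
  x @ \oo --> l <->
  forall e : R, 0 < e -> exists N, forall n, (N <= n)%N -> nm (x n - l) < e.
Proof.
rewrite cvg_nm; split.
  move=> /cvgrPdist_lt h e /h [N _ hN]; exists N => n Nn.
  by have := hN n Nn; rewrite /= sub0r normrN ger0_norm ?nm_ge0.
move=> h; apply/cvgrPdist_lt => e /h [N hN]; exists N => // n Nn /=.
by rewrite sub0r normrN ger0_norm ?nm_ge0// hN.
Qed.

Lemma closure_nm (V : normedModType C) (S : set V) x :
  closure S x <-> forall e : R, 0 < e -> exists2 y, S y & nm (x - y) < e.
Proof.
split=> [cS e e0|h B].
  have /cS [y [Sy]] : nbhs x (ball x ((e%:C)%C : C)).
    by apply: nbhsx_ballx; rewrite ltcR.
  rewrite -ball_normE /ball_ /= nmE ltcR => xy; by exists y.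
move=> /nbhs_ballP [e /= e0 hB].
have eR : e = ((complex.Re e)%:C)%C by rewrite RRe_real// gtr0_real.
have /h [y Sy xy] : 0 < complex.Re e by rewrite -ltcR -eR.
by exists y; split => //; apply: hB; rewrite -ball_normE /ball_ /= nmE eR ltcR.
Qed.

Lemma closure_seq (V : normedModType C) (S : set V) x :
  closure S x -> exists2 u : nat -> V, (forall n, S (u n)) & u @ \oo --> x.
Proof.
move=> /closure_nm h.
have {}h n : exists y, S y /\ nm (x - y) < n.+1%:R^-1.
  by have [|y ? ?] := h n.+1%:R^-1; [rewrite invr_gt0|exists y].
have [u hu] := choice h; exists u => [n|]; first by case: (hu n).
apply/cvg_nm; apply/cvgrPdist_lt => e e0.
have := @cvg_harmonic R => /cvgrPdist_lt /(_ e e0); apply: filterS => n.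
rewrite !sub0r !normrN ger0_norm; last by rewrite harmonic_ge0.
rewrite ger0_norm ?nm_ge0// nmB /harmonic /=; apply: lt_trans.
by have [] := hu n.
Qed.

Lemma complete_nm (V : completeNormedModType C) (x : nat -> V) :
  (forall e : R, 0 < e -> exists N, forall n m, (N <= n)%N -> (N <= m)%N ->
     nm (x n - x m) < e) ->
  exists l : V, x @ \oo --> l.
Proof.
move=> h; suff : cvg (x @ \oo) by move=> /cvg_ex [l xl]; exists l.
apply/cauchy_cvgP/cauchyP => e e0.
have eR : e = ((complex.Re e)%:C)%C by rewrite RRe_real// gtr0_real.
have /h [N hN] : 0 < complex.Re e by rewrite -ltcR -eR.
exists (x N); exists N => // n /= Nn.
by rewrite -ball_normE /ball_ /= nmE eR ltcR hN.
Qed.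

(** The explicit rate accompanies the limit because [fast_cvg] and [in_image_clos] need it. *)
Lemma geo_complete (V : completeNormedModType C) (x : nat -> V) (K r : R) :
  0 <= r -> r < 1 -> (forall n, nm (x n.+1 - x n) <= K * r ^+ n) ->
  exists2 l : V, x @ \oo --> l & forall n, nm (l - x n) <= K * r ^+ n / (1 - r).
Proof.
move=> r0 r1 hx.
have K0 : 0 <= K.
  by have := hx 0%N; rewrite expr0 mulr1; apply: le_trans; exact: nm_ge0.
have r1' : 0 < 1 - r by rewrite subr_gt0.
(* The exact partial geometric sum is carried along, since the bound without the factor [1 - r ^+ k]
   is not stable under the induction. *)
have hd n k : nm (x (n + k)%N - x n) <= K * r ^+ n / (1 - r) * (1 - r ^+ k).
  elim: k => [|k IH]; first by rewrite addn0 subrr nm0 expr0 subrr mulr0.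
  apply: le_trans (nmBD (x (n + k)%N) _ _) _; rewrite addnS.
  apply: le_trans (lerD (hx _) IH) _; rewrite exprD exprS le_eqVlt; apply/orP.
  left; apply/eqP; field; lra.
have hd' n k : nm (x (n + k)%N - x n) <= K * r ^+ n / (1 - r).
  apply: le_trans (hd _ _) _; rewrite ler_piMr//.
    by rewrite divr_ge0 ?mulr_ge0 ?exprn_ge0 // ltW.
  by rewrite lerBlDr lerDl exprn_ge0.
have cv0 : (fun n => K * r ^+ n / (1 - r)) @ \oo --> (0 : R).
  have -> : (0 : R) = K * 0 / (1 - r) by rewrite mulr0 mul0r.
  by apply: cvgMl; apply: cvgMr; apply: cvg_expr; rewrite ger0_norm.
have [l xl] : exists l : V, x @ \oo --> l.
  apply: complete_nm => e e0.
  have /cvgrPdist_lt /(_ (e / 2)) [|N _ hN] := cv0; first by rewrite divr_gt0.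
  exists N => n m Nn Nm; apply: le_lt_trans (nmBD (x N) _ _) _.
  rewrite (splitr e) (nmB (x N)).
  have := hN N (leqnn N); rewrite /= sub0r normrN => hN'.
  have {}hN' := le_lt_trans (ler_norm _) hN'.
  by apply: ltrD; [rewrite -(subnKC Nn)|rewrite -(subnKC Nm)];
    exact: le_lt_trans (hd' _ _) hN'.
exists l => // n.
apply/ler_addgt0Pr => e e0.
have /cvg_nmP /(_ e e0) [N hN] := xl.
apply: le_trans (nmBD (x (n + N)%N) _ _) _; rewrite addrC lerD//.
by rewrite nmB ltW// hN// leq_addl.
Qed.

Lemma blP (V W : completeNormedModType C) (T : V -> W) :
  bounded_linear T <->
  linear T /\ exists2 K : R, 0 <= K & forall v, nm (T v) <= K * nm v.
Proof.
split=> [[lT cT]|[lT [K K0 hK]]]; last first.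
  split=> // v; apply/cvgrPdist_lt => e e0.
  have eR : e = ((complex.Re e)%:C)%C by rewrite RRe_real// gtr0_real.
  have e0' : 0 < complex.Re e by rewrite -ltcR -eR.
  have K1 : 0 < K + 1 by rewrite ltr_wpDl.
  have d0 : (0 : C) < ((complex.Re e / (K + 1))%:C)%C by rewrite ltcR divr_gt0.
  have := nbhsx_ballx v _ d0; apply: filterS => w.
  rewrite -ball_normE /ball_ /= nmE ltcR => vw.
  rewrite -(linB lT) nmE eR ltcR; apply: le_lt_trans (hK _) _.
  move: vw; rewrite ltr_pdivlMr// => vw; apply: le_lt_trans vw.
  by rewrite mulrC ler_wpM2l ?nm_ge0// lerDl.
split=> //.
have T0 := lin0 lT.
have /cvgrPdist_lt /(_ 1 ltr01) := cT 0.
rewrite T0 => /nbhs_ballP [d /= d0 hd].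
have dR : d = ((complex.Re d)%:C)%C by rewrite RRe_real// gtr0_real.
have d0' : 0 < complex.Re d by rewrite -ltcR -dR.
exists (2 / complex.Re d) => [|v]; first by rewrite divr_ge0// ltW.
have [->|v0] := eqVneq v 0; first by rewrite T0 !nm0 mulr0.
have nv0 : 0 < nm v by rewrite lt_def nm_eq0 v0 nm_ge0.
(* This factor rescales [v] to norm [d / 2], strictly inside the ball on which [T] has norm less
   than 1; hence the constant [2 / d]. *)
set k : R := complex.Re d / 2 / nm v.
have k0 : 0 < k by rewrite !divr_gt0.
have : ball (0 : V) d ((k%:C)%C *: v).
  rewrite -ball_normE /ball_ /= sub0r normrN nmE dR ltcR nmZ nmR gtr0_norm//.
  by rewrite /k divfK ?gt_eqF// gtr_pMr// invf_lt1 ?ltr1n.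
move=> /hd /=; rewrite sub0r normrN (linZ lT) nmE nmZ nmR gtr0_norm// -[1]/((1%:C)%C) ltcR.
move=> h; apply: ltW; have -> : 2 / complex.Re d * nm v = k^-1.
  by rewrite /k; field; rewrite ?gt_eqF// mulf_neq0 ?gt_eqF.
by rewrite -[k^-1]mulr1 ltr_pdivlMl.
Qed.

End NormBasics.

(** * Hilbert spaces and Hilbert-Schmidt operators *)

Section Total.
Variable R : realType.
Local Notation C := R[i].

Lemma cvg_seq_eq (T : topologicalType) (u v : nat -> T) (l : T) :
  (forall n, u n = v n) -> u @ \oo --> l -> v @ \oo --> l.
Proof. by move=> /funext ->. Qed.

Lemma lspan_ind (V : lmodType C) (S P : set V) :
  P 0 -> (forall k x y, P x -> P y -> P (k *: x + y)) -> S `<=` P ->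
  lspan S `<=` P.
Proof.
move=> P0 PD SP x [n [c [v [Sv ->]]]].
elim/big_rec: _ => // i y _; apply: PD; exact/SP/Sv.
Qed.

(** Most statements about the whole algebra are reduced by this principle to the matrix coefficients
    [words]. *)
Lemma total_ind (V : completeNormedModType C) (S P : set V) :
  P 0 -> (forall k x y, P x -> P y -> P (k *: x + y)) ->
  (forall x, closure P x -> P x) -> S `<=` P ->
  total_set S -> forall x, P x.
Proof.
move=> P0 PD Pc SP tS x; apply: Pc.
have : closure (lspan S) x by rewrite tS.
by apply: closure_subset; exact: lspan_ind.
Qed.

Lemma bl_lin (V W : completeNormedModType C) (T : V -> W) :
  bounded_linear T -> linear T.
Proof. by case. Qed.

Lemma bl_bound (V W : completeNormedModType C) (T : V -> W) :
  bounded_linear T -> exists2 K : R, 0 <= K & forall v, nm (T v) <= K * nm v.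
Proof. by move=> /blP[]. Qed.

Lemma bl_cvg (V W : completeNormedModType C) (T : V -> W) (u : nat -> V) l :
  bounded_linear T -> u @ \oo --> l -> T \o u @ \oo --> T l.
Proof. by case=> _ cT ul; apply: (continuous_cvg _ (cT l) ul). Qed.

Lemma bl_eq_total (V W : completeNormedModType C) (S : set V) (T T' : V -> W) :
  bounded_linear T -> bounded_linear T' -> total_set S ->
  (forall x, S x -> T x = T' x) -> T =1 T'.
Proof.
move=> bT bT' tS h; apply: (total_ind (S := S)) => //.
- by rewrite (lin0 (bl_lin bT)) (lin0 (bl_lin bT')).
- by move=> k x y hx hy; rewrite (bl_lin bT) (bl_lin bT') hx hy.
- move=> x /closure_seq [u uP ux].
  have Tu := bl_cvg bT ux; have := bl_cvg bT' ux.
  have <- : T \o u = T' \o u by apply/funext => n; exact: uP.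
  by move: Tu; apply: cvg_unique.
Qed.

Lemma bl_comp (U V W : completeNormedModType C) (T : V -> W) (S : U -> V) :
  bounded_linear T -> bounded_linear S -> bounded_linear (fun x => T (S x)).
Proof.
move=> [lT cT] [lS cS]; split=> [k x y|]; first by rewrite lS lT.
by move=> x; apply: continuous_comp; [exact: cS|exact: cT].
Qed.

(** Squared norms are what can be summed and integrated. The free weight [e] loses nothing:
    optimising it in [sq_triangle] recovers the exact triangle inequality. *)
Lemma nm_sq_D (V : normedModType C) (e : R) (x y : V) : 0 < e ->
  nm (x + y) ^+ 2 <= (1 + e) * nm x ^+ 2 + (1 + e^-1) * nm y ^+ 2.
Proof.
move=> e0; apply: (@le_trans _ _ ((nm x + nm y) ^+ 2)).
  by rewrite ler_pXn2r ?nnegrE ?addr_ge0 ?nm_ge0// nmD.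
have h : 0 <= (e * nm x - nm y) ^+ 2 / e by rewrite divr_ge0 ?sqr_ge0 ?ltW.
have -> : (1 + e) * nm x ^+ 2 + (1 + e^-1) * nm y ^+ 2 =
  (nm x + nm y) ^+ 2 + (e * nm x - nm y) ^+ 2 / e by field; rewrite gt_eqF.
by rewrite lerDl.
Qed.

Lemma nm_sq_D2 (V : normedModType C) (x y : V) :
  nm (x + y) ^+ 2 <= 2 * nm x ^+ 2 + 2 * nm y ^+ 2.
Proof. by have := nm_sq_D x y ltr01; rewrite invr1. Qed.

Lemma ReX2 (V : normedZmodType C) (x : V) : complex.Re (`|x| ^+ 2) = nm x ^+ 2.
Proof. by rewrite nmE -rmorphXn. Qed.

Lemma cvg_nm_cvg (V : normedModType C) (x : nat -> V) l :
  x @ \oo --> l -> (fun n => nm (x n)) @ \oo --> nm l.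
Proof.
move=> xl; apply/cvgrPdist_lt => e e0; have [N hN] := (cvg_nmP _ _).1 xl _ e0.
exists N => // n /= Nn; apply: le_lt_trans (hN n Nn).
rewrite ler_norml; have := nmBD (x n) l 0; have := nmBD l (x n) 0.
by rewrite !subr0 (nmB l); lra.
Qed.

End Total.

Section HilbertBasics.
Variable R : realType.
Local Notation C := R[i].
Variable H : hilbertType R.
Implicit Types (x y v w : H) (k : C).

Lemma dotpDr x y v : dotp v (x + y) = dotp v x + dotp v y.
Proof. exact: (linD (dotp_linear v)). Qed.
Lemma dotpZr k x v : dotp v (k *: x) = k * dotp v x.
Proof. exact: (linZ (dotp_linear v)). Qed.
Lemma dotpBr x y v : dotp v (x - y) = dotp v x - dotp v y.
Proof. exact: (linB (dotp_linear v)). Qed.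
Lemma dotp0r v : dotp v 0 = 0.
Proof. exact: (lin0 (dotp_linear v)). Qed.
Lemma dotpNr v x : dotp v (- x) = - dotp v x.
Proof. exact: (linN (dotp_linear v)). Qed.
Lemma dotp_sumr v (I : Type) (r : seq I) (P : pred I) (F : I -> H) :
  dotp v (\sum_(i <- r | P i) F i) = \sum_(i <- r | P i) dotp v (F i).
Proof. exact: (lin_sum (dotp_linear v)). Qed.
Lemma dotpDl x y v : dotp (x + y) v = dotp x v + dotp y v.
Proof. by rewrite dotp_conj dotpDr rmorphD /= -!dotp_conj. Qed.
Lemma dotpZl k x v : dotp (k *: x) v = Num.conj k * dotp x v.
Proof. by rewrite dotp_conj dotpZr rmorphM /= -!dotp_conj. Qed.
Lemma dotpBl x y v : dotp (x - y) v = dotp x v - dotp y v.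
Proof. by rewrite dotp_conj dotpBr rmorphB /= -!dotp_conj. Qed.
Lemma dotp0l v : dotp 0 v = 0.
Proof. by rewrite dotp_conj dotp0r conjC0. Qed.
Lemma dotp_suml v (I : Type) (r : seq I) (P : pred I) (F : I -> H) :
  dotp (\sum_(i <- r | P i) F i) v = \sum_(i <- r | P i) dotp (F i) v.
Proof.
rewrite dotp_conj dotp_sumr rmorph_sum; apply: eq_bigr => i _.
by rewrite /= -dotp_conj.
Qed.

Lemma dotpxx x : dotp x x = ((nm x ^+ 2)%:C)%C.
Proof. by rewrite dotp_norm nmE rmorphXn. Qed.

Lemma conj_dotp x y : Num.conj (dotp x y) = dotp y x.
Proof. by rewrite -dotp_conj. Qed.

Lemma RmulC (a : R) k : complex.Re ((a%:C)%C * k) = a * complex.Re k.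
Proof. by case: k => b c; simpc. Qed.

Lemma mul_conj k : k * Num.conj k = ((nm k ^+ 2)%:C)%C.
Proof. by rewrite -normCK nmE rmorphXn. Qed.

Lemma ReD (k l : C) : complex.Re (k + l) = complex.Re k + complex.Re l.
Proof. exact: raddfD. Qed.
Lemma ReB (k l : C) : complex.Re (k - l) = complex.Re k - complex.Re l.
Proof. exact: raddfB. Qed.
Lemma ImD (k l : C) : complex.Im (k + l) = complex.Im k + complex.Im l.
Proof. exact: raddfD. Qed.
Lemma Re_conj k : complex.Re (Num.conj k) = complex.Re k.
Proof. by case: k. Qed.
Lemma Im_conj k : complex.Im (Num.conj k) = - complex.Im k.
Proof. by case: k. Qed.

Lemma add_conj k : k + Num.conj k = ((2 * complex.Re k)%:C)%C.
Proof. by case: k => a b; apply/eqP; rewrite eq_complex /= subrr mulr_natl mulr2n !eqxx. Qed.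

Lemma nmD_sq x y :
  nm (x + y) ^+ 2 = nm x ^+ 2 + nm y ^+ 2 + 2 * complex.Re (dotp x y).
Proof.
apply: (@complexI R); rewrite -dotpxx dotpDl !dotpDr !dotpxx (dotp_conj x y).
rewrite !rmorphD/= -add_conj.
by ring.
Qed.

Lemma nmB_sq x y :
  nm (x - y) ^+ 2 = nm x ^+ 2 + nm y ^+ 2 - 2 * complex.Re (dotp x y).
Proof. by rewrite nmD_sq nmN dotpNr raddfN mulrN. Qed.

Lemma cauchy_schwarz x y : nm (dotp x y) <= nm x * nm y.
Proof.
have [->|x0] := eqVneq x 0; first by rewrite dotp0l !nm0 mul0r.
have nx : 0 < nm x by rewrite lt_def nm_eq0 x0 nm_ge0.
set k : C := dotp x y / ((nm x ^+ 2)%:C)%C.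
have := sqr_ge0 (nm (y - k *: x)).
rewrite nmB_sq dotpZr nmZ exprMn (_ : k * dotp y x = ((nm (dotp x y) ^+ 2 / nm x ^+ 2)%:C)%C); last first.
  by rewrite /k mulrAC -(conj_dotp x y) mul_conj fmorph_div.
have -> : nm k = nm (dotp x y) / nm x ^+ 2.
  by rewrite nmM nmV nmR ger0_norm// sqr_ge0.
move=> h; rewrite -(@ler_pXn2r _ 2)// ?nnegrE ?mulr_ge0 ?nm_ge0//.
have {h} : 0 <= nm y ^+ 2 - nm (dotp x y) ^+ 2 / nm x ^+ 2.
  apply: le_trans h _; rewrite le_eqVlt; apply/orP; left; apply/eqP => /=.
  by field; rewrite gt_eqF.
by rewrite subr_ge0 ler_pdivrMr ?exprn_gt0// exprMn mulrC.
Qed.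

Lemma dotp_cvg (x y : nat -> H) lx ly : x @ \oo --> lx -> y @ \oo --> ly ->
  (fun n => dotp (x n) (y n) : R[i]^o) @ \oo --> (dotp lx ly : R[i]^o).
Proof.
move=> xl yl; apply/cvg_nm; apply: (@squeeze_cvgr _ _ _ _ (cst 0)
  (fun n => nm (x n - lx) * nm (y n) + nm lx * nm (y n - ly))) => /=.
- apply: nearW => n; rewrite nm_ge0 /=.
  have -> : dotp (x n) (y n) - dotp lx ly =
     dotp (x n - lx) (y n) + dotp lx (y n - ly).
    by rewrite dotpBl dotpBr addrA subrK.
  by apply: le_trans (nmD _ _) _; rewrite lerD// cauchy_schwarz.
- exact: cvg_cst.
- have -> : (0 : R) = 0 * nm ly + nm lx * 0 by rewrite mul0r mulr0 addr0.
  apply: cvgD; first by apply: cvgM; [exact/cvg_nm|exact: cvg_nm_cvg].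
  by apply: cvgMr; exact/cvg_nm.
Qed.

Lemma dotp_ext x y : (forall v, dotp v x = dotp v y) -> x = y.
Proof.
move=> h; apply/eqP; rewrite -subr_eq0 -nm_eq0 -sqrf_eq0.
by have := dotpxx (x - y); rewrite dotpBr h subrr => /esym/eqP; rewrite -(rmorph0 (real_complex R)) (inj_eq (@complexI R)).
Qed.

End HilbertBasics.

Lemma sum_sub (V : zmodType) (F : nat -> V) n m : (n <= m)%N ->
  \sum_(0 <= k < m) F k - \sum_(0 <= k < n) F k = \sum_(n <= k < m) F k.
Proof. by move=> h; rewrite (big_cat_nat (leq0n _) h)/= addrAC subrr add0r. Qed.

Lemma sum_mask (V : zmodType) (F G : nat -> V) n m : (n <= m)%N ->
  (forall k, (k < n)%N -> G k = 0) -> (forall k, (n <= k)%N -> G k = F k) ->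
  \sum_(0 <= k < m) G k = \sum_(n <= k < m) F k.
Proof.
move=> h G0 GF; rewrite (big_cat_nat (leq0n _) h)/= [X in X + _]big_nat.
rewrite [X in X + _]big1 ?add0r => [|i /andP[_ /G0//]].
by rewrite big_nat [RHS]big_nat; apply: eq_bigr => i /andP[/GF].
Qed.

Section OrthonormalBasis.
Variable R : realType.
Local Notation C := R[i].
Variables (H : hilbertType R) (b : nat -> H).
Hypothesis hb : orthonormal_basis b.
Implicit Types (x y v w : H).

Let orth i j : dotp (b i) (b j) = (i == j)%:R. Proof. by case: hb. Qed.

Lemma nm_b i : nm (b i) = 1.
Proof.
apply/eqP; rewrite -(@eqrXn2 _ 2) ?nm_ge0// expr1n.
by apply/eqP/(@complexI R); rewrite -dotpxx orth eqxx.
Qed.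

Lemma dotp_comb n (c : nat -> C) i :
  dotp (b i) (\sum_(0 <= k < n) c k *: b k) = if (i < n)%N then c i else 0.
Proof.
rewrite dotp_sumr; under eq_bigr do rewrite dotpZr orth.
case: ifP => hi.
  rewrite (bigD1_seq i) ?mem_index_iota ?iota_uniq//= eqxx mulr1.
  by rewrite big1 ?addr0// => j ji; rewrite eq_sym (negbTE ji) mulr0.
rewrite big_nat big1// => j /andP[_ jn]; case: eqVneq => [ij|]; last by rewrite mulr0.
by rewrite ij jn in hi.
Qed.

Lemma nm_comb n (c : nat -> C) :
  nm (\sum_(0 <= k < n) c k *: b k) ^+ 2 = \sum_(0 <= k < n) nm (c k) ^+ 2.
Proof.
apply: (@complexI R); rewrite -dotpxx dotp_suml rmorph_sum /= big_nat [RHS]big_nat.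
apply: eq_bigr => i /andP[_ hi].
by rewrite dotpZl dotp_comb hi mulrC mul_conj.
Qed.

Definition onb_proj n x := \sum_(0 <= k < n) dotp (b k) x *: b k.

Lemma bessel_eq n x :
  nm (x - onb_proj n x) ^+ 2 =
  nm x ^+ 2 - \sum_(0 <= k < n) nm (dotp (b k) x) ^+ 2.
Proof.
rewrite nmB_sq nm_comb /onb_proj dotp_sumr.
rewrite (_ : complex.Re _ = \sum_(0 <= k < n) nm (dotp (b k) x) ^+ 2).
  by ring.
rewrite -[RHS](_ : complex.Re (\sum_(0 <= k < n) nm (dotp (b k) x) ^+ 2)%:C%C = _)//.
congr complex.Re; rewrite rmorph_sum; apply: eq_bigr => k _ /=.
by rewrite dotpZr -(conj_dotp (b k) x) mul_conj.
Qed.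

Lemma bessel n x : \sum_(0 <= k < n) nm (dotp (b k) x) ^+ 2 <= nm x ^+ 2.
Proof. by rewrite -subr_ge0 -bessel_eq sqr_ge0. Qed.

(** The residual is orthogonal to the span of the first [n] basis vectors, so Pythagoras applies. *)
Lemma onb_best n x (c : nat -> C) :
  nm (x - onb_proj n x) <= nm (x - \sum_(0 <= k < n) c k *: b k).
Proof.
set y := x - onb_proj n x; set s := \sum_(0 <= k < n) c k *: b k.
have -> : x - s = y + (onb_proj n x - s) by rewrite addrA subrK.
rewrite -(@ler_pXn2r _ 2)// ?nnegrE ?nm_ge0// (nmD_sq y).
rewrite (_ : dotp y _ = 0) /= ?mulr0 ?addr0 ?lerDl ?sqr_ge0//.
rewrite /s /onb_proj -sumrB dotp_sumr big_nat big1// => i /andP[_ hi].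
rewrite -scalerBl dotpZr -(conj_dotp (b i) y) /y dotpBr.
by rewrite dotp_comb hi subrr conjC0 mulr0.
Qed.

Lemma lspan_comb x : lspan (range b) x ->
  exists n (c : nat -> C), x = \sum_(0 <= k < n) c k *: b k.
Proof.
move: x; apply: lspan_ind; first by exists 0%N, (cst 0); rewrite big_geq.
  move=> k x y [n [c ->]] [m [d ->]].
  have ext p (e : nat -> C) : (p <= maxn n m)%N ->
      \sum_(0 <= k < p) e k *: b k =
      \sum_(0 <= k < maxn n m) (if (k < p)%N then e k else 0) *: b k.
    move=> hp; rewrite [RHS](big_cat_nat (leq0n _) hp)//= [X in _ = _ + X]big_nat [X in _ = _ + X]big1 ?addr0.
      by rewrite big_nat [RHS]big_nat; apply: eq_bigr => i /andP[_ ->].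
    by move=> i /andP[hi _]; rewrite ltnNge hi scale0r.
  exists (maxn n m), (fun i => k * (if (i < n)%N then c i else 0) +
                               (if (i < m)%N then d i else 0)).
  rewrite (ext n) ?leq_maxl// (ext m) ?leq_maxr// scaler_sumr -big_split.
  by apply: eq_bigr => i _ /=; rewrite scalerDl scalerA.
move=> _ [j _ <-]; exists j.+1, (fun i => (i == j)%:R).
rewrite big_nat_recr//= eqxx scale1r big_nat big1 ?add0r// => i /andP[_ hi].
by rewrite (ltn_eqF hi) scale0r.
Qed.

(** Totality gives a finite combination close to [x]; the projection onto the same basis vectors is
    at least as close, and further basis vectors can only improve it. *)
Lemma onb_proj_cvg x : (fun n => onb_proj n x) @ \oo --> x.
Proof.
apply/cvg_nmP => e e0; have [_ tb] := hb.
have : closure (lspan (range b)) x by rewrite tb.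
move=> /closure_nm /(_ e e0) [y /lspan_comb [n [c ->]] hy].
exists n => m nlem; rewrite nmB.
have h : nm (x - onb_proj m x) ^+ 2 <= nm (x - onb_proj n x) ^+ 2.
  rewrite !bessel_eq lerD2l lerN2 (big_cat_nat (leq0n _) nlem)//= lerDl sumr_ge0// => i _.
  exact: sqr_ge0.
have {}h : nm (x - onb_proj m x) <= nm (x - onb_proj n x).
  by rewrite -(@ler_pXn2r _ 2)// ?nnegrE ?nm_ge0.
by apply: le_lt_trans h _; apply: le_lt_trans (onb_best _ _ _) hy.
Qed.

Lemma parseval_cvg x :
  (fun n => \sum_(0 <= k < n) nm (dotp (b k) x) ^+ 2) @ \oo --> nm x ^+ 2.
Proof.
have h := cvg_nm_cvg (@onb_proj_cvg x).
apply: (cvg_seq_eq (u := fun n => nm (onb_proj n x) * nm (onb_proj n x))).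
  by move=> n; rewrite -expr2 nm_comb.
by rewrite expr2; exact: cvgM.
Qed.

Lemma nneseries_cvg (u : nat -> R) (l : R) :
  (fun n => \sum_(0 <= k < n) u k) @ \oo --> l ->
  (\sum_(0 <= k <oo) (u k)%:E = l%:E)%E.
Proof.
move=> ul; apply/cvg_lim => //.
have -> : (fun n => (\sum_(0 <= k < n) (u k)%:E)%E) = EFin \o (fun n => \sum_(0 <= k < n) u k).
  by apply/funext => n; rewrite /= -sumEFin.
by apply: cvg_EFin => //; exact: nearW.
Qed.

Lemma parseval x :
  (\sum_(0 <= k <oo) (nm (dotp (b k) x) ^+ 2)%:E = (nm x ^+ 2)%:E)%E.
Proof. exact/nneseries_cvg/parseval_cvg. Qed.
Lemma onb_ext x y : (forall k : nat, dotp (b k) x = dotp (b k) y) -> x = y.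
Proof.
move=> h; have := @onb_proj_cvg y; have := @onb_proj_cvg x.
have -> : onb_proj^~ x = onb_proj^~ y.
  by apply/funext => n; apply: eq_bigr => k _; rewrite h.
exact: cvg_unique.
Qed.

Lemma riesz_fischer (c : nat -> C) (M : R) :
  (forall n, \sum_(0 <= k < n) nm (c k) ^+ 2 <= M) ->
  exists x, forall k : nat, dotp (b k) x = c k.
Proof.
move=> cM.
set S := fun n => \sum_(0 <= k < n) nm (c k) ^+ 2.
have nd : nondecreasing_seq S.
  apply/nondecreasing_seqP => n; rewrite /S big_nat_recr//= lerDl; exact: sqr_ge0.
have cS : cvgn S.
  by apply: nondecreasing_is_cvgn => //; exists M => _ [n _ <-]; exact: cM.
have [x hx] : exists x : H, (fun n => \sum_(0 <= k < n) c k *: b k) @ \oo --> x.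
  apply: complete_nm => e e0.
  have e20 : 0 < e ^+ 2 by rewrite exprn_gt0.
  have /cauchy_cvgP/cauchyP h := cS.
  (* Two late partial sums lie within [e^2 / 2] of the same number, hence within [e^2] of each
     other. *)
  have [l /= [N _ hN]] := h _ (divr_gt0 e20 (ltr0n _ 2)).
  have key n m : (N <= n)%N -> (n <= m)%N ->
    nm (\sum_(0 <= k < m) c k *: b k - \sum_(0 <= k < n) c k *: b k) < e.
    move=> Nn nlem.
    have -> : \sum_(0 <= k < m) c k *: b k - \sum_(0 <= k < n) c k *: b k =
       \sum_(0 <= k < m) (if (k < n)%N then 0 else c k) *: b k.
      rewrite (sum_sub (fun k => c k *: b k) nlem); apply/esym/sum_mask => // i hi.
        by rewrite hi scale0r.
      by rewrite ltnNge hi.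
    rewrite -(@ltr_pXn2r _ 2)// ?nnegrE ?nm_ge0 ?(ltW e0)// nm_comb.
    have -> : \sum_(0 <= k < m) nm (if (k < n)%N then 0 else c k) ^+ 2 = S m - S n.
      rewrite /S (sum_sub (fun k => nm (c k) ^+ 2) nlem); apply: sum_mask => // i hi.
        by rewrite hi nm0 expr0n.
      by rewrite ltnNge hi.
    have := hN n Nn; have := hN m (leq_trans Nn nlem).
    rewrite -ball_normE /ball_ /= !ltr_norml; lra.
  exists N => n m Nn Nm; have [nlem|mn] := leqP n m; first by rewrite nmB key.
  by rewrite key// ltnW.
exists x => k.
have h1 : (fun n => dotp (b k) (\sum_(0 <= k < n) c k *: b k) : R[i]^o) @ \oo --> (dotp (b k) x : R[i]^o).
  by apply: dotp_cvg => //; exact: cvg_cst.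
have h2 : (fun n => dotp (b k) (\sum_(0 <= k < n) c k *: b k) : R[i]^o) @ \oo --> (c k : R[i]^o).
  apply: cvg_near_cst; exists k.+1 => // n /= kn.
  by rewrite dotp_comb kn.
by move: h1 h2; apply: cvg_unique.
Qed.
End OrthonormalBasis.

Arguments parseval_cvg {R H b} hb x.
Arguments onb_proj_cvg {R H b} hb x.

Lemma sum_cauchy_schwarz (R : realType) (n : nat) (u v : nat -> R) :
  (forall k, 0 <= u k) -> (forall k, 0 <= v k) ->
  (\sum_(0 <= k < n) u k * v k) ^+ 2 <=
  (\sum_(0 <= k < n) u k ^+ 2) * (\sum_(0 <= k < n) v k ^+ 2).
Proof.
move=> u0 v0; elim: n => [|n IH]; first by rewrite !big_geq// expr0n mul0r.
rewrite !big_nat_recr//=.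
set S := \sum_(0 <= k < n) u k * v k in IH *.
set A := \sum_(0 <= k < n) u k ^+ 2 in IH *.
set B := \sum_(0 <= k < n) v k ^+ 2 in IH *.
have S0 : 0 <= S by rewrite sumr_ge0// => i _; rewrite mulr_ge0.
have A0 : 0 <= A by rewrite sumr_ge0// => i _; rewrite sqr_ge0.
have B0 : 0 <= B by rewrite sumr_ge0// => i _; rewrite sqr_ge0.
set a := u n; set c := v n.
have a0 : 0 <= a := u0 n. have c0 : 0 <= c := v0 n.
(* This is the cross term. Since [S^2 <= A B], its square is at most [4 A B a^2 c^2], which falls
   short of the square of the right-hand side by [(A c^2 - B a^2)^2]. *)
suff : 2 * S * (a * c) <= A * c ^+ 2 + B * a ^+ 2.
  move=> h; have -> : (S + a * c) ^+ 2 = S ^+ 2 + 2 * S * (a * c) + a ^+ 2 * c ^+ 2 by ring.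
  have -> : (A + a ^+ 2) * (B + c ^+ 2) = A * B + (A * c ^+ 2 + B * a ^+ 2) + a ^+ 2 * c ^+ 2 by ring.
  by rewrite lerD2r lerD.
rewrite -(@ler_pXn2r _ 2)// ?nnegrE; last 2 first.
- by rewrite !mulr_ge0.
- by rewrite addr_ge0// mulr_ge0// sqr_ge0.
have h : 4 * S ^+ 2 * (a * c) ^+ 2 <= 4 * (A * B) * (a * c) ^+ 2.
  by rewrite ler_wpM2r ?sqr_ge0// ler_wpM2l.
apply: (@le_trans _ _ (4 * (A * B) * (a * c) ^+ 2)).
  by apply: le_trans h; rewrite le_eqVlt; apply/orP; left; apply/eqP; ring.
rewrite -subr_ge0 (_ : _ - _ = (A * c ^+ 2 - B * a ^+ 2) ^+ 2) ?sqr_ge0//; ring.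
Qed.

Section HilbertSchmidt.
Variable R : realType.
Local Notation C := R[i].
Variables (H : hilbertType R) (b : nat -> H).
Hypothesis hb : orthonormal_basis b.
Implicit Types (x y v w : H).

Lemma sum_cs_C n m (u : nat -> C) (c : nat -> H) :
  nm (\sum_(n <= k < m) u k *: c k) ^+ 2 <=
  (\sum_(n <= k < m) nm (u k) ^+ 2) * (\sum_(n <= k < m) nm (c k) ^+ 2).
Proof.
have [h|h] := leqP m n; first by rewrite !big_geq// nm0 expr0n mul0r.
rewrite -(subnK (ltnW h)) addnC.
have sh (V : zmodType) (F : nat -> V) :
    \sum_(n <= k < n + (m - n)) F k = \sum_(0 <= k < m - n) F (k + n)%N.
  by rewrite -{1}[n]add0n big_addn addKn.
rewrite !sh.
apply: le_trans (sum_cauchy_schwarz _ (fun k => nm_ge0 _) (fun k => nm_ge0 _)).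
rewrite ler_pXn2r ?nnegrE ?nm_ge0 ?sumr_ge0//; last by move=> i _; rewrite mulr_ge0 ?nm_ge0.
by apply: le_trans (nm_sum _ _ _) _; apply: ler_sum => i _; rewrite nmZ.
Qed.

(** An operator is rebuilt from its columns; [limit_op] uses this to produce fibrewise limits of
    Hilbert-Schmidt operators. *)
Lemma column_op (c : nat -> H) (M : R) :
  (forall n, \sum_(0 <= k < n) nm (c k) ^+ 2 <= M) ->
  exists T : H -> H, bounded_linear T /\ forall k : nat, T (b k) = c k.
Proof.
move=> cM.
have M0 : 0 <= M by have := cM 0%N; rewrite big_geq.
pose s v n := \sum_(0 <= k < n) dotp (b k) v *: c k.
have cs v : exists l : H, s v @ \oo --> l.
  apply: complete_nm => e e0.
  pose e' := e ^+ 2 / (M + 1).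
  have M1 : 0 < M + 1 by rewrite ltr_wpDl.
  have e'0 : 0 < e' by rewrite divr_gt0// exprn_gt0.
  have /cvgrPdist_lt /(_ _ (divr_gt0 e'0 (ltr0n _ 2))) [N _ hN] := parseval_cvg hb v.
  have key n m : (N <= n)%N -> (n <= m)%N -> nm (s v m - s v n) < e.
    move=> Nn nlem; rewrite /s (sum_sub (fun k => dotp (b k) v *: c k) nlem).
    rewrite -(@ltr_pXn2r _ 2)// ?nnegrE ?nm_ge0 ?(ltW e0)//.
    apply: le_lt_trans (sum_cs_C _ _ _ _) _.
    apply: (@le_lt_trans _ _ ((\sum_(n <= k < m) nm (dotp (b k) v) ^+ 2) * (M + 1))).
      rewrite ler_wpM2l ?sumr_ge0// => [i _|]; first exact: sqr_ge0.
      apply: (@le_trans _ _ M); last by rewrite lerDl.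
      apply: le_trans (cM m).
      rewrite [leRHS](big_cat_nat (leq0n _) nlem)/= lerDr sumr_ge0// => i _; exact: sqr_ge0.
    rewrite -ltr_pdivlMr// -/e' -(sum_sub (fun k => nm (dotp (b k) v) ^+ 2) nlem).
    have := hN n Nn; have := hN m (leq_trans Nn nlem).
    rewrite /= !ltr_norml; lra.
  exists N => n m Nn Nm; have [nlem|mn] := leqP n m; first by rewrite nmB key.
  by rewrite key// ltnW.
have [T hT] := choice cs; exists T; split.
  apply/blP; split.
    move=> k x y; have h1 := hT (k *: x + y).
    have h2 : s (k *: x + y) @ \oo --> k *: T x + T y.
      apply: (cvg_seq_eq (u := fun n => k *: s x n + s y n)).
        move=> n; rewrite /s scaler_sumr -big_split; apply: eq_bigr => j _ /=.
        by rewrite dotpDr dotpZr scalerDl scalerA.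
      by apply: cvgD; [apply: cvgZr; exact: hT|exact: hT].
    by move: h1 h2; apply: cvg_unique.
  exists (Num.sqrt M) => [|v]; first exact: sqrtr_ge0.
  have h := cvg_nm_cvg (hT v).
  apply: (cvgr_to_le h); apply: nearW => n.
  rewrite -(@ler_pXn2r _ 2)// ?nnegrE ?mulr_ge0 ?nm_ge0 ?sqrtr_ge0// exprMn sqr_sqrtr//.
  apply: le_trans (sum_cs_C _ _ _ _) _; rewrite mulrC.
  by rewrite ler_pM ?sumr_ge0 ?bessel// => i _; exact: sqr_ge0.
move=> k; have h1 := hT (b k); have h2 : s (b k) @ \oo --> c k.
  apply: cvg_near_cst; exists k.+1 => // n /= kn.
  rewrite /s (bigD1_seq k) ?mem_index_iota ?iota_uniq//=.
  rewrite (hb.1 k k) eqxx scale1r big1 ?addr0// => j jk.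
  by rewrite (hb.1 j k) (negbTE jk) scale0r.
by move: h1 h2; apply: cvg_unique.
Qed.

(** Serves twice: for [D^-1] and for the resolvent [(1 + D)^-1]. *)
Lemma diag_op (s : nat -> R) (K : R) : 0 <= K -> (forall k, `|s k| <= K) ->
  exists D : H -> H, [/\ bounded_linear D,
    forall (k : nat) v, dotp (b k) (D v) = ((s k)%:C)%C * dotp (b k) v &
    forall v, nm (D v) <= K * nm v].
Proof.
move=> K0 sK.
have ex v : exists w, forall k : nat, dotp (b k) w = ((s k)%:C)%C * dotp (b k) v.
  apply: (riesz_fischer hb (M := K ^+ 2 * nm v ^+ 2)) => n.
  apply: (@le_trans _ _ (\sum_(0 <= k < n) K ^+ 2 * nm (dotp (b k) v) ^+ 2)).
    apply: ler_sum => i _; rewrite nmM exprMn ler_wpM2r ?sqr_ge0// nmR.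
    by rewrite ler_pXn2r ?nnegrE.
  by rewrite -mulr_sumr ler_wpM2l ?sqr_ge0// bessel.
have [D hD] := choice ex.
have bD v : nm (D v) <= K * nm v.
  rewrite -(@ler_pXn2r _ 2)// ?nnegrE ?mulr_ge0 ?nm_ge0// exprMn.
  have h := parseval_cvg hb (D v).
  have h' : (fun n => K ^+ 2 * \sum_(0 <= k < n) nm (dotp (b k) v) ^+ 2) @ \oo --> K ^+ 2 * nm v ^+ 2.
    by apply: cvgMr; exact: parseval_cvg.
  apply: (ler_cvg_to h h'); apply: nearW => n.
  rewrite mulr_sumr; apply: ler_sum => i _; rewrite hD nmM exprMn ler_wpM2r ?sqr_ge0// nmR.
  by rewrite ler_pXn2r ?nnegrE.
exists D; split => //; apply/blP; split; last by exists K.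
move=> k x y; apply: (onb_ext hb) => j.
by rewrite hD !dotpDr !dotpZr !hD mulrDr mulrCA.
Qed.

End HilbertSchmidt.

Section HilbertSchmidtNorm.
Variable R : realType.
Local Notation C := R[i].
Local Open Scope ereal_scope.

Lemma nneseries_bounded (u : nat -> R) : (forall n, (0 <= u n)%R) ->
  \sum_(0 <= n <oo) (u n)%:E < +oo ->
  exists M, forall n, (\sum_(0 <= k < n) u k <= M)%R.
Proof.
move=> u0 h; exists (fine (\sum_(0 <= n <oo) (u n)%:E)) => n.
rewrite -lee_fin fineK; last first.
  by rewrite ge0_fin_numE// nneseries_ge0// => i _ _; rewrite lee_fin.
rewrite -sumEFin; apply: nneseries_lim_ge => i _ _; by rewrite lee_fin.
Qed.

Lemma nneseries_le_bound (u : nat -> R) (M : R) : (forall n, (0 <= u n)%R) ->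
  (forall n, (\sum_(0 <= k < n) u k <= M)%R) ->
  \sum_(0 <= n <oo) (u n)%:E <= M%:E.
Proof.
move=> u0 h; apply: lime_le; first by apply: is_cvg_nneseries => i _ _; rewrite lee_fin.
by apply: nearW => n; rewrite sumEFin lee_fin.
Qed.

Section anybasis.
Variables (H : hilbertType R) (b : nat -> H).
Implicit Types (S T : H -> H).

Lemma hsE T : hs_norm2 b T = \sum_(0 <= n <oo) (nm (T (b n)) ^+ 2)%:E.
Proof. by apply: eq_eseriesr => n _; rewrite ReX2. Qed.

Lemma hs_ge0 T : 0 <= hs_norm2 b T.
Proof. by rewrite hsE nneseries_ge0// => n _ _; rewrite lee_fin sqr_ge0. Qed.

Lemma hs_bound S T (K : R) :
  (forall n, (nm (S (b n)) ^+ 2 <= K * nm (T (b n)) ^+ 2)%R) ->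
  hs_norm2 b S <= K%:E * hs_norm2 b T.
Proof.
move=> h; rewrite !hsE -nneseriesZl => [|n _]; last by rewrite lee_fin sqr_ge0.
apply: lee_nneseries => n _; first by rewrite lee_fin sqr_ge0.
by rewrite -EFinM lee_fin.
Qed.

Lemma hs_Z (k : C) T :
  hs_norm2 b (fun v => k *: T v) = ((nm k ^+ 2)%:E * hs_norm2 b T).
Proof.
rewrite !hsE -nneseriesZl => [|n _]; last by rewrite lee_fin sqr_ge0.
by apply: eq_eseriesr => n _; rewrite nmZ exprMn EFinM.
Qed.

Lemma hs_D (e : R) S T : (0 < e)%R ->
  hs_norm2 b (fun v => (S v + T v)%R) <=
  (1 + e)%:E * hs_norm2 b S + (1 + e^-1)%:E * hs_norm2 b T.
Proof.
move=> e0; rewrite !hsE -!nneseriesZl; try by move=> n _; rewrite lee_fin sqr_ge0.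
have e1 : (0 <= 1 + e)%R by rewrite addr_ge0// ltW.
have e2 : (0 <= 1 + e^-1)%R by rewrite addr_ge0// invr_ge0 ltW.
rewrite -nneseriesD; try by move=> n _ _; rewrite -EFinM lee_fin mulr_ge0// sqr_ge0.
apply: lee_nneseries => n _; first by rewrite lee_fin sqr_ge0.
by rewrite -!EFinM -EFinD lee_fin nm_sq_D.
Qed.

Lemma hs_BC S T :
  hs_norm2 b (fun v => S v - T v)%R = hs_norm2 b (fun v => T v - S v)%R.
Proof. by rewrite !hsE; apply: eq_eseriesr => n _; rewrite nmB. Qed.

Lemma hs_term T n : (nm (T (b n)) ^+ 2)%:E <= hs_norm2 b T.
Proof.
rewrite hsE; apply: (@le_trans _ _ (\sum_(0 <= k < n.+1) (nm (T (b k)) ^+ 2)%:E)).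
  rewrite big_nat_recr//= leeDr// sume_ge0// => i _; by rewrite lee_fin sqr_ge0.
by apply: nneseries_lim_ge => i _ _; rewrite lee_fin sqr_ge0.
Qed.

Lemma hs_eq0_b T : hs_norm2 b T = 0 -> forall n, T (b n) = 0%R.
Proof.
move=> h n; have := hs_term T n; rewrite h lee_fin => h'.
apply/eqP; rewrite -nm_eq0 -sqrf_eq0; apply/eqP/le_anti; by rewrite h' sqr_ge0.
Qed.

Lemma bl_eq_b S T : bounded_linear S -> bounded_linear T ->
  total_set (range b) -> (forall n, S (b n) = T (b n)) -> forall v, S v = T v.
Proof.
by move=> bS bT tb h; apply: (bl_eq_total bS bT tb) => _ [n _ <-].
Qed.

Lemma hs_eq0 T : bounded_linear T -> total_set (range b) ->
  hs_norm2 b T = 0 -> forall v, T v = 0%R.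
Proof.
move=> bT tb h; apply: (bl_eq_b bT _ tb); last exact: hs_eq0_b.
by apply/blP; split=> [k x y|]; [rewrite scaler0 addr0|exists 0%R => // v; rewrite nm0 mul0r].
Qed.

End anybasis.

Section onb.
Variables (H : hilbertType R) (b : nat -> H).
Hypothesis hb : orthonormal_basis b.
Implicit Types (S T : H -> H).

Lemma hs_matrix T : hs_norm2 b T =
  \sum_(0 <= k <oo) \sum_(0 <= j <oo) (nm (dotp (b j) (T (b k))) ^+ 2)%:E.
Proof. by rewrite hsE; apply: eq_eseriesr => k _; rewrite (parseval hb). Qed.

Lemma hs_rows T : hs_norm2 b T =
  \sum_(0 <= j <oo) \sum_(0 <= k <oo) (nm (dotp (b j) (T (b k))) ^+ 2)%:E.
Proof.
by rewrite hs_matrix nneseries_interchange// => i j; rewrite lee_fin sqr_ge0.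
Qed.

Lemma hs_entry T j k : (nm (dotp (b j) (T (b k))) ^+ 2)%:E <= hs_norm2 b T.
Proof.
apply: le_trans (hs_term b T k); rewrite lee_fin ler_pXn2r ?nnegrE ?nm_ge0//.
by apply: le_trans (cauchy_schwarz _ _) _; rewrite (nm_b hb) mul1r.
Qed.

(** The estimate goes row by row, as [B] would mix the columns: the [j]-th row of [T] is the
    functional of a vector [r], and multiplying by [B] on the right replaces [r] by [Bs r]. *)
Lemma hs_right T (B Bs : H -> H) (K : R) : bounded_linear T ->
  hs_norm2 b T < +oo -> (0 <= K)%R ->
  (forall v w, dotp v (B w) = dotp (Bs v) w) ->
  (forall v, nm (Bs v) <= K * nm v)%R ->
  hs_norm2 b (fun v => T (B v)) <= (K ^+ 2)%:E * hs_norm2 b T.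
Proof.
move=> bT hT K0 adjB bK.
rewrite !hs_rows.
rewrite -nneseriesZl; last by move=> i _; apply: nneseries_ge0 => n _ _; rewrite lee_fin sqr_ge0.
apply: lee_nneseries => j _.
  by move=> _; apply: nneseries_ge0 => n _ _; rewrite lee_fin sqr_ge0.
have [r hr] : exists r, forall k : nat, dotp (b k) r = Num.conj (dotp (b j) (T (b k))).
  have [M hM] : exists M, forall n, (\sum_(0 <= k < n) nm (T (b k)) ^+ 2 <= M)%R.
    by apply: nneseries_bounded => [n|]; [exact: sqr_ge0|rewrite -hsE].
  apply: (riesz_fischer hb (M := M)) => n; apply: le_trans (hM n).
  apply: ler_sum => k _; rewrite nmJ ler_pXn2r ?nnegrE ?nm_ge0//.
  by apply: le_trans (cauchy_schwarz _ _) _; rewrite (nm_b hb) mul1r.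
have hr' v : dotp r v = dotp (b j) (T v).
  move: v; apply: (total_ind (S := range b)) => //.
  - by rewrite (lin0 (bl_lin bT)) !dotp0r.
  - by move=> k x y hx hy; rewrite (bl_lin bT) !dotpDr !dotpZr hx hy.
  - move=> x /closure_seq [u uP ux].
    have h1 : (fun n => dotp r (u n) : R[i]^o) @ \oo --> (dotp r x : R[i]^o).
      by apply: dotp_cvg => //; exact: cvg_cst.
    have h2 : (fun n => dotp (b j) (T (u n)) : R[i]^o) @ \oo --> (dotp (b j) (T x) : R[i]^o).
      by apply: dotp_cvg; [exact: cvg_cst|exact: bl_cvg].
    move: h2; have -> : (fun n => dotp (b j) (T (u n)) : R[i]^o) = (fun n => dotp r (u n)).
      by apply/funext => n; rewrite uP.
    by move: h1; apply: cvg_unique.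
  - by move=> _ [n _ <-]; rewrite dotp_conj hr conjCK.
  - by case: hb.
have e1 : \sum_(0 <= k <oo) (nm (dotp (b j) (T (B (b k)))) ^+ 2)%:E = (nm (Bs r) ^+ 2)%:E.
  rewrite -(parseval hb); apply: eq_eseriesr => k _.
  by rewrite -hr' adjB dotp_conj nmJ.
have e2 : \sum_(0 <= k <oo) (nm (dotp (b j) (T (b k))) ^+ 2)%:E = (nm r ^+ 2)%:E.
  rewrite -(parseval hb); apply: eq_eseriesr => k _.
  by rewrite -hr' dotp_conj nmJ.
rewrite e1 e2 -EFinM lee_fin -exprMn ler_pXn2r ?nnegrE ?mulr_ge0 ?nm_ge0//.
Qed.

End onb.
End HilbertSchmidtNorm.

(** * C*-algebras *)

Lemma cvg_uniq (R : realType) (V : normedModType R[i]) (u : nat -> V) (l l' : V) :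
  u @ \oo --> l -> u @ \oo --> l' -> l = l'.
Proof. exact: cvg_unique. Qed.

Section CStarBasics.
Variable R : realType.
Local Notation C := R[i].
Variable A : cstarType R.
Implicit Types (a b x y z : A) (k : C).

Lemma cmulDr a x y : a ** (x + y) = a ** x + a ** y.
Proof. exact: (linD (cmul_linear_r a)). Qed.
Lemma cmulZr k a x : a ** (k *: x) = k *: (a ** x).
Proof. exact: (linZ (cmul_linear_r a)). Qed.
Lemma cmulBr a x y : a ** (x - y) = a ** x - a ** y.
Proof. exact: (linB (cmul_linear_r a)). Qed.
Lemma cmul0r a : a ** 0 = 0.
Proof. exact: (lin0 (cmul_linear_r a)). Qed.
Lemma cmul_sumr a (I : Type) (r : seq I) (P : pred I) (F : I -> A) :
  a ** (\sum_(i <- r | P i) F i) = \sum_(i <- r | P i) a ** F i.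
Proof. exact: (lin_sum (cmul_linear_r a)). Qed.
Lemma cmulDl a x y : (x + y) ** a = x ** a + y ** a.
Proof. exact: (linD (cmul_linear_l a)). Qed.
Lemma cmulZl k a x : (k *: x) ** a = k *: (x ** a).
Proof. exact: (linZ (cmul_linear_l a)). Qed.
Lemma cmulBl a x y : (x - y) ** a = x ** a - y ** a.
Proof. exact: (linB (cmul_linear_l a)). Qed.
Lemma cmul0l a : 0 ** a = 0.
Proof. exact: (lin0 (cmul_linear_l a)). Qed.
Lemma cmul_suml a (I : Type) (r : seq I) (P : pred I) (F : I -> A) :
  (\sum_(i <- r | P i) F i) ** a = \sum_(i <- r | P i) F i ** a.
Proof. exact: (lin_sum (cmul_linear_l a)). Qed.

Lemma adj0 : adj (0 : A) = 0.
Proof.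
have := adj_semilinear 1 (0 : A) 0; rewrite conjC1 !scale1r addr0 => /eqP.
by rewrite -subr_eq subrr eq_sym => /eqP.
Qed.
Lemma adjD x y : adj (x + y) = adj x + adj y.
Proof. by have := adj_semilinear 1 x y; rewrite conjC1 !scale1r. Qed.
Lemma adjZ k x : adj (k *: x) = Num.conj k *: adj x.
Proof. by have := adj_semilinear k x 0; rewrite !addr0 adj0 addr0. Qed.
Lemma adjN x : adj (- x) = - adj x.
Proof. by rewrite -scaleN1r adjZ rmorphN rmorph1 scaleN1r. Qed.
Lemma adjB x y : adj (x - y) = adj x - adj y.
Proof. by rewrite adjD adjN. Qed.
Lemma adj1 : adj (cone : A) = cone.
Proof. by rewrite -[LHS]cmul1r -{2}[cone]adjK -adjM cmul1r adjK. Qed.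
Lemma adj_sum (I : Type) (r : seq I) (P : pred I) (F : I -> A) :
  adj (\sum_(i <- r | P i) F i) = \sum_(i <- r | P i) adj (F i).
Proof. exact: (big_morph _ adjD adj0). Qed.

Lemma nm_cmul x y : nm (x ** y) <= nm x * nm y.
Proof. by rewrite -lecR rmorphM /= -!nmE cmul_norm. Qed.

Lemma nm_cstar x : nm (adj x ** x) = nm x ^+ 2.
Proof. by apply: (@complexI R); rewrite rmorphXn /= -!nmE cstar_norm. Qed.

Lemma nm_adj x : nm (adj x) = nm x.
Proof.
have le y : nm y <= nm (adj y).
  have [->|y0] := eqVneq y 0; first by rewrite nm0 nm_ge0.
  have ny : 0 < nm y by rewrite lt_def nm_eq0 y0 nm_ge0.
  by rewrite -(ler_pM2r ny) -expr2 -nm_cstar nm_cmul.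
by apply/le_anti; rewrite le andbT -{2}[x]adjK le.
Qed.

Lemma adj_cvg (u : nat -> A) l : u @ \oo --> l -> (fun n => adj (u n)) @ \oo --> adj l.
Proof.
move=> /cvg_nm h; apply/cvg_nm; move: h; apply: cvg_seq_eq => n.
by rewrite -adjB nm_adj.
Qed.

Lemma cmul_bl_r a : bounded_linear (cmul a).
Proof.
apply/blP; split; first exact: cmul_linear_r.
by exists (nm a); [exact: nm_ge0|exact: nm_cmul].
Qed.

Lemma cmul_bl_l a : bounded_linear (cmul ^~ a).
Proof.
apply/blP; split; first exact: cmul_linear_l.
by exists (nm a); [exact: nm_ge0|move=> v; rewrite mulrC; exact: nm_cmul].
Qed.

Lemma cmul_cvg (u v : nat -> A) l m : u @ \oo --> l -> v @ \oo --> m ->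
  (fun n => u n ** v n) @ \oo --> l ** m.
Proof.
move=> ul vm; apply/cvg_nm; apply: (@squeeze_cvgr _ _ _ _ (cst 0)
  (fun n => nm (u n - l) * nm (v n) + nm l * nm (v n - m))) => /=.
- apply: nearW => n; rewrite nm_ge0 /=.
  have -> : u n ** v n - l ** m = (u n - l) ** v n + l ** (v n - m).
    by rewrite cmulBl cmulBr addrA subrK.
  by apply: le_trans (nmD _ _) _; rewrite lerD// nm_cmul.
- exact: cvg_cst.
- have -> : (0 : R) = 0 * nm m + nm l * 0 by rewrite mul0r mulr0 addr0.
  apply: cvgD; first by apply: cvgM; [exact/cvg_nm|exact: cvg_nm_cvg].
  by apply: cvgMr; exact/cvg_nm.
Qed.

(* The fixed point [z = (x + z^2) / 2] gives the square root [1 - z] of [1 - x]. *)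
Lemma sqrt_one_sub x : adj x = x -> nm x <= 2^-1 ->
  exists y, adj y = y /\ y ** y = cone - x.
Proof.
move=> xs xle.
pose f z : A := (2^-1 : C) *: (x + z ** z).
pose z := fix z n := if n is m.+1 then f (z m) else 0.
have nm2 : nm (2^-1 : C) = 2^-1.
  by rewrite nmV -[2 : C](rmorph_nat (real_complex R)) nmR ger0_norm.
(* The ball of radius 3/4 is invariant because [(1/2 + 9/16) / 2 < 3/4], and on it the iteration
   contracts by the factor 3/4. *)
have zb n : nm (z n) <= 3 / 4.
  elim: n => [|n IH] /=; first by rewrite nm0; lra.
  rewrite /f nmZ nm2; have h1 := nmD x (z n ** z n).
  have h2 := nm_cmul (z n) (z n).
  have h3 : nm (z n) * nm (z n) <= (3/4) * (3/4) by rewrite ler_pM ?nm_ge0.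
  lra.
have zs n : adj (z n) = z n.
  elim: n => [|n IH] /=; first exact: adj0.
  rewrite /f adjZ adjD adjM IH xs rmorphV ?unitfE ?pnatr_eq0// rmorph_nat//.
have zd n : nm (z n.+1 - z n) <= 1 * (3 / 4) ^+ n.
  rewrite mul1r; elim: n => [|n IH].
    rewrite expr0 subr0 /= /f cmul0r addr0 nmZ nm2; lra.
  rewrite exprS [z n.+2]/= [X in _ - X]/= /f -scalerBr nmZ nm2 opprD addrACA subrr add0r.
  have -> : z n.+1 ** z n.+1 - z n ** z n =
    z n.+1 ** (z n.+1 - z n) + (z n.+1 - z n) ** z n by rewrite cmulBl cmulBr addrA subrK.
  set d := z n.+1 - z n in IH *.
  have h := nmD (z n.+1 ** d) (d ** z n).
  have h1 := nm_cmul (z n.+1) d; have h2 := nm_cmul d (z n).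
  have d0 := nm_ge0 d.
  have h3 : nm (z n.+1) * nm d <= 3 / 4 * nm d by rewrite ler_wpM2r.
  have h4 : nm d * nm (z n) <= nm d * (3 / 4) by rewrite ler_wpM2l.
  have h5 : 3 / 4 * nm d <= 3 / 4 * (3 / 4) ^+ n by rewrite ler_wpM2l//; lra.
  lra.
have [||l zl _] := geo_complete _ _ zd; [lra|lra|].
have ls : adj l = l.
  have := adj_cvg zl; have -> : (fun n => adj (z n)) = z by apply/funext.
  by move=> h; exact: cvg_uniq h zl.
have lf : l = (2^-1 : C) *: (x + l ** l).
  have h1 : (fun n => z n.+1) @ \oo --> l by rewrite cvg_shiftS.
  have h2 : (fun n => z n.+1) @ \oo --> (2^-1 : C) *: (x + l ** l).
    by apply: cvgZr; apply: cvgD; [exact: cvg_cst|exact: cmul_cvg].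
  by move: h1 h2; apply: cvg_unique.
exists (cone - l); split; first by rewrite adjB adj1 ls.
have l2 : l ** l = l + l - x.
  have : (2 : C) *: l = x + l ** l.
    by rewrite {1}lf scalerA divff ?scale1r// pnatr_eq0.
  by rewrite scaler_nat mulr2n => ->; rewrite addrAC subrr add0r.
rewrite cmulBl !cmulBr !cmul1l cmul1r l2 opprB.
by rewrite [X in _ + X]addrAC addrK addrA subrK.
Qed.

(** Positivity replaces spectral theory: after rescaling, [1 - r (adj a ** a)] is the square of a
    selfadjoint [y], and pairing with [v] shows [nm v ^+ 2 - r * nm (p a v) ^+ 2 >= 0]. The factor 2
    comes from the radius 1/2 in [sqrt_one_sub]. *)
Lemma rep_bound (H : hilbertType R) (p : A -> H -> H) : representation p ->
  forall a v, nm (p a v) ^+ 2 <= 2 * nm a ^+ 2 * nm v ^+ 2.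
Proof.
move=> [bp lp p1 pM pA] a v.
have [->|a0] := eqVneq a 0.
  have -> : p 0 v = 0.
    have := lp 1 0 0 v; rewrite !scale1r addr0 => /eqP.
    by rewrite -subr_eq subrr eq_sym => /eqP.
  by rewrite !nm0 expr0n /= mulr0 mul0r.
have na : 0 < nm a by rewrite lt_def nm_eq0 a0 nm_ge0.
pose r := (2 * nm a ^+ 2)^-1.
have r0 : 0 < r by rewrite invr_gt0 mulr_gt0// exprn_gt0.
pose x : A := (r%:C)%C *: (adj a ** a).
have [||y [ys yy]] := @sqrt_one_sub x.
- rewrite /x adjZ adjM adjK; congr (_ *: _); exact: conjc_real.
- rewrite /x nmZ nm_cstar nmR gtr0_norm// /r invfM mulfVK// gt_eqF// exprn_gt0//.
have lin k b c : p (k *: b + c) v = k *: p b v + p c v by exact: lp.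
have e1 : p (cone - x) v = v - (r%:C)%C *: p (adj a ** a) v.
  rewrite -[cone - x]addrC -[- x]scaleN1r /x scalerA lin p1 addrC mulN1r.
  by rewrite scaleNr.
have e2 : dotp v (p (adj a ** a) v) = ((nm (p a v) ^+ 2)%:C)%C.
  by rewrite pM pA dotpxx.
have e3 : dotp v (p (cone - x) v) = ((nm (p y v) ^+ 2)%:C)%C.
  by rewrite -yy pM -{1}ys pA dotpxx.
move: e3; rewrite e1 dotpBr dotpZr e2 dotpxx -rmorphM -rmorphB => /(@complexI R) e3.
have : 0 <= nm v ^+ 2 - r * nm (p a v) ^+ 2 by rewrite e3 sqr_ge0.
by rewrite subr_ge0 /r ler_pdivrMl ?mulr_gt0 ?exprn_gt0.
Qed.

End CStarBasics.

(** * Closed star-subalgebras and generation by alpha and gamma *)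

Section SubCStar.
Variable R : realType.
Local Notation C := R[i].
Variables (A : cstarType R) (S : set A).

Inductive star_poly : A -> Prop :=
| star_poly_gen x : S x -> star_poly x
| star_poly1 : star_poly cone
| star_poly_lin k x y : star_poly x -> star_poly y -> star_poly (k *: x + y)
| star_polyM x y : star_poly x -> star_poly y -> star_poly (x ** y)
| star_poly_adj x : star_poly x -> star_poly (adj x).

Lemma star_poly0 : star_poly 0.
Proof.
have := star_poly_lin (-1) star_poly1 star_poly1.
by rewrite scaleN1r addNr.
Qed.

(** A boolean predicate, so that the subtype below inherits the module structure. *)
Definition star_clos : {pred A} := fun x => `[< closure star_poly x >].

Lemma star_closP x : reflect (closure star_poly x) (x \in star_clos).
Proof. by apply: (iffP idP) => [/asboolP|h]//; apply/asboolP. Qed.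

Lemma star_clos_seq x : x \in star_clos ->
  exists2 u : nat -> A, (forall n, star_poly (u n)) & u @ \oo --> x.
Proof. by move=> /star_closP /closure_seq. Qed.

Lemma seq_closure (V : normedModType C) (P : set V) (u : nat -> V) l :
  (forall n, P (u n)) -> u @ \oo --> l -> closure P l.
Proof.
move=> uP /cvg_nmP ul; apply/closure_nm => e /ul [N hN].
by exists (u N) => //; rewrite nmB hN.
Qed.

Lemma star_clos_of x : star_poly x -> x \in star_clos.
Proof. by move=> h; apply/star_closP; exact: subset_closure. Qed.

Lemma star_clos_lin k x y : x \in star_clos -> y \in star_clos ->
  k *: x + y \in star_clos.
Proof.
move=> /star_clos_seq [u uP ux] /star_clos_seq [v vP vy]; apply/star_closP.
apply: (@seq_closure _ _ (fun n => k *: u n + v n)).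
  by move=> n; exact: star_poly_lin.
by apply: cvgD => //; exact: cvgZr.
Qed.

Lemma star_closM x y : x \in star_clos -> y \in star_clos -> x ** y \in star_clos.
Proof.
move=> /star_clos_seq [u uP ux] /star_clos_seq [v vP vy]; apply/star_closP.
apply: (@seq_closure _ _ (fun n => u n ** v n)).
  by move=> n; exact: star_polyM.
exact: cmul_cvg.
Qed.

Lemma star_clos_adj x : x \in star_clos -> adj x \in star_clos.
Proof.
move=> /star_clos_seq [u uP ux]; apply/star_closP.
apply: (@seq_closure _ _ (fun n => adj (u n))).
  by move=> n; exact: star_poly_adj.
exact: adj_cvg.
Qed.

Fact star_clos_submod : submod_closed star_clos.
Proof.
split; first exact/star_clos_of/star_poly0.
exact: star_clos_lin.
Qed.

HB.instance Definition _ := GRing.isSubmodClosed.Build C A star_clos star_clos_submod.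

(** The closed subalgebra is turned into a C*-algebra in its own right, because the universal
    property speaks only of such targets. *)
Record star_sub := StarSub { star_val : A ; star_valP : star_val \in star_clos }.

HB.instance Definition _ := [isSub for star_val].
HB.instance Definition _ := [Choice of star_sub by <:].
HB.instance Definition _ := [SubChoice_isSubLmodule of star_sub by <:].

Fact star_norm_triangle (x y : star_sub) :
  `|star_val (x + y)| <= `|star_val x| + `|star_val y|.
Proof. exact: ler_normD. Qed.
Fact star_normZ (k : C) (x : star_sub) : `|star_val (k *: x)| = `|k| * `|star_val x|.
Proof. exact: normrZ. Qed.
Fact star_norm0 (x : star_sub) : `|star_val x| = 0 -> x = 0.
Proof. by move=> /normr0_eq0 h; apply/val_inj. Qed.

HB.instance Definition _ := @Lmodule_isNormed.Build C star_sub
  (fun x => `|star_val x|) star_norm_triangle star_normZ star_norm0.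

Fact star_sub_complete (F : set_system star_sub) :
  ProperFilter F -> cauchy F -> cvg F.
Proof.
move=> FF Fc.
have cA : cauchy (star_val @ F).
  apply/cauchyP => e e0; have /cauchyP /(_ e e0) [x xF] := Fc.
  exists (star_val x); move: xF; rewrite /fmap /=.
  apply: filterS => y; rewrite -!ball_normE /ball_ /=.
  by rewrite -[star_val x - star_val y]/(star_val (x - y)).
have : cvg (star_val @ F) by apply/cauchy_cvgP.
move=> /cvg_ex [l Fl].
have lK : l \in star_clos.
  apply/star_closP; rewrite [closure _](closure_id (closure star_poly)).1; last exact: closed_closure.
  move=> B /Fl FB; have [x xB] := filter_ex (FB : F (star_val @^-1` B)).
  by exists (star_val x); split => //; apply/star_closP; exact: star_valP.
apply/cvg_ex; exists (StarSub lK); apply/cvgrPdist_lt => e e0.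
by have /cvgrPdist_lt /(_ e e0) := Fl.
Qed.

HB.instance Definition _ := Uniform_isComplete.Build star_sub star_sub_complete.

Definition star_one : star_sub := StarSub (star_clos_of star_poly1).
Definition star_mul (x y : star_sub) : star_sub :=
  StarSub (star_closM (star_valP x) (star_valP y)).
Definition star_adj (x : star_sub) : star_sub :=
  StarSub (star_clos_adj (star_valP x)).

Fact star_mulA : associative star_mul.
Proof. by move=> x y z; apply/val_inj; exact: cmulA. Qed.
Fact star_mul1l : left_id star_one star_mul.
Proof. by move=> x; apply/val_inj; exact: cmul1l. Qed.
Fact star_mul1r : right_id star_one star_mul.
Proof. by move=> x; apply/val_inj; exact: cmul1r. Qed.
Fact star_mul_linr x : linear (star_mul x).
Proof. by move=> k y z; apply/val_inj; exact: cmul_linear_r. Qed.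
Fact star_mul_linl y : linear (star_mul ^~ y).
Proof. by move=> k x z; apply/val_inj; exact: cmul_linear_l. Qed.
Fact star_adj_semilin (k : C) x y :
  star_adj (k *: x + y) = Num.conj k *: star_adj x + star_adj y.
Proof. by apply/val_inj; exact: adj_semilinear. Qed.
Fact star_adjK : involutive star_adj.
Proof. by move=> x; apply/val_inj; exact: adjK. Qed.
Fact star_adjM x y : star_adj (star_mul x y) = star_mul (star_adj y) (star_adj x).
Proof. by apply/val_inj; exact: adjM. Qed.
Fact star_mul_norm x y : `|star_mul x y| <= `|x| * `|y|.
Proof. exact: cmul_norm. Qed.
Fact star_cstar x : `|star_mul (star_adj x) x| = `|x| ^+ 2.
Proof. exact: cstar_norm. Qed.

HB.instance Definition _ := @CompleteNormed_isCStar.Build R star_sub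
  star_one star_mul star_adj star_mulA star_mul1l star_mul1r star_mul_linr
  star_mul_linl star_adj_semilin star_adjK star_adjM star_mul_norm star_cstar.

End SubCStar.

Section Generation.
Variables (R : realType) (q : R) (A : cstarType R) (a c : A).
Hypothesis univ : SUq2_universal q a c.

(** The universal property maps [A] into the closed subalgebra generated by [a] and [c]. Followed by
    the inclusion, this is an endomorphism fixing [a] and [c], hence the identity by uniqueness. *)
Lemma SUq2_generated (x : A) : closure (star_poly [set a; c]) x.
Proof.
have [rel un] := univ.
have aS : a \in star_clos [set a; c].
  by apply: star_clos_of; apply: star_poly_gen; left.
have cS : c \in star_clos [set a; c].
  by apply: star_clos_of; apply: star_poly_gen; right.
pose B := star_sub [set a; c].
have relB : @SUq2_relations R q B (StarSub aS) (StarSub cS).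
  case: rel => r1 r2 r3 r4 r5.
  by split; apply/val_inj => /=; [exact: r1|exact: r2|exact: r3|exact: r4|exact: r5].
have [f [[[lf f1 fM fA] fa fc] _]] := un B _ _ relB.
have [g [_ gu]] := un A a c rel.
have g1 : g = id by apply: gu; split=> //; split.
have g2 : g = (fun x => star_val (f x)).
  apply: gu; split; last 2 first.
  - by rewrite fa.
  - by rewrite fc.
  split.
  - by move=> k y z; rewrite lf.
  - by rewrite f1.
  - by move=> y z; rewrite fM.
  - by move=> y; rewrite fA.
have : x = star_val (f x) by have := congr1 (fun h : A -> A => h x) g2; rewrite g1.
by move=> ->; apply/star_closP; exact: star_valP.
Qed.

End Generation.

(** * Integration on the circle *)

Section ComplexMeasurable.
Variables (R : realType) (d : measure_display) (T : measurableType d).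
Local Notation C := R[i].
Implicit Types f g : T -> C.

Lemma cmeas_cst (k : C) : cmeasurable (fun _ : T => k).
Proof. by split; exact: measurable_cst. Qed.

Lemma cmeasD f g : cmeasurable f -> cmeasurable g -> cmeasurable (fun x => f x + g x).
Proof.
move=> [f1 f2] [g1 g2]; split.
- rewrite (_ : (fun x => _) = (fun x => complex.Re (f x)) \+ (fun x => complex.Re (g x))).
    exact: measurable_funD.
  by apply/funext => x /=; rewrite ReD.
- rewrite (_ : (fun x => _) = (fun x => complex.Im (f x)) \+ (fun x => complex.Im (g x))).
    exact: measurable_funD.
  by apply/funext => x /=; rewrite ImD.
Qed.

Lemma cmeasM f g : cmeasurable f -> cmeasurable g -> cmeasurable (fun x => f x * g x).
Proof.
move=> [f1 f2] [g1 g2]; split.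
- rewrite (_ : (fun x => _) = ((fun x => complex.Re (f x)) \* (fun x => complex.Re (g x)))
     \- ((fun x => complex.Im (f x)) \* (fun x => complex.Im (g x)))).
    by apply: measurable_funB; exact: measurable_funM.
  by apply/funext => x /=; case: (f x) (g x) => a b [c e].
- rewrite (_ : (fun x => _) = ((fun x => complex.Re (f x)) \* (fun x => complex.Im (g x)))
     \+ ((fun x => complex.Im (f x)) \* (fun x => complex.Re (g x)))).
    by apply: measurable_funD; exact: measurable_funM.
  by apply/funext => x /=; case: (f x) (g x) => a b [c e].
Qed.

Lemma cmeasZ (k : C) f : cmeasurable f -> cmeasurable (fun x => k * f x).
Proof. by move=> mf; apply: cmeasM => //; exact: cmeas_cst. Qed.

Lemma cmeasB f g : cmeasurable f -> cmeasurable g -> cmeasurable (fun x => f x - g x).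
Proof.
move=> mf mg; rewrite (_ : (fun x => _) = (fun x => f x + (- 1) * g x)).
  by apply: cmeasD => //; exact: cmeasZ.
by apply/funext => x; rewrite mulN1r.
Qed.

Lemma cmeasJ f : cmeasurable f -> cmeasurable (fun x => Num.conj (f x)).
Proof.
move=> [f1 f2]; split.
- rewrite (_ : (fun x => _) = (fun x => complex.Re (f x)))//.
  by apply/funext => x; rewrite Re_conj.
- rewrite (_ : (fun x => _) = \- (fun x => complex.Im (f x))).
    exact: measurableT_comp.
  by apply/funext => x; rewrite Im_conj.
Qed.

Lemma cmeas_sum (I : Type) (r : seq I) (P : pred I) (F : I -> T -> C) :
  (forall i, cmeasurable (F i)) -> cmeasurable (fun x => \sum_(i <- r | P i) F i x).
Proof.
move=> mF; elim: r => [|i r IH].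
  rewrite (_ : (fun _ => _) = fun=> 0); first exact: cmeas_cst.
  by apply/funext => x; rewrite big_nil.
rewrite (_ : (fun x => _) = fun x => (if P i then F i x else 0) + \sum_(i <- r | P i) F i x).
  apply: cmeasD => //; case: (P i) => //; exact: cmeas_cst.
by apply/funext => x; rewrite big_cons; case: ifP; rewrite ?add0r.
Qed.

Lemma cmeas_lim (F : nat -> T -> C) f : (forall n, cmeasurable (F n)) ->
  (forall x, (fun n => F n x : R[i]^o) @ \oo --> (f x : R[i]^o)) -> cmeasurable f.
Proof.
move=> mF Ff.
have h (g : C -> R) : (forall k l, g (k - l) = g k - g l) -> (forall k, `|g k| <= nm k) ->
    forall x, (fun n => g (F n x)) @ \oo --> g (f x).
  move=> gB gle x; apply/cvgrPdist_lt => e e0.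
  have /cvg_nmP /(_ e e0) [N hN] := Ff x; exists N => // n /= Nn.
  by rewrite distrC -gB; apply: le_lt_trans (gle _) (hN n Nn).
split.
- apply: (measurable_fun_cvg (h := fun n x => complex.Re (F n x))).
    by move=> m; case: (mF m).
  by move=> x _; apply: h => // [k l|k]; [exact: ReB|exact: nmRe].
- apply: (measurable_fun_cvg (h := fun n x => complex.Im (F n x))).
    by move=> m; case: (mF m).
  by move=> x _; apply: h => // [k l|k]; [exact: raddfB|exact: nmIm].
Qed.

Lemma cmeas_nm2 f : cmeasurable f -> measurable_fun setT (fun x => nm (f x) ^+ 2).
Proof.
move=> [f1 f2]; rewrite (_ : (fun x => _) =
  (fun x => complex.Re (f x) ^+ 2) \+ (fun x => complex.Im (f x) ^+ 2)).
  by apply: measurable_funD; exact: measurable_funX.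
by apply/funext => x; rewrite nm_sqr.
Qed.

Lemma cmeas_real (f : T -> R) : measurable_fun setT f ->
  cmeasurable (fun x => ((f x)%:C)%C).
Proof. by move=> mf; split => //=; exact: measurable_cst. Qed.

End ComplexMeasurable.

Section ComplexIntegral.
Variables (R : realType) (d : measure_display) (T : measurableType d).
Variable P : probability T R.
Local Notation C := R[i].
Implicit Types f g : T -> C.

Definition bmeas f := cmeasurable f /\ exists M : R, forall x, nm (f x) <= M.

Definition cint f : C :=
  Complex (\int[P]_x complex.Re (f x)) (\int[P]_x complex.Im (f x)).

Lemma bmeas_integrable f : bmeas f ->
  P.-integrable setT (EFin \o (fun x => complex.Re (f x))) /\
  P.-integrable setT (EFin \o (fun x => complex.Im (f x))).
Proof.
move=> [[f1 f2] [M fM]].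
have PT : (P setT < +oo)%E by rewrite probability_setT ltry.
split; apply: measurable_bounded_integrable => //;
  exists M; split; rewrite ?num_real// => y My x _ /=.
- exact: le_trans (le_trans (nmRe _) (fM x)) (ltW My).
- exact: le_trans (le_trans (nmIm _) (fM x)) (ltW My).
Qed.

Lemma bmeas_cst (k : C) : bmeas (fun=> k).
Proof. by split; [exact: cmeas_cst|exists (nm k)]. Qed.

Lemma bmeasD f g : bmeas f -> bmeas g -> bmeas (fun x => f x + g x).
Proof.
move=> [mf [M fM]] [mg [N gN]]; split; first exact: cmeasD.
by exists (M + N) => x; apply: le_trans (nmD _ _) _; exact: lerD.
Qed.

Lemma bmeasM f g : bmeas f -> bmeas g -> bmeas (fun x => f x * g x).
Proof.
move=> [mf [M fM]] [mg [N gN]]; split; first exact: cmeasM.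
by exists (M * N) => x; rewrite nmM; apply: ler_pM; rewrite ?nm_ge0.
Qed.

Lemma bmeasZ k f : bmeas f -> bmeas (fun x => k * f x).
Proof. by move=> ?; apply: bmeasM => //; exact: bmeas_cst. Qed.

Lemma bmeasJ f : bmeas f -> bmeas (fun x => Num.conj (f x)).
Proof. by move=> [mf [M fM]]; split; [exact: cmeasJ|exists M => x; rewrite nmJ]. Qed.

Lemma bmeasX f n : bmeas f -> bmeas (fun x => f x ^+ n).
Proof.
move=> bf; elim: n => [|n IH]; first by under eq_fun do rewrite expr0; exact: bmeas_cst.
by under eq_fun do rewrite exprS; exact: bmeasM.
Qed.

Lemma bmeas_sum (I : Type) (r : seq I) (Q : pred I) (F : I -> T -> C) :
  (forall i, bmeas (F i)) -> bmeas (fun x => \sum_(i <- r | Q i) F i x).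
Proof.
move=> mF; elim: r => [|i r IH].
  by under eq_fun do rewrite big_nil; exact: bmeas_cst.
under eq_fun do rewrite big_cons.
by case: (Q i) => //; exact: bmeasD.
Qed.

Lemma cintD f g : bmeas f -> bmeas g -> cint (fun x => f x + g x) = cint f + cint g.
Proof.
move=> /bmeas_integrable[f1 f2] /bmeas_integrable[g1 g2].
apply/eqP; rewrite eq_complex /= -!RintegralD//; apply/andP; split; apply/eqP;
  by apply: eq_Rintegral => x _; rewrite ?ReD ?ImD.
Qed.

Lemma cintZ k f : bmeas f -> cint (fun x => k * f x) = k * cint f.
Proof.
move=> /bmeas_integrable[f1 f2]; case: k => a b.
apply/eqP; rewrite eq_complex /= -!RintegralZl//.
have i1 (c : R) : P.-integrable setT (EFin \o (fun x => c * complex.Re (f x))).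
  exact: (integrableZl measurableT c f1).
have i2 (c : R) : P.-integrable setT (EFin \o (fun x => c * complex.Im (f x))).
  exact: (integrableZl measurableT c f2).
rewrite -RintegralB// -RintegralD//.
apply/andP; split; apply/eqP; apply: eq_Rintegral => x _; by case: (f x).
Qed.

Lemma cint_cst k : cint (fun=> k) = k.
Proof.
by case: k => a b; rewrite /cint /= !Rintegral_cst// /= probability_setT /= !mulr1.
Qed.

Lemma cint_sum (I : Type) (r : seq I) (Q : pred I) (F : I -> T -> C) :
  (forall i, bmeas (F i)) ->
  cint (fun x => \sum_(i <- r | Q i) F i x) = \sum_(i <- r | Q i) cint (F i).
Proof.
move=> mF; elim: r => [|i r IH].
  rewrite big_nil -[RHS]cint_cst; congr cint; apply/funext => x; by rewrite big_nil.
rewrite big_cons -IH; case: ifP => h; last first.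
  by congr cint; apply/funext => x; rewrite big_cons h.
rewrite -cintD//; last exact: bmeas_sum.
by congr cint; apply/funext => x; rewrite big_cons h.
Qed.

(** Bounding real and imaginary part separately costs the factor 2, which reappears in the Cauchy
    estimates. *)
Lemma cint_bound f (M : R) : bmeas f -> (forall x, nm (f x) <= M) ->
  nm (cint f) <= 2 * M.
Proof.
move=> bf fM; have [f1 f2] := bmeas_integrable bf.
have key (g : T -> R) : P.-integrable setT (EFin \o g) -> (forall x, `|g x| <= M) ->
    `|\int[P]_x g x| <= M.
  move=> ig gM; apply: le_trans (le_normr_Rintegral _ ig) _ => //.
  have -> : M = \int[P]_x (cst M x) by rewrite Rintegral_cst//= probability_setT mulr1.
  apply: le_Rintegral => //.
  - exact: (integrable_abse ig).
  - by apply: finite_measure_integrable_cst.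
apply: le_trans (nm_ReIm _) _; rewrite mulr_natl mulr2n /=; apply: lerD; apply: key => // x.
- exact: le_trans (nmRe _) (fM x).
- exact: le_trans (nmIm _) (fM x).
Qed.

Lemma cint_real (g : T -> R) : measurable_fun setT g -> (forall x, 0 <= g x) ->
  (exists M : R, forall x, g x <= M) ->
  (\int[P]_x (g x)%:E = (complex.Re (cint (fun x => ((g x)%:C)%C)))%:E)%E.
Proof.
move=> mg g0 [M gM]; have bg : bmeas (fun x => ((g x)%:C)%C).
  by split; [exact: cmeas_real|exists M => x; rewrite nmR ger0_norm].
have [f1 _] := bmeas_integrable bg.
rewrite /cint /= /Rintegral fineK//; exact: integrable_fin_num f1.
Qed.

End ComplexIntegral.

(** * Integrals of powers over the circle *)

Section CircleIntegral.
Variable R : realType.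
Local Notation C := R[i].
Local Notation circ := (@circle_lebesgue R).
Local Open Scope ring_scope.

Lemma measurable_circle_coord : measurable_fun setT (@circle_coord R).
Proof. by move=> _ Y mY; exists Y. Qed.

Lemma cmeas_circle : cmeasurable (fun la : circle R => (la : C)).
Proof.
have mc := measurable_circle_coord; split.
- exact: (measurableT_comp measurable_fst mc).
- exact: (measurableT_comp measurable_snd mc).
Qed.

Lemma nm_circle (la : circle R) : nm (la : C) = 1.
Proof. by case: la => z /= /eqP h; rewrite /nm h. Qed.

Lemma bmeas_circle : bmeas (fun la : circle R => (la : C)).
Proof. by split; [exact: cmeas_circle|exists 1 => la; rewrite nm_circle]. Qed.

Lemma circle_conj (la : circle R) : (la : C) * Num.conj (la : C) = 1.
Proof. by rewrite mul_conj nm_circle expr1n. Qed.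

Lemma circle_expX m (t : R) : (circle_exp t : C) ^+ m =
  Complex (cos (2 * pi * m%:R * t)) (sin (2 * pi * m%:R * t)).
Proof.
elim: m => [|m IH]; first by rewrite expr0 mulr0 mul0r cos0 sin0.
rewrite exprS IH /= (_ : 2 * pi * m.+1%:R * t = 2 * pi * t + 2 * pi * m%:R * t).
  by rewrite cosD sinD; simpc; congr (Complex _ _); ring.
by rewrite -natr1; ring.
Qed.

Lemma ge0_int_circle (f : circle R -> \bar R) : measurable_fun setT f ->
  (forall x, 0 <= f x)%E ->
  (\int[circ]_x f x = \int[lebesgue_measure]_(t in `[0%R, 1%R]) f (circle_exp t))%E.
Proof.
move=> mf f0; rewrite ge0_integral_distribution// integral_uniform//=.
  by rewrite subr0 invr1 mul1e.
by apply: measurableT_comp => //; exact: measurable_circle_exp.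
Qed.

(** The summand 1 keeps the integrand nonnegative when [f] is a cosine or a sine, as the change of
    variables [ge0_int_circle] requires. *)
Lemma int_one_plus (F f : R -> R) :
  (forall t : R, is_derive t (1 : R) F (1 + f t)) -> continuous f -> F 1 - F 0 = 1 ->
  (\int[lebesgue_measure]_(t in `[0%R, 1%R]) (1 + f t)%:E = 1)%E.
Proof.
move=> dF cf F1; rewrite (@continuous_FTC2 _ _ F)//.
- by rewrite -EFinB F1.
- apply: continuous_subspaceT => x; apply: cvgD; [exact: cvg_cst|exact: cf].
- have cF : continuous F.
    by move=> x; apply: differentiable_continuous; apply/derivable1_diffP; have := dF x; case.
  split.
  + by move=> x _; have := dF x; case.
  + by apply: cvg_at_right_filter; exact: cF.
  + by apply: cvg_at_left_filter; exact: cF.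
- by move=> x _; rewrite derive1E; have := dF x; case.
Qed.

Lemma cont_lin (k : R) : continuous (fun t : R => k * t).
Proof. by move=> t; apply: cvgMr; exact: cvg_id. Qed.

Lemma cint_circleX m : (0 < m)%N -> cint circ (fun la : circle R => (la : C) ^+ m) = 0.
Proof.
move=> m0; set k : R := 2 * pi * m%:R.
have k0 : k != 0 by rewrite !mulf_neq0// ?gt_eqF ?pi_gt0// ltr0n.
have ek : Complex (cos k) (sin k) = 1.
  have := circle_expX m 1; rewrite mulr1 -/k => <-.
  by rewrite /= mulr1 mulr_natl cos2pi sin2pi expr1n.
have bl := bmeasX m bmeas_circle.
have [i1 i2] := bmeas_integrable circ bl.
have mlX : cmeasurable (fun la : circle R => (la : C) ^+ m) by case: bl.
have nmX1 (la : circle R) : nm ((la : C) ^+ m) = 1 by rewrite nmX nm_circle expr1n.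
(* Real and imaginary part are treated alike: [g] is one of them, [gg] the corresponding
   trigonometric function and [G] a primitive of [1 + gg]. *)
have key (g : C -> R) (G gg : R -> R) : (forall t, g ((circle_exp t : C) ^+ m) = gg t) ->
    measurable_fun setT (fun la : circle R => g ((la : C) ^+ m)) ->
    circ.-integrable setT (EFin \o (fun la : circle R => g ((la : C) ^+ m))) ->
    (forall la : circle R, -1 <= g ((la : C) ^+ m)) ->
    (forall t : R, is_derive t (1 : R) G (1 + gg t)) -> continuous gg -> G 1 - G 0 = 1 ->
    \int[circ]_x g ((x : C) ^+ m) = 0.
  move=> gE mg ig g1 dG cg G1.
  have ic : circ.-integrable setT (EFin \o cst (1 : R)) by apply: finite_measure_integrable_cst.
  have : (\int[circ]_x (1 + g ((x : C) ^+ m))%:E = 1)%E.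
    rewrite ge0_int_circle.
    - rewrite -(int_one_plus dG cg G1); apply: eq_integral => t _.
      by rewrite gE.
    - by apply/measurable_EFinP; apply: measurable_funD.
    - by move=> x; rewrite lee_fin -lerBlDl sub0r.
  move=> h; have : \int[circ]_x (1 + g ((x : C) ^+ m)) = 1 by rewrite /Rintegral h.
  rewrite (RintegralD _ ic ig)// Rintegral_cst//= probability_setT mulr1.
  by move=> e1; apply: (addrI 1); rewrite e1 addr0.
rewrite /cint; apply/eqP; rewrite eq_complex /=; apply/andP; split; apply/eqP.
- apply: (key _ (fun t => t + k^-1 * sin (k * t)) (fun t => cos (k * t))) => //.
  + by move=> t; rewrite circle_expX.
  + by case: mlX.
  + move=> la; have := nmRe ((la : C) ^+ m); rewrite nmX1 ler_norml; by case/andP.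
  + move=> t; apply: is_derive_eq; rewrite /GRing.scale /=; field.
    done.
  + by move=> t; apply: continuous_comp; [exact: cont_lin|exact: continuous_cos].
  + rewrite mulr1 mulr0 sin0 mulr0 addr0 subr0.
    suff -> : sin k = 0 by rewrite mulr0 addr0.
    by case: ek.
- apply: (key _ (fun t => t - k^-1 * cos (k * t)) (fun t => sin (k * t))) => //.
  + by move=> t; rewrite circle_expX.
  + by case: mlX.
  + move=> la; have := nmIm ((la : C) ^+ m); rewrite nmX1 ler_norml; by case/andP.
  + move=> t; apply: is_derive_eq; rewrite /GRing.scale /=; field.
    done.
  + by move=> t; apply: continuous_comp; [exact: cont_lin|exact: continuous_sin].
  + rewrite mulr1 mulr0 cos0.
    suff -> : cos k = 1 by ring.
    by case: ek.
Qed.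

Lemma cintJ (d : measure_display) (T : measurableType d) (P : probability T R) (f : T -> C) :
  bmeas f -> cint P (fun x => Num.conj (f x)) = Num.conj (cint P f).
Proof.
move=> bf; have [f1 f2] := bmeas_integrable P bf.
apply/eqP; rewrite eq_complex; apply/andP; split; apply/eqP; rewrite ?Re_conj ?Im_conj /=.
- by apply: eq_Rintegral => x _; rewrite Re_conj.
- transitivity (\int[P]_x (-1 * complex.Im (f x))).
    by apply: eq_Rintegral => x _; rewrite Im_conj mulN1r.
  by rewrite RintegralZl// mulN1r.
Qed.

End CircleIntegral.

Section SquareIntegral.
Variables (R : realType) (d : measure_display) (T : measurableType d).
Variable P : probability T R.
Local Notation C := R[i].
Local Open Scope ereal_scope.

Definition L2n (f : T -> C) : \bar R := \int[P]_x (nm (f x) ^+ 2)%:E.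

Lemma L2n_ge0 f : 0 <= L2n f.
Proof. by apply: integral_ge0 => x _; rewrite lee_fin sqr_ge0. Qed.

Lemma mnm2 (f : T -> C) : cmeasurable f -> measurable_fun setT (fun x => (nm (f x) ^+ 2)%:E).
Proof. by move=> mf; apply/measurable_EFinP; exact: cmeas_nm2. Qed.

Lemma L2n_le f g (K : R) : (0 <= K)%R -> cmeasurable f -> cmeasurable g ->
  (forall x, nm (f x) ^+ 2 <= K * nm (g x) ^+ 2)%R ->
  L2n f <= K%:E * L2n g.
Proof.
move=> K0 mf mg h; rewrite /L2n -ge0_integralZl_EFin//; last 2 first.
- by move=> x _; rewrite lee_fin sqr_ge0.
- exact: mnm2.
apply: ge0_le_integral => //.
- by move=> x _; rewrite lee_fin sqr_ge0.
- exact: mnm2.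
- by apply: emeasurable_funM; [exact: measurable_cst|exact: mnm2].
- by move=> x _; rewrite -EFinM lee_fin h.
Qed.

Lemma L2n_D f g : cmeasurable f -> cmeasurable g ->
  L2n (fun x => f x + g x)%R <= 2%:E * L2n f + 2%:E * L2n g.
Proof.
move=> mf mg; rewrite /L2n -!ge0_integralZl_EFin//; try by
  [move=> x _; rewrite lee_fin sqr_ge0|exact: mnm2].
have m2 (h : T -> C) : cmeasurable h -> measurable_fun setT (fun x => 2%:E * (nm (h x) ^+ 2)%:E).
  by move=> mh; apply: emeasurable_funM; [exact: measurable_cst|exact: mnm2].
have p2 (h : T -> C) x : 0 <= 2%:E * (nm (h x) ^+ 2)%:E.
  by rewrite -EFinM lee_fin mulr_ge0// sqr_ge0.
rewrite -ge0_integralD//; try exact: m2.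
apply: ge0_le_integral => //.
- by move=> x _; rewrite lee_fin sqr_ge0.
- by apply: mnm2; exact: cmeasD.
- by apply: emeasurable_funD; exact: m2.
- by move=> x _; rewrite -!EFinM -EFinD lee_fin; exact: (@nm_sq_D2 _ (R[i]^o : normedModType R[i])).
Qed.

Lemma L2n_bounded f (M : R) : cmeasurable f -> (forall x, nm (f x) <= M)%R ->
  L2n f <= (M ^+ 2)%:E.
Proof.
move=> mf fM; apply: (@le_trans _ _ (\int[P]_x (cst (M ^+ 2)%:E x))).
  apply: ge0_le_integral => //.
  - by move=> x _; rewrite lee_fin sqr_ge0.
  - exact: mnm2.
  - move=> x _; rewrite lee_fin ler_pXn2r ?nnegrE ?nm_ge0//.
    exact: le_trans (nm_ge0 _) (fM x).
by rewrite integral_cst//= probability_setT mule1.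
Qed.

(** Dominated convergence to 0, in the form used by approximation arguments, which need one good
    index. *)
Lemma small_integral (u : nat -> T -> R) (w : T -> R) (e : R) :
  (forall n, measurable_fun setT (u n)) -> (forall n x, 0 <= u n x)%R ->
  (forall x, (fun n => u n x) @ \oo --> 0%R) ->
  measurable_fun setT w -> (forall n x, u n x <= w x)%R ->
  \int[P]_x (w x)%:E < +oo -> (0 < e)%R ->
  exists n, \int[P]_x (u n x)%:E <= e%:E.
Proof.
move=> mu u0 ulim mw uw iw e0.
have w0 x : (0 <= w x)%R := le_trans (u0 0%N x) (uw 0%N x).
have [|||||_ _ h] := @dominated_convergence _ _ _ P setT measurableT
  (fun n x => (u n x)%:E) (cst 0) (EFin \o w).
- by move=> n; apply/measurable_EFinP.
- exact: measurable_cst.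
- apply: aeW => x _; apply: cvg_EFin; [exact: nearW|exact: ulim].
- apply/integrableP; split; first exact/measurable_EFinP.
  rewrite (eq_integral (fun x => (w x)%:E))// => x _.
  by rewrite /= ger0_norm.
- by apply: aeW => x n _; rewrite /= lee_fin ger0_norm.
rewrite integral0 in h.
have /fine_cvgP[hfin hlim] := h.
have [N1 _ h1] := hfin.
have /cvgrPdist_lt /(_ e e0) [N2 _ h2] := hlim.
exists (maxn N1 N2).
have f1 := h1 _ (leq_maxl N1 N2); have f2 := h2 _ (leq_maxr N1 N2).
rewrite /= in f1 f2; rewrite -(fineK f1) lee_fin ltW//.
by move: f2; rewrite sub0r normrN; apply: le_lt_trans; exact: ler_norm.
Qed.

End SquareIntegral.

(** * Density of trigonometric polynomials in L2 of the circle *)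

Section TrigDensity.
Variable R : realType.
Local Notation C := R[i].
Local Notation circ := (@circle_lebesgue R).
Local Notation N2 := (L2n circ).
Implicit Types (f g p : circle R -> C).

(** The constructors mirror what left multiplication by [gamma] and its adjoint does to a matrix
    unit, so that [M_elem_trig] and [z_trig] are inductions over them. *)
Inductive trig : (circle R -> C) -> Prop :=
| trig1 : trig (fun=> 1)
| trig_lin (k : C) f g : trig f -> trig g -> trig (fun x => k * f x + g x)
| trig_mul f : trig f -> trig (fun x => (x : C) * f x)
| trig_mulJ f : trig f -> trig (fun x => Num.conj (x : C) * f x).

Lemma trig_bmeas f : trig f -> bmeas f.
Proof.
elim=> [|k g h _ bg _ bh|g _ bg|g _ bg]; first exact: bmeas_cst.
- by apply: bmeasD => //; exact: bmeasZ.
- by apply: bmeasM => //; exact: bmeas_circle.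
- by apply: bmeasM => //; apply: bmeasJ; exact: bmeas_circle.
Qed.

Lemma trig0 : trig (fun=> 0).
Proof.
have := trig_lin (-1) trig1 trig1; congr trig.
by apply/funext => x; rewrite mulr1 addNr.
Qed.

Definition trig_appr f := cmeasurable f /\
  forall e : R, 0 < e -> exists2 p, trig p & (N2 (fun x => (f x - p x)%R) <= e%:E)%E.

Lemma trig_appr_of f : trig f -> trig_appr f.
Proof.
move=> tf; split; first by case: (trig_bmeas tf).
move=> e e0; exists f => //; rewrite /L2n (eq_integral (cst 0%E)) ?integral0 ?lee_fin ?ltW//.
by move=> x _; rewrite subrr nm0 expr0n.
Qed.

Lemma trig_cmeas p : trig p -> cmeasurable p.
Proof. by move=> /trig_bmeas []. Qed.

Lemma trig_appr_clos f : cmeasurable f ->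
  (forall e : R, 0 < e -> exists2 g, trig_appr g & (N2 (fun x => (f x - g x)%R) <= e%:E)%E) ->
  trig_appr f.
Proof.
move=> mf h; split=> // e e0.
have e4 : 0 < e / 4 by rewrite divr_gt0.
have [g [mg ag] fg] := h _ e4.
have [p tp gp] := ag _ e4.
exists p => //; have mp := trig_cmeas tp.
have -> : (fun x => f x - p x) = (fun x => (f x - g x) + (g x - p x)).
  by apply/funext => x; rewrite addrA subrK.
apply: le_trans (L2n_D _ _ _) _; [exact: cmeasB|exact: cmeasB|].
apply: (@le_trans _ _ (2%:E * (e / 4)%:E + 2%:E * (e / 4)%:E)%E).
  by apply: leeD; apply: lee_pmul => //; exact: L2n_ge0.
by rewrite -EFinM -EFinD lee_fin; lra.
Qed.

Lemma trig_appr_lin k f g : trig_appr f -> trig_appr g ->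
  trig_appr (fun x => k * f x + g x).
Proof.
move=> [mf af] [mg ag]; split; first by apply: cmeasD => //; exact: cmeasZ.
move=> e e0; pose K := nm k ^+ 2.
have K0 : 0 <= K by exact: sqr_ge0.
have e1 : 0 < e / (4 * (K + 1)) by rewrite divr_gt0// mulr_gt0// ltr_wpDl.
have e2 : 0 < e / 4 by rewrite divr_gt0.
have [p tp fp] := af _ e1; have [r tr gr] := ag _ e2.
have mp := trig_cmeas tp; have mr := trig_cmeas tr.
exists (fun x => k * p x + r x); first exact: trig_lin.
have -> : (fun x => k * f x + g x - (k * p x + r x)) =
    (fun x => k * (f x - p x) + (g x - r x)).
  by apply/funext => x; ring.
apply: le_trans (L2n_D _ _ _) _; [by apply: cmeasZ; exact: cmeasB|exact: cmeasB|].
have h : (N2 (fun x => (k * (f x - p x))%R) <= K%:E * (e / (4 * (K + 1)))%:E)%E.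
  apply: (@le_trans _ _ (K%:E * N2 (fun x => (f x - p x)%R))%E).
    apply: L2n_le => //; [by apply: cmeasZ; exact: cmeasB|exact: cmeasB|].
    by move=> x; rewrite nmM exprMn.
  by apply: lee_pmul => //; exact: L2n_ge0.
apply: (@le_trans _ _ (2%:E * (K * (e / (4 * (K + 1))))%:E + 2%:E * (e / 4)%:E)%E).
  by apply: leeD; apply: lee_pmul => //; exact: L2n_ge0.
rewrite -!EFinM -EFinD lee_fin.
have : K * (e / (4 * (K + 1))) <= e / 4.
  have K1 : 0 < K + 1 by rewrite ltr_wpDl.
  have -> : K * (e / (4 * (K + 1))) = e / 4 * (K / (K + 1)) by field; rewrite gt_eqF.
  by rewrite ler_piMr ?(ltW e2)// ler_pdivrMr// mul1r lerDl.
lra.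
Qed.

Lemma trig_appr_fin f : trig_appr f -> (N2 f < +oo)%E.
Proof.
move=> [mf af]; have [p tp fp] := af 1 ltr01; have mp := trig_cmeas tp.
have [_ [M pM]] := trig_bmeas tp.
have -> : f = (fun x => (f x - p x) + p x) by apply/funext => x; rewrite subrK.
apply: le_lt_trans (L2n_D _ _ _) _ => //; first exact: cmeasB.
apply: (@le_lt_trans _ _ (2%:E * 1%:E + 2%:E * (M ^+ 2)%:E)%E); last by rewrite -!EFinM -EFinD ltry.
apply: leeD; apply: lee_pmul => //; [exact: L2n_ge0|exact: L2n_ge0|].
exact: L2n_bounded.
Qed.

(* Bounded real functions multiplying the closure of the trigonometric
   polynomials into itself: an algebra stable under bounded pointwise limits. *)
Definition trig_mult (v : circle R -> R) := [/\ measurable_fun setT v,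
  exists M : R, forall x, `|v x| <= M &
  forall g, trig_appr g -> trig_appr (fun x => ((v x)%:C)%C * g x)].

(** Dominated convergence: the squared error is at most [(2 M)^2 |g|^2], which is integrable because
    [g] is a limit of bounded functions in L2. *)
Lemma trig_mult_lim (F : nat -> circle R -> R) (v : circle R -> R) (M : R) :
  (forall n, trig_mult (F n)) -> (forall n x, `|F n x| <= M) ->
  (forall x, (fun n => F n x) @ \oo --> v x) -> trig_mult v.
Proof.
move=> mF FM Fv.
have mv : measurable_fun setT v.
  by apply: (measurable_fun_cvg (h := F)) => [n|x _]; [case: (mF n)|exact: Fv].
have vM x : `|v x| <= M.
  have h : (fun n => `|F n x|) @ \oo --> `|v x| by apply: cvg_norm; exact: Fv.
  by apply: (cvgr_to_le h); apply: nearW => n; exact: FM.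
split=> //; first by exists M.
move=> g ag; have [mg _] := ag; have gfin := trig_appr_fin ag.
have M0 : 0 <= M by apply: le_trans (vM point).
apply: trig_appr_clos; first by apply: cmeasM => //; exact: cmeas_real.
move=> e e0.
have mFn n : measurable_fun setT (F n) by case: (mF n).
have [|||||||n hn] := @small_integral _ _ _ circ
  (fun n x => nm (((v x)%:C)%C * g x - ((F n x)%:C)%C * g x) ^+ 2)
  (fun x => (2 * M) ^+ 2 * nm (g x) ^+ 2) e.
- by move=> n; apply: cmeas_nm2; apply: cmeasB; apply: cmeasM => //; exact: cmeas_real.
- by move=> n x; exact: sqr_ge0.
- move=> x.
  have E n : nm (((v x)%:C)%C * g x - ((F n x)%:C)%C * g x) ^+ 2 =
      (v x - F n x) ^+ 2 * nm (g x) ^+ 2.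
    by rewrite -mulrBl nmM -rmorphB nmR exprMn real_normK ?num_real.
  apply: (cvg_seq_eq (fun n => esym (E n))).
  have -> : (0 : R) = (v x - v x) * (v x - v x) * nm (g x) ^+ 2 by rewrite subrr mul0r mul0r.
  apply: cvgMl; rewrite (_ : (fun n => (v x - F n x) ^+ 2) = (fun n => (v x - F n x) * (v x - F n x))).
    by apply: cvgM; apply: cvgB; (try exact: cvg_cst); exact: Fv.
  by apply/funext => n; rewrite expr2.
- by apply: measurable_funM; [exact: measurable_cst|exact: cmeas_nm2].
- move=> n x; rewrite -mulrBl nmM -rmorphB nmR exprMn ler_wpM2r ?sqr_ge0//.
  rewrite ler_pXn2r ?nnegrE// ?mulr_ge0//; apply: le_trans (ler_normB _ _) _.
  by rewrite mulr_natl mulr2n lerD.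
- rewrite (eq_integral (fun x => ((2 * M) ^+ 2)%:E * (nm (g x) ^+ 2)%:E)%E)//.
  rewrite ge0_integralZl_EFin ?sqr_ge0//; last 2 first.
    by move=> x _; rewrite lee_fin sqr_ge0.
    exact: mnm2.
  by apply: lte_mul_pinfty => //; rewrite lee_fin sqr_ge0.
- exact: e0.
by exists (fun x => ((F n x)%:C)%C * g x) => //; case: (mF n) => _ _; apply.
Qed.

Lemma trig_mult_cst (k : R) : trig_mult (fun=> k).
Proof.
split; [exact: measurable_cst|by exists (`|k|)|].
move=> g ag; have := trig_appr_lin ((k%:C)%C) ag (trig_appr_of trig0).
by congr trig_appr; apply/funext => x; rewrite addr0.
Qed.

Lemma trig_multD v w : trig_mult v -> trig_mult w -> trig_mult (fun x => v x + w x).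
Proof.
move=> [mv [M vM] av] [mw [N wN] aw]; split; first exact: measurable_funD.
  by exists (M + N) => x; apply: le_trans (ler_normD _ _) _; exact: lerD.
move=> g ag; have := trig_appr_lin 1 (av g ag) (aw g ag).
by congr trig_appr; apply/funext => x; rewrite mul1r -mulrDl rmorphD.
Qed.

Lemma trig_multM v w : trig_mult v -> trig_mult w -> trig_mult (fun x => v x * w x).
Proof.
move=> [mv [M vM] av] [mw [N wN] aw]; split; first exact: measurable_funM.
  by exists (M * N) => x; rewrite normrM; apply: ler_pM.
move=> g ag; have := av _ (aw g ag).
by congr trig_appr; apply/funext => x; rewrite mulrA -rmorphM.
Qed.

Lemma trig_multZ k v : trig_mult v -> trig_mult (fun x => k * v x).
Proof. by move=> h; apply: trig_multM => //; exact: trig_mult_cst. Qed.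

Lemma trig_multX v n : trig_mult v -> trig_mult (fun x => v x ^+ n).
Proof.
move=> h; elim: n => [|n IH]; first by under eq_fun do rewrite expr0; exact: trig_mult_cst.
by under eq_fun do rewrite exprS; exact: trig_multM.
Qed.

(** A function of modulus at most 1 acts contractively on L2, so it carries approximations of [g] to
    approximations of the product, and multiplication by [z] or its conjugate preserves [trig]. *)
Lemma trig_mult_ReIm :
  trig_mult (fun x => complex.Re (x : C)) /\ trig_mult (fun x => complex.Im (x : C)).
Proof.
have [m1 m2] := cmeas_circle R.
have key (h : circle R -> C) (f : circle R -> C) : (forall g, trig g -> trig (fun x => h x * g x)) ->
    (forall x, nm (h x) <= 1) -> cmeasurable h -> forall g, trig_appr g -> trig_appr (fun x => h x * g x).
  move=> th h1 mh g [mg ag]; split; first exact: cmeasM.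
  move=> e e0; have [p tp gp] := ag e e0; exists (fun x => h x * p x); first exact: th.
  have mp := trig_cmeas tp.
  apply: le_trans gp; rewrite -[leRHS]mul1e; apply: L2n_le => //.
  - by apply: cmeasB; exact: cmeasM.
  - exact: cmeasB.
  - move=> x; rewrite -mulrBr nmM exprMn ler_wpM2r ?sqr_ge0//.
    by rewrite -(expr1n _ 2) ler_pXn2r ?nnegrE ?nm_ge0.
split; split => //.
- by exists 1 => x; apply: le_trans (nmRe _) _; rewrite nm_circle.
- apply: (key (fun x => ((complex.Re (x : C))%:C)%C) (fun=> 0)).
  + move=> g tg; have := trig_lin (2^-1) (trig_mul tg) (trig_lin (2^-1) (trig_mulJ tg) trig0).
    congr trig; apply/funext => x; rewrite addr0 -mulrDr -mulrDl add_conj mulrA rmorphM rmorph_nat.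
    by rewrite mulKf ?pnatr_eq0.
  + by move=> x; rewrite nmR; apply: le_trans (nmRe _) _; rewrite nm_circle.
  + exact: cmeas_real.
- by exists 1 => x; apply: le_trans (nmIm _) _; rewrite nm_circle.
- apply: (key (fun x => ((complex.Im (x : C))%:C)%C) (fun=> 0)).
  + move=> g tg; have := trig_lin (- (2^-1) * Complex 0 1) (trig_mul tg)
      (trig_lin (2^-1 * Complex 0 1) (trig_mulJ tg) trig0).
    congr trig; apply/funext => -[[a b] h] /=; rewrite addr0 !mulrA -mulrDl; congr (_ * _).
    rewrite -[2^-1 : C]/((2 : C)^-1) (_ : (2 : C)^-1 = ((2^-1)%:C)%C) ?fmorphV ?rmorph_nat//.
    by apply/eqP; rewrite eq_complex; simpc; apply/andP; split; apply/eqP => /=; field.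
  + by move=> x; rewrite nmR; apply: le_trans (nmIm _) _; rewrite nm_circle.
  + exact: cmeas_real.
Qed.

Lemma trig_mult_ext v w : (forall x, v x = w x) -> trig_mult v -> trig_mult w.
Proof. by move=> /funext ->. Qed.

Lemma cvg_geo0 (a : R) : 0 <= a -> a < 1 -> (fun n => a ^+ n) @ \oo --> (0 : R).
Proof. by move=> a0 a1; apply: cvg_expr; rewrite ger0_norm. Qed.

(* [p' = p + (v^2 - p^2)/2] increases to [|v|]. *)
Lemma trig_mult_abs v : trig_mult v -> (forall x, `|v x| <= 1) ->
  trig_mult (fun x => `|v x|).
Proof.
move=> tv v1.
pose p := fix p n (x : circle R) : R :=
  if n is m.+1 then p m x + 2^-1 * (v x ^+ 2 + (- 1) * p m x ^+ 2) else 0.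
have tp n : trig_mult (p n).
  elim: n => [|n IH]; first exact: trig_mult_cst.
  apply: trig_multD; first exact: IH.
  apply: trig_multZ; apply: trig_multD; first exact: trig_multX tv.
  by apply: trig_multZ; exact: trig_multX IH.
have pb n x : 0 <= p n x <= `|v x|.
  elim: n => [|n /andP[IH0 IH1]] /=; first by rewrite lexx normr_ge0.
  have := v1 x; have : v x ^+ 2 = `|v x| ^+ 2 by rewrite real_normK ?num_real.
  have := normr_ge0 (v x); move: (`|v x|) (v x ^+ 2) IH0 IH1 => a _ h0 h1 a0 -> a1.
  by apply/andP; split; nra.
(* One iteration multiplies the error by [1 - (|v| + p) / 2], which is at most [1 - |v| / 2]. *)
have pe n x : `|v x| - p n x <= (1 - `|v x| / 2) ^+ n * `|v x|.
  elim: n => [|n IH] /=; first by rewrite expr0 mul1r subr0.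
  have /andP[p0 p1] := pb n x.
  rewrite [_ ^+ n.+1]exprS -[leRHS]mulrA; apply: (@le_trans _ _ ((1 - `|v x| / 2) * (`|v x| - p n x))).
    have := v1 x; have : v x ^+ 2 = `|v x| ^+ 2 by rewrite real_normK ?num_real.
    have := normr_ge0 (v x); move: (`|v x|) (v x ^+ 2) p0 p1 => a _ h0 h1 a0 -> a1; nra.
  by rewrite ler_wpM2l// subr_ge0; have := v1 x; have := normr_ge0 (v x); lra.
apply: (trig_mult_lim (F := p) (M := 1)) => //.
  by move=> n x; have /andP[p0 p1] := pb n x; rewrite ger0_norm// (le_trans p1).
move=> x; have [v0|v0] := eqVneq (`|v x|) 0.
  apply: cvg_near_cst; apply: nearW => n; apply/le_anti; have := pb n x.
  by rewrite v0 => /andP[-> ->].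
have vp : 0 < `|v x| by rewrite lt_def v0 normr_ge0.
have lim0 : (fun n => `|v x| - (1 - `|v x| / 2) ^+ n * `|v x|) @ \oo --> `|v x|.
  have h : (fun n => `|v x| - (1 - `|v x| / 2) ^+ n * `|v x|) @ \oo --> `|v x| - 0 * `|v x|.
    apply: cvgB; first exact: cvg_cst.
    by apply: cvgMl; apply: cvg_geo0; have := v1 x; lra.
  by rewrite mul0r subr0 in h.
apply: (squeeze_cvgr _ lim0 (cvg_cst (`|v x|))); apply: nearW => n.
have /andP[_ ->] := pb n x; rewrite andbT.
by have := pe n x; lra.
Qed.

(** With [u] the positive part of [v] scaled into [0, 1], the indicator is the bounded limit of
    [1 - (1 - u)^n]. *)
Lemma trig_mult_pos v (K : R) : trig_mult v -> (forall x, `|v x| <= K) ->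
  trig_mult (fun x => ((0 < v x)%R)%:R).
Proof.
move=> tv vK; pose c := (K + 1)^-1.
have K0 : 0 <= K := le_trans (normr_ge0 _) (vK point).
have K1 : 0 < K + 1 by rewrite ltr_wpDl.
have c0 : 0 < c by rewrite invr_gt0.
pose w x := c * v x.
have w1 x : `|w x| <= 1.
  rewrite /w normrM gtr0_norm// mulrC ler_pdivrMr// mul1r.
  by apply: le_trans (vK x) _; rewrite lerDl.
have tw : trig_mult w by exact: trig_multZ.
pose u x := 2^-1 * (w x + `|w x|).
have tu : trig_mult u.
  by apply: trig_multZ; apply: trig_multD; [exact: tw|exact: trig_mult_abs tw w1].
have u01 x : 0 <= u x <= 1.
  have := w1 x; have := ler_norm (w x); have := ler_norm (- w x); rewrite normrN /u.
  by move=> h1 h2 h3; apply/andP; split; lra.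
apply: (trig_mult_lim (F := fun n x => 1 + (- 1) * (1 + (- 1) * u x) ^+ n) (M := 1)).
- move=> n; apply: trig_multD; first exact: trig_mult_cst.
  apply: trig_multZ; apply: trig_multX; apply: trig_multD; first exact: trig_mult_cst.
  exact: trig_multZ.
- move=> n x; have /andP[u0 u1] := u01 x.
  have h0 : 0 <= 1 + (- 1) * u x by lra.
  have h1 : 1 + (- 1) * u x <= 1 by lra.
  have := exprn_ge0 n h0; have := exprn_ile1 n h0 h1; rewrite ler_norml; lra.
- move=> x; have [vx|vx] := ltP 0 (v x).
    have up : 0 < u x by rewrite /u gtr0_norm /w ?mulr_gt0//; have := mulr_gt0 c0 vx; lra.
    have h : (fun n => 1 + (- 1) * (1 + (- 1) * u x) ^+ n) @ \oo --> (1 + (- 1) * 0 : R).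
      apply: cvgD; first exact: cvg_cst.
      by apply: cvgMr; apply: cvg_geo0; have /andP[] := u01 x; lra.
    by rewrite mulr0 addr0 in h.
  have -> : u x = 0.
    by rewrite /u ler0_norm ?subrr ?mulr0// /w pmulr_rle0.
  apply: cvg_near_cst; apply: nearW => n; by rewrite mulr0 addr0 expr1n mulr1 addrN.
Qed.

Definition trig_set : set (set (circle R)) :=
  [set B : set (circle R) | trig_mult (fun x => (x \in B)%:R)].

Lemma trig_setC B : trig_set B -> trig_set (~` B).
Proof.
move=> tB; have := trig_multD (trig_mult_cst 1) (trig_multZ (-1) tB).
apply: trig_mult_ext => x; rewrite in_setC.
by case: (x \in B); rewrite /= ?mulr1 ?mulr0 ?addr0 ?addrN.
Qed.

Lemma trig_setI B D : trig_set B -> trig_set D -> trig_set (B `&` D).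
Proof.
move=> tB tD; have := trig_multM tB tD.
apply: trig_mult_ext => x; rewrite in_setI.
by case: (x \in B); case: (x \in D); rewrite /= ?mulr1 ?mulr0.
Qed.

Lemma trig_set0 : trig_set set0.
Proof. by apply: trig_mult_ext (trig_mult_cst 0) => x; rewrite in_set0. Qed.

Lemma trig_set_bigcup (A : (set (circle R))^nat) :
  (forall n, trig_set (A n)) -> trig_set (\bigcup_n A n).
Proof.
move=> tA; pose F n x : bool := \big[orb/false]_(0 <= k < n) (x \in A k).
have tF n : trig_mult (fun x => (F n x)%:R).
  elim: n => [|n IH].
    by apply: trig_mult_ext (trig_mult_cst 0) => x; rewrite /F big_geq.
  have := trig_multD IH (trig_multD (tA n) (trig_multZ (-1) (trig_multM IH (tA n)))).
  apply: trig_mult_ext => x; rewrite /F big_nat_recr//=.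
  by case: (\big[_/_]_(_ <= _ < _) _); case: (x \in A n); rewrite /=; ring.
apply: (trig_mult_lim (F := fun n x => (F n x)%:R) (M := 1)) => //.
  by move=> n x; case: (F n x); rewrite ?normr1// normr0.
move=> x; apply: cvg_near_cst.
have [xA|xA] := boolP (x \in _).
- have [k _ Akx] := set_mem xA; exists k.+1 => // n /= kn.
  suff -> : F n x by [].
  rewrite /F big_has; apply/hasP; exists k; last exact: mem_set.
  by rewrite mem_index_iota.
- apply: nearW => n; suff -> : F n x = false by [].
  rewrite /F big1// => k _; apply/negbTE; apply: contra xA => h.
  by apply/mem_set; exists k => //; exact: set_mem.
Qed.

(** Phrased for preimages under a map so as to serve both real functions on the circle and the
    embedding [circle_coord] into the plane. *)
Lemma trig_set_sigma (Y : Type) (phi : circle R -> Y) :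
  sigma_algebra setT [set B : set Y | trig_set (phi @^-1` B)].
Proof.
split => /=.
- by rewrite preimage_set0; exact: trig_set0.
- by move=> B tB; rewrite setTD preimage_setC; exact: trig_setC.
- by move=> A tA; rewrite preimage_bigcup; exact: trig_set_bigcup.
Qed.

(** Open half-lines generate the Borel sets of the line, and [trig_mult_pos] settles the
    half-lines. *)
Lemma trig_set_ray (v : circle R -> R) : trig_mult v ->
  forall B : set (measurableTypeR R), measurable B -> trig_set (v @^-1` B).
Proof.
move=> tv B; rewrite RGenOInfty.measurableE.
apply: (@smallest_sub _ (sigma_algebra setT) (@RGenOInfty.G R)
  [set B | trig_set (v @^-1` B)]); first exact: trig_set_sigma.
move=> _ [x ->]; have [_ [K vK] _] := tv.
have := trig_mult_pos (v := fun y => v y + (- x)) (K := K + `|x|).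
move=> h; apply: trig_mult_ext (h _ _) => [y||y].
- congr ((nat_of_bool _)%:R); apply/esym; rewrite subr_gt0.
  apply/idP/idP => [/set_mem|yx]; first by rewrite /= in_itv /= andbT.
  by apply/mem_set; rewrite /= in_itv /= yx.
- by apply: trig_multD => //; exact: trig_mult_cst.
- by apply: le_trans (ler_normD _ _) _; rewrite normrN lerD2r.
Qed.

(** Borel sets of the circle are traces of Borel sets of the plane; these are generated by
    rectangles, that is, by conditions on the real and imaginary parts. *)
Lemma trig_set_measurable (B : set (circle R)) : measurable B -> trig_set B.
Proof.
case=> D mD <-; rewrite setTI.
have [tRe tIm] := trig_mult_ReIm.
move: mD; rewrite measurable_prod_measurableType.
move: D; apply: (@smallest_sub _ (sigma_algebra setT) _
  [set B | trig_set (@circle_coord R @^-1` B)]); first exact: trig_set_sigma.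
move=> _ [U mU [V mV <-]].
suff : trig_set (((fun x : circle R => complex.Re (x : C)) @^-1` U) `&`
  ((fun x : circle R => complex.Im (x : C)) @^-1` V)) by [].
by apply: trig_setI; exact: trig_set_ray.
Qed.

Import HBSimple HBNNSimple.

(** Simple functions are combinations of indicators, and a bounded function is a bounded limit of
    simple ones. *)
Lemma trig_mult_measurable (v : circle R -> R) (M : R) :
  measurable_fun setT v -> (forall x, 0 <= v x <= M) -> trig_mult v.
Proof.
move=> mv vM.
have mv' : measurable_fun setT (EFin \o v) by exact/measurable_EFinP.
pose F := nnsfun_approx measurableT mv'.
have v0 x : (0 <= (EFin \o v) x)%E by rewrite lee_fin; have /andP[] := vM x.
have lim x : (fun n => F n x) @ \oo --> v x.
  have := cvg_nnsfun_approx measurableT mv' (fun x _ => v0 x) (x := x) Logic.I.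
  by move=> /fine_cvgP[_].
apply: (trig_mult_lim (F := fun n x => F n x) (M := M)) => //.
- move=> n.
  have E := fimfunEord (F n).
  apply: (trig_mult_ext (fun x => esym (E x))).
  elim: index_enum => [|i r IH].
    by apply: trig_mult_ext (trig_mult_cst 0) => x; rewrite big_nil.
  apply: trig_mult_ext (trig_multD (trig_multZ _ (trig_set_measurable _)) IH) => [x|].
    by rewrite big_cons indicE.
  exact: measurable_sfunP.
- move=> n x; rewrite ger0_norm; last exact: fun_ge0.
  apply: le_trans (_ : v x <= M); last by have /andP[] := vM x.
  have h := nd_nnsfun_approx measurableT mv'.
  apply: (cvgr_to_ge (lim x)); exists n => // m /= nm.
  by have /lefP/(_ x) := h _ _ nm.
Qed.

Lemma trig_dense (f : circle R -> C) : cmeasurable f -> (N2 f < +oo)%E -> trig_appr f.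
Proof.
have bnd (g : circle R -> R) (M : R) : measurable_fun setT g -> (forall x, `|g x| <= M) ->
    trig_appr (fun x => ((g x)%:C)%C).
  move=> mg gM; have h : trig_mult g.
    apply: (trig_mult_ext (v := fun x => (g x + M) + (- M))) => [x|]; first by rewrite addrK.
    apply: trig_multD; last exact: trig_mult_cst.
    apply: (trig_mult_measurable (M := M + M)).
      by apply: measurable_funD => //; exact: measurable_cst.
    by move=> x; have := gM x; rewrite ler_norml => /andP[h1 h2]; apply/andP; split; lra.
  have [_ _ /(_ _ (trig_appr_of trig1))] := h; congr trig_appr.
  by apply/funext => x; rewrite mulr1.
move=> mf ff; apply: trig_appr_clos => // e e0.
(* Truncation to the set where [|f|^2 <= n]: the result is bounded by [n + 1] and agrees with [f] at
   each given point for large [n]. *)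
pose T n x : bool := nm (f x) ^+ 2 <= n%:R.
pose F n x := (T n x)%:R * f x.
have mT n : measurable_fun setT (fun x => (T n x)%:R : R).
  have mS := cmeas_nm2 mf measurableT (measurable_itv (Interval -oo%O (BRight (n%:R : R)))).
  rewrite setTI in mS; rewrite (_ : (fun x => _) = \1_((fun x => nm (f x) ^+ 2) @^-1` `]-oo, (n%:R : R)])).
    exact: measurable_indic.
  apply/funext => x; rewrite indicE /T; congr ((nat_of_bool _)%:R).
  apply/idP/idP => [h|/set_mem]; last by rewrite /= in_itv.
  by apply/mem_set; rewrite /= in_itv.
have mF n : cmeasurable (F n).
  apply: cmeasM => //; rewrite (_ : (fun x => _) = (fun x => (((T n x)%:R : R)%:C)%C)).
    exact: cmeas_real.
  by apply/funext => x; rewrite rmorph_nat.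
have [|||||||n hn] := @small_integral _ _ _ circ
  (fun n x => nm (f x - F n x) ^+ 2) (fun x => nm (f x) ^+ 2) e.
- by move=> n; apply: cmeas_nm2; exact: cmeasB.
- by move=> n x; exact: sqr_ge0.
- move=> x; have [N] := ex_intro (fun n => nm (f x) ^+ 2 <= n%:R) (Num.truncn (nm (f x) ^+ 2)).+1 (ltW (truncnS_gt _)).
  move=> hN; apply: cvg_near_cst; exists N => // n /= Nn.
  by rewrite /F /T (le_trans hN) ?ler_nat// mul1r subrr nm0 expr0n.
- exact: cmeas_nm2.
- move=> n x; rewrite /F; case: (T n x); first by rewrite mul1r subrr nm0 expr0n sqr_ge0.
  by rewrite mul0r subr0.
- exact: ff.
- exact: e0.
exists (F n) => //.
have FM x : nm (F n x) <= n%:R + 1.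
  rewrite /F; case h : (T n x); last by rewrite mul0r nm0 addr_ge0.
  rewrite mul1r; have := nm_ge0 (f x); move: h; rewrite /T; move: (nm (f x)) (n%:R : R) => a c h1 h2; nra.
have [mRe mIm] := mF n.
have := trig_appr_lin (Complex 0 1) (bnd (fun x => complex.Im (F n x)) (n%:R + 1) mIm _)
  (bnd (fun x => complex.Re (F n x)) (n%:R + 1) mRe _).
move=> h; have {h} := h (fun x => le_trans (nmIm _) (FM x)) (fun x => le_trans (nmRe _) (FM x)).
congr trig_appr; apply/funext => x; by rewrite [RHS]complexE addrC.
Qed.

End TrigDensity.

(** * Entire functions *)

Section Entire.
Variable R : realType.
Local Notation C := R[i].
Local Notation circ := (@circle_lebesgue R).
Implicit Types (f g : C -> C) (p : {poly C}) (z w : C).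

(* Locally uniform limits of polynomials. *)
Definition entire f := forall r e : R, 0 < e ->
  exists p, forall z, nm z <= r -> nm (f z - p.[z]) <= e.

Lemma entire_ext f g : f =1 g -> entire f -> entire g.
Proof. by move=> /funext ->. Qed.

Lemma poly_bounded p (r : R) : exists2 M : R, 0 <= M & forall z, nm z <= r -> nm p.[z] <= M.
Proof.
exists (\sum_(i < size p) nm p`_i * (`|r| ^+ i)).
  by rewrite sumr_ge0// => i _; rewrite mulr_ge0 ?nm_ge0// exprn_ge0.
move=> z zr; rewrite horner_coef; apply: le_trans (nm_sum _ _ _) _.
apply: ler_sum => i _; rewrite nmM nmX ler_wpM2l ?nm_ge0// lerXn2r ?nnegrE ?nm_ge0//.
exact: le_trans zr (ler_norm _).
Qed.

Lemma entire_poly p : entire (fun z => p.[z]).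
Proof. by move=> r e e0; exists p => z _; rewrite subrr nm0 ltW. Qed.

Lemma entire_bounded f (r : R) : entire f ->
  exists2 M : R, 0 <= M & forall z, nm z <= r -> nm (f z) <= M.
Proof.
move=> ef; have [p hp] := ef r 1 ltr01; have [M M0 hM] := poly_bounded p r.
exists (1 + M); first by rewrite addr_ge0.
move=> z zr; rewrite -(subrK p.[z] (f z)); apply: le_trans (nmD _ _) _.
by apply: lerD; [exact: hp|exact: hM].
Qed.

Lemma entire_lin (k : C) f g : entire f -> entire g -> entire (fun z => k * f z + g z).
Proof.
move=> ef eg r e e0; have K1 : 0 < nm k + 1 by rewrite ltr_wpDl// nm_ge0.
have e1 : 0 < e / 2 / (nm k + 1) by rewrite !divr_gt0.
have [p hp] := ef r _ e1; have [s hs] := eg r (e / 2) (divr_gt0 e0 (ltr0n _ 2)).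
exists (k *: p + s) => z zr; rewrite hornerD hornerZ.
have -> : k * f z + g z - (k * p.[z] + s.[z]) = k * (f z - p.[z]) + (g z - s.[z]) by ring.
rewrite (splitr e); apply: le_trans (nmD _ _) _; apply: lerD; last exact: hs.
rewrite nmM; apply: (@le_trans _ _ ((nm k + 1) * (e / 2 / (nm k + 1)))).
  by apply: ler_pM; rewrite ?nm_ge0 ?lerDl//; exact: hp.
by rewrite mulrC divfK// gt_eqF.
Qed.

Lemma entireM f g : entire f -> entire g -> entire (fun z => f z * g z).
Proof.
move=> ef eg r e e0.
have [M M0 fM] := entire_bounded r ef; have [N N0 gN] := entire_bounded r eg.
have D0 : 0 < M + N + 1 by rewrite ltr_wpDl// addr_ge0.
(* The error of the product is at most [d N + M d + d^2], and [d <= 1] bounds this by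
   [d (M + N + 1)]. *)
pose d := Num.min 1 (e / (M + N + 1)).
have d0 : 0 < d by rewrite lt_min ltr01 divr_gt0.
have d1 : d <= 1 by rewrite ge_min lexx.
have d2 : d * (M + N + 1) <= e by rewrite -ler_pdivlMr// ge_min lexx orbT.
have [p hp] := ef r _ d0; have [s hs] := eg r _ d0.
exists (p * s) => z zr; rewrite hornerM.
have -> : f z * g z - p.[z] * s.[z] = (f z - p.[z]) * g z + f z * (g z - s.[z])
     - (f z - p.[z]) * (g z - s.[z]) by ring.
have h1 := hp z zr; have h2 := hs z zr; have h3 := fM z zr; have h4 := gN z zr.
apply: le_trans (nmD _ _) _; rewrite nmN; apply: (@le_trans _ _ (d * N + M * d + d * 1)).
  apply: lerD; last by rewrite nmM ler_pM ?nm_ge0// (le_trans h2).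
  apply: le_trans (nmD _ _) _; rewrite !nmM.
  by apply: lerD; apply: ler_pM => //; exact: nm_ge0.
by apply: le_trans d2; rewrite le_eqVlt; apply/orP; left; apply/eqP; ring.
Qed.

Lemma entire_shift (s : C) f : entire f -> entire (fun z => f (z + s)).
Proof.
move=> ef r e e0; have [p hp] := ef (r + nm s) e e0.
exists (p \Po ('X + s%:P)) => z zr.
rewrite horner_comp hornerD hornerX hornerC; apply: hp.
by apply: le_trans (nmD _ _) _; rewrite lerD2r.
Qed.

(** Conjugating the coefficients of an approximating polynomial gives a polynomial again. The
    reflected function is the second factor of the product to which Liouville's theorem is
    applied. *)
Lemma entire_sharp f : entire f -> entire (fun z => Num.conj (f (Num.conj z))).
Proof.
move=> ef r e e0; have [p hp] := ef r e e0.
exists (map_poly Num.conj p) => z zr.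
rewrite -[z in _.[z]]conjCK horner_map /= -rmorphB nmJ; apply: hp.
by rewrite nmJ.
Qed.

Lemma entire_cst (k : C) : entire (fun=> k).
Proof.
by apply: (@entire_ext (fun z => (k%:P).[z])) (entire_poly _) => z; rewrite hornerC.
Qed.

Lemma circle_orth (i n : nat) :
  cint circ (fun x : circle R => (x : C) ^+ i * Num.conj (x : C) ^+ n) = (i == n)%:R.
Proof.
have key m k : cint circ (fun x : circle R => (x : C) ^+ (m + k) * Num.conj (x : C) ^+ k) = (m == 0%N)%:R.
  transitivity (cint circ (fun x : circle R => (x : C) ^+ m)).
    by congr cint; apply/funext => x; rewrite exprD -mulrA -exprMn circle_conj expr1n mulr1.
  case: m => [|m]; last by rewrite cint_circleX.
  transitivity (cint circ (fun _ : circle R => 1 : C)); last by rewrite cint_cst.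
  by congr cint.
have [ni|ni] := leqP n i.
  have -> : (i == n) = ((i - n)%N == 0%N) by rewrite subn_eq0 eqn_leq ni andbT.
  by rewrite -{1}(subnK ni) key.
have -> : (fun x : circle R => (x : C) ^+ i * Num.conj (x : C) ^+ n) =
   (fun x : circle R => Num.conj ((x : C) ^+ ((n - i) + i) * Num.conj (x : C) ^+ i)).
  by apply/funext => x; rewrite subnK ?(ltnW ni)// rmorphM !rmorphXn /= conjCK mulrC.
rewrite cintJ; last first.
  by apply: bmeasM; apply: bmeasX; [|apply: bmeasJ]; exact: bmeas_circle.
by rewrite key subn_eq0 leqNgt ni conjC0 (ltn_eqF ni).
Qed.

(** For entire [f] this is [r^n] times the [n]-th Taylor coefficient: Cauchy's integral formula,
    written as a Fourier coefficient. *)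
Definition circle_mean f (r : R) (n : nat) : C :=
  cint circ (fun x : circle R => f ((r%:C)%C * (x : C)) * Num.conj (x : C) ^+ n).

Lemma bmeas_mean f r n : entire f ->
  bmeas (fun x : circle R => f ((r%:C)%C * (x : C)) * Num.conj (x : C) ^+ n).
Proof.
move=> ef; apply: bmeasM; last by apply: bmeasX; apply: bmeasJ; exact: bmeas_circle.
have nx (x : circle R) : nm ((r%:C)%C * (x : C)) <= `|r|.
  by rewrite nmM nmR nm_circle mulr1.
split; last first.
  by have [M _ hM] := entire_bounded `|r| ef; exists M => x; exact: hM.
have hex (k : nat) : exists p : {poly C}, forall z, nm z <= `|r| -> nm (f z - p.[z]) <= k.+1%:R^-1.
  by apply: ef; rewrite invr_gt0.
have [p hp] := choice hex.
apply: (cmeas_lim (F := fun k (x : circle R) => (p k).[(r%:C)%C * (x : C)])).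
  move=> k; rewrite (_ : (fun x => _) = fun x : circle R => \sum_(i < size (p k)) (p k)`_i * ((r%:C)%C * (x : C)) ^+ i).
    apply: (bmeas_sum _ _ _).1 => i; apply: bmeasZ; apply: bmeasX; apply: bmeasZ; exact: bmeas_circle.
  by apply/funext => x; rewrite horner_coef.
move=> x; apply/cvg_nm; apply: (@squeeze_cvgr _ _ _ _ (cst 0) (@harmonic R)) => //.
- by apply: nearW => k; rewrite nm_ge0 /= nmB hp.
- exact: cvg_cst.
- exact: cvg_harmonic.
Qed.

Lemma circle_mean_poly p (r : R) n : circle_mean (fun z => p.[z]) r n = p`_n * ((r ^+ n)%:C)%C.
Proof.
rewrite /circle_mean.
have bx (i : nat) : bmeas (fun x : circle R => (x : C) ^+ i * Num.conj (x : C) ^+ n).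
  by apply: bmeasM; apply: bmeasX; [|apply: bmeasJ]; exact: bmeas_circle.
transitivity (cint circ (fun x : circle R => \sum_(i < size p) (p`_i * ((r ^+ i)%:C)%C) * ((x : C) ^+ i * Num.conj (x : C) ^+ n))).
  congr cint; apply/funext => x; rewrite horner_coef mulr_suml; apply: eq_bigr => i _.
  by rewrite exprMn rmorphXn /=; ring.
rewrite cint_sum => [|i]; last exact: bmeasZ.
under eq_bigr do rewrite cintZ// circle_orth.
have [np|np] := ltnP n (size p).
  rewrite (bigD1 (Ordinal np))//= eqxx mulr1 big1 ?addr0// => i.
  by rewrite -val_eqE /= => /negbTE ->; rewrite mulr0.
rewrite nth_default// mul0r big1// => i _.
by rewrite (ltn_eqF (leq_trans (ltn_ord i) np)) mulr0.
Qed.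

Lemma circle_mean_close f p (r e : R) n : entire f ->
  (forall z, nm z <= `|r| -> nm (f z - p.[z]) <= e) ->
  nm (circle_mean f r n - p`_n * ((r ^+ n)%:C)%C) <= 2 * e.
Proof.
move=> ef h; rewrite -circle_mean_poly /circle_mean -[- cint _ _]mulN1r -cintZ; last exact: (bmeas_mean r n (entire_poly p)).
rewrite -cintD; last 2 first.
- exact: bmeas_mean.
- by apply: bmeasZ; exact: (bmeas_mean r n (entire_poly p)).
apply: cint_bound.
  by apply: bmeasD; [exact: bmeas_mean|apply: bmeasZ; exact: (bmeas_mean r n (entire_poly p))].
move=> x; rewrite mulN1r -mulrBl nmM nmX nmJ nm_circle expr1n mulr1; apply: h.
by rewrite nmM nmR nm_circle mulr1.
Qed.

(** Cauchy's estimates, obtained by comparison with the zero function, which a polynomial bounded by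
    [M] approximates with error [M]. *)
Lemma entire_coef_bound p (r M : R) n : (forall z, nm z <= `|r| -> nm p.[z] <= M) ->
  nm p`_n * `|r| ^+ n <= 2 * M.
Proof.
move=> h; have := @circle_mean_close (fun=> 0) p r M n (entire_cst 0).
rewrite /circle_mean (_ : (fun x => 0 * _) = fun=> 0); last by apply/funext => x; rewrite mul0r.
rewrite cint_cst sub0r nmN nmM nmR normrX; apply => z zr.
by rewrite sub0r nmN h.
Qed.

(** The Cauchy estimates give a geometric series of ratio at most 1/2, so the bound does not involve
    the degree of [p] and survives locally uniform limits. *)
Lemma poly_remainder p (r M : R) n z : 0 < r -> (forall z, nm z <= r -> nm p.[z] <= M) ->
  2 * nm z <= r -> nm (p.[z] - \sum_(0 <= i < n) p`_i * z ^+ i) <= 4 * M * (nm z / r) ^+ n.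
Proof.
move=> r0 hM zr; set x := nm z / r.
have x0 : 0 <= x by rewrite divr_ge0 ?nm_ge0// ltW.
have x1 : x <= 2^-1 by rewrite ler_pdivrMr//; lra.
have M0 : 0 <= M by apply: le_trans (nm_ge0 _) (hM 0 _); rewrite nm0 ltW.
have cb i : nm (p`_i * z ^+ i) <= 2 * M * x ^+ i.
  rewrite nmM nmX /x expr_div_n mulrA ler_pdivlMr ?exprn_gt0// mulrAC ler_wpM2r ?exprn_ge0 ?nm_ge0//.
  by have := @entire_coef_bound p r M i; rewrite gtr0_norm//; apply.
have geo k j : \sum_(k <= i < j) 2 * M * x ^+ i <= 4 * M * x ^+ k.
  have [jk|kj] := leqP j k; first by rewrite big_geq// !mulr_ge0// exprn_ge0.
  rewrite -(subnK (ltnW kj)); move: (j - k)%N => m; elim: m k {kj} => [|m IH] k.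
    by rewrite add0n big_geq// !mulr_ge0// exprn_ge0.
  rewrite big_ltn; last by rewrite addSn ltnS leq_addl.
  rewrite addSnnS; apply: le_trans (lerD (lexx _) (IH _)) _.
  rewrite exprS; have := exprn_ge0 k x0; move: (x ^+ k) => y y0.
  have : M * y * x <= M * y * 2^-1 by rewrite ler_wpM2l// mulr_ge0.
  lra.
rewrite horner_coef -(big_mkord xpredT (fun i => p`_i * z ^+ i)).
have [np|np] := leqP n (size p).
  rewrite (sum_sub (fun i => p`_i * z ^+ i) np); apply: le_trans (nm_sum _ _ _) _.
  by apply: le_trans (ler_sum _ (fun i _ => cb i)) (geo _ _).
rewrite nmB (sum_sub (fun i => p`_i * z ^+ i) (ltnW np)) big_nat big1 ?nm0.
  by rewrite !mulr_ge0// exprn_ge0.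
by move=> i /andP[hi _]; rewrite nth_default// mul0r.
Qed.

Lemma entire_taylor f (r M : R) : 0 < r -> entire f -> (forall z, nm z <= r -> nm (f z) <= M) ->
  exists b : nat -> C, forall n z, 2 * nm z <= r ->
    nm (f z - \sum_(0 <= i < n) b i * z ^+ i) <= 4 * M * (nm z / r) ^+ n.
Proof.
move=> r0 ef fM; pose b i := circle_mean f r i / ((r ^+ i)%:C)%C; exists b => n z zr.
set x := nm z / r.
have x0 : 0 <= x by rewrite divr_ge0 ?nm_ge0// ltW.
have x1 : x <= 1 by rewrite ler_pdivrMr//; have := nm_ge0 z; lra.
have xn1 : x ^+ n <= 1 by rewrite exprn_ile1.
apply/ler_addgt0Pr => e e0.
(* The errors to absorb are [d] from [f - p], [4 d] from replacing the bound [M] by [M + d], and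
   [2 d] for each of the [n] coefficients. *)
pose d := e / (5 + n%:R * 2).
have D0 : 0 < 5 + n%:R * 2 :> R by rewrite ltr_wpDr// mulr_ge0.
have d0 : 0 < d by rewrite divr_gt0.
have [p hp] := ef r d d0.
have pM w : nm w <= r -> nm p.[w] <= M + d.
  move=> wr; rewrite -(subrK (f w) p.[w]) addrC; apply: le_trans (nmD _ _) _.
  by apply: lerD; [exact: fM|rewrite nmB hp].
have hr := poly_remainder n r0 pM zr; rewrite -/x in hr.
have hs : nm (\sum_(0 <= i < n) p`_i * z ^+ i - \sum_(0 <= i < n) b i * z ^+ i) <= n%:R * 2 * d.
  rewrite -sumrB; apply: le_trans (nm_sum _ _ _) _.
  apply: (@le_trans _ _ (\sum_(0 <= i < n) 2 * d)).
    apply: ler_sum => i _; rewrite -mulrBl nmM nmX.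
    have : nm (circle_mean f r i - p`_i * ((r ^+ i)%:C)%C) <= 2 * d.
      by apply: circle_mean_close => // w; rewrite gtr0_norm//; exact: hp.
    have -> : circle_mean f r i - p`_i * ((r ^+ i)%:C)%C = (b i - p`_i) * ((r ^+ i)%:C)%C.
      rewrite /b mulrBl divfK// -(rmorph0 (real_complex R)) (inj_eq (@complexI R)).
      by rewrite expf_neq0// gt_eqF.
    rewrite nmM nmR ger0_norm ?exprn_ge0 ?(ltW r0)// nmB => h; apply: le_trans h.
    rewrite ler_wpM2l ?nm_ge0// lerXn2r ?nnegrE ?nm_ge0 ?(ltW r0)//.
    by have := nm_ge0 z; lra.
  by rewrite sumr_const_nat subn0 -[_ *+ n]mulr_natl mulrA.
have -> : f z - \sum_(0 <= i < n) b i * z ^+ i = (f z - p.[z]) +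
   (p.[z] - \sum_(0 <= i < n) p`_i * z ^+ i) +
   (\sum_(0 <= i < n) p`_i * z ^+ i - \sum_(0 <= i < n) b i * z ^+ i) by ring.
apply: le_trans (nmD _ _) _; apply: le_trans (lerD (nmD _ _) (lexx _)) _.
have hz : nm (f z - p.[z]) <= d by apply: hp; have := nm_ge0 z; lra.
apply: (@le_trans _ _ (d + 4 * (M + d) * x ^+ n + n%:R * 2 * d)).
  by apply: lerD => //; apply: lerD.
have : d * x ^+ n <= d by rewrite ler_piMr// ltW.
have : d * (5 + n%:R * 2) = e by rewrite /d divfK// gt_eqF.
move: (n%:R : R) => N; move: (x ^+ n) => y; nra.
Qed.

(** The first Taylor remainder is at most [4 M |z| / r], and the radius [r] may be taken as large as
    desired. *)
Lemma liouville f (M : R) : entire f -> (forall z, nm (f z) <= M) -> forall z, f z = f 0.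
Proof.
move=> ef fM z.
have M0 : 0 <= M := le_trans (nm_ge0 _) (fM 0).
apply/eqP; rewrite -subr_eq0 -nm_eq0; apply/eqP/le_anti; rewrite nm_ge0 andbT.
apply/ler_addgt0Pr => e e0; rewrite add0r.
pose r := 2 * nm z + 4 * M * nm z / e + 1.
have h0 : 0 <= 4 * M * nm z / e by rewrite divr_ge0 ?(ltW e0)// !mulr_ge0// nm_ge0.
have r0 : 0 < r by rewrite ltr_wpDl// addr_ge0// mulr_ge0// nm_ge0.
have [b hb] := entire_taylor r0 ef (fun z _ => fM z).
have b0 : b 0%N = f 0.
  have := hb 1%N 0; rewrite nm0 mul0r expr1 !mulr0 big_nat1 expr0 mulr1 => /(_ (ltW r0)).
  move=> h; apply/esym/eqP; rewrite -subr_eq0 -nm_eq0; apply/eqP/le_anti.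
  by rewrite nm_ge0 andbT.
have := hb 1%N z; rewrite big_nat1 expr0 mulr1 expr1 b0 => h.
apply: le_trans (h _) _; first by rewrite /r -addrA lerDl addr_ge0.
rewrite mulrA ler_pdivrMr// /r.
have -> : e * (2 * nm z + 4 * M * nm z / e + 1) = 4 * M * nm z + e * (2 * nm z + 1).
  by field; rewrite gt_eqF.
by rewrite lerDl mulr_ge0 ?(ltW e0)// addr_ge0// mulr_ge0// nm_ge0.
Qed.

(** The Taylor coefficients vanish one after the other: the first nonzero one would dominate the
    remainder at small real [t]. At [z] the remainders then tend to 0 because [|z| / r < 1/2]. *)
Lemma entire_real0 f : entire f -> (forall t : R, f ((t%:C)%C) = 0) -> forall z, f z = 0.
Proof.
move=> ef f0 z.
pose r := 2 * nm z + 1.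
have r0 : 0 < r by rewrite ltr_wpDl// mulr_ge0// nm_ge0.
have [M M0 fM] := entire_bounded r ef.
have [b hb] := entire_taylor r0 ef fM.
have b0 n : b n = 0.
  elim/ltn_ind: n => n IH.
  apply/eqP; rewrite -nm_eq0; apply/eqP/le_anti; rewrite nm_ge0 andbT.
  apply/ler_addgt0Pr => e e0; rewrite add0r.
  pose K := 4 * M / r ^+ n.+1.
  have K0 : 0 <= K by rewrite divr_ge0 ?mulr_ge0// exprn_ge0// ltW.
  pose t := Num.min (r / 2) (e / (K + 1)).
  have K1 : 0 < K + 1 by rewrite ltr_wpDl.
  have t0 : 0 < t by rewrite lt_min !divr_gt0.
  have tr2 : t <= r / 2 by rewrite ge_min lexx.
  have tr : 2 * t <= r by lra.
  have te : t * (K + 1) <= e by rewrite -ler_pdivlMr// ge_min lexx orbT.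
  have := hb n.+1 ((t%:C)%C); rewrite f0 sub0r nmN nmR gtr0_norm// => /(_ tr).
  rewrite big_nat_recr//= big_nat big1 => [|i /andP[_ hi]]; last by rewrite IH// mul0r.
  rewrite add0r nmM nmX nmR gtr0_norm// => h.
  have : nm (b n) <= K * t.
    rewrite -(ler_pM2r (exprn_gt0 n t0)); apply: le_trans h _.
    rewrite /K expr_div_n [t ^+ n.+1]exprS le_eqVlt; apply/orP; left; apply/eqP.
    by field; rewrite expf_neq0// gt_eqF.
  by move=> h'; apply: le_trans h' _; nra.
apply/eqP; rewrite -nm_eq0; apply/eqP/le_anti; rewrite nm_ge0 andbT.
have hz n : nm (f z) <= 4 * M * (2^-1) ^+ n.
  have := hb n z; rewrite big1 => [|i _]; last by rewrite b0 mul0r.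
  rewrite subr0 => h; apply: le_trans (h _) _; first by rewrite lerDl.
  rewrite ler_wpM2l ?mulr_ge0// lerXn2r ?nnegrE ?divr_ge0 ?nm_ge0 ?(ltW r0)//.
  rewrite ler_pdivrMr// /r; have := nm_ge0 z; lra.
have lim : (fun n => 4 * M * (2^-1) ^+ n) @ \oo --> (4 * M * 0 : R).
  apply: cvgMr; apply: cvg_geo0; lra.
rewrite mulr0 in lim; apply: (cvgr_to_ge lim); exact: nearW.
Qed.

Lemma entire_eq f g : entire f -> entire g ->
  (forall t : R, f ((t%:C)%C) = g ((t%:C)%C)) -> f =1 g.
Proof.
move=> ef eg fg z; apply/eqP; rewrite eq_sym -subr_eq0 addrC -mulN1r; apply/eqP.
move: z; apply: entire_real0; first exact: entire_lin.
by move=> t; rewrite fg mulN1r addNr.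
Qed.

(** Convergence at the point [2 r'] bounds the terms there, so on the disc of radius [r'] the tails
    are dominated by a geometric series of ratio 1/2. *)
Lemma entire_series (c : nat -> C) f :
  (forall z, (fun n => \sum_(0 <= k < n) c k * z ^+ k : R[i]^o) @ \oo --> (f z : R[i]^o)) ->
  entire f.
Proof.
move=> h r e e0.
pose r' := `|r| + 1.
have r'0 : 0 < r' by rewrite ltr_wpDl.
have [K K0 hK] : exists2 K : R, 0 <= K & forall k, nm (c k) * (2 * r') ^+ k <= K.
  have cz := h (((2 * r')%:C)%C).
  have /cvg_nmP /(_ 1 ltr01) [N hN] := cz.
  (* Each term is the difference of two consecutive partial sums, both within 1 of the limit. *)
  have c0 k : (N <= k)%N -> nm (c k) * (2 * r') ^+ k <= 2.
    move=> Nk; have h1 := hN k Nk; have h2 := hN k.+1 (leqW Nk).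
    have -> : nm (c k) * (2 * r') ^+ k = nm (c k * ((2 * r')%:C)%C ^+ k).
      by rewrite nmM nmX nmR ger0_norm// mulr_ge0// ltW.
    move: h2; rewrite big_nat_recr//=; set s := \sum_(_ <= _ < _) _ in h1 *; set y := c k * _ => h2.
    have -> : y = (s + y - f (((2 * r')%:C)%C)) - (s - f (((2 * r')%:C)%C)) by ring.
    by apply: le_trans (nmD _ _) _; rewrite nmN; lra.
  exists (2 + \sum_(0 <= k < N) nm (c k) * (2 * r') ^+ k).
    by rewrite addr_ge0// sumr_ge0// => i _; rewrite mulr_ge0 ?nm_ge0// exprn_ge0// mulr_ge0// ltW.
  have t0 i : 0 <= nm (c i) * (2 * r') ^+ i by rewrite mulr_ge0 ?nm_ge0// exprn_ge0// mulr_ge0// ltW.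
  move=> k; have [Nk|kN] := leqP N k; first by apply: le_trans (c0 k Nk) _; rewrite lerDl sumr_ge0.
  rewrite (bigD1_seq k) ?mem_index_iota ?iota_uniq//= addrCA lerDl addr_ge0// sumr_ge0//.
have lim : (fun n => K * (2^-1) ^+ n / (1 - 2^-1)) @ \oo --> (K * 0 / (1 - 2^-1) : R).
  by apply: cvgMl; apply: cvgMr; apply: cvg_geo0; lra.
rewrite mulr0 mul0r in lim; have /cvgrPdist_lt /(_ e e0) [N _ hN] := lim.
exists (\poly_(i < N) c i) => z zr.
have tail m : nm (\sum_(0 <= k < N + m) c k * z ^+ k - \sum_(0 <= k < N) c k * z ^+ k) <= e.
  rewrite (sum_sub (fun k => c k * z ^+ k) (leq_addr _ _)); apply: le_trans (nm_sum _ _ _) _.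
  have zr' : nm z <= r' by apply: le_trans zr _; rewrite /r' (le_trans (ler_norm r))// lerDl.
  apply: (@le_trans _ _ (K * (2^-1) ^+ N / (1 - 2^-1) * (1 - 2^-1 ^+ m))).
    elim: m => [|m IH]; first by rewrite addn0 big_geq// expr0 subrr mulr0.
    rewrite addnS big_nat_recr ?leq_addr//=; apply: le_trans (lerD IH (_ : _ <= K * 2^-1 ^+ (N + m))) _.
      rewrite nmM nmX exprVn ler_pdivlMr ?exprn_gt0//; apply: le_trans (hK (N + m)%N).
      rewrite -mulrA ler_wpM2l ?nm_ge0// exprMn mulrC ler_wpM2l ?exprn_ge0//.
      by rewrite lerXn2r ?nnegrE ?nm_ge0 ?(ltW r'0).
    rewrite exprD exprS le_eqVlt; apply/orP; left; apply/eqP; by field.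
  have := hN N (leqnn N); rewrite /= sub0r normrN => /(le_lt_trans (ler_norm _)) /ltW h'.
  apply: le_trans h'; rewrite ler_piMr//.
    by rewrite divr_ge0 ?mulr_ge0 ?exprn_ge0//; lra.
have hp : (\poly_(i < N) c i).[z] = \sum_(0 <= k < N) c k * z ^+ k.
  by rewrite horner_poly big_mkord.
rewrite hp; apply/ler_addgt0Pr => d d0.
have /cvg_nmP /(_ d d0) [N' hN'] := h z.
have := hN' (N + N')%N (leq_addl _ _) => h1.
have := tail N' => h2.
apply: le_trans (nmBD (\sum_(0 <= k < N + N') c k * z ^+ k) _ _) _.
by rewrite addrC; apply: lerD => //; rewrite nmB ltW.
Qed.

End Entire.


(** * Analytic continuation of one-parameter groups *)

Section BoundedFunctional.
Variables (R : realType) (V : normedModType R[i]).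

Definition bounded_functional (l : V -> R[i]) :=
  linear (l : V -> R[i]^o) /\ exists2 K : R, 0 <= K & forall v, nm (l v) <= K * nm v.

Lemma bounded_functional_cvg (l : V -> R[i]) (u : nat -> V) (x : V) :
  bounded_functional l -> u @ \oo --> x ->
  (fun n => l (u n) : R[i]^o) @ \oo --> (l x : R[i]^o).
Proof.
move=> [ll [K K0 hK]] ux; apply/cvg_nm; apply: (@squeeze_cvgr _ _ _ _ (cst 0)
  (fun n => K * nm (u n - x))) => /=.
- by apply: nearW => n; rewrite nm_ge0 -[X in nm X](linB ll) hK.
- exact: cvg_cst.
- by rewrite -(mulr0 K); apply: cvgMr; exact/cvg_nm.
Qed.

End BoundedFunctional.

Section OneParameter.
Variables (R : realType) (A : cstarType R) (H : hilbertType R) (p : A -> H -> H).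
Local Notation C := R[i].
Hypothesis fp : faithful_representation p.
Variable tau : R -> A -> A.
Hypothesis tau_hom : forall t, star_hom (tau t).
Hypothesis tau0 : forall a, tau 0 a = a.
Hypothesis tauD : forall s t a, tau (s + t) a = tau s (tau t a).

Let rp : representation p. Proof. by case: fp. Qed.

(** A [star_hom] carries no continuity; composing with [p] gives a representation, whose
    coefficients are bounded by [rep_bound]. *)
Let rp_tau t : representation (fun a => p (tau t a)).
Proof.
have [bp lp p1 pM pA] := rp; have [lt t1 tM tA] := tau_hom t.
split => //.
- by move=> k a b v; rewrite lt lp.
- by move=> v; rewrite t1 p1.
- by move=> a b v; rewrite tM pM.
- by move=> a v w; rewrite tA pA.
Qed.

Lemma rep_coef_bl (p' : A -> H -> H) v w : representation p' ->
  bounded_functional (fun a => dotp v (p' a w)).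
Proof.
move=> rp'; have rb := rep_bound rp'; case: rp' => _ lp _ _ _; split.
  by move=> k a b; rewrite lp dotpDr dotpZr.
exists (nm v * (Num.sqrt 2 * nm w)) => [|a].
  by rewrite !mulr_ge0 ?nm_ge0 ?sqrtr_ge0.
apply: le_trans (cauchy_schwarz _ _) _; rewrite -mulrA ler_wpM2l ?nm_ge0//.
rewrite -(@ler_pXn2r _ 2)// ?nnegrE ?mulr_ge0 ?nm_ge0 ?sqrtr_ge0//.
rewrite !exprMn sqr_sqrtr//; apply: le_trans (rb a w) _.
by rewrite mulrAC.
Qed.

Lemma faithful_eq a b : (forall v w, dotp v (p a w) = dotp v (p b w)) -> a = b.
Proof.
move=> h; case: fp => _; apply; apply/funext => w; apply: dotp_ext => v; exact: h.
Qed.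

Lemma entire_functional (F : C -> A) (l : A -> C) : entire_function F ->
  bounded_functional l -> entire (fun z => l (F z)).
Proof.
move=> [c hc] bl; apply: (entire_series (c := fun n => l (c n))) => z.
apply: cvg_seq_eq (bounded_functional_cvg bl (hc z)) => n /=.
rewrite /series /= [LHS](lin_sum bl.1); apply: eq_bigr => i _.
by rewrite [LHS](linZ bl.1) [LHS]mulrC.
Qed.

Lemma entire_function_bounded (F : C -> A) : entire_function F ->
  exists2 K : R, 0 <= K & forall z, nm z <= 1 -> nm (F z) <= K.
Proof.
move=> [c hc].
have /cvg_nmP /(_ 1 ltr01) [N hN] := hc 2.
have n2 : nm (2 : C) = 2 by rewrite -[2 : C](rmorph_nat (real_complex R)) nmR ger0_norm.
have c0 k : (N <= k)%N -> nm (c k) * 2 ^+ k <= 2.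
  move=> Nk; have h1 := hN k Nk; have h2 := hN k.+1 (leqW Nk).
  have -> : nm (c k) * 2 ^+ k = nm ((2 : C) ^+ k *: c k) by rewrite nmZ nmX n2 mulrC.
  move: h2; rewrite /series /= in h1 *; rewrite big_nat_recr//=.
  set s := \sum_(_ <= _ < _) _ in h1 *; set y := _ *: c k => h2.
  have -> : y = (s + y - F 2) - (s - F 2) by rewrite opprB addrA subrK addrC addKr.
  by apply: le_trans (nmD _ _) _; rewrite nmN; lra.
pose t k := nm (c k) * 2 ^+ k.
have t0 i : 0 <= t i by rewrite mulr_ge0 ?nm_ge0// exprn_ge0.
pose K := 2 + \sum_(0 <= k < N) t k.
have K0 : 0 <= K by rewrite addr_ge0// sumr_ge0.
have hK k : nm (c k) * 2 ^+ k <= K.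
  have [Nk|kN] := leqP N k; first by apply: le_trans (c0 k Nk) _; rewrite lerDl sumr_ge0.
  rewrite /K (bigD1_seq k) ?mem_index_iota ?iota_uniq//= addrCA lerDl addr_ge0// sumr_ge0//.
exists (2 * K) => [|z z1]; first by rewrite mulr_ge0.
have h := cvg_nm_cvg (hc z).
apply: (cvgr_to_le h); apply: nearW => n.
rewrite /series /=; apply: le_trans (nm_sum _ _ _) _.
apply: (@le_trans _ _ (2 * K * (1 - 2^-1 ^+ n))); last first.
  by rewrite ler_piMr ?mulr_ge0// lerBlDr lerDl exprn_ge0.
elim: n => [|n IH]; first by rewrite big_geq// expr0 subrr mulr0.
rewrite big_nat_recr//=; apply: le_trans (lerD IH (_ : _ <= K * 2^-1 ^+ n)) _.
  rewrite nmZ nmX exprVn ler_pdivlMr ?exprn_gt0//; apply: le_trans (hK n).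
  rewrite -mulrA ler_piMl ?t0//.
  by rewrite exprn_ile1 ?nm_ge0.
rewrite exprS le_eqVlt; apply/orP; left; apply/eqP; by field.
Qed.

(** The coefficients of both sides are entire in [z] and agree on the real axis by the group law. *)
Lemma tau_entire_shift F y (t : R) z : entire_function F ->
  (forall s : R, F ((s%:C)%C) = tau s y) -> F (z + (t%:C)%C) = tau t (F z).
Proof.
move=> eF Fy; apply: faithful_eq => v w.
have e1 := entire_shift ((t%:C)%C) (entire_functional eF (rep_coef_bl v w rp)).
have e2 := entire_functional eF (rep_coef_bl v w (rp_tau t)).
apply: (entire_eq e1 e2) => s.
by rewrite -rmorphD !Fy addrC tauD.
Qed.

(** A point of the strip is a point of the unit disc translated by a real [a], and [rep_bound]
    applied to the representation [p] composed with [tau a] is uniform in [a]. *)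
Lemma tau_strip_bounded F y v w : entire_function F ->
  (forall s : R, F ((s%:C)%C) = tau s y) ->
  exists2 K : R, 0 <= K & forall z, `|complex.Im z| <= 1 -> nm (dotp v (p (F z) w)) <= K.
Proof.
move=> eF Fy; have [K K0 hK] := entire_function_bounded eF.
exists (nm v * (Num.sqrt 2 * K * nm w)); first by rewrite !mulr_ge0 ?nm_ge0 ?sqrtr_ge0.
move=> [a b] /= b1; have -> : Complex a b = Complex 0 b + (a%:C)%C by simpc.
rewrite (tau_entire_shift _ _ eF Fy); apply: le_trans (cauchy_schwarz _ _) _.
rewrite ler_wpM2l ?nm_ge0// -(@ler_pXn2r _ 2)// ?nnegrE ?mulr_ge0 ?nm_ge0 ?sqrtr_ge0//.
apply: le_trans (rep_bound (rp_tau a) _ _) _.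
rewrite !exprMn sqr_sqrtr// ler_wpM2r ?sqr_ge0// ler_wpM2l// ler_pXn2r ?nnegrE ?nm_ge0//.
by apply: hK; rewrite /nm normc_def /= expr0n add0r sqrtr_sqr.
Qed.

(** The imaginary part is brought into [-1, 1] by unit steps along the period. *)
Lemma strip_periodic_bounded (f : C -> C) (K : R) :
  (forall z, f (z - 'i%C) = f z) -> (forall z, `|complex.Im z| <= 1 -> nm (f z) <= K) ->
  forall z, nm (f z) <= K.
Proof.
move=> per hK.
have per2 z : f (z + 'i%C) = f z by rewrite -(per (z + _)) addrK.
have key n (a b : R) : `|b| <= n%:R + 1 -> nm (f (Complex a b)) <= K.
  elim: n b => [|n IH] b; first by rewrite add0r => hb; exact: hK.
  rewrite -natr1 => hb; have [b1|b1] := lerP (`|b|) 1; first exact: hK.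
  have [b0|b0] := lerP 0 b.
    rewrite -per (_ : Complex a b - 'i%C = Complex a (b - 1)); last by simpc.
    by apply: IH; rewrite ger0_norm in hb b1 * => //; rewrite ger0_norm; lra.
  rewrite -per2 (_ : Complex a b + 'i%C = Complex a (b + 1)); last by simpc.
  by apply: IH; rewrite ltr0_norm in hb b1 * => //; rewrite ler0_norm; lra.
case=> a b; apply: (key (Num.truncn (`|b|))).
by rewrite natr1 ltW// truncnS_gt.
Qed.

(* Comparing two coefficients [f], [f'] through the periodic entire function
   [f z * (f' z^* )^*], which is constant by Liouville, shows that [F z] is a
   multiple [m z] of [y]; then [m] is multiplicative and [m (-i/4)] is real. *)
Lemma tau_analytic_value F y (c : R) : entire_function F ->
  (forall s : R, F ((s%:C)%C) = tau s y) -> 0 < c ->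
  (forall z, F (z - 'i%C) = (c%:C)%C *: F z) ->
  F (Complex 0 (- 2^-1)) = ((Num.sqrt c)%:C)%C *: y.
Proof.
move=> eF Fy c0 Fc.
have Fy0 : F 0 = y by have := Fy 0; rewrite tau0.
(* The comparison requires a coefficient that does not vanish on [y]; if there is none, then [y] and
   all values of [F] are 0. *)
have [[v0 [w0 hne]]|hz] := pselect (exists v w, dotp v (p y w) != 0); last first.
  have y0 : y = 0.
    apply: faithful_eq => v w; have [bp lp _ _ _] := rp.
    have -> : p 0 w = 0 by have := lp (-1) 0 0 w; rewrite scaler0 addr0 scaleN1r addNr.
    rewrite dotp0r; apply/eqP; apply: contra_notT hz => h; by exists v, w.
  have F0 z : F z = 0.
    apply: faithful_eq => v w.
    have [bp lp _ _ _] := rp.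
    have p0 : p 0 w = 0 by have := lp (-1) 0 0 w; rewrite scaler0 addr0 scaleN1r addNr.
    rewrite p0 dotp0r; move: z; apply: entire_real0.
      exact: (entire_functional eF (rep_coef_bl v w rp)).
    move=> t; rewrite Fy y0; have [lt _ _ _] := tau_hom t.
    by rewrite (lin0 lt) p0 dotp0r.
  by rewrite F0 y0 scaler0.
pose f v w z : C := dotp v (p (F z) w).
have ef v w : entire (f v w) := entire_functional eF (rep_coef_bl v w rp).
have fc v w z : f v w (z - 'i%C) = (c%:C)%C * f v w z.
  have := linZ (rep_coef_bl v w rp).1 ((c%:C)%C) (F z).
  by rewrite -Fc.
have cC : (c%:C)%C != 0 by rewrite -(rmorph0 (real_complex R)) (inj_eq (@complexI R)) gt_eqF.
have key v w z : f v w z * Num.conj (f v0 w0 (Num.conj z)) = f v w 0 * Num.conj (f v0 w0 0).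
  pose k z := f v w z * Num.conj (f v0 w0 (Num.conj z)).
  have ek : entire k by apply: entireM => //; exact: entire_sharp.
  have per u : k (u - 'i%C) = k u.
    have cE : Num.conj (u - 'i%C) = Num.conj u + 'i%C :> C.
      by case: (u) => a b; apply/eqP; rewrite eq_complex /= oppr0 opprD opprK !eqxx.
    rewrite /k fc cE.
    have := fc v0 w0 (Num.conj u + 'i%C); rewrite addrK => e.
    rewrite e rmorphM /= (_ : Num.conj (c%:C)%C = (c%:C)%C :> C); last exact: conjc_real.
    by ring.
  have [K1 K10 h1] := tau_strip_bounded v w eF Fy.
  have [K2 K20 h2] := tau_strip_bounded v0 w0 eF Fy.
  have kb : forall z, nm (k z) <= K1 * K2.
    apply: strip_periodic_bounded per _ => u hu.
    rewrite /k nmM nmJ ler_pM ?nm_ge0// ?h1// h2// Im_conj normrN//.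
  have := liouville ek kb z; rewrite /k /= conjC0.
  by [].
pose g := f v0 w0.
have g0 : g 0 != 0 by rewrite /g /f Fy0.
have gz z : g z != 0.
  have := key v0 w0 z; rewrite -/g; apply: contra_eq_neq => ->.
  by rewrite mul0r eq_sym mulf_neq0// conjC_eq0.
pose m z := g z / g 0.
have gm z : Num.conj (g (Num.conj z)) = g 0 * Num.conj (g 0) / g z.
  by apply: (mulfI (gz z)); rewrite -/g key [RHS]mulrC divfK.
have fm v w z : f v w z = m z * f v w 0.
  have := key v w z; rewrite -/g gm => h.
  have gc : g 0 * Num.conj (g 0) / g z != 0.
    by rewrite !mulf_neq0 ?conjC_eq0// invr_eq0.
  apply: (mulIf gc); rewrite h /m; field.
  by rewrite g0 gz.
have Fm z : F z = m z *: y.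
  apply: faithful_eq => v w.
  have := linZ (rep_coef_bl v w rp).1 (m z) y => ->.
  by rewrite -Fy0; exact: fm.
have m0 : m 0 = 1 by rewrite /m divff.
have mc z : m (z - 'i%C) = (c%:C)%C * m z by rewrite /m /g fc mulrA.
have mJ z : m z * Num.conj (m (Num.conj z)) = 1.
  rewrite /m rmorphM fmorphV /= gm; field.
  by rewrite conjC_eq0 g0 gz.
have mD z u : m (z + u) = m z * m u.
  have e1 := entire_shift z (ef v0 w0).
  have e2 := entire_lin (m z) (ef v0 w0) (entire_cst 0).
  have h : (fun u => f v0 w0 (u + z)) =1 (fun u => m z * f v0 w0 u + 0).
    apply: entire_eq e1 e2 _ => t; rewrite addr0 addrC /f (tau_entire_shift _ _ eF Fy).
    have [lt _ _ _] := tau_hom t.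
    rewrite Fm (linZ lt) -Fy.
    exact: (linZ (rep_coef_bl v0 w0 rp).1).
  by have := h u; rewrite addr0 addrC /m /g => ->; rewrite mulrA.
pose a := m (Complex 0 (- 4^-1)); pose a' := m (Complex 0 4^-1).
have aa' : a * a' = 1.
  by rewrite -mD (_ : _ + _ = 0) ?m0//; simpc; rewrite addNr.
have aJ : a * Num.conj a' = 1.
  rewrite -[RHS](mJ (Complex 0 (- 4^-1))); congr (_ * Num.conj (m _)).
  by apply/eqP; rewrite eq_complex /= opprK !eqxx.
have a0 : a != 0 by apply: contra_eq_neq aa' => ->; rewrite mul0r eq_sym oner_eq0.
have a'r : Num.conj a' = a' by apply: (mulfI a0); rewrite aa' aJ.
have ar : Num.conj a = a.
  have a'0 : a' != 0 by apply: contra_eq_neq aa' => ->; rewrite mulr0 eq_sym oner_eq0.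
  by apply: (mulIf a'0); rewrite -{1}a'r -rmorphM aa' rmorph1.
have aR : a = ((complex.Re a)%:C)%C.
  case: (a) ar => x z /= /eqP; rewrite eq_complex /= => /andP[_ /eqP h].
  by have -> : z = 0 by lra.
(* As [a], the value of [m] at [-i/4], is real, the value [a^2] at [-i/2] is nonnegative; this
   selects the positive square root of [c]. *)
have m2 : m (Complex 0 (- 2^-1)) = a * a.
  rewrite -mD; congr m; simpc; congr Complex; lra.
have m1 : a * a * (a * a) = (c%:C)%C.
  rewrite -!mD -[RHS]mulr1 -m0 -mc; congr m; rewrite sub0r; simpc.
  by congr Complex; lra.
rewrite Fm m2; congr (_ *: _).
rewrite {}aR in m1 *; move: m1; rewrite -!rmorphM => /(@complexI R) h.
congr (_%:C)%C; rewrite -h -expr2 sqrtr_sqr ger0_norm//.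
by rewrite sqr_ge0.
Qed.

End OneParameter.

Section Lspan.
Variable R : realType.
Local Notation C := R[i].

Lemma lspan_of (V : lmodType C) (S : set V) x : S x -> lspan S x.
Proof.
by move=> Sx; exists 1%N, (fun=> 1), (fun=> x); split => //; rewrite big_ord1 scale1r.
Qed.

Lemma lspan0 (V : lmodType C) (S : set V) : lspan S 0.
Proof.
by exists 0%N, (fun=> 0), (fun=> 0); split; [case|rewrite big_ord0].
Qed.

Lemma lspan_lin (V : lmodType C) (S : set V) k x y :
  lspan S x -> lspan S y -> lspan S (k *: x + y).
Proof.
move=> [n [c [v [Sv ->]]]] [m [d [w [Sw ->]]]].
exists (n + m)%N, (fun i : 'I_(n + m) => match fintype.split i with inl i => k * c i | inr i => d i end),
  (fun i : 'I_(n + m) => match fintype.split i with inl i => v i | inr i => w i end); split.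
  by move=> i; case: (fintype.split i).
rewrite big_split_ord /= scaler_sumr; congr (_ + _); apply: eq_bigr => i _.
  by rewrite (unsplitK (inl i)) scalerA.
by rewrite (unsplitK (inr i)).
Qed.

Lemma lspanZ (V : lmodType C) (S : set V) k x : lspan S x -> lspan S (k *: x).
Proof. by move=> h; rewrite -[k *: x]addr0; apply: lspan_lin => //; exact: lspan0. Qed.

Lemma lspan_mul (A : cstarType R) (S : set A) :
  (forall x y, S x -> S y -> lspan S (x ** y)) ->
  forall x y, lspan S x -> lspan S y -> lspan S (x ** y).
Proof.
move=> h x y Sx; move: y; apply: lspan_ind.
- by rewrite cmul0r; exact: lspan0.
- by move=> k y z Py Pz; rewrite cmulDr cmulZr; exact: lspan_lin.
move=> y Sy; move: x Sx; apply: lspan_ind.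
- by rewrite cmul0l; exact: lspan0.
- by move=> k u v Pu Pv; rewrite cmulDl cmulZl; exact: lspan_lin.
by move=> x Sx; exact: h.
Qed.

Lemma lspan_adj (A : cstarType R) (S : set A) :
  (forall x, S x -> lspan S (adj x)) -> forall x, lspan S x -> lspan S (adj x).
Proof.
move=> h; apply: lspan_ind => //.
- by rewrite adj0; exact: lspan0.
- by move=> k x y Px Py; rewrite adjD adjZ; exact: lspan_lin.
Qed.

Definition cpow (A : cstarType R) (x : A) n := iter n (cmul x) cone.

Lemma cpowS (A : cstarType R) (x : A) n : cpow x n.+1 = x ** cpow x n.
Proof. by []. Qed.
Lemma cpowSr (A : cstarType R) (x : A) n : cpow x n.+1 = cpow x n ** x.
Proof.
elim: n => [|n IH]; first by rewrite /cpow /= cmul1l cmul1r.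
by rewrite cpowS {1}IH cmulA.
Qed.
End Lspan.

(** * The algebra of SU_q(2) and its unitary antipode *)

Section SUq2Algebra.
Variables (R : realType) (q : R).
Hypothesis q0 : q != 0.
Local Notation C := R[i].
Local Notation qC := ((q%:C)%C : C).
Variable G : SUq2 q.
Local Notation a := (al : G).
Local Notation c := (ga : G).

Let rel : SUq2_relations q a c. Proof. by case: (fun_alg_universal G). Qed.

Lemma qC0 : qC != 0.
Proof. by rewrite -(rmorph0 (real_complex R)) (inj_eq (@complexI R)). Qed.

Lemma conj_real (x : R) : Num.conj ((x%:C)%C : C) = (x%:C)%C.
Proof. exact: conjc_real. Qed.

Lemma rel_aa : adj a ** a + adj c ** c = cone. Proof. by case: rel. Qed.
Lemma rel_aa' : a ** adj a + ((q ^+ 2)%:C)%C *: (c ** adj c) = cone.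
Proof. by case: rel. Qed.
Lemma rel_cc : c ** adj c = adj c ** c. Proof. by case: rel. Qed.
Lemma rel_ac : a ** c = qC *: (c ** a). Proof. by case: rel. Qed.
Lemma rel_ac' : a ** adj c = qC *: (adj c ** a). Proof. by case: rel. Qed.
Lemma rel_ca : adj c ** adj a = qC *: (adj a ** adj c).
Proof. by have := congr1 adj rel_ac; rewrite adjZ !adjM conj_real. Qed.
Lemma rel_ca' : c ** adj a = qC *: (adj a ** c).
Proof. by have := congr1 adj rel_ac'; rewrite adjZ !adjM adjK conj_real. Qed.

(** The fundamental corepresentation; the factor [- q] in the upper right corner makes the matrix
    unitary. *)
Definition fund (i j : 'I_2) : G :=
  if i == 0 then (if j == 0 then a else - qC *: adj c)
  else (if j == 0 then c else adj a).

Lemma I2P (i : 'I_2) : (i = 0) + (i = 1).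
Proof.
case: i => [[|[|]]] // h; [left|right]; exact/val_inj.
Qed.

Lemma sum2 (V : nmodType) (F : 'I_2 -> V) : \sum_i F i = F 0 + F 1.
Proof.
by rewrite big_ord_recl big_ord1; congr (_ + F _); exact/val_inj.
Qed.

Lemma fund_comult i j : comult (fund i j) = \sum_k leg1 (fund i k) ** leg2 (fund k j).
Proof.
have [li [l1i l1M l1A]] : star_hom (@leg1 R q G) by case: (tens_algP G).
have [lj [l2i l2M l2A]] : star_hom (@leg2 R q G) by case: (tens_algP G).
have [lD Di DM DA] := comult_hom G.
have comm : forall x y : G, leg1 x ** leg2 y = leg2 y ** leg1 x by case: (tens_algP G).
rewrite sum2 /fund.
case: (I2P i) => ->; case: (I2P j) => -> /=.
- by rewrite comult_al (linZ li) cmulZl scaleNr.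
- rewrite (linZ lD) DA comult_ga adjD !adjM -!l1A -!l2A adjK -!comm (linZ lj) (linZ li).
  by rewrite !cmulZl !cmulZr scalerDr addrC.
- by rewrite comult_ga.
- rewrite DA comult_al adjB adjZ !adjM -!l1A -!l2A adjK -!comm (linZ lj) cmulZr.
  by rewrite conj_real scaleNr addrC.
Qed.

Lemma fund_unit i l : \sum_k adj (fund k i) ** fund k l = (i == l)%:R *: cone.
Proof.
rewrite sum2 /fund; case: (I2P i) => ->; case: (I2P l) => -> /=; rewrite ?scale1r ?scale0r.
- exact: rel_aa.
- rewrite cmulZr scaleNr rel_ca.
  by rewrite addNr.
- rewrite adjZ adjK cmulZl rmorphN /= conj_real adjK rel_ac scaleNr addNr//.
- rewrite adjZ !adjK cmulZl cmulZr scalerA rmorphN /= conj_real mulrNN -expr2 -rmorphXn /=.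
  by rewrite addrC rel_aa'.
Qed.

Lemma fund_unit' i l : \sum_k fund i k ** adj (fund l k) = (i == l)%:R *: cone.
Proof.
rewrite sum2 /fund; case: (I2P i) => ->; case: (I2P l) => -> /=; rewrite ?scale1r ?scale0r.
- rewrite adjZ adjK cmulZl cmulZr scalerA rmorphN /= conj_real mulrNN -expr2 -rmorphXn /=.
  by rewrite -rel_cc rel_aa'.
- by rewrite adjK cmulZl scaleNr rel_ac' addrN.
- by rewrite adjZ adjK cmulZr rmorphN /= conj_real scaleNr rel_ca' addrN.
- by rewrite adjK rel_cc addrC rel_aa.
Qed.

Lemma fund_corep : unitary_corep fund.
Proof. by split; [exact: fund_comult|exact: fund_unit|exact: fund_unit']. Qed.

(** The one-dimensional representation at [rho] sends [fund] to the diagonal matrix with entries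
    [rho ^ fund_wt i]; see [psi1_fund]. *)
Definition fund_wt (i : 'I_2) : int := if i == 0 then 1 else -1.

(** Nested pairs index the tensor powers of [fund], so that coefficients and weights are defined by
    recursion. *)
Fixpoint widx (n : nat) : finType :=
  if n is m.+1 then ('I_2 * widx m)%type else unit.

Fixpoint wcoef (n : nat) : widx n -> widx n -> G :=
  if n is m.+1 return widx n -> widx n -> G
  then fun i j => fund i.1 j.1 ** wcoef i.2 j.2 else fun _ _ => cone.

Fixpoint wwt (n : nat) : widx n -> int :=
  if n is m.+1 return widx n -> int then fun i => fund_wt i.1 + wwt i.2 else fun=> 0.

(** Coefficients of tensor powers are preferred to monomials in the generators: on them the
    comultiplication is matrix multiplication, and a product concatenates the indices. *)
Definition words : set G := [set x | exists n (i j : widx n), x = wcoef i j].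

Lemma words1 : words cone. Proof. by exists 0%N, tt, tt. Qed.

Lemma words_fund i j : words (fund i j).
Proof. by exists 1%N, (i, tt), (j, tt); rewrite /= cmul1r. Qed.

Lemma wordsM x y : words x -> words y -> words (x ** y).
Proof.
move=> [n [i [j ->]]] wy; elim: n i j => [|n IH] i j /=; first by rewrite cmul1l.
have [m [k [l e]]] := IH i.2 j.2.
by exists m.+1, (i.1, k), (j.1, l); rewrite -cmulA e.
Qed.

(** The fundamental corepresentation is self-conjugate up to scalars: each adjoint of an entry is a
    multiple of another entry. *)
Lemma words_adj_fund i j : lspan words (adj (fund i j)).
Proof.
rewrite /fund; case: (I2P i) => ->; case: (I2P j) => -> /=.
- by apply: lspan_of; exact: (words_fund 1 1).
- by rewrite adjZ adjK; apply: lspanZ; apply: lspan_of; exact: (words_fund 1 0).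
- have -> : adj c = (- qC)^-1 *: fund 0 1.
    by rewrite /fund /= scalerA mulVf ?scale1r// oppr_eq0 qC0.
  by apply: lspanZ; apply: lspan_of; exact: words_fund.
- by rewrite adjK; apply: lspan_of; exact: (words_fund 0 0).
Qed.

Lemma words_span_mul x y : lspan words x -> lspan words y -> lspan words (x ** y).
Proof. by apply: lspan_mul => u v uw vw; apply: lspan_of; exact: wordsM. Qed.

Lemma words_span_adj x : lspan words x -> lspan words (adj x).
Proof.
move: x; apply: lspan_adj => _ [n [i [j ->]]].
elim: n i j => [|n IH] i j /=; first by rewrite adj1; apply: lspan_of; exact: words1.
by rewrite adjM; apply: words_span_mul => //; exact: words_adj_fund.
Qed.

Lemma words_total : total_set words.
Proof.
apply/seteqP; split => // x _.
suff h : star_poly [set a; c] `<=` lspan words.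
  by apply: (closure_subset h); exact: SUq2_generated (fun_alg_universal G) x.
move=> y; elim=> [z [->|->]||k u v _ hu _ hv|u v _ hu _ hv|u _ hu].
- by apply: lspan_of; exact: (words_fund 0 0).
- by apply: lspan_of; exact: (words_fund 1 0).
- by apply: lspan_of; exact: words1.
- exact: lspan_lin.
- exact: words_span_mul.
- exact: words_span_adj.
Qed.

Lemma wcoef_comult n (i j : widx n) :
  comult (wcoef i j) = \sum_k leg1 (wcoef i k) ** leg2 (wcoef k j).
Proof.
have [li l1i l1M l1A] : star_hom (@leg1 R q G) by case: (tens_algP G).
have [lj l2i l2M l2A] : star_hom (@leg2 R q G) by case: (tens_algP G).
have [lD Di DM DA] := comult_hom G.
have comm : forall x y : G, leg1 x ** leg2 y = leg2 y ** leg1 x by case: (tens_algP G).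
elim: n i j => [|n IH] i j /=.
  by rewrite Di (big_pred1 tt) => [|[]//]; rewrite l1i l2i cmul1l.
rewrite DM fund_comult IH cmul_suml -(pair_bigA _ (fun k1 k2 => leg1 (fund i.1 k1 ** wcoef i.2 k2) **
  leg2 (fund k1 j.1 ** wcoef k2 j.2))) /=.
apply: eq_bigr => k1 _; rewrite cmul_sumr; apply: eq_bigr => k2 _.
rewrite l1M l2M -!cmulA; congr (_ ** _); rewrite !cmulA; congr (_ ** _).
by rewrite comm.
Qed.

Lemma wcoef_unit n (i l : widx n) :
  \sum_k adj (wcoef k i) ** wcoef k l = (i == l)%:R *: cone.
Proof.
elim: n i l => [|n IH] i l /=.
  rewrite (big_pred1 tt) => [|[]//]; rewrite adj1 cmul1l.
  by case: i l => [] [] /=; rewrite scale1r.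
rewrite -(pair_bigA _ (fun k1 k2 => adj (fund k1 i.1 ** wcoef k2 i.2) ** (fund k1 l.1 ** wcoef k2 l.2))) /=.
rewrite exchange_big /=.
under eq_bigr => k2 _.
  rewrite (eq_bigr (fun k1 => adj (wcoef k2 i.2) ** ((adj (fund k1 i.1) ** fund k1 l.1) ** wcoef k2 l.2))); last first.
    by move=> k1 _; rewrite adjM !cmulA.
  rewrite -cmul_sumr -cmul_suml fund_unit cmulZl cmul1l cmulZr.
  over.
rewrite -scaler_sumr IH scalerA; congr (_ *: _).
case: i l => [i1 i2] [l1 l2] /=; rewrite -pair_eqE /pair_eq /=.
by case: (i1 == l1); case: (i2 == l2); rewrite ?mul1r ?mul0r ?mulr0.
Qed.

(** * Weights and normal forms *)

Local Notation x := (c ** adj c).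

(** Polynomials in [x]. All coefficients of weight zero lie here, and the values of the Haar state
    are reduced to this commutative algebra. *)
Definition xspan : set G := lspan [set y | exists k, y = cpow x k].

Lemma xspan_pow k : xspan (cpow x k).
Proof. by apply: lspan_of; exists k. Qed.
Lemma xspan1 : xspan cone. Proof. exact: (xspan_pow 0). Qed.
Lemma xspan_x : xspan x.
Proof. by have := xspan_pow 1; rewrite /cpow /= cmul1r. Qed.

Lemma cpowD (y : G) m n : cpow y (m + n) = cpow y m ** cpow y n.
Proof. by elim: m => [|m IH]; [rewrite cmul1l|rewrite addSn !cpowS IH cmulA]. Qed.

Lemma xspanM P Q : xspan P -> xspan Q -> xspan (P ** Q).
Proof.
apply: lspan_mul => _ _ [k ->] [l ->]; rewrite -cpowD; exact: xspan_pow.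
Qed.

Lemma qcomm_pow (y z : G) (k : C) n : y ** z = k *: (z ** y) ->
  y ** cpow z n = k ^+ n *: (cpow z n ** y).
Proof.
move=> h; elim: n => [|n IH]; first by rewrite expr0 scale1r /cpow /= cmul1l cmul1r.
rewrite cpowS cmulA h cmulZl -cmulA IH cmulZr scalerA -exprS cmulA //.
Qed.

Lemma c_x : c ** x = x ** c.
Proof. by rewrite {1}rel_cc cmulA. Qed.
Lemma c'_x : adj c ** x = x ** adj c.
Proof. by rewrite cmulA -rel_cc. Qed.
Lemma a_x : a ** x = (qC ^+ 2) *: (x ** a).
Proof. by rewrite cmulA rel_ac cmulZl -cmulA rel_ac' cmulZr scalerA -expr2 cmulA. Qed.
Lemma adj_x : adj x = x. Proof. by rewrite adjM adjK. Qed.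
Lemma a'_x : adj a ** x = (qC ^- 2) *: (x ** adj a).
Proof.
have := congr1 adj a_x; rewrite adjZ !adjM adjK rmorphXn /= conj_real => ->.
by rewrite scalerA mulVf ?scale1r// expf_neq0// qC0.
Qed.
Lemma a'_c : adj a ** c = qC^-1 *: (c ** adj a).
Proof. by rewrite rel_ca' scalerA mulVf ?scale1r// qC0. Qed.
Lemma a'_c' : adj a ** adj c = qC^-1 *: (adj c ** adj a).
Proof. by rewrite rel_ca scalerA mulVf ?scale1r// qC0. Qed.

Lemma xspan_comm (y : G) (k : C) : y ** x = k *: (x ** y) ->
  forall P, xspan P -> exists2 P', xspan P' & y ** P = P' ** y.
Proof.
move=> h; apply: lspan_ind.
- by exists 0; [exact: lspan0|rewrite cmul0r cmul0l].
- move=> l u v [u' Xu' hu] [v' Xv' hv]; exists (l *: u' + v'); first exact: lspan_lin.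
  by rewrite cmulDr cmulZr hu hv cmulDl cmulZl.
- move=> _ [n ->]; exists (k ^+ n *: cpow x n); first by apply: lspanZ; exact: xspan_pow.
  by rewrite (qcomm_pow _ h) cmulZl.
Qed.

Definition zpow (y : G) (t : int) : G :=
  match t with Posz n => cpow y n | Negz n => cpow (adj y) n.+1 end.

Lemma zpow_mul_pos (y : G) t : xspan (y ** adj y) ->
  exists2 P, xspan P & y ** zpow y t = P ** zpow y (t + 1).
Proof.
move=> Xy; case: t => [n|[|n]].
- by exists cone; [exact: xspan1|rewrite cmul1l (_ : Posz n + 1 = Posz n.+1)//; lia].
- by exists (y ** adj y) => //; rewrite (_ : Negz 0 + 1 = Posz 0)//= /cpow /= !cmul1r.
- exists (y ** adj y) => //; rewrite (_ : Negz n.+1 + 1 = Negz n); last by lia.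
  by rewrite [zpow _ _]cpowS cmulA.
Qed.

Lemma zpow_mul_neg (y : G) t : xspan (adj y ** y) ->
  exists2 P, xspan P & adj y ** zpow y t = P ** zpow y (t - 1).
Proof.
move=> Xy; case: t => [[|n]|n].
- exists cone; first exact: xspan1.
  by rewrite (_ : Posz 0 - 1 = Negz 0)//= cmul1l.
- exists (adj y ** y) => //; rewrite (_ : Posz n.+1 - 1 = Posz n); last by lia.
  by rewrite [zpow _ _]cpowS cmulA.
- exists cone; first exact: xspan1.
  by rewrite (_ : Negz n - 1 = Negz n.+1) ?cmul1l//; lia.
Qed.

Lemma zpow_comm (y z : G) (k l : C) t : y ** z = k *: (z ** y) -> y ** adj z = l *: (adj z ** y) ->
  exists m : C, y ** zpow z t = m *: (zpow z t ** y).
Proof.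
move=> h h'; case: t => n; first by exists (k ^+ n); exact: qcomm_pow.
by exists (l ^+ n.+1); exact: qcomm_pow.
Qed.

Lemma xspan_aa' : xspan (a ** adj a).
Proof.
have -> : a ** adj a = (- (q ^+ 2)%:C)%C *: x + cone.
  by rewrite -rel_aa' scaleNr addrC addrK.
by apply: lspan_lin; [exact: xspan_x|exact: xspan1].
Qed.

Lemma xspan_a'a : xspan (adj a ** a).
Proof.
have -> : adj a ** a = (-1) *: x + cone by rewrite -rel_aa scaleN1r rel_cc addrC addrK.
by apply: lspan_lin; [exact: xspan_x|exact: xspan1].
Qed.

(* Negative exponents stand for powers of the adjoints. *)
Definition nform (s t : int) (y : G) :=
  exists2 P, xspan P & y = P ** zpow c t ** zpow a s.

Lemma nformZ k s t y : nform s t y -> nform s t (k *: y).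
Proof.
by move=> [P XP ->]; exists (k *: P); [exact: lspanZ|rewrite !cmulZl].
Qed.

Lemma xspan_zpow_c t P : xspan P -> exists2 P', xspan P' & zpow c t ** P = P' ** zpow c t.
Proof.
apply: (xspan_comm (k := 1)); rewrite scale1r.
have h1 : x ** c = 1 *: (c ** x) by rewrite scale1r c_x.
have h2 : x ** adj c = 1 *: (adj c ** x) by rewrite scale1r c'_x.
by case: t => n; [have := qcomm_pow n h1|have := qcomm_pow n.+1 h2];
  rewrite expr1n scale1r => ->.
Qed.

(** An element commuting up to scalars with [x], [c] and [adj c] can be moved through the first two
    factors until it meets the power of [a]. *)
Lemma nform_step_a s s' t (y b : G) (k l m : C) :
  b ** x = k *: (x ** b) -> b ** c = l *: (c ** b) -> b ** adj c = m *: (adj c ** b) ->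
  (exists2 P, xspan P & b ** zpow a s = P ** zpow a s') ->
  nform s t y -> nform s' t (b ** y).
Proof.
move=> bx bc bc' [P2 XP2 e3] [P XP ->].
have [P' XP' e1] := xspan_comm bx XP.
have [r e2] := zpow_comm t bc bc'.
have [P3 XP3 e4] := xspan_zpow_c t XP2.
exists (r *: (P' ** P3)); first by apply: lspanZ; exact: xspanM.
rewrite !cmulA e1 -[P' ** b ** _]cmulA e2 cmulZr !cmulZl; congr (_ *: _).
by rewrite -!cmulA e3 [zpow c t ** _]cmulA e4 !cmulA.
Qed.

Lemma nform_step_c s t t' (y b : G) :
  b ** x = x ** b ->
  (exists2 P, xspan P & b ** zpow c t = P ** zpow c t') ->
  nform s t y -> nform s t' (b ** y).
Proof.
move=> bx [P2 XP2 e2] [P XP ->].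
have [P' XP' e1] := xspan_comm (k := 1) (etrans bx (esym (scale1r _))) XP.
exists (P' ** P2); first exact: xspanM.
by rewrite !cmulA e1 -[P' ** b ** _]cmulA e2 !cmulA.
Qed.

Lemma xspan_c'c : xspan (adj c ** c). Proof. by rewrite -rel_cc; exact: xspan_x. Qed.

(** Prepending an entry of [fund] moves a single exponent by one: [s] for [alpha] and its adjoint,
    [t] for [gamma] and its adjoint. The weights of row and column record exactly this change. *)
Lemma wcoef_nform n (i j : widx n) :
  exists s t, [/\ wwt i = s - t, wwt j = s + t & nform s t (wcoef i j)].
Proof.
elim: n i j => [|n IH] i j.
  exists 0, 0; split => //; exists cone; first exact: xspan1.
  by rewrite /= /cpow /= !cmul1l.
have [s [t [hi hj hn]]] := IH i.2 j.2.
rewrite /= {2}/fund_wt {1}/fund_wt /fund hi hj.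
case: (I2P i.1) => ->; case: (I2P j.1) => -> /=.
- exists (s + 1), t; split; [lia|lia|].
  apply: nform_step_a a_x rel_ac rel_ac' _ hn; exact: zpow_mul_pos xspan_aa'.
- exists s, (t - 1); split; [lia|lia|].
  rewrite cmulZl; apply: nformZ; apply: nform_step_c c'_x _ hn.
  exact: zpow_mul_neg xspan_c'c.
- exists s, (t + 1); split; [lia|lia|].
  apply: nform_step_c c_x _ hn; exact: zpow_mul_pos xspan_x.
- exists (s - 1), t; split; [lia|lia|].
  apply: nform_step_a a'_x a'_c a'_c' _ hn; exact: zpow_mul_neg xspan_a'a.
Qed.

Lemma wcoef_zero_weight n (i j : widx n) : wwt i = 0 -> wwt j = 0 ->
  xspan (wcoef i j).
Proof.
have [s [t [-> -> [P XP ->]]]] := wcoef_nform i j => h1 h2.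
have -> : t = 0 by lia.
have -> : s = 0 by lia.
by rewrite /= /cpow /= !cmul1r.
Qed.

Lemma aa'_pow n : cpow a n.+1 ** cpow (adj a) n.+1 =
  cpow a n ** cpow (adj a) n - ((q ^+ (2 * n.+1))%:C)%C *: (x ** (cpow a n ** cpow (adj a) n)).
Proof.
have -> : cpow a n.+1 ** cpow (adj a) n.+1 = cpow a n ** (a ** adj a) ** cpow (adj a) n.
  by rewrite cpowSr cpowS !cmulA.
have -> : a ** adj a = cone - ((q ^+ 2)%:C)%C *: x by rewrite -rel_aa' addrK.
rewrite cmulBr cmul1r cmulBl; congr (_ - _); rewrite cmulZr cmulZl.
have e : cpow a n ** x = (qC ^+ (2 * n)) *: (x ** cpow a n).
  elim: n => [|n IH]; first by rewrite /cpow /= cmul1l cmul1r scale1r.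
  rewrite cpowS -cmulA IH cmulZr cmulA a_x cmulZl scalerA -cmulA mulnS exprD.
  by rewrite [qC ^+ 2 * _]mulrC.
rewrite e cmulZl scalerA -cmulA; congr (_ *: _).
by rewrite !rmorphXn /= -exprD mulnS.
Qed.

(** The polynomial is [(1 - q^2 x) ... (1 - q^(2n) x)]. Its leading coefficient is recorded because
    [haar_moment_xn] divides by the difference of this coefficient from 1. *)
Lemma aa'_pow_poly n : exists d : nat -> R,
  cpow a n ** cpow (adj a) n = \sum_(k < n.+1) ((d k)%:C)%C *: cpow x k /\
  d n = \prod_(i < n) (- q ^+ (2 * i.+1)).
Proof.
elim: n => [|n [d [e dn]]].
  exists (fun=> 1); split; last by rewrite big_ord0.
  by rewrite big_ord1 scale1r cmul1l.
exists (fun k => (if (k < n.+1)%N then d k else 0) -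
   q ^+ (2 * n.+1) * (if k is k'.+1 then d k' else 0)); split; last first.
  by rewrite ltnn sub0r big_ord_recr /= -dn mulrN mulrC.
rewrite aa'_pow e cmul_sumr scaler_sumr.
under [RHS]eq_bigr do rewrite rmorphB scalerBl.
rewrite sumrB; congr (_ - _).
  rewrite [RHS]big_ord_recr /= ltnn scale0r addr0; apply: eq_bigr => i _ /=.
  by rewrite ltn_ord.
rewrite [RHS]big_ord_recl /= mulr0 scale0r add0r; apply: eq_bigr => i _.
by rewrite cmulZr scalerA rmorphM.
Qed.


(** * The unitary antipode on matrix coefficients *)

Section UnitaryAntipode.
Variable Ra : G -> G.
Hypothesis RaP : unitary_antipode Ra.
Local Notation abs_q := (((`|q|)%:C)%C : C).

Lemma Ra_adj y : Ra (adj y) = adj (Ra y). Proof. by case: RaP. Qed.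
Lemma RaM y z : Ra (y ** z) = Ra z ** Ra y. Proof. by case: RaP => _ []. Qed.
Lemma Ra1 : Ra cone = cone. Proof. by case: RaP => _ []. Qed.
Lemma RaK : involutive Ra. Proof. by case: RaP. Qed.
Lemma Ra_bl : bounded_linear Ra. Proof. by case: RaP. Qed.
Lemma Ra_lin : linear Ra. Proof. exact: bl_lin Ra_bl. Qed.

Lemma entire_functionZ (F : C -> G) (k : C) :
  entire_function F -> entire_function (fun z => k *: F z).
Proof.
move=> [d hd]; exists (fun n => k *: d n) => z.
apply: cvg_seq_eq (cvgZr (hd z)) => n; rewrite /series /= scaler_sumr.
by apply: eq_bigr => i _; rewrite !scalerA mulrC.
Qed.

(** Using the defining relation of the antipode twice gives [F (z - i) = k F z] for the entire
    extension, with [k = 1] for [alpha] and [k = q^2] for [gamma]. Then [tau_analytic_value]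
    evaluates [F] at [-i/2], where the root [|q|] of [q^2] appears. *)
Lemma Ra_gen : Ra a = adj a /\ Ra c = - (abs_q / qC) *: c.
Proof.
case: RaP => _ _ _ _ [tau [th [t0 tD] tc tR an]].
(* The faithful representation against which identities are tested is the one supplied by the
   spatial tensor product. *)
have [H [K [L [t [p [p' [P [_ fp _ _ _]]]]]]]] : exists (H K L : hilbertType R)
    (t : H -> K -> L) (p : G -> H -> H) (p' : G -> K -> K) (P : tens_alg G -> L -> L),
    [/\ hilbert_tensor t, faithful_representation p, faithful_representation p',
        faithful_representation P &
        forall a b v w, P (leg1 a ** leg2 b) (t v w) = t (p a v) (p' b w)].
  by case: (tens_algP G).
have rp : representation p by case: fp.
(* The relation at [-i/2] propagates along the translates. *)
have prop (F F' : C -> G) y y' : entire_function F -> entire_function F' ->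
    (forall s : R, F ((s%:C)%C) = tau s y) -> (forall s : R, F' ((s%:C)%C) = tau s y') ->
    F (Complex 0 (- 2^-1)) = Ra y' ->
    forall z, F (z + Complex 0 (- 2^-1)) = Ra (F' z).
  move=> eF eF' Fy Fy' h z; apply: (faithful_eq fp) => v w.
  have e1 := entire_shift (Complex 0 (- 2^-1)) (entire_functional eF (rep_coef_bl v w rp)).
  have bR : bounded_functional (fun y => dotp v (p (Ra y) w)).
    have [l1 [K1 K10 b1]] := rep_coef_bl v w rp; have [lR [K2 K20 b2]] := (blP Ra).1 Ra_bl.
    split=> [k y1 y2|]; first by rewrite lR; exact: l1.
    exists (K1 * K2) => [|y1]; first exact: mulr_ge0.
    by apply: le_trans (b1 _) _; rewrite -mulrA ler_wpM2l.
  have e2 := entire_functional eF' bR.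
  apply: (entire_eq e1 e2) => s; rewrite Fy' -tR -h addrC.
  by rewrite (tau_entire_shift fp th tD _ _ eF Fy).
have half2 z : z + Complex 0 (- 2^-1) + Complex 0 (- 2^-1) = z - 'i%C :> C.
  by rewrite -addrA; congr (_ + _); simpc; congr Complex; lra.
have [F00 [e00 t00 a00]] := an 2 fund fund_corep 0 0.
have [F10 [e10 t10 a10]] := an 2 fund fund_corep 1 0.
have [F11 [e11 t11 a11]] := an 2 fund fund_corep 1 1.
rewrite /fund /= in t00 a00 t10 a10 t11 a11.
have b00 := congr1 Ra a00; have b10 := congr1 Ra a10; have b11 := congr1 Ra a11.
rewrite !RaK in b00 b10 b11.
rewrite adjK in b11.
have p00 := prop _ _ _ _ e00 e11 t00 t11 b00.
have p11 := prop _ _ _ _ e11 e00 t11 t00 b11.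
have adjZc : adj (- qC *: adj c) = - qC *: c.
  by rewrite adjZ adjK rmorphN /= conj_real.
rewrite adjZc in b10.
have e10' := entire_functionZ (- qC) e10.
have t10' (s : R) : - qC *: F10 ((s%:C)%C) = tau s (- qC *: c).
  by have [lt _ _ _] := th s; rewrite t10 (linZ lt).
have p10 := prop _ _ _ _ e10 e10' t10 t10' b10.
split.
  have h z : F00 (z - 'i%C) = ((1%:C)%C : C) *: F00 z.
    by rewrite scale1r -half2 p00 p11 RaK.
  have := tau_analytic_value fp th t0 tD e00 t00 ltr01 h.
  rewrite b00 sqrtr1 scale1r => e.
  by rewrite -{1}[a]adjK Ra_adj e.
have h z : F10 (z - 'i%C) = (((q ^+ 2)%:C)%C : C) *: F10 z.
  rewrite -half2 p10 (linZ Ra_lin) p10 !(linZ Ra_lin) RaK scalerA.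
  by rewrite mulrNN -rmorphM -expr2.
have q2 : 0 < q ^+ 2 by rewrite exprn_even_gt0.
have := tau_analytic_value fp th t0 tD e10 t10 q2 h.
rewrite b10 sqrtr_sqr (linZ Ra_lin) => e.
have qN : - qC != 0 by rewrite oppr_eq0 qC0.
apply: (scalerI qN); rewrite e scalerA; congr (_ *: _).
by field; exact: qC0.
Qed.

Lemma Ra_a : Ra a = adj a. Proof. by case: Ra_gen. Qed.
Lemma Ra_c : Ra c = - (abs_q / qC) *: c. Proof. by case: Ra_gen. Qed.

Let s := (((Num.sqrt `|q|)%:C)%C : C).

Let s2 : s * s = abs_q.
Proof. by rewrite /s -rmorphM -expr2 sqr_sqrtr. Qed.

Lemma sq0 : s != 0.
Proof.
rewrite /s -(rmorph0 (real_complex R)) (inj_eq (@complexI R)) gt_eqF//.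
by rewrite sqrtr_gt0 normr_gt0.
Qed.

(** The scalar is written as a power of [s = |q|^(1/2)] in a difference of weights, a form that is
    multiplicative along tensor powers. *)
Lemma Ra_fund i k : Ra (fund i k) = (s ^ (fund_wt i - fund_wt k)) *: adj (fund k i).
Proof.
have aq0 : abs_q != 0 by rewrite -s2 mulf_neq0 ?sq0.
have absq2 : abs_q * abs_q = qC * qC.
  by rewrite -!rmorphM -!expr2 real_normK ?num_real.
rewrite /fund /fund_wt; case: (I2P i) => ->; case: (I2P k) => -> /=.
- by rewrite subrr expr0z scale1r Ra_a.
- rewrite (_ : 1 - -1 = 2%:Z)// -exprnP expr2 s2 (linZ Ra_lin) Ra_adj Ra_c adjZ scalerA.
  congr (_ *: _); rewrite rmorphN fmorph_div /= !conj_real mulrNN mulrC divfK//; exact: qC0.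
- rewrite (_ : -1 - 1 = - 2%:Z)// -exprz_inv -exprnP expr2 -invfM s2 Ra_c adjZ adjK scalerA rmorphN /= conj_real.
  have -> : abs_q / qC = qC / abs_q by apply/eqP; rewrite eqr_div ?qC0// absq2.
  by rewrite mulrN [qC / _]mulrC.
- by rewrite subrr expr0z scale1r Ra_adj Ra_a adjK.
Qed.

Lemma Ra_wcoef n (i k : widx n) :
  Ra (wcoef i k) = (s ^ (wwt i - wwt k)) *: adj (wcoef k i).
Proof.
elim: n i k => [|n IH] i k /=; first by rewrite subr0 expr0z scale1r Ra1 adj1.
rewrite RaM IH Ra_fund adjM cmulZl cmulZr scalerA -expfzDr; last exact: sq0.
by congr (_ ^ _ *: _); ring.
Qed.

Lemma Ra_x : Ra x = x.
Proof.
have aq0 : abs_q != 0 by rewrite -s2 mulf_neq0 ?sq0.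
have absq2 : abs_q * abs_q = qC * qC.
  by rewrite -!rmorphM -!expr2 real_normK ?num_real.
rewrite RaM Ra_adj Ra_c adjZ cmulZl cmulZr scalerA -rel_cc rmorphN fmorph_div /= !conj_real.
rewrite mulrNN mulf_div absq2 divff ?scale1r//.
by rewrite mulf_neq0 ?qC0.
Qed.

Lemma Ra_xspan P : xspan P -> Ra P = P.
Proof.
move: P; apply: lspan_ind.
- exact: lin0 Ra_lin.
- by move=> k u v hu hv; rewrite Ra_lin hu hv.
move=> _ [k ->]; elim: k => [|k IH]; first exact: Ra1.
by rewrite cpowS RaM IH Ra_x -cpowSr.
Qed.

End UnitaryAntipode.
End SUq2Algebra.
Arguments fund {R q G} i j.
Arguments wcoef {R q G n} i j.
Arguments xspan {R q G}.

(** * Fields of Hilbert-Schmidt operators *)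

(** The optimal weight is [c / a]. Both numbers are first enlarged by [e / 2], which keeps the
    quotient meaningful when one of them is 0. *)
Lemma sq_triangle (R : realType) (x a c : R) : 0 <= x -> 0 <= a -> 0 <= c ->
  (forall e, 0 < e -> x ^+ 2 <= (1 + e) * a ^+ 2 + (1 + e^-1) * c ^+ 2) -> x <= a + c.
Proof.
move=> x0 a0 c0 h; apply/ler_addgt0Pr => e e0.
have e2 : 0 <= e / 2 by rewrite divr_ge0// ltW.
pose u := a + e / 2; pose w := c + e / 2.
have u0 : 0 < u by rewrite ltr_wpDl// divr_gt0.
have w0 : 0 < w by rewrite ltr_wpDl// divr_gt0.
have au : a ^+ 2 <= u ^+ 2.
  by rewrite ler_pXn2r ?nnegrE ?(ltW u0)// lerDl.
have cw : c ^+ 2 <= w ^+ 2.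
  by rewrite ler_pXn2r ?nnegrE ?(ltW w0)// lerDl.
have -> : a + c + e = u + w by rewrite /u /w; field.
rewrite -(ler_pXn2r (_ : 0 < 2)%N) ?nnegrE ?addr_ge0 ?(ltW u0) ?(ltW w0)//.
have := h _ (divr_gt0 w0 u0); rewrite invf_div => hx; apply: (le_trans hx).
have k1 : 0 <= 1 + w / u by rewrite addr_ge0// divr_ge0 ?(ltW u0) ?(ltW w0).
have k2 : 0 <= 1 + u / w by rewrite addr_ge0// divr_ge0 ?(ltW u0) ?(ltW w0).
apply: (le_trans (lerD (ler_wpM2l k1 au) (ler_wpM2l k2 cw))).
rewrite le_eqVlt; apply/orP; left; apply/eqP; field.
by rewrite !gt_eqF.
Qed.

Section HSFields.
Variables (R : realType) (H : hilbertType R) (b : nat -> H).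
Hypothesis hb : orthonormal_basis b.
Variables (d : measure_display) (X : measurableType d) (P : probability X R).
Local Notation C := R[i].
Implicit Types (T S : X -> H -> H).
Local Open Scope ereal_scope.

Definition mfield T := forall n m : nat, cmeasurable (fun x => dotp (b n) (T x (b m))).
Definition hsI T := \int[P]_x hs_norm2 b (T x).
(** The constant-fibre form of [hs_direct_integral], used over the second circle alone. *)
Definition hsfield T :=
  [/\ forall x, hilbert_schmidt b (T x), mfield T & hsI T < +oo].
(** Since [fine] turns an infinite integral into 0, this behaves as a norm only on fields with
    finite [hsI]. *)
Definition hsn T : R := Num.sqrt (fine (hsI T)).

Lemma mfield_hs T : mfield T -> measurable_fun setT (fun x => hs_norm2 b (T x)).
Proof.
move=> mT; under eq_fun do rewrite (hs_matrix hb).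
apply: ge0_emeasurable_sum => [k x _ _|k _].
  by apply: nneseries_ge0 => n _ _; rewrite lee_fin sqr_ge0.
apply: ge0_emeasurable_sum => [j x _ _|j _]; first by rewrite lee_fin sqr_ge0.
by apply/measurable_EFinP; exact: cmeas_nm2.
Qed.

Lemma hsI_ge0 T : 0 <= hsI T.
Proof. by apply: integral_ge0 => x _; exact: hs_ge0. Qed.

Lemma hsn_ge0 T : (0 <= hsn T)%R. Proof. exact: sqrtr_ge0. Qed.

Lemma hsIE T : hsI T < +oo -> hsI T = (hsn T ^+ 2)%:E.
Proof.
move=> h; have hf : hsI T \is a fin_num by rewrite ge0_fin_numE// hsI_ge0.
by rewrite /hsn sqr_sqrtr ?fineK// fine_ge0// hsI_ge0.
Qed.

Lemma hsn_le T (K : R) : (0 <= K)%R -> hsI T <= (K ^+ 2)%:E -> (hsn T <= K)%R.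
Proof.
move=> K0 h; have hf : hsI T < +oo := le_lt_trans h (ltry _).
by rewrite -(ler_pXn2r (_ : 0 < 2)%N) ?nnegrE ?hsn_ge0// -lee_fin -hsIE.
Qed.

Lemma mfield_lin (k : C) T S : mfield T -> mfield S -> mfield (fun x v => k *: T x v + S x v)%R.
Proof.
move=> mT mS n m; under eq_fun do rewrite dotpDr dotpZr.
by apply: cmeasD => //; exact: cmeasZ.
Qed.

Lemma hilbert_schmidt_lin (k : C) (A B : H -> H) : hilbert_schmidt b A -> hilbert_schmidt b B ->
  hilbert_schmidt b (fun v => k *: A v + B v)%R.
Proof.
move=> [/blP[lA [KA KA0 hA]] fA] [/blP[lB [KB KB0 hB]] fB]; split.
  apply/blP; split.
    by move=> l u v; rewrite lA lB !scalerDr !scalerA [(k * l)%R]mulrC addrACA.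
  exists (nm k * KA + KB)%R; first by rewrite addr_ge0// mulr_ge0// nm_ge0.
  move=> v; apply: le_trans (nmD _ _) _; rewrite nmZ mulrDl -mulrA; apply: lerD => //.
  by rewrite ler_wpM2l ?nm_ge0.
apply: (le_lt_trans (hs_D b (fun v => k *: A v)%R B ltr01)).
rewrite hs_Z; apply: lte_add_pinfty; last by rewrite lte_mul_pinfty// lee_fin addr_ge0// invr_ge0.
rewrite lte_mul_pinfty ?lee_fin ?addr_ge0//.
by rewrite lte_mul_pinfty ?lee_fin ?sqr_ge0.
Qed.

Lemma hsI_D (e : R) T S : (0 < e)%R -> mfield T -> mfield S ->
  hsI (fun x v => T x v + S x v)%R <= (1 + e)%:E * hsI T + (1 + e^-1)%:E * hsI S.
Proof.
move=> e0 mT mS.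
have e1 : (0 <= 1 + e)%R by rewrite addr_ge0// ltW.
have e2 : (0 <= 1 + e^-1)%R by rewrite addr_ge0// invr_ge0 ltW.
have mm (k : R) U : mfield U -> measurable_fun setT (fun x => k%:E * hs_norm2 b (U x)).
  by move=> mU; apply: emeasurable_funM; [exact: measurable_cst|exact: mfield_hs].
rewrite /hsI -!ge0_integralZl_EFin//; try by [exact: mfield_hs|move=> x _; exact: hs_ge0].
rewrite -ge0_integralD//; try by
  [exact: mm|move=> x _; rewrite mule_ge0 ?lee_fin ?hs_ge0].
apply: ge0_le_integral => //.
- by move=> x _; exact: hs_ge0.
- apply: mfield_hs => n m; have := mfield_lin 1%R mT mS n m; congr cmeasurable.
  by apply/funext => x; rewrite scale1r.
- by apply: emeasurable_funD; exact: mm.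
- by move=> x _; exact: hs_D.
Qed.

Lemma hsI_Z (k : C) T : mfield T ->
  hsI (fun x v => k *: T x v)%R = (nm k ^+ 2)%:E * hsI T.
Proof.
move=> mT; rewrite /hsI -ge0_integralZl_EFin//; last 3 first.
- by move=> x _; exact: hs_ge0.
- exact: mfield_hs.
- exact: sqr_ge0.
by apply: eq_integral => x _; exact: hs_Z.
Qed.

Lemma mfield0 : mfield (fun _ _ => 0%R).
Proof. by move=> n m; under eq_fun do rewrite dotp0r; exact: cmeas_cst. Qed.

Lemma hs_norm2_0 : hs_norm2 b (fun _ : H => 0%R : H) = 0.
Proof. by rewrite hsE eseries0// => n _ _; rewrite nm0 expr0n. Qed.

Lemma hsI0 : hsI (fun _ _ => 0%R) = 0.
Proof. by rewrite /hsI (eq_integral (cst 0)) ?integral0// => x _; exact: hs_norm2_0. Qed.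

Lemma hsn0 : hsn (fun _ _ => 0%R) = 0%R.
Proof. by rewrite /hsn hsI0 sqrtr0. Qed.

Lemma hsfield0 : hsfield (fun _ _ => 0%R).
Proof.
have bl0 : bounded_linear (fun _ : H => 0%R : H).
  by apply/blP; split; [move=> k u v; rewrite scaler0 addr0|exists 0%R => // v; rewrite nm0 mul0r].
split=> [x||]; [by split=> //; rewrite hs_norm2_0|exact: mfield0|by rewrite hsI0].
Qed.

Lemma hsfield_lin (k : C) T S : hsfield T -> hsfield S ->
  hsfield (fun x v => k *: T x v + S x v)%R.
Proof.
move=> [hT mT iT] [hS mS iS]; split => [x||].
- exact: hilbert_schmidt_lin.
- exact: mfield_lin.
have mkT : mfield (fun x v => k *: T x v)%R.
  by move=> n m; under eq_fun do rewrite dotpZr; exact: cmeasZ.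
apply: (le_lt_trans (hsI_D ltr01 mkT mS)); rewrite hsI_Z//.
apply: lte_add_pinfty; last by rewrite lte_mul_pinfty// lee_fin addr_ge0// invr_ge0.
rewrite lte_mul_pinfty ?lee_fin ?addr_ge0//.
by rewrite lte_mul_pinfty ?lee_fin ?sqr_ge0.
Qed.

Lemma field_ext T S : (forall x v, T x v = S x v) -> T = S.
Proof. by move=> h; apply/funext => x; apply/funext => v. Qed.

Lemma hsfieldD T S : hsfield T -> hsfield S -> hsfield (fun x v => T x v + S x v)%R.
Proof.
move=> hT hS; have := hsfield_lin 1%R hT hS; congr hsfield.
by apply: field_ext => x v; rewrite scale1r.
Qed.

Lemma hsfieldZ (k : C) T : hsfield T -> hsfield (fun x v => k *: T x v)%R.
Proof.
move=> hT; have := hsfield_lin k hT hsfield0; congr hsfield.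
by apply: field_ext => x v; rewrite addr0.
Qed.

Lemma hsfieldB T S : hsfield T -> hsfield S -> hsfield (fun x v => T x v - S x v)%R.
Proof.
move=> hT hS; have := hsfield_lin (-1)%R hS hT; congr hsfield.
by apply: field_ext => x v; rewrite scaleN1r addrC.
Qed.

Lemma hsnZ (k : C) T : hsfield T -> hsn (fun x v => k *: T x v)%R = (nm k * hsn T)%R.
Proof.
move=> [_ mT iT]; rewrite {1}/hsn hsI_Z// (hsIE iT) -EFinM /= -exprMn sqrtr_sqr ger0_norm//.
by rewrite mulr_ge0 ?nm_ge0 ?hsn_ge0.
Qed.

Lemma hsnBC T S : hsn (fun x v => T x v - S x v)%R = hsn (fun x v => S x v - T x v)%R.
Proof. by rewrite /hsn /hsI; congr (Num.sqrt (fine _)); apply: eq_integral => x _; exact: hs_BC. Qed.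

Lemma hsnD T S : hsfield T -> hsfield S ->
  (hsn (fun x v => T x v + S x v) <= hsn T + hsn S)%R.
Proof.
move=> hT hS; have [_ _ iTS] := hsfieldD hT hS.
case: hT hS => [_ mT iT] [_ mS iS].
have key (e : R) : (0 < e)%R -> (hsn (fun x v => T x v + S x v) ^+ 2 <=
    (1 + e) * hsn T ^+ 2 + (1 + e^-1) * hsn S ^+ 2)%R.
  by move=> e0; have := hsI_D e0 mT mS; rewrite (hsIE iTS) (hsIE iT) (hsIE iS) -!EFinM -EFinD lee_fin.
by apply: sq_triangle; rewrite ?hsn_ge0.
Qed.

Lemma hsnBD S T U : hsfield T -> hsfield S -> hsfield U ->
  (hsn (fun x v => T x v - U x v) <= hsn (fun x v => T x v - S x v) + hsn (fun x v => S x v - U x v))%R.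
Proof.
move=> hT hS hU; rewrite (_ : (fun x v => T x v - U x v)%R =
  fun x v => ((T x v - S x v) + (S x v - U x v))%R).
  exact: hsnD (hsfieldB hT hS) (hsfieldB hS hU).
by apply: field_ext => x v; rewrite addrA subrK.
Qed.

Lemma hsn_dist T S : hsfield T -> hsfield S ->
  (hsn T <= hsn S + hsn (fun x v => T x v - S x v))%R.
Proof.
move=> hT hS; rewrite [X in (hsn X <= _)%R](_ : T = fun x v => (S x v + (T x v - S x v))%R).
  exact: hsnD hS (hsfieldB hT hS).
by apply: field_ext => x v; rewrite addrC subrK.
Qed.

Lemma hsn_ae0 T : hsfield T -> hsn T = 0%R -> {ae P, forall x, forall v, T x v = 0%R}.
Proof.
move=> [hT mT iT] T0.
have : \int[P]_(x in setT) `|hs_norm2 b (T x)| = 0.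
  rewrite (eq_integral (fun x => hs_norm2 b (T x))).
    by have := hsIE iT; rewrite T0 expr0n /hsI /= => ->.
  by move=> x _; rewrite gee0_abs// hs_ge0.
move/(ae_eq_integral_abs P measurableT (mfield_hs mT)).
apply: filterS => x /(_ I) h; have [bT _] := hT x.
by apply: (hs_eq0 bT _ h); case: hb.
Qed.

Lemma hsn_ae_eq T S : hsfield T -> hsfield S -> hsn (fun x v => T x v - S x v)%R = 0%R ->
  {ae P, forall x, forall v, T x v = S x v}.
Proof.
move=> hT hS h; have := hsn_ae0 (hsfieldB hT hS) h; apply: filterS => x hx v.
by apply/eqP; rewrite -subr_eq0 hx.
Qed.

Let half_sqr : (2^-1 ^+ 2 = 4^-1 :> R)%R.
Proof. by rewrite exprVn -natrX. Qed.

(** The weight [4^m] against squares bounds the [m]-th increment by a multiple of [2^-m]. The factor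
    4 in the rate is the square of the sum 2 of the geometric series. *)
Lemma fast_cvg (V : completeNormedModType R[i]) (u : nat -> V) (M : R) :
  (forall n, \sum_(0 <= m < n) 4 ^+ m * nm (u m.+1 - u m) ^+ 2 <= M)%R ->
  exists2 l : V, u @ \oo --> l & forall n, (nm (u n - l) ^+ 2 <= 4 * 4^-1 ^+ n * M)%R.
Proof.
move=> hM; have M0 : (0 <= M)%R by have := hM 0%N; rewrite big_geq.
have inc n : (nm (u n.+1 - u n) <= Num.sqrt M * (2^-1) ^+ n)%R.
  rewrite -(ler_pXn2r (_ : 0 < 2)%N) ?nnegrE ?nm_ge0 ?mulr_ge0 ?sqrtr_ge0 ?exprn_ge0 ?invr_ge0//.
  rewrite exprMn sqr_sqrtr// -exprM mulnC exprM half_sqr.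
  rewrite exprVn ler_pdivlMr ?exprn_gt0// mulrC.
  apply: le_trans (hM n.+1); rewrite big_nat_recr//= lerDr sumr_ge0// => i _.
  by rewrite mulr_ge0 ?sqr_ge0 ?exprn_ge0.
have [l ul hl] : exists2 l : V, u @ \oo --> l &
    forall n, (nm (l - u n) <= Num.sqrt M * (2^-1) ^+ n / (1 - 2^-1))%R.
  by apply: geo_complete => //; rewrite invf_lt1// ltr1n.
exists l => // n.
have h2 : ((1 - 2^-1)^-1 = 2 :> R)%R by field.
have := hl n; rewrite nmB h2 => h.
apply: (@le_trans _ _ ((Num.sqrt M * 2^-1 ^+ n * 2) ^+ 2)%R).
  by rewrite ler_pXn2r ?nnegrE ?nm_ge0// !mulr_ge0 ?sqrtr_ge0 ?exprn_ge0 ?invr_ge0.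
rewrite !exprMn sqr_sqrtr// -exprM mulnC exprM half_sqr.
by rewrite le_eqVlt; apply/orP; left; apply/eqP; ring.
Qed.

(** * Completeness of the space of fields *)

Section Completeness.
Variable T : nat -> X -> H -> H.
Hypothesis hT : forall n, hsfield (T n).
Hypothesis fast : forall n, (hsn (fun x v => T n.+1 x v - T n x v) <= 8^-1 ^+ n)%R.

Let inc m x : \bar R := hs_norm2 b (fun v => T m.+1 x v - T m x v)%R.
(** The integral of the [m]-th term is at most [4^m 64^-m = 16^-m]. Hence [F] is integrable, and
    where it is finite it controls the convergence of all columns at once. *)
Let F x : \bar R := \sum_(0 <= m <oo) (4 ^+ m)%:E * inc m x.
Let term m k x : R := (4 ^+ m * nm (T m.+1 x (b k) - T m x (b k)) ^+ 2)%R.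

Let term_ge0 m k x : (0 <= term m k x)%R.
Proof. by apply: mulr_ge0; [exact: exprn_ge0|exact: sqr_ge0]. Qed.

Let FE x : F x = \sum_(0 <= k <oo) \sum_(0 <= m <oo) (term m k x)%:E.
Proof.
rewrite nneseries_interchange; last by move=> i j; rewrite lee_fin term_ge0.
apply: eq_eseriesr => m _; rewrite /inc hsE -nneseriesZl => [|n _]; last by rewrite lee_fin sqr_ge0.
by apply: eq_eseriesr => k _; rewrite /term EFinM.
Qed.

Let F_ge0 x : 0 <= F x.
Proof. by apply: nneseries_ge0 => m _ _; rewrite mule_ge0 ?hs_ge0 ?lee_fin ?exprn_ge0. Qed.

Let mF : measurable_fun setT F.
Proof.
apply: ge0_emeasurable_sum => [m x _ _|m _].
  by rewrite mule_ge0 ?hs_ge0 ?lee_fin ?exprn_ge0.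
apply: emeasurable_funM; first exact: measurable_cst.
by have [_ mD _] := hsfieldB (hT m.+1) (hT m); exact: mfield_hs mD.
Qed.

Let intF : \int[P]_x F x <= 2%:E.
Proof.
rewrite integral_nneseries//; last 2 first.
- move=> m; apply: emeasurable_funM; first exact: measurable_cst.
  by have [_ mD _] := hsfieldB (hT m.+1) (hT m); exact: mfield_hs mD.
- by move=> m x _; rewrite mule_ge0 ?hs_ge0 ?lee_fin ?exprn_ge0.
apply: (@le_trans _ _ (\sum_(0 <= m <oo) (16^-1 ^+ m)%:E)).
  apply: lee_nneseries => m _.
    by move=> _; apply: integral_ge0 => x _; rewrite mule_ge0 ?hs_ge0 ?lee_fin ?exprn_ge0.
  have [_ mD iD] := hsfieldB (hT m.+1) (hT m).
  rewrite ge0_integralZl_EFin//; last 2 first.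
  - by move=> x _; exact: hs_ge0.
  - exact: mfield_hs mD.
  have hI := hsIE iD; rewrite /hsI in hI; rewrite /inc hI -EFinM lee_fin.
  have e : (16^-1 ^+ m = 4 ^+ m * (8^-1 ^+ m) ^+ 2 :> R)%R.
    by rewrite -exprM mulnC exprM -exprMn; congr (_ ^+ _)%R; field.
  rewrite e ler_wpM2l ?exprn_ge0// ler_pXn2r ?nnegrE ?hsn_ge0//.
apply: nneseries_le_bound => n; first by rewrite exprn_ge0// invr_ge0.
apply: (@le_trans _ _ (2 - 2 * 16^-1 ^+ n)%R); last by rewrite gerBl mulr_ge0// exprn_ge0// invr_ge0.
elim: n => [|n IH]; first by rewrite big_geq// expr0; lra.
rewrite big_nat_recr//= exprS; have : (0 <= 16^-1 ^+ n :> R)%R by rewrite exprn_ge0// invr_ge0.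
by move: IH; set r := (16^-1 ^+ n)%R; lra.
Qed.

(* The estimate is vacuous where [F] is infinite, so no null set has to be
   discarded. *)
Let limit_op x : exists S : H -> H, [/\ hilbert_schmidt b S,
  F x < +oo -> forall k, (fun n => T n x (b k)) @ \oo --> S (b k),
  ~~ (F x < +oo) -> S = (fun=> 0%R) &
  forall n, hs_norm2 b (fun v => T n x v - S v)%R <= (4 * 4^-1 ^+ n)%:E * F x].
Proof.
have [Ff|Ff] := boolP (F x < +oo); last first.
  exists (fun=> 0%R); split=> //.
    by have [h _ _] := hsfield0; exact: h.
  move=> n; have -> : F x = +oo by apply/eqP; rewrite -leye_eq leNgt.
  by rewrite gt0_muley ?leey// lte_fin mulr_gt0// exprn_gt0// invr_gt0.
have rowF k : \sum_(0 <= m <oo) (term m k x)%:E <= F x.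
  rewrite FE; apply: (@le_trans _ _ (\sum_(0 <= j < k.+1) \sum_(0 <= m <oo) (term m j x)%:E)).
    rewrite big_nat_recr//= leeDr// sume_ge0// => j _.
    by apply: nneseries_ge0 => m _ _; rewrite lee_fin.
  by apply: nneseries_lim_ge => j _ _; apply: nneseries_ge0 => m _ _; rewrite lee_fin.
pose M k := fine (\sum_(0 <= m <oo) (term m k x)%:E).
have ME k : \sum_(0 <= m <oo) (term m k x)%:E = (M k)%:E.
  rewrite fineK// ge0_fin_numE; first exact: le_lt_trans (rowF k) Ff.
  by apply: nneseries_ge0 => m _ _; rewrite lee_fin.
have M0 k : (0 <= M k)%R by apply: fine_ge0; apply: nneseries_ge0 => m _ _; rewrite lee_fin.
have FM : F x = \sum_(0 <= k <oo) (M k)%:E by rewrite FE; apply: eq_eseriesr => k _; exact: ME.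
have colP k : exists l : H, (fun n => T n x (b k)) @ \oo --> l /\
    forall n, (nm (T n x (b k) - l) ^+ 2 <= 4 * 4^-1 ^+ n * M k)%R.
  have [|l l1 l2] := @fast_cvg H (fun n => T n x (b k)) (M k); last by exists l.
  move=> n; change (\sum_(0 <= m < n) term m k x <= M k)%R; rewrite -lee_fin -ME -sumEFin.
  by apply: nneseries_lim_ge => m _ _; rewrite lee_fin.
have [l hl] := choice colP.
have [B hB] : exists B, forall n, (\sum_(0 <= k < n) nm (l k) ^+ 2 <= B)%R.
  have [h0 _ _] := hT 0; have [_ f0] := h0 x; rewrite hsE in f0.
  have [B1 hB1] := nneseries_bounded (fun n => sqr_ge0 _) f0.
  have fM : \sum_(0 <= k <oo) (M k)%:E < +oo by rewrite -FM.
  have [B2 hB2] := nneseries_bounded M0 fM.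
  exists (2 * B1 + 8 * B2)%R => n.
  apply: (@le_trans _ _ (\sum_(0 <= k < n) (2 * nm (T 0%N x (b k)) ^+ 2 + 8 * M k))%R).
    apply: ler_sum => k _; have [_ /(_ 0%N)] := hl k; rewrite expr0 mulr1 => h.
    have -> : l k = (T 0%N x (b k) + (l k - T 0%N x (b k)))%R by rewrite addrC subrK.
    apply: le_trans (nm_sq_D2 _ _) _; rewrite lerD2l nmB; lra.
  rewrite big_split /= -!mulr_sumr; by apply: lerD; apply: ler_wpM2l.
have [S [bS Sb]] := column_op hb hB.
exists S; split=> //.
- split=> //; rewrite hsE; under eq_eseriesr do rewrite Sb.
  by apply: le_lt_trans (ltry B); apply: nneseries_le_bound => // n; exact: sqr_ge0.
- by move=> _ k; rewrite Sb; case: (hl k).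
- move=> n; rewrite hsE FM -nneseriesZl => [|k _]; last by rewrite lee_fin.
  apply: lee_nneseries => k _; first by rewrite lee_fin sqr_ge0.
  by rewrite -EFinM lee_fin Sb; case: (hl k).
Qed.

Lemma hsfield_complete : exists2 S, hsfield S &
  forall n, (hsn (fun x v => T n x v - S x v) <= 3 * 2^-1 ^+ n)%R.
Proof.
have [S hS] := choice limit_op.
have mS : mfield S.
  (* Off [D] the limit is 0, so everywhere it is the limit of the fields multiplied by the indicator
     of [D], which are measurable. *)
  move=> j k; pose D := [set x | F x < +oo].
  have mD : measurable D.
    by rewrite -[D]setTI; exact: emeasurable_fun_infty_o measurableT mF _.
  apply: (cmeas_lim (F := fun n x => ((\1_D x)%:C)%C * dotp (b j) (T n x (b k)))%R).
    move=> n; apply: cmeasM; first by apply: cmeas_real; exact: measurable_indic.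
    by have [_ mT _] := hT n; exact: mT.
  move=> x; have [_ h1 h2 _] := hS x; rewrite indicE.
  have [xD|xD] := boolP (x \in D).
    rewrite (_ : (fun n => _) = fun n => dotp (b j) (T n x (b k)) : R[i]^o); last first.
      by apply/funext => n; rewrite mul1r.
    by apply: dotp_cvg; [exact: cvg_cst|apply: h1; rewrite inE in xD].
  rewrite h2 ?dotp0r; last by apply: contra xD => xD; rewrite inE.
  rewrite (_ : (fun n => _) = cst (0 : R[i]^o)%R); first exact: cvg_cst.
  by apply/funext => n; rewrite mul0r.
have mTS n : mfield (fun x v => T n x v - S x v)%R.
  have [_ mT _] := hT n; have := mfield_lin (-1)%R mS mT; congr mfield.
  by apply: field_ext => x v; rewrite scaleN1r addrC.
have bound n : hsI (fun x v => T n x v - S x v)%R <= (8 * 4^-1 ^+ n)%:E.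
  have c0 : (0 <= 4 * 4^-1 ^+ n :> R)%R by rewrite mulr_ge0// exprn_ge0// invr_ge0.
  apply: (@le_trans _ _ (\int[P]_x ((4 * 4^-1 ^+ n)%:E * F x))).
    apply: ge0_le_integral => //.
    - by move=> x _; exact: hs_ge0.
    - exact: mfield_hs (mTS n).
    - by apply: emeasurable_funM; [exact: measurable_cst|].
    - by move=> x _; case: (hS x).
  rewrite ge0_integralZl_EFin// (_ : (8 * 4^-1 ^+ n)%R = (4 * 4^-1 ^+ n * 2)%R); last by ring.
  by rewrite [X in _ <= X]EFinM lee_wpmul2l.
have hSf : hsfield S.
  split=> // [x|]; first by case: (hS x).
  have [_ mT iT] := hT 0; rewrite (_ : S = fun x v => (T 0%N x v + - 1 *: (T 0%N x v - S x v))%R).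
    have mN : mfield (fun x v => -1 *: (T 0%N x v - S x v))%R.
      by move=> i j; under eq_fun do rewrite dotpZr; apply: cmeasZ; exact: mTS.
    apply: (le_lt_trans (hsI_D ltr01 mT mN)); rewrite hsI_Z//.
    apply: lte_add_pinfty; first by rewrite lte_mul_pinfty// lee_fin addr_ge0.
    rewrite lte_mul_pinfty ?lee_fin ?addr_ge0 ?invr_ge0//.
    rewrite lte_mul_pinfty ?lee_fin ?sqr_ge0//; exact: le_lt_trans (bound 0%N) (ltry _).
  by apply: field_ext => x v; rewrite scaleN1r opprB addrC subrK.
exists S => // n; apply: hsn_le.
  by rewrite mulr_ge0// exprn_ge0// invr_ge0.
(* The constant 3 arises from [8 <= 9 = 3^2]. *)
apply: le_trans (bound n) _; rewrite lee_fin exprMn -exprM mulnC exprM half_sqr.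
rewrite ler_wpM2r ?exprn_ge0 ?invr_ge0//; lra.
Qed.

End Completeness.

Lemma dotp_expand u w : (fun N => \sum_(0 <= j < N) dotp u (b j) * dotp (b j) w : R[i]^o)%R @ \oo -->
  (dotp u w : R[i]^o).
Proof.
apply: (@cvg_seq_eq (R[i]^o) (fun N => dotp u (onb_proj b N w))) => [N|].
  by rewrite /onb_proj dotp_sumr; apply: eq_bigr => j _; rewrite dotpZr mulrC.
by apply: dotp_cvg; [exact: cvg_cst|exact: onb_proj_cvg].
Qed.

Arguments dotp_expand u w : clear implicits.

(** The entries of a product are series of products of entries; the adjoint of [A x] turns such a
    series into the expansion of an inner product, which converges. *)
Lemma mfield_comp A B : (forall x, exists A', forall v w, dotp v (A x w) = dotp (A' v) w) ->
  mfield A -> mfield B -> mfield (fun x v => A x (B x v)).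
Proof.
move=> hA mA mB n m.
apply: (cmeas_lim (F := fun N x => \sum_(0 <= j < N) dotp (b n) (A x (b j)) * dotp (b j) (B x (b m)))%R).
  by move=> N; apply: cmeas_sum => j; exact: cmeasM.
move=> x; have [A' hA'] := hA x; rewrite hA'.
by apply: (@cvg_seq_eq (R[i]^o) _ _ _ _ (dotp_expand (A' (b n)) (B x (b m)))) => N; apply: eq_bigr => j _; rewrite hA'.
Qed.

(** The coefficients of the adjoint applied to [v] must be the conjugates of [dotp v (A (b k))].
    Evaluating [A] on a truncation [w] of this series gives [nm w ^+ 2 <= K * nm v * nm w], so they
    are square summable. *)
Lemma bl_adjoint (A : H -> H) : bounded_linear A -> exists A', forall v w, dotp v (A w) = dotp (A' v) w.
Proof.
move=> bA; have [K K0 hK] := bl_bound bA.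
have hr v : exists u, forall k : nat, dotp (b k) u = Num.conj (dotp v (A (b k))).
  apply: (riesz_fischer hb (M := ((K * nm v) ^+ 2)%R)) => N.
  pose w := (\sum_(0 <= k < N) Num.conj (dotp v (A (b k))) *: b k)%R.
  pose S := (\sum_(0 <= k < N) nm (dotp v (A (b k))) ^+ 2)%R.
  have S0 : (0 <= S)%R by apply: sumr_ge0 => k _; exact: sqr_ge0.
  have nw : (nm w ^+ 2 = S)%R by rewrite nm_comb//; apply: eq_bigr => k _; rewrite nmJ.
  have e : dotp v (A w) = (S%:C)%C.
    rewrite /w (lin_sum (bl_lin bA)) dotp_sumr rmorph_sum /=; apply: eq_bigr => k _.
    by rewrite (linZ (bl_lin bA)) dotpZr mulrC mul_conj.
  have : (S <= K * nm v * nm w)%R.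
    have := cauchy_schwarz v (A w); rewrite e nmR ger0_norm// => h; apply: le_trans h _.
    by rewrite mulrAC -[leRHS]mulrC ler_wpM2l ?nm_ge0// mulrC.
  under eq_bigr do rewrite nmJ; rewrite -/S.
  have w0 := nm_ge0 w; have v0 := nm_ge0 v; rewrite -nw => h.
  have [->|wn] := eqVneq (nm w) 0%R; first by rewrite expr0n sqr_ge0.
  have wp : (0 < nm w)%R by rewrite lt_neqAle eq_sym wn.
  rewrite ler_pXn2r ?nnegrE ?mulr_ge0//.
  by rewrite -(ler_pM2r wp) -expr2.
have [A' hA'] := choice hr; exists A' => v w.
have h1 := dotp_expand (A' v) w.
have h2 : (fun N => \sum_(0 <= j < N) dotp (A' v) (b j) * dotp (b j) w : R[i]^o)%R @ \oo -->
    (dotp v (A w) : R[i]^o).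
  apply: (@cvg_seq_eq (R[i]^o) (fun N => dotp v (A (onb_proj b N w)))) => [N|].
    rewrite /onb_proj (lin_sum (bl_lin bA)) dotp_sumr; apply: eq_bigr => j _.
    by rewrite (linZ (bl_lin bA)) dotpZr mulrC -[dotp (A' v) _]conj_dotp hA' conjCK.
  by apply: dotp_cvg; [exact: cvg_cst|apply: (bl_cvg bA); exact: onb_proj_cvg].
exact: cvg_uniq h2 h1.
Qed.

Lemma hsfield_mul_l A (K : R) T : (0 <= K)%R -> (forall x, bounded_linear (A x)) ->
  (forall x v, nm (A x v) <= K * nm v)%R -> mfield A -> hsfield T ->
  hsfield (fun x v => A x (T x v)) /\ (hsn (fun x v => A x (T x v)) <= K * hsn T)%R.
Proof.
move=> K0 bA hK mA hT; have [hsT mT iT] := hT.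
have hle x : hs_norm2 b (fun v => A x (T x v)) <= (K ^+ 2)%:E * hs_norm2 b (T x).
  apply: hs_bound => n; rewrite -exprMn ler_pXn2r ?nnegrE ?mulr_ge0 ?nm_ge0//; exact: hK.
have mAT : mfield (fun x v => A x (T x v)).
  by apply: mfield_comp => // x; exact: bl_adjoint.
have ile : hsI (fun x v => A x (T x v)) <= ((K * hsn T) ^+ 2)%:E.
  rewrite exprMn EFinM -(hsIE iT) /hsI -ge0_integralZl_EFin//; last 3 first.
  - by move=> x _; exact: hs_ge0.
  - exact: mfield_hs.
  - exact: sqr_ge0.
  apply: ge0_le_integral => //.
  - by move=> x _; exact: hs_ge0.
  - exact: mfield_hs.
  - by apply: emeasurable_funM; [exact: measurable_cst|exact: mfield_hs].
split; last by apply: hsn_le => //; rewrite mulr_ge0 ?hsn_ge0.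
split; [move=> x|exact: mAT|exact: le_lt_trans ile (ltry _)].
have [bT fT] := hsT x; split; first exact: bl_comp.
by apply: le_lt_trans (hle x) _; rewrite lte_mul_pinfty// lee_fin sqr_ge0.
Qed.

Lemma hsfield_mul_r B Bs (K : R) T : (0 <= K)%R -> (forall x, bounded_linear (B x)) ->
  (forall x v w, dotp v (B x w) = dotp (Bs x v) w) ->
  (forall x v, nm (Bs x v) <= K * nm v)%R -> mfield B -> hsfield T ->
  hsfield (fun x v => T x (B x v)) /\ (hsn (fun x v => T x (B x v)) <= K * hsn T)%R.
Proof.
move=> K0 bB aB hK mB hT; have [hsT mT iT] := hT.
have hle x : hs_norm2 b (fun v => T x (B x v)) <= (K ^+ 2)%:E * hs_norm2 b (T x).
  by have [bT fT] := hsT x; apply: (hs_right hb bT fT K0 (aB x)) => v; exact: hK.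
have mAT : mfield (fun x v => T x (B x v)).
  by apply: mfield_comp => // x; apply: bl_adjoint; case: (hsT x).
have ile : hsI (fun x v => T x (B x v)) <= ((K * hsn T) ^+ 2)%:E.
  rewrite exprMn EFinM -(hsIE iT) /hsI -ge0_integralZl_EFin//; last 3 first.
  - by move=> x _; exact: hs_ge0.
  - exact: mfield_hs.
  - exact: sqr_ge0.
  apply: ge0_le_integral => //.
  - by move=> x _; exact: hs_ge0.
  - exact: mfield_hs.
  - by apply: emeasurable_funM; [exact: measurable_cst|exact: mfield_hs].
split; last by apply: hsn_le => //; rewrite mulr_ge0 ?hsn_ge0.
split; [move=> x|exact: mAT|exact: le_lt_trans ile (ltry _)].
have [bT fT] := hsT x; split; first exact: bl_comp.
by apply: le_lt_trans (hle x) _; rewrite lte_mul_pinfty// lee_fin sqr_ge0.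
Qed.

(** The function [f] times the matrix unit taking [b k] to [b j]. *)
Definition elem j k (f : X -> C) : X -> H -> H := fun x v => ((f x * dotp (b k) v) *: b j)%R.

Lemma hs_rank1 k (w : H) : hs_norm2 b (fun v => dotp (b k) v *: w)%R = (nm w ^+ 2)%:E.
Proof.
rewrite hsE; apply: nneseries_cvg; apply: cvg_near_cst; exists k.+1 => // n /= kn.
rewrite big_mkord (bigD1 (Ordinal kn))//= big1 ?addr0.
  by case: hb => /(_ k k) -> _; rewrite eqxx scale1r.
move=> i; rewrite -val_eqE /= => ik; case: hb => /(_ k i) -> _.
by rewrite eq_sym (negbTE ik) scale0r nm0 expr0n.
Qed.

Lemma elem_hs j k f x : hs_norm2 b (elem j k f x) = (nm (f x) ^+ 2)%:E.
Proof.
rewrite (_ : elem j k f x = fun v => dotp (b k) v *: (f x *: b j))%R.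
  by rewrite hs_rank1 nmZ (nm_b hb) mulr1.
by apply/funext => v; rewrite /elem scalerA mulrC.
Qed.

Lemma elem_hsI j k f : hsI (elem j k f) = L2n P f.
Proof. by apply: eq_integral => x _; exact: elem_hs. Qed.

Lemma rank1_bl k (w : H) : bounded_linear (fun v => dotp (b k) v *: w)%R.
Proof.
apply/blP; split=> [l u v|]; first by rewrite dotpDr dotpZr scalerDl scalerA.
exists (nm w); first exact: nm_ge0.
move=> v; rewrite nmZ mulrC ler_wpM2l ?nm_ge0//.
by apply: le_trans (cauchy_schwarz _ _) _; rewrite (nm_b hb) mul1r.
Qed.

Lemma elem_hsfield j k f : cmeasurable f -> L2n P f < +oo -> hsfield (elem j k f).
Proof.
move=> mf fi; split=> [x|n m|]; last by rewrite elem_hsI.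
  split; last by rewrite elem_hs ltry.
  rewrite (_ : elem j k f x = fun v => dotp (b k) v *: (f x *: b j))%R; first exact: rank1_bl.
  by apply/funext => v; rewrite /elem scalerA mulrC.
rewrite (_ : (fun x => _) = fun x => (f x * (dotp (b k) (b m) * dotp (b n) (b j))))%R.
  by apply: cmeasM => //; exact: cmeas_cst.
by apply/funext => x; rewrite /elem dotpZr mulrA.
Qed.

Lemma nneseries_partial (u : nat -> R) (W : R) : (forall n, (0 <= u n)%R) ->
  \sum_(0 <= n <oo) (u n)%:E = W%:E -> (fun n => \sum_(0 <= k < n) u k)%R @ \oo --> W.
Proof.
move=> u0 uW; have [|M hM] := nneseries_bounded u0 _; first by rewrite uW ltry.
have cu : cvgn (fun n => \sum_(0 <= k < n) u k)%R.
  apply: nondecreasing_is_cvgn.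
    by apply/nondecreasing_seqP => n; rewrite big_nat_recr//= lerDl.
  by exists M => _ [n _ <-].
have := nneseries_cvg cu; rewrite uW => -[->]; exact: cu.
Qed.

(** Two truncations: a field is the limit of finite sums of its columns, and a column is the limit
    of finite sums of its entries. *)
Lemma hsfield_ind (M : set (X -> H -> H)) :
  M (fun _ _ => 0%R) ->
  (forall T S, M T -> M S -> M (fun x v => T x v + S x v)%R) ->
  (forall T, hsfield T -> (forall e : R, (0 < e)%R -> exists S, [/\ M S, hsfield S &
      (hsn (fun x v => T x v - S x v) <= e)%R]) -> M T) ->
  (forall j k f, cmeasurable f -> L2n P f < +oo -> M (elem j k f)) ->
  forall T, hsfield T -> M T.
Proof.
move=> M0 MD Mc Me T hT; have [hsT mT iT] := hT.
have msum (F : nat -> X -> H -> H) N : (forall k, M (F k)) -> M (fun x v => \sum_(0 <= k < N) F k x v)%R.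
  move=> hF; elim: N => [|N IH].
    by rewrite (_ : (fun x v => _) = fun _ _ => 0%R)//; apply: field_ext => x v; rewrite big_geq.
  rewrite (_ : (fun x v => _) = fun x v => (\sum_(0 <= k < N) F k x v + F N x v)%R); first exact: MD.
  by apply: field_ext => x v; rewrite big_nat_recr.
have hsum (F : nat -> X -> H -> H) N : (forall k, hsfield (F k)) -> hsfield (fun x v => \sum_(0 <= k < N) F k x v)%R.
  move=> hF; elim: N => [|N IH].
    by rewrite (_ : (fun x v => _) = fun _ _ => 0%R); [exact: hsfield0|apply: field_ext => x v; rewrite big_geq].
  rewrite (_ : (fun x v => _) = fun x v => (\sum_(0 <= k < N) F k x v + F N x v)%R); first exact: (hsfieldD IH (hF N)).
  by apply: field_ext => x v; rewrite big_nat_recr.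
(* The step common to both truncations, by dominated convergence: the error tends to 0 in each fibre
   and is dominated by the field itself. *)
have lim0 (S : X -> H -> H) (F : nat -> X -> H -> H) : hsfield S -> (forall k, M (F k)) -> (forall k, hsfield (F k)) ->
    (forall N x, hs_norm2 b (fun v => S x v - \sum_(0 <= k < N) F k x v)%R <= hs_norm2 b (S x)) ->
    (forall x, (fun N => fine (hs_norm2 b (fun v => S x v - \sum_(0 <= k < N) F k x v)%R)) @ \oo --> 0%R) -> M S.
  move=> hS MF hF dom lim; apply: Mc => // e e0.
  have [hsS mS iS] := hS.
  have fS x : hs_norm2 b (S x) \is a fin_num by rewrite ge0_fin_numE ?hs_ge0//; case: (hsS x).
  have hD N := hsfieldB hS (hsum F N hF).
  have fD N x : hs_norm2 b (fun v => S x v - \sum_(0 <= k < N) F k x v)%R \is a fin_num.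
    by rewrite ge0_fin_numE ?hs_ge0//; have [h _ _] := hD N; case: (h x).
  have e2 : (0 < e ^+ 2)%R by rewrite exprn_gt0.
  have [|||||N hN] := @small_integral _ _ _ P
    (fun N x => fine (hs_norm2 b (fun v => S x v - \sum_(0 <= k < N) F k x v)%R))
    (fun x => fine (hs_norm2 b (S x))) (e ^+ 2)%R _ _ lim _ _ _ e2.
  - move=> N; apply/measurable_EFinP; rewrite (_ : _ \o _ = fun x => hs_norm2 b (fun v => S x v - \sum_(0 <= k < N) F k x v)%R).
      by have [_ h _] := hD N; exact: mfield_hs h.
    by apply/funext => x; rewrite /= fineK.
  - by move=> N x; rewrite fine_ge0 ?hs_ge0.
  - apply/measurable_EFinP; rewrite (_ : _ \o _ = fun x => hs_norm2 b (S x)); first exact: mfield_hs.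
    by apply/funext => x; rewrite /= fineK.
  - by move=> N x; rewrite -lee_fin !fineK.
  - by rewrite (eq_integral (fun x => hs_norm2 b (S x)))// => x _; rewrite fineK.
  exists (fun x v => \sum_(0 <= k < N) F k x v)%R; split; [exact: msum|exact: hsum|].
  apply: hsn_le; first exact: ltW.
  by apply: le_trans hN; rewrite /hsI le_eqVlt; apply/orP; left; apply/eqP; apply: eq_integral => x _; rewrite fineK.
have col (g : X -> H) k : (forall j : nat, cmeasurable (fun x => dotp (b j) (g x))) ->
    \int[P]_x (nm (g x) ^+ 2)%:E < +oo -> M (fun x v => dotp (b k) v *: g x)%R /\ hsfield (fun x v => dotp (b k) v *: g x)%R.
  move=> mg ig.
  have hC : hsfield (fun x v => dotp (b k) v *: g x)%R.
    split=> [x|n m|].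
    - by split; [exact: rank1_bl|rewrite hs_rank1 ltry].
    - by under eq_fun do rewrite dotpZr; apply: cmeasZ.
    - by rewrite /hsI; under eq_integral do rewrite hs_rank1.
  split => //.
  have mnm : measurable_fun setT (fun x => (nm (g x) ^+ 2)%:E).
    under eq_fun do rewrite -(parseval hb).
    apply: ge0_emeasurable_sum => [j x _ _|j _]; first by rewrite lee_fin sqr_ge0.
    by apply/measurable_EFinP; exact: cmeas_nm2.
  have L2j (j : nat) : L2n P (fun x => dotp (b j) (g x)) < +oo.
    apply: le_lt_trans ig; apply: ge0_le_integral => //.
    - by move=> x _; rewrite lee_fin sqr_ge0.
    - by apply/measurable_EFinP; exact: cmeas_nm2.
    - move=> x _; rewrite lee_fin ler_pXn2r ?nnegrE ?nm_ge0//.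
      by apply: le_trans (cauchy_schwarz _ _) _; rewrite (nm_b hb) mul1r.
  have dE N x : hs_norm2 b (fun v => dotp (b k) v *: g x - \sum_(0 <= j < N) elem j k (fun x => dotp (b j) (g x)) x v)%R =
      (nm (g x - onb_proj b N (g x)) ^+ 2)%:E.
    rewrite -(hs_rank1 k); congr hs_norm2; apply/funext => v.
    rewrite scalerBr /onb_proj scaler_sumr; congr (_ - _)%R; apply: eq_bigr => j _.
    by rewrite /elem scalerA mulrC.
  apply: (lim0 _ (fun j => elem j k (fun x => dotp (b j) (g x)))); first exact: hC.
  - by move=> j; exact: Me.
  - by move=> j; exact: elem_hsfield.
  - move=> N x; rewrite dE hs_rank1 lee_fin bessel_eq// gerBl sumr_ge0// => j _; exact: sqr_ge0.
  - move=> x; apply: (cvg_seq_eq (u := fun N => (nm (g x - onb_proj b N (g x))%R * nm (g x - onb_proj b N (g x))%R)%R)) => [N|].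
      by rewrite dE /= expr2.
    have h : (fun N => nm (g x - onb_proj b N (g x))%R) @ \oo --> 0%R.
      have /cvg_nm h := @onb_proj_cvg _ _ _ hb (g x).
      by apply: cvg_seq_eq h => N; rewrite nmB.
    by rewrite -[X in _ --> X](mulr0 0%R); apply: cvgM.
have colT k : M (fun x v => dotp (b k) v *: T x (b k))%R /\ hsfield (fun x v => dotp (b k) v *: T x (b k))%R.
  apply: col => [j|]; first exact: mT.
  apply: le_lt_trans iT; apply: ge0_le_integral => //.
  - by move=> x _; rewrite lee_fin sqr_ge0.
  - under eq_fun do rewrite -(parseval hb).
    apply: ge0_emeasurable_sum => [j x _ _|j _]; first by rewrite lee_fin sqr_ge0.
    by apply/measurable_EFinP; exact: cmeas_nm2.
  - exact: mfield_hs.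
  - by move=> x _; exact: hs_term.
have dE N x n : (T x (b n) - \sum_(0 <= k < N) dotp (b k) (b n) *: T x (b k) = if (n < N)%N then 0 else T x (b n))%R.
  case: ifP => nN.
    rewrite big_mkord (bigD1 (Ordinal nN))//= big1 ?addr0.
      by case: hb => /(_ n n) -> _; rewrite eqxx scale1r subrr.
    move=> i; rewrite -val_eqE /= => ik; case: hb => /(_ i n) -> _.
    by rewrite (negbTE ik) scale0r.
  rewrite big_nat big1 ?subr0// => i /andP[_ iN]; case: hb => /(_ i n) -> _.
  by rewrite (_ : (i == n) = false) ?scale0r//; apply/eqP => e; rewrite -e iN in nN.
apply: (lim0 _ (fun k x v => dotp (b k) v *: T x (b k))%R); first exact: hT.
- by move=> k; case: (colT k).
- by move=> k; case: (colT k).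
- move=> N x; have := @hs_bound R H b (fun v => T x v - \sum_(0 <= k < N) dotp (b k) v *: T x (b k))%R (T x) 1%R.
  rewrite mul1e; apply => n; rewrite dE mul1r; case: (n < N)%N => //.
  by rewrite nm0 expr0n sqr_ge0.
move=> x; have [_ fT] := hsT x.
have fn : hs_norm2 b (T x) \is a fin_num by rewrite ge0_fin_numE ?hs_ge0.
pose W := fine (hs_norm2 b (T x)).
have part : (fun n => \sum_(0 <= k < n) nm (T x (b k)) ^+ 2)%R @ \oo --> W.
  by apply: nneseries_partial => [n|]; [exact: sqr_ge0|rewrite -hsE fineK].
apply: (cvg_seq_eq (u := fun N => W - \sum_(0 <= k < N) nm (T x (b k)) ^+ 2)%R) => [N|].
  apply/esym; apply: (@EFin_inj R); rewrite fineK; last first.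
    rewrite ge0_fin_numE ?hs_ge0//; apply: le_lt_trans fT.
    have := @hs_bound R H b (fun v => T x v - \sum_(0 <= k < N) dotp (b k) v *: T x (b k))%R (T x) 1%R.
    rewrite mul1e; apply => n; rewrite dE mul1r; case: (n < N)%N => //.
    by rewrite nm0 expr0n sqr_ge0.
  rewrite hsE; apply: nneseries_cvg.
  have h : (fun n => \sum_(0 <= k < n) nm (T x (b k)) ^+ 2 - \sum_(0 <= k < N) nm (T x (b k)) ^+ 2)%R @ \oo -->
      (W - \sum_(0 <= k < N) nm (T x (b k)) ^+ 2)%R by apply: cvgB => //; exact: cvg_cst.
  apply: cvg_trans h; apply: near_eq_cvg; exists N => // n /= Nn.
  rewrite sum_sub// -(sum_mask (G := fun k => if (k < N)%N then 0%R else (nm (T x (b k)) ^+ 2)%R) Nn).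
  - by apply: eq_bigr => k _; rewrite dE; case: ifP => //; rewrite nm0 expr0n.
  - by move=> k ->.
  - by move=> k; rewrite leqNgt => /negbTE ->.
rewrite -[X in _ --> X](subrr W); apply: cvgB => //; exact: cvg_cst.
Qed.

End HSFields.

(** * Diagonal operators and the Plancherel measure *)

Section DiagOperator.
Variables (R : realType) (H : hilbertType R) (b : nat -> H).
Hypothesis hb : orthonormal_basis b.
Variable d : nat -> R.
Hypothesis d_gt0 : forall k, 0 < d k.
Local Notation D := (diag_operator b d).

Lemma diag_basis (k : nat) : D (b k, ((d k)%:C)%C *: b k).
Proof.
move=> j /=; rewrite dotpZr; case: hb => /(_ j k) -> _.
by case: eqVneq => [->//|_]; rewrite !mulr0.
Qed.

(** Testing against the pairs of [diag_basis] recovers every coordinate of [v], and the maximal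
    domain of [D] asks for nothing more. *)
Lemma diag_selfadjoint u v : D (u, v) <-> (forall x y, D (x, y) -> dotp u y = dotp v x).
Proof.
split=> [Duv x y Dxy|h k /=].
  apply: (cvg_uniq (dotp_expand hb (u := u) (w := y))).
  apply: (@cvg_seq_eq (R[i]^o) _ _ _ _ (dotp_expand hb (u := v) (w := x))) => N.
  apply: eq_bigr => k _; rewrite (Dxy k) -[dotp v _]conj_dotp (Duv k) /= rmorphM /= conj_dotp.
  by rewrite conj_real; ring.
have := h _ _ (diag_basis k); rewrite dotpZr => /(congr1 Num.conj).
by rewrite rmorphM /= !conj_dotp conj_real => ->.
Qed.

Lemma diag_positive : strictly_positive_selfadjoint D.
Proof.
split.
- move=> x y y' h h'; apply: (onb_ext hb) => k; have := h k; have := h' k.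
  by rewrite /= => -> ->.
- exact: diag_selfadjoint.
- apply/seteqP; split=> // x _; have [_ tot] := hb.
  have : closure (lspan (range b)) x by rewrite tot.
  apply: closure_subset; apply: lspan_ind.
  + by exists 0 => k /=; rewrite !dotp0r mulr0.
  + move=> l u v [u' hu] [v' hv]; exists (l *: u' + v') => k /=.
    have := hu k; have := hv k; rewrite /= !dotpDr !dotpZr => -> ->; ring.
  + by move=> _ [k _ <-]; exists (((d k)%:C)%C *: b k); exact: diag_basis.
- move=> x y Dxy x0.
  have real : dotp x y = Num.conj (dotp x y).
    by rewrite conj_dotp; apply: ((diag_selfadjoint x y).1 Dxy x y Dxy).
  have im0 : complex.Im (dotp x y) = 0.
    have := congr1 (@complex.Im R) real; rewrite Im_conj => h; lra.
  have [k hk] : exists k : nat, dotp (b k) x != 0.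
    apply: contrapT => h; case/eqP: x0; apply: (onb_ext hb) => k; rewrite dotp0r.
    by apply: contrapT => /eqP hk; apply: h; exists k.
  (* The expansion of [dotp x y] along the basis has nonnegative terms, and the one at [k] is
     positive. *)
  pose term j := d j * nm (dotp (b j) x) ^+ 2.
  have t0 j : 0 <= term j by rewrite mulr_ge0 ?sqr_ge0// ltW.
  have tk : 0 < term k.
    by rewrite mulr_gt0// exprn_gt0// lt_neqAle eq_sym nm_eq0 hk nm_ge0.
  have tE j : dotp x (b j) * dotp (b j) y = ((term j)%:C)%C.
    by rewrite (Dxy j) /= mulrCA -[dotp x _]conj_dotp mulrC [Num.conj _ * _]mulrC mul_conj mulrC -rmorphM.
  have /cvg_nmP /(_ _ tk) [N hN] := dotp_expand hb (u := x) (w := y).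
  have := hN (maxn N k.+1) (leq_maxl _ _); set M := maxn _ _ => h.
  have kM : (k < M)%N by exact: leq_maxr.
  have sE : \sum_(0 <= j < M) dotp x (b j) * dotp (b j) y = ((\sum_(0 <= j < M) term j)%:C)%C.
    by rewrite rmorph_sum /=; apply: eq_bigr => j _; exact: tE.
  have ts : term k <= \sum_(0 <= j < M) term j.
    by rewrite big_mkord (bigD1 (Ordinal kM))//= lerDl sumr_ge0.
  rewrite ltcE /= im0 eqxx /=; have := le_lt_trans (nmRe _) h.
  rewrite ReB sE /= ltr_norml => /andP[_]; lra.
Qed.

End DiagOperator.

(** Covers the first circle, where [Irr_D] is the identity. *)
Lemma identity_positive (R : realType) (H : hilbertType R) :
  strictly_positive_selfadjoint [set p : H * H | p.2 = p.1].
Proof.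
split=> /=.
- by move=> x y y' /= -> ->.
- move=> u v /=; split=> [-> x y /= -> //|h]; apply: dotp_ext => w.
  by rewrite -conj_dotp -(h w w erefl) conj_dotp.
- by apply/seteqP; split=> // x _; apply: subset_closure; exists x.
- move=> x y /= -> x0; rewrite dotpxx -[X in X < _]/((0%:C)%C) ltcR exprn_gt0//.
  by rewrite lt_neqAle eq_sym nm_eq0 x0 nm_ge0.
Qed.

(** * The Plancherel measure on the spectrum *)

Section IrrMeasure.
Variable R : realType.
Local Notation circ := (@circle_lebesgue R).
Local Notation mu := (@Plancherel_measure R).

Lemma measurable_Irr (d : measure_display) (T : measurableType d) (F : Irr R -> T) :
  measurable_fun setT (fun z : circle R => F (inl z)) ->
  measurable_fun setT (fun z : circle R => F (inr z)) -> measurable_fun setT F.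
Proof.
move=> m1 m2 _ B mB; split.
- by have := m1 measurableT B mB; rewrite !setTI.
- by have := m2 measurableT B mB; rewrite !setTI.
Qed.

Lemma cmeas_Irr (f : Irr R -> R[i]) : cmeasurable (fun z : circle R => f (inl z)) ->
  cmeasurable (fun z : circle R => f (inr z)) -> cmeasurable f.
Proof. by move=> [h1 h2] [h3 h4]; split; exact: measurable_Irr. Qed.

Lemma cmeas_inl (f : Irr R -> R[i]) : cmeasurable f -> cmeasurable (fun z : circle R => f (inl z)).
Proof.
have ml : measurable_fun setT (fun z : circle R => inl z : Irr R) by move=> _ B [mB _]; rewrite setTI.
by move=> [h1 h2]; split; [exact: (measurableT_comp h1 ml)|exact: (measurableT_comp h2 ml)].
Qed.

Lemma cmeas_inr (f : Irr R -> R[i]) : cmeasurable f -> cmeasurable (fun z : circle R => f (inr z)).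
Proof.
move=> [h1 h2]; split.
- exact: (measurableT_comp h1 (@measurable_Irr2 R)).
- exact: (measurableT_comp h2 (@measurable_Irr2 R)).
Qed.

(** The exceptional set is allowed to contain the whole first circle, which has measure 0. *)
Lemma ae_Irr (Q : Irr R -> Prop) : {ae circ, forall z, Q (inr z)} -> {ae mu, forall x, Q x}.
Proof.
move=> [N [mN N0 hN]].
exists [set x : Irr R | if x is inr z then N z else True]; split.
- by split; [exact: measurableT|exact: mN].
- by rewrite -[LHS]/(circ N).
- by move=> [z|z] //= nQ; apply: hN.
Qed.

Lemma ge0_int_Irr (F : Irr R -> \bar R) : measurable_fun setT F -> (forall x, 0 <= F x)%E ->
  (\int[mu]_x F x = \int[circ]_z F (inr z))%E.
Proof. by move=> mF F0; rewrite ge0_integral_distribution. Qed.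

Lemma circle_eq_coord (z w : circle R) : complex.Re (z : R[i]) = complex.Re (w : R[i]) ->
  (0 <= complex.Im (z : R[i])) = (0 <= complex.Im (w : R[i])) -> z = w.
Proof.
move=> hre him; apply: val_inj => /=.
have n1 : nm (z : R[i]) ^+ 2 = nm (w : R[i]) ^+ 2 by rewrite !nm_circle.
apply/eqP; rewrite eq_complex hre eqxx /=; move: n1; rewrite !nm_sqr hre => /addrI/eqP.
rewrite eqf_sqr => /orP[//|/eqP e]; rewrite e in him *.
have [p|p] := leP 0 (complex.Im (w : R[i])).
  rewrite p oppr_ge0 in him; have w0 : complex.Im (w : R[i]) = 0 by apply/eqP; rewrite eq_le him p.
  by rewrite w0 oppr0.
by move: him; rewrite (ltW (_ : 0 < - _)) ?oppr_gt0// leNgt p.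
Qed.

Lemma circle_Im (z : circle R) :
  `|complex.Im (z : R[i])| = Num.sqrt (1 - complex.Re (z : R[i]) ^+ 2).
Proof.
by rewrite -sqrtr_sqr -[1](expr1n R 2) -(nm_circle z) nm_sqr addrAC subrr add0r.
Qed.

(* The upper half circle is projected to [-1, 1], the lower one to [2, 4]. *)
Lemma Plancherel_standard : standard_measure mu.
Proof.
split; first exact: sigma_finiteT.
pose up (z : circle R) := 0 <= complex.Im (z : R[i]).
pose f (x : Irr R) : R := match x with inl _ => 0
  | inr z => if up z then complex.Re (z : R[i]) else complex.Re (z : R[i]) + 3 end.
have re1 (z : circle R) : -1 <= complex.Re (z : R[i]) <= 1.
  by rewrite -ler_norml; apply: le_trans (nmRe _) _; rewrite nm_circle.
have [mRe mIm] := @cmeas_circle R.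
have mup : measurable (up : set (circle R)).
  have -> : (up : set (circle R)) = setT `&` (fun z : circle R => complex.Im (z : R[i])) @^-1` `[0, +oo[%classic.
    by apply/seteqP; split => z; rewrite /= in_itv /= andbT => //; case.
  exact: mIm.
exists [set x : Irr R | if x is inl _ then True else False], f; split.
- by split; [exact: measurableT|exact: measurable0].
- by rewrite -[LHS]/(circ set0) measure0.
- apply: measurable_Irr; first exact: measurable_cst.
  apply: measurable_fun_ifT => //.
  + by apply: (measurable_fun_bool true); rewrite ?setTI; exact: mup.
  + by apply: measurable_funD => //; exact: measurable_cst.
- move=> [z|z] [w|w] //= _ _ h; congr inr; have := re1 z; have := re1 w.
  move: h; have := @circle_eq_coord z w; rewrite -/(up z) -/(up w).
  case: (up z); case: (up w) => hz h /andP[h1 h2] /andP[h3 h4].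
  + exact: hz.
  + by exfalso; clear hz; lra.
  + by exfalso; clear hz; lra.
  + by apply: hz => //; apply: (addIr 3).
move=> B [_ [C mC eC]].
have mem (z : circle R) : B (inr z) <-> C (complex.Re (z : R[i]), complex.Im (z : R[i])).
  by rewrite -[B (inr z)]/((inr @^-1` B) z) -eC setTI.
(* [g1] and [g2] reconstruct a point of the upper and of the open lower half circle from its
   coordinate, so that the image of [B] becomes an explicit Borel set. *)
pose g1 (s : R) : measurableTypeR R * measurableTypeR R := (s, Num.sqrt (1 - s ^+ 2)).
pose g2 (s : R) : measurableTypeR R * measurableTypeR R := (s - 3, - Num.sqrt (1 - (s - 3) ^+ 2)).
have mid : measurable_fun setT (fun s : measurableTypeR R => s : measurableTypeR R) by exact: measurable_id.
have msub : measurable_fun setT (fun s : measurableTypeR R => s - 3 : measurableTypeR R).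
  by apply: measurable_funB => //; exact: measurable_cst.
have msq (g : measurableTypeR R -> measurableTypeR R) : measurable_fun setT g ->
    measurable_fun setT (fun s => Num.sqrt (1 - g s ^+ 2) : measurableTypeR R).
  move=> mg; apply: (measurableT_comp (f := (Num.sqrt : measurableTypeR R -> measurableTypeR R))).
    by apply: continuous_measurable_fun; exact: sqrt_continuous.
  by apply: measurable_funB; [exact: measurable_cst|exact: measurable_funX].
have mg1 : measurable_fun setT g1 by apply: measurable_fun_pair => //; exact: msq.
have mg2 : measurable_fun setT g2.
  by apply: measurable_fun_pair => //; apply: measurableT_comp => //; exact: msq.
have -> : f @` (B `\` [set x : Irr R | if x is inl _ then True else False]) =
    (`[-1, 1]%classic `&` g1 @^-1` C) `|` (`]2, 4[%classic `&` g2 @^-1` C).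
  apply/seteqP; split.
    move=> _ [[z|z] /= [Bz nz] <-]; first by case: nz.
    move: (mem z).1 => /(_ Bz) Cz; have r1 := re1 z; have im := circle_Im z.
    rewrite /up; have [p|p] := leP 0 (complex.Im (z : R[i])).
      left; split; first by rewrite /= in_itv.
      by rewrite /g1 /= -im ger0_norm.
    right; rewrite ltr0_norm// in im.
    have imp : 0 < Num.sqrt (1 - complex.Re (z : R[i]) ^+ 2) by rewrite -im oppr_gt0.
    have re2 : complex.Re (z : R[i]) ^+ 2 < 1 by rewrite sqrtr_gt0 subr_gt0 in imp.
    split; last by rewrite /g2 /= addrK -im opprK.
    by rewrite /= in_itv /=; apply/andP; split; nra.
  have onc (s r : R) : s ^+ 2 + r ^+ 2 = 1 -> exists z : circle R,
      complex.Re (z : R[i]) = s /\ complex.Im (z : R[i]) = r.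
    move=> h; have hz : `|Complex s r| == 1 by rewrite normc_def /= h sqrtr1.
    by exists (Circle hz).
  move=> s [[/=]|[/=]]; rewrite in_itv /= => /andP[s1 s2] Cs.
    have h : 0 <= 1 - s ^+ 2 by nra.
    have [|z [hr hi]] := onc s (Num.sqrt (1 - s ^+ 2)).
      by rewrite sqr_sqrtr// addrC subrK.
    exists (inr z); last by rewrite /f /up hi hr sqrtr_ge0.
    by split=> //; apply: (mem z).2; rewrite hr hi.
  have h : 0 < 1 - (s - 3) ^+ 2 by nra.
  have [|z [hr hi]] := onc (s - 3) (- Num.sqrt (1 - (s - 3) ^+ 2)).
    by rewrite sqrrN sqr_sqrtr ?(ltW h)// addrC subrK.
  exists (inr z); last by rewrite /f /up hi hr oppr_ge0 leNgt sqrtr_gt0 h subrK.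
  by split=> //; apply: (mem z).2; rewrite hr hi.
apply: measurableU; apply: measurableI => //.
- by have := mg1 measurableT C mC; rewrite setTI.
- by have := mg2 measurableT C mC; rewrite setTI.
Qed.

End IrrMeasure.

(** * The Haar state and the Plancherel transform *)

Section HaarState.
Variables (R : realType) (q : R).
Hypothesis q_gtN1 : -1 < q.
Hypothesis q_lt1 : q < 1.
Hypothesis q0 : q != 0.
Local Notation C := R[i].
Local Notation qC := ((q%:C)%C : C).
Local Notation circ := (@circle_lebesgue R).
Variables (G : SUq2 q) (L : dual_data G).
Local Notation a := (al : G).
Local Notation c := (ga : G).
Local Notation x := (c ** adj c).
Local Notation h := (haar L).
Variables (H1 H2 : hilbertType R) (one : H1) (phi : nat -> H2).
Hypothesis one_norm : `|one| = 1.
Hypothesis phi_basis : orthonormal_basis phi.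
Variables (psi1 : circle R -> G -> H1 -> H1) (psi2 : circle R -> G -> H2 -> H2).
Hypothesis psi1P : forall rho, is_psi1 rho (psi1 rho).
Hypothesis psi2P : forall la, is_psi2 phi la (psi2 la).

Lemma rep0 (A : cstarType R) (H : hilbertType R) (p : A -> H -> H) v :
  representation p -> p 0 v = 0.
Proof.
by case=> _ lp _ _ _; have := lp (-1) 0 0 v; rewrite scaler0 addr0 scaleN1r addNr.
Qed.

Lemma repZ (A : cstarType R) (H : hilbertType R) (p : A -> H -> H) k y v :
  representation p -> p (k *: y) v = k *: p y v.
Proof. by move=> rp; have [_ lp _ _ _] := rp; have := lp k y 0 v; rewrite addr0 (rep0 _ rp) addr0. Qed.

Lemma repD (A : cstarType R) (H : hilbertType R) (p : A -> H -> H) y z v :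
  representation p -> p (y + z) v = p y v + p z v.
Proof. by move=> rp; have [_ lp _ _ _] := rp; have := lp 1 y z v; rewrite !scale1r. Qed.

Lemma rep_sum (A : cstarType R) (H : hilbertType R) (p : A -> H -> H) v (I : Type)
  (r : seq I) (P : pred I) (F : I -> A) : representation p ->
  p (\sum_(i <- r | P i) F i) v = \sum_(i <- r | P i) p (F i) v.
Proof. by move=> rp; apply: (big_morph (fun y => p y v)) => [y z|]; [exact: repD|exact: rep0]. Qed.

Lemma lin_cvg (V : normedModType R[i]) (k : C) (u v : nat -> V) lu lv :
  u @ \oo --> lu -> v @ \oo --> lv -> (fun n => k *: u n + v n) @ \oo --> k *: lu + lv.
Proof. by move=> hu hv; apply: cvgD => //; exact: cvgZr. Qed.

Lemma haar_lin : linear (h : G -> R[i]^o). Proof. by case: (haarP L). Qed.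
Lemma haar1 : h cone = 1. Proof. by case: (haarP L). Qed.
Lemma haarD y z : h (y + z) = h y + h z. Proof. exact: (linD haar_lin). Qed.
Lemma haarZ k y : h (k *: y) = k * h y. Proof. exact: (linZ haar_lin). Qed.
Lemma haar_sum (I : Type) (r : seq I) (P : pred I) (F : I -> G) :
  h (\sum_(i <- r | P i) F i) = \sum_(i <- r | P i) h (F i).
Proof. exact: (lin_sum haar_lin). Qed.

Lemma Lam_lin : linear (Lam L). Proof. by case: (gnsP L). Qed.
Lemma Lam_dotp y z : dotp (Lam L y) (Lam L z) = h (adj y ** z).
Proof. by case: (gnsP L). Qed.
Lemma Lam_dense : closure (range (Lam L)) = setT. Proof. by case: (gnsP L). Qed.
Lemma lreg_rep : representation (lreg L). Proof. by case: (gnsP L). Qed.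
Lemma lreg_Lam y z : lreg L y (Lam L z) = Lam L (y ** z). Proof. by case: (gnsP L). Qed.

(** Boundedness is read off the vector functional of [Lam cone] in the GNS representation. *)
Lemma haar_bf : bounded_functional h.
Proof.
have e : h = fun y => dotp (Lam L cone) (lreg L y (Lam L cone)).
  by apply/funext => y; rewrite lreg_Lam Lam_dotp adj1 cmul1l cmul1r.
by rewrite e; exact: rep_coef_bl lreg_rep.
Qed.

Lemma haar_adj y : h (adj y) = Num.conj (h y).
Proof.
have := conj_dotp (Lam L cone) (Lam L y).
by rewrite !Lam_dotp adj1 cmul1l cmul1r => ->.
Qed.

Lemma psi1_rep rho : representation (psi1 rho). Proof. by case: (psi1P rho). Qed.
Lemma psi2_rep la : representation (psi2 la). Proof. by case: (psi2P la). Qed.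

Lemma rep_adjE (A : cstarType R) (H : hilbertType R) (p : A -> H -> H) y v w :
  representation p -> dotp v (p (adj y) w) = dotp (p y v) w.
Proof. by case. Qed.

Lemma rep_adjE' (A : cstarType R) (H : hilbertType R) (p : A -> H -> H) y v w :
  representation p -> dotp v (p y w) = dotp (p (adj y) v) w.
Proof. by move=> rp; rewrite -[in LHS](adjK y); exact: rep_adjE. Qed.

Lemma circle_conjV (rho : circle R) : Num.conj (rho : C) = (rho : C)^-1.
Proof.
have r0 : (rho : C) != 0 by rewrite -nm_eq0 nm_circle oner_eq0.
by apply: (mulfI r0); rewrite circle_conj divff.
Qed.

Lemma psi1_fund rho i j v : psi1 rho (fund i j : G) v =
  if i == j then ((rho : C) ^ (fund_wt i)) *: v else 0.
Proof.
have rp := psi1_rep rho; have [_ /(_ _)] := psi1P rho => hp.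
rewrite /fund /fund_wt; case: (I2P i) => ->; case: (I2P j) => -> /=.
- by have [-> _] := hp v.
- rewrite (repZ _ _ _ rp) (_ : psi1 rho (adj c) v = 0) ?scaler0//.
  by apply: dotp_ext => w; rewrite (rep_adjE _ _ _ rp) (hp w).2 dotp0l dotp0r.
- by have [_ ->] := hp v.
- apply: dotp_ext => w; rewrite (rep_adjE _ _ _ rp) (hp w).1 dotpZl dotpZr.
  by rewrite circle_conjV.
Qed.

Lemma psi1_wcoef rho n (i j : widx n) v : psi1 rho (wcoef i j : G) v =
  if i == j then ((rho : C) ^ (wwt i)) *: v else 0.
Proof.
have rp := psi1_rep rho; have [_ _ p1 pM _] := rp.
have r0 : (rho : C) != 0 by rewrite -nm_eq0 nm_circle oner_eq0.
elim: n i j => [|n IH] i j; first by case: i j => [] [] /=; rewrite p1 expr0z scale1r.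
rewrite /= pM IH psi1_fund; case: i j => [i1 i2] [j1 j2] /=.
rewrite -[(i1, i2) == _]/((i1 == j1) && (i2 == j2)).
case: (i1 == j1); last by rewrite /=; case: (i2 == j2).
rewrite /=; case: (i2 == j2); last by rewrite scaler0.
by rewrite scalerA -expfzDr.
Qed.

Lemma circle_not_root (m : int) : m != 0 -> exists rho : circle R, (rho : C) ^ m != 1.
Proof.
have key n : (0 < n)%N -> exists rho : circle R, (rho : C) ^+ n != 1.
  (* The [n]-th power of this point is -1. *)
  move=> n0; exists (circle_exp ((2 * n%:R)^-1)); rewrite circle_expX.
  have -> : 2 * pi * n%:R * (2 * n%:R)^-1 = pi :> R.
    by field; rewrite pnatr_eq0 -lt0n n0.
  rewrite cospi eq_complex /= negb_and; apply/orP; left.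
  by rewrite eq_sym -addr_eq0 -[1+1]/(2%:R) pnatr_eq0.
case: m => [[|n]|n] // _; first exact: (key n.+1).
have [rho hr] := key n.+1 isT; exists rho.
by rewrite NegzE -exprnN invr_eq1.
Qed.

Lemma one_neq0 : one != 0.
Proof.
by apply/eqP => h1; have := one_norm; rewrite h1 normr0 => /eqP; rewrite eq_sym oner_eq0.
Qed.

Lemma slice_eval : exists2 E : tens_alg G -> G, bounded_linear E &
  [/\ forall y z, E (leg1 y ** leg2 z) = h z *: y,
      forall y, E (comult y) = h y *: cone,
      forall y Z, E (leg1 y ** Z) = y ** E Z &
      forall y Z, E (Z ** leg1 y) = E Z ** y].
Proof.
have [_ _ _ [E [bE E1 E2]] _] := haarP L; exists E => //.
have [[li l1i l1M l1A] [lj l2i l2M l2A] comm tot _] := tens_algP G.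
split => // y.
- apply: (bl_eq_total (bl_comp bE (cmul_bl_r _)) (bl_comp (cmul_bl_r y) bE) tot).
  by move=> _ [u [v ->]]; rewrite cmulA -l1M !E1 cmulZr.
- apply: (bl_eq_total (bl_comp bE (cmul_bl_l _)) (bl_comp (cmul_bl_l y) bE) tot).
  by move=> _ [u [v ->]]; rewrite -cmulA -comm cmulA -l1M !E1 cmulZl.
Qed.

(** Applying the one-dimensional representation at [rho] to the invariance
    [(id (x) h) (comult u) = h(u) 1] gives [rho^(wwt i) h(u) = h(u)], and some [rho] has
    [rho^(wwt i) != 1]. The other slice will give the column weight. *)
Lemma haar_weight_l n (i j : widx n) : wwt i != 0 -> h (wcoef i j : G) = 0.
Proof.
move=> /circle_not_root [rho hr].
have [_ _ _ [E [bE E1 E2]] _] := haarP L.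
have rp := psi1_rep rho; have [_ _ p1 _ _] := rp.
have := congr1 (fun y => psi1 rho y one) (E2 (wcoef i j)).
rewrite /= wcoef_comult (lin_sum (bl_lin bE)) (rep_sum _ _ _ _ rp).
under eq_bigr do rewrite E1 (repZ _ _ _ rp) psi1_wcoef.
rewrite (bigD1 i)//= eqxx big1 ?addr0 => [|k ki]; last first.
  by rewrite eq_sym (negbTE ki) scaler0.
rewrite (repZ _ _ _ rp) p1 scalerA => /eqP; rewrite -subr_eq0 -scalerBl scaler_eq0 (negbTE one_neq0) orbF.
rewrite -{2}[h _]mulr1 -mulrBr mulf_eq0 subr_eq0 (negbTE hr) orbF => /eqP //.
Qed.

Lemma haar_weight_r n (i j : widx n) : wwt j != 0 -> h (wcoef i j : G) = 0.
Proof.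
move=> /circle_not_root [rho hr].
have [_ _ _ _ [E [bE E1 E2]]] := haarP L.
have rp := psi1_rep rho; have [_ _ p1 _ _] := rp.
have := congr1 (fun y => psi1 rho y one) (E2 (wcoef i j)).
rewrite /= wcoef_comult (lin_sum (bl_lin bE)) (rep_sum _ _ _ _ rp).
under eq_bigr do rewrite E1 (repZ _ _ _ rp) psi1_wcoef.
rewrite (bigD1 j)//= eqxx big1 ?addr0 => [|k ki]; last first.
  by rewrite (negbTE ki) scaler0.
rewrite (repZ _ _ _ rp) p1 scalerA => /eqP; rewrite -subr_eq0 -scalerBl scaler_eq0 (negbTE one_neq0) orbF.
rewrite -{2}[h _]mulr1 -mulrBr mulf_eq0 subr_eq0 (negbTE hr) orbF => /eqP //.
Qed.

Local Notation t := (q ^+ 2).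

Lemma q2_gt0 : 0 < t. Proof. by rewrite exprn_even_gt0. Qed.
Lemma q2_lt1 : t < 1. Proof.
rewrite -real_normK ?num_real// exprn_ilt1 ?normr_ge0//.
by rewrite ltr_norml q_gtN1.
Qed.
Lemma q2n k : q ^+ (2 * k) = t ^+ k. Proof. by rewrite exprM. Qed.
Lemma q2k_le1 k : t ^+ k <= 1.
Proof. by rewrite exprn_ile1 ?ltW ?q2_lt1 ?q2_gt0. Qed.

(** * The infinite-dimensional representations on powers and words *)

Lemma psi2_a la k : psi2 la a (phi k) =
  ((Num.sqrt (1 - t ^+ k))%:C)%C *: (if k is j.+1 then phi j else 0).
Proof. by have [_ /(_ k)[-> _]] := psi2P la; rewrite q2n. Qed.
Lemma psi2_c la k : psi2 la c (phi k) = ((la : C) * ((q ^+ k)%:C)%C) *: phi k.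
Proof. by have [_ /(_ k)[_ ->]] := psi2P la. Qed.

Lemma phi_orth i j : dotp (phi i) (phi j) = (i == j)%:R.
Proof. by case: phi_basis. Qed.

Lemma psi2_c' la k : psi2 la (adj c) (phi k) =
  (Num.conj (la : C) * ((q ^+ k)%:C)%C) *: phi k.
Proof.
apply: (onb_ext phi_basis) => j; rewrite (rep_adjE _ _ _ (psi2_rep la)) psi2_c dotpZl dotpZr.
rewrite !phi_orth rmorphM /= conj_real; case: eqVneq => [->//|_]; by rewrite !mulr0.
Qed.

Lemma psi2_a' la k : psi2 la (adj a) (phi k) =
  ((Num.sqrt (1 - t ^+ k.+1))%:C)%C *: phi k.+1.
Proof.
apply: (onb_ext phi_basis) => j; rewrite (rep_adjE _ _ _ (psi2_rep la)) psi2_a dotpZl dotpZr.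
rewrite conj_real; case: j => [|j]; first by rewrite dotp0l phi_orth !mulr0.
rewrite !phi_orth eqSS; case: eqVneq => [->//|_]; by rewrite !mulr0.
Qed.

Lemma psi2_x la k : psi2 la x (phi k) = ((t ^+ k)%:C)%C *: phi k.
Proof.
have [lb lp p1 pM _] := psi2_rep la.
rewrite pM psi2_c' (linZ (bl_lin (lb c))) psi2_c scalerA; congr (_ *: _).
rewrite mulrACA [Num.conj _ * _]mulrC circle_conj mul1r -rmorphM.
by rewrite -exprD addnn -mul2n q2n.
Qed.

Lemma rep_blZ (A : cstarType R) (H : hilbertType R) (p : A -> H -> H) y k v :
  representation p -> p y (k *: v) = k *: p y v.
Proof. by case=> lb _ _ _ _; rewrite (linZ (bl_lin (lb y))). Qed.

Lemma psi2_xn la n k : psi2 la (cpow x n) (phi k) = ((t ^+ (k * n))%:C)%C *: phi k.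
Proof.
have rp := psi2_rep la; have [lb lp p1 pM _] := rp.
elim: n => [|n IH]; first by rewrite muln0 expr0 p1 scale1r.
by rewrite cpowS pM IH (rep_blZ _ _ _ rp) psi2_x scalerA -rmorphM -exprD mulnS addnC.
Qed.

Lemma psi2_aan la n k : psi2 la (cpow a n ** cpow (adj a) n) (phi k) =
  ((\prod_(i < n) (1 - t ^+ (k + i.+1)))%:C)%C *: phi k.
Proof.
have rp := psi2_rep la; have [lb lp p1 pM _] := rp.
elim: n => [|n IH]; first by rewrite /cpow /= cmul1l p1 big_ord0 scale1r.
rewrite aa'_pow// -scaleN1r scalerA addrC lp pM IH (rep_blZ _ _ _ rp) psi2_x.
rewrite !scalerA -scalerDl big_ord_recr /=; congr (_ *: _).
by rewrite q2n exprD !(rmorphM, rmorphB, rmorph1) /=; ring.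
Qed.

Lemma cxn n : cpow c n ** cpow (adj c) n = cpow x n.
Proof.
elim: n => [|n IH]; first by rewrite /cpow /= cmul1l.
rewrite cpowSr cpowS -[x in RHS]/x cpowS -IH.
have e1 : c ** adj c ** cpow (adj c) n = cpow (adj c) n ** (c ** adj c).
  have := qcomm_pow (k := 1) n (_ : c ** adj c ** adj c = 1 *: (adj c ** (c ** adj c))).
  by rewrite expr1n !scale1r; apply; rewrite -[RHS]/(adj c ** (c ** adj c)) c'_x// -rel_cc.
have e2 : cpow c n ** (c ** adj c) = c ** adj c ** cpow c n.
  have := qcomm_pow (k := 1) n (_ : c ** adj c ** c = 1 *: (c ** (c ** adj c))).
  by rewrite expr1n !scale1r => ->//; rewrite c_x.
by rewrite !cmulA -[cpow c n ** c ** adj c]cmulA e2.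
Qed.

(* The vacuum expectation of [(id (x) h) (comult (gamma^n gamma^*n))]. *)
Lemma haar_xn n : h (cpow x n) = h (cpow a n ** cpow (adj a) n).
Proof.
have [E bE [E1 E2 El Er]] := slice_eval.
have [[li l1i l1M l1A] [lj l2i l2M l2A] comm tot _] := tens_algP G.
have [lD Di DM DA] := comult_hom G.
have la1 : `|1 : C| == 1 by rewrite normr1.
pose p := psi2 (Circle la1); have rp : representation p := psi2_rep _.
have [lb lp p1 pM pA] := rp.
have pc0 : p (adj c) (phi 0%N) = phi 0%N.
  by rewrite /p psi2_c' /= conjC1 mul1r expr0 scale1r.
have pa0 : p a (phi 0%N) = 0 by rewrite /p psi2_a scaler0.
have Dpow (y : G) m : comult (cpow y m) = cpow (comult y) m.
  by elim: m => [|m IH]; [exact: Di|rewrite !cpowS DM IH].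
have l2pow (y : G) m : leg2 (cpow y m) = cpow (leg2 y) m.
  by elim: m => [|m IH]; [exact: l2i|rewrite !cpowS l2M IH].
(* The vector [phi 0] is fixed by [adj gamma] and killed by [alpha]. So in each factor
   [comult (adj gamma)] only the term with [adj gamma] in the first leg survives, and it leaves
   [adj alpha] in the second leg. *)
have right m (b : G) Z v : dotp v (p (E (Z ** cpow (comult (adj c)) m ** leg2 b)) (phi 0%N)) =
    dotp v (p (E (Z ** leg2 (cpow (adj a) m ** b))) (phi 0%N)).
  elim: m b => [|m IH] b; first by rewrite /cpow /= cmul1r cmul1l.
  rewrite cpowSr cmulA; set W := Z ** _; rewrite DA comult_ga adjD !adjM -!l1A -!l2A adjK -!comm cmulDr cmulDl.
  rewrite (linD (bl_lin bE)) (repD _ _ _ rp) dotpDr.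
  have e1 W' y z : E (W' ** (leg1 y ** leg2 z) ** leg2 b) = E (W' ** leg2 (z ** b)) ** y.
    by rewrite -Er l2M -!cmulA; congr (E (_ ** _)); rewrite -comm !cmulA comm.
  rewrite !e1 !pM pc0 pa0.
  have -> : p (E (W ** leg2 (adj c ** b))) 0 = 0 by exact: (lin0 (bl_lin (lb _))).
  by rewrite dotp0r addr0 /W IH cmulA -cpowSr.
(* The mirror image: here the adjoints of the first legs act on [phi 0] through the left entry of
   the inner product. *)
have left m (b : G) Z v : dotp (phi 0%N) (p (E (leg2 b ** cpow (comult c) m ** Z)) v) =
    dotp (phi 0%N) (p (E (leg2 (b ** cpow a m) ** Z)) v).
  elim: m b => [|m IH] b; first by rewrite /cpow /= !cmul1r.
  rewrite cpowS -!cmulA; set W := cpow _ m ** Z.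
  rewrite comult_ga cmulDl cmulDr (linD (bl_lin bE)) (repD _ _ _ rp) dotpDr.
  have e1 y z : E (leg2 b ** (leg1 y ** leg2 z ** W)) = y ** E (leg2 (b ** z) ** W).
    by rewrite -El l2M !cmulA comm.
  rewrite !e1 !pM (rep_adjE' c _ _ rp) pc0 (rep_adjE' (adj a) _ _ rp) adjK pa0 dotp0l addr0.
  by rewrite /W cmulA IH cpowS cmulA.
have := E2 (cpow x n); rewrite -cxn DM !Dpow => e.
have := congr1 (fun y => dotp (phi 0%N) (p y (phi 0%N))) e.
rewrite /= (repZ _ _ _ rp) p1 dotpZr phi_orth mulr1 => <-.
have := right n cone (cpow (comult c) n) (phi 0%N); rewrite l2i !cmul1r => ->.
have := left n cone (leg2 (cpow (adj a) n)) (phi 0%N); rewrite l2i !cmul1l => ->.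
have -> : leg2 (cpow a n) ** leg2 (cpow (adj a) n) = leg1 cone ** leg2 (cpow a n ** cpow (adj a) n).
  by rewrite l1i cmul1l l2M.
by rewrite E1 (repZ _ _ _ rp) p1 dotpZr phi_orth mulr1.
Qed.

(** Extending the basis by 0 to negative indices makes [alpha phi_0 = 0] an instance of a uniform
    shift formula. *)
Definition phiz (m : int) : H2 := if m is Posz k then phi k else 0.

Lemma psi2_fund (i j : 'I_2) : exists (s u : int) (r : int -> C),
  [/\ fund_wt i = s - u, fund_wt j = s + u &
      forall la m, psi2 la (fund i j : G) (phiz m) = ((la : C) ^ u * r m) *: phiz (m - s)].
Proof.
have v0 la y : psi2 la y 0 = 0.
  by have [lb _ _ _ _] := psi2_rep la; exact: (lin0 (bl_lin (lb y))).
rewrite /fund /fund_wt; case: (I2P i) => ->; case: (I2P j) => -> /=.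
- exists 1, 0, (fun m => if m is Posz k then ((Num.sqrt (1 - t ^+ k))%:C)%C else 0).
  split => // la [k|k]; last by rewrite v0 mulr0 scale0r.
  rewrite psi2_a expr0z mul1r; case: k => [//|k].
  by have -> : k.+1%:Z - 1 = k by lia.
- exists 0, (-1), (fun m => if m is Posz k then - qC * ((q ^+ k)%:C)%C else 0).
  split => // la [k|k]; last by rewrite v0 mulr0 scale0r.
  rewrite subr0 (repZ _ _ _ (psi2_rep la)) psi2_c' scalerA circle_conjV; congr (_ *: _).
  by rewrite -/((la : C) ^- 1) expr1 mulrCA.
- exists 0, 1, (fun m => if m is Posz k then ((q ^+ k)%:C)%C else 0).
  split => // la [k|k]; last by rewrite v0 mulr0 scale0r.
  by rewrite psi2_c subr0 expr1z.
- exists (-1), 0, (fun m => if m is Posz k then ((Num.sqrt (1 - t ^+ k.+1))%:C)%C else 0).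
  split => // la [k|k]; last by rewrite v0 mulr0 scale0r.
  by rewrite psi2_a' expr0z mul1r opprK (_ : k%:Z + 1 = k.+1)// -addn1.
Qed.

(** Products of weighted shifts are weighted shifts. The dependence on [la] is confined to the
    single power [la^u], and both [u] and the shift [s] are determined by the weights of the
    word. *)
Lemma psi2_wcoef n (i j : widx n) : exists (s u : int) (r : int -> C),
  [/\ wwt i = s - u, wwt j = s + u &
      forall la m, psi2 la (wcoef i j : G) (phiz m) = ((la : C) ^ u * r m) *: phiz (m - s)].
Proof.
elim: n i j => [|n IH] i j.
  exists 0, 0, (fun=> 1); split => // la m.
  by have [_ _ p1 _ _] := psi2_rep la; rewrite p1 expr0z mul1r scale1r subr0.
have [s [u [r [h1 h2 hr]]]] := IH i.2 j.2.
have [s' [u' [r' [h1' h2' hr']]]] := psi2_fund i.1 j.1.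
exists (s' + s), (u' + u), (fun m => r' (m - s) * r m); split => [||la m] /=.
- by rewrite h1 h1'; ring.
- by rewrite h2 h2'; ring.
have la0 : (la : C) != 0 by rewrite -nm_eq0 nm_circle oner_eq0.
have [_ _ _ pM _] := psi2_rep la; rewrite pM hr (rep_blZ _ _ _ (psi2_rep la)) hr' scalerA.
rewrite expfzDr//; have -> : m - s - s' = m - (s' + s) by ring.
by congr (_ *: _); ring.
Qed.

Lemma circle_zV (la : circle R) n : (la : C) ^ (Negz n) = Num.conj ((la : C) ^+ n.+1).
Proof. by rewrite NegzE -exprnN -exprVn -circle_conjV rmorphXn. Qed.

Lemma bmeas_circleZ (u : int) : bmeas (fun la : circle R => (la : C) ^ u).
Proof.
case: u => n; first exact: bmeasX (@bmeas_circle R).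
by under eq_fun do rewrite circle_zV; apply: bmeasJ; exact: bmeasX (@bmeas_circle R).
Qed.

Lemma cint_circleZ (u : int) : u != 0 -> cint circ (fun la : circle R => (la : C) ^ u) = 0.
Proof.
case: u => [[|n]|n] // _; first exact: cint_circleX.
have -> : (fun la : circle R => (la : C) ^ Negz n) = (fun la => Num.conj ((la : C) ^+ n.+1)).
  by apply/funext => la; exact: circle_zV.
rewrite cintJ ?cint_circleX ?conjC0//; exact: bmeasX (@bmeas_circle R).
Qed.

Lemma rep_nm (A : cstarType R) (H : hilbertType R) (p : A -> H -> H) y v :
  representation p -> nm (p y v) <= 2 * nm y * nm v.
Proof.
move=> rp; have h := rep_bound rp y v.
rewrite -(ler_pXn2r (_ : 0 < 2)%N) ?nnegrE ?mulr_ge0 ?nm_ge0//.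
apply: le_trans h _; rewrite !exprMn ler_wpM2r ?sqr_ge0// ler_wpM2r ?sqr_ge0//; lra.
Qed.

Lemma rep_cvg (A : cstarType R) (H : hilbertType R) (p : A -> H -> H) (u : nat -> A) y v :
  representation p -> u @ \oo --> y -> (fun n => p (u n) v) @ \oo --> p y v.
Proof.
move=> rp uy; apply/cvg_nm; apply: (@squeeze_cvgr _ _ _ _ (cst 0)
  (fun n => 2 * nm (u n - y) * nm v)) => /=.
- apply: nearW => n; rewrite nm_ge0 /=.
  have -> : p (u n) v - p y v = p (u n - y) v.
    by rewrite (repD _ _ _ rp) -[- y]scaleN1r (repZ _ _ _ rp) scaleN1r.
  exact: rep_nm.
- exact: cvg_cst.
- rewrite -[X in _ --> X](mul0r (nm v)) -[X in X * _](mulr0 2); apply: cvgMl; apply: cvgMr; exact/cvg_nm.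
Qed.

(* Measurability passes from words in the generators to their closed span. *)
Lemma field_cmeas (H : hilbertType R) (p : circle R -> G -> H -> H) v w :
  (forall la, representation (p la)) ->
  (forall n (i j : widx n), cmeasurable (fun la => dotp v (p la (wcoef i j) w))) ->
  forall y, cmeasurable (fun la => dotp v (p la y w)).
Proof.
move=> rp hw y; move: y.
apply: (total_ind (S := @words R q G)); last exact: words_total.
- by under eq_fun do rewrite (rep0 _ (rp _)) dotp0r; exact: cmeas_cst.
- move=> k y z hy hz; under eq_fun do rewrite (repD _ _ _ (rp _)) (repZ _ _ _ (rp _)) dotpDr dotpZr.
  by apply: cmeasD => //; exact: cmeasZ.
- move=> y /closure_seq [u hu uy]; apply: (cmeas_lim hu) => la.
  by apply: dotp_cvg; [exact: cvg_cst|exact: rep_cvg].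
- by move=> _ [n [i [j ->]]]; exact: hw.
Qed.

Lemma psi2_cmeas j k y : cmeasurable (fun la => dotp (phi j) (psi2 la y (phi k))).
Proof.
apply: field_cmeas; first exact: psi2_rep.
move=> n i l; have [s [u [r [_ _ hr]]]] := psi2_wcoef i l.
rewrite (_ : (fun la => _) = fun la : circle R =>
   (r k * dotp (phi j) (phiz (k%:Z - s))) * (la : C) ^ u).
  by apply: cmeasZ; case: (bmeas_circleZ u).
by apply/funext => la; have := hr la k%:Z; rewrite /= => ->; rewrite dotpZr; ring.
Qed.

Lemma psi1_cmeas v w y : cmeasurable (fun la => dotp v (psi1 la y w)).
Proof.
apply: field_cmeas; first exact: psi1_rep.
move=> n i l; rewrite (_ : (fun la => _) = fun la : circle R =>
   (if i == l then dotp v w else 0) * (la : C) ^ (wwt i)).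
  by apply: cmeasZ; case: (bmeas_circleZ (wwt i)).
apply/funext => la; rewrite psi1_wcoef; case: (i == l); first by rewrite dotpZr mulrC.
by rewrite dotp0r mul0r.
Qed.

Lemma psi2_nm la y k : nm (psi2 la y (phi k)) <= 2 * nm y.
Proof. by apply: le_trans (rep_nm _ _ (psi2_rep la)) _; rewrite (nm_b phi_basis) mulr1. Qed.

Lemma psi2_coef_nm la y j k : nm (dotp (phi j) (psi2 la y (phi k))) <= 2 * nm y.
Proof.
apply: le_trans (cauchy_schwarz _ _) _; rewrite (nm_b phi_basis) mul1r; exact: psi2_nm.
Qed.

Lemma psi2_bmeas j k y : bmeas (fun la => dotp (phi j) (psi2 la y (phi k))).
Proof. by split; [exact: psi2_cmeas|exists (2 * nm y) => la; exact: psi2_coef_nm]. Qed.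

(** * The trace formula for the Haar state *)

Definition diag_mean k y := cint circ (fun la => dotp (phi k) (psi2 la y (phi k))).

Lemma diag_mean_lin k l y z : diag_mean k (l *: y + z) = l * diag_mean k y + diag_mean k z.
Proof.
rewrite /diag_mean -cintZ; last exact: psi2_bmeas.
rewrite -cintD; [|exact/bmeasZ/psi2_bmeas|exact: psi2_bmeas].
congr cint; apply/funext => la.
by rewrite (repD _ _ _ (psi2_rep la)) (repZ _ _ _ (psi2_rep la)) dotpDr dotpZr.
Qed.

Lemma diag_mean_nm k y : nm (diag_mean k y) <= 4 * nm y.
Proof.
have -> : 4 = 2 * 2 :> R by rewrite -natrM.
by rewrite -mulrA; apply: cint_bound => [|la]; [exact: psi2_bmeas|exact: psi2_coef_nm].
Qed.

(** The square of the [k]-th eigenvalue of [D^-1], see [dinv_wt_sq]; the factor [1 - t] makes the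
    total mass 1. *)
Definition wt_k k : R := (1 - t) * t ^+ k.

Lemma wt_ge0 k : 0 <= wt_k k.
Proof.
apply: mulr_ge0; first by rewrite subr_ge0; exact: ltW q2_lt1.
by apply: exprn_ge0; exact: ltW q2_gt0.
Qed.

Lemma wt_sum N : \sum_(0 <= k < N) wt_k k = 1 - t ^+ N.
Proof.
elim: N => [|N IH]; first by rewrite big_geq// expr0 subrr.
by rewrite big_nat_recr//= IH /wt_k [t ^+ N.+1]exprS; ring.
Qed.

Definition haar_sumN N y : C := \sum_(0 <= k < N) ((wt_k k)%:C)%C * diag_mean k y.

Lemma haar_sumN_lin N k y z : haar_sumN N (k *: y + z) = k * haar_sumN N y + haar_sumN N z.
Proof.
rewrite /haar_sumN mulr_sumr -big_split; apply: eq_bigr => i _ /=.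
by rewrite diag_mean_lin; ring.
Qed.

Lemma haar_sumN_nm N y : nm (haar_sumN N y) <= 4 * nm y.
Proof.
apply: le_trans (@nm_sum R R[i] _ _ _ _) _.
apply: (@le_trans _ _ (\sum_(0 <= k < N) wt_k k * (4 * nm y))).
  apply: ler_sum => k _; rewrite nmM nmR ger0_norm ?wt_ge0// ler_wpM2l ?wt_ge0//.
  exact: diag_mean_nm.
rewrite -mulr_suml wt_sum ler_piMl ?mulr_ge0 ?nm_ge0// gerBl exprn_ge0// ltW//; exact: q2_gt0.
Qed.

Definition haar_cvg y := (fun N => haar_sumN N y : R[i]^o) @ \oo --> (h y : R[i]^o).

Lemma haar_cvg_lin k y z : haar_cvg y -> haar_cvg z -> haar_cvg (k *: y + z).
Proof.
move=> hy hz; have h1 := @lin_cvg (R[i]^o) k _ _ _ _ hy hz.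
have e : (h (k *: y + z) : R[i]^o) = k *: (h y : R[i]^o) + (h z : R[i]^o).
  by rewrite haarD haarZ.
by rewrite /haar_cvg e; apply: cvg_seq_eq h1 => N; rewrite haar_sumN_lin.
Qed.

Lemma haar_sum_xn n N : haar_sumN N (cpow x n) =
  ((\sum_(0 <= k < N) wt_k k * t ^+ (k * n))%:C)%C.
Proof.
have e k : diag_mean k (cpow x n) = ((t ^+ (k * n))%:C)%C.
  rewrite /diag_mean -[RHS](cint_cst circ); congr cint; apply/funext => la.
  by rewrite psi2_xn dotpZr phi_orth eqxx mulr1.
by rewrite /haar_sumN rmorph_sum /=; apply: eq_bigr => k _; rewrite e [in RHS]rmorphM.
Qed.

Lemma haar_sum_aan n N : haar_sumN N (cpow a n ** cpow (adj a) n) =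
  ((\sum_(0 <= k < N) wt_k k * \prod_(i < n) (1 - t ^+ (k + i.+1)))%:C)%C.
Proof.
have e k : diag_mean k (cpow a n ** cpow (adj a) n) = ((\prod_(i < n) (1 - t ^+ (k + i.+1)))%:C)%C.
  rewrite /diag_mean -[RHS](cint_cst circ); congr cint; apply/funext => la.
  by rewrite psi2_aan dotpZr phi_orth eqxx mulr1.
by rewrite /haar_sumN rmorph_sum /=; apply: eq_bigr => k _; rewrite e [in RHS]rmorphM.
Qed.

Lemma tpow_cvg m : (fun N => t ^+ (N + m)) @ \oo --> (0 : R).
Proof.
apply: (cvg_seq_eq (u := fun N => t ^+ N * t ^+ m)) => [N|]; first by rewrite exprD.
rewrite -(mul0r (t ^+ m)); apply: cvgMl.
by apply: cvg_geo0; [exact: ltW q2_gt0|exact: q2_lt1].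
Qed.

Lemma one_sub_t n : 1 - t ^+ n.+1 != 0.
Proof.
by rewrite subr_eq0 eq_sym lt_eqF// exprn_ilt1// ?q2_lt1// ltW// q2_gt0.
Qed.

(** The sum over [k] of the geometric series with terms [(1 - t) t^(k (n + 1))]. *)
Definition haar_moment n : R := (1 - t) / (1 - t ^+ n.+1).

Lemma haar_sum_xn_cvg n :
  (fun N => \sum_(0 <= k < N) wt_k k * t ^+ (k * n)) @ \oo --> haar_moment n.
Proof.
have key N : \sum_(0 <= k < N) wt_k k * t ^+ (k * n) =
    haar_moment n - haar_moment n * t ^+ (n.+1 * N).
  elim: N => [|N IH]; first by rewrite big_geq// muln0 expr0 mulr1 subrr.
  rewrite big_nat_recr//= IH /haar_moment /wt_k mulnS [t ^+ (n.+1 + _)]exprD mulSn exprD -[(N * n)%N]mulnC.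
  by have h1 := one_sub_t n; field.
apply: (cvg_seq_eq (u := fun N => haar_moment n - haar_moment n * (t ^+ n.+1) ^+ N)) => [N|].
  by rewrite key exprM.
rewrite -[X in _ --> X]subr0 -[X in _ - X](mulr0 (haar_moment n)).
apply: cvgB; first exact: cvg_cst.
apply: cvgMr; apply: cvg_geo0; first by apply: exprn_ge0; exact: ltW q2_gt0.
by rewrite exprn_ilt1 ?q2_lt1// ltW// q2_gt0.
Qed.

(** Telescoping: the partial sums are [haar_moment n] times the product of the [n + 1] factors
    [1 - t^(N + i)], which vanishes at [N = 0] because of [i = 0] and tends to 1. *)
Lemma haar_sum_aan_cvg n :
  (fun N => \sum_(0 <= k < N) wt_k k * \prod_(i < n) (1 - t ^+ (k + i.+1))) @ \oo -->
  haar_moment n.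
Proof.
have key N : \sum_(0 <= k < N) wt_k k * \prod_(i < n) (1 - t ^+ (k + i.+1)) =
    haar_moment n * \prod_(i < n.+1) (1 - t ^+ (N + i)).
  elim: N => [|N IH].
    by rewrite big_geq// big_ord_recl /= expr0 subrr mul0r mulr0.
  rewrite big_nat_recr//= IH big_ord_recl [in RHS]big_ord_recr /= /haar_moment /wt_k.
  have -> : \prod_(i < n) (1 - t ^+ (N + bump 0 i)) = \prod_(i < n) (1 - t ^+ (N + i.+1)).
    by apply: eq_bigr => i _.
  have -> : \prod_(i < n) (1 - t ^+ (N.+1 + i)) = \prod_(i < n) (1 - t ^+ (N + i.+1)).
    by apply: eq_bigr => i _; rewrite addSnnS.
  rewrite addn0 addSnnS exprD.
  by have h1 := one_sub_t n; field.
apply: (cvg_seq_eq (u := fun N => haar_moment n * \prod_(i < n.+1) (1 - t ^+ (N + i)))) => [N|].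
  by rewrite key.
rewrite -[X in _ --> X]mulr1; apply: cvgMr.
elim: (n.+1) => [|m IH].
  by apply: (cvg_seq_eq (u := cst (1 : R))) => [N|]; [rewrite big_ord0|exact: cvg_cst].
apply: (cvg_seq_eq (u := fun N => \prod_(i < m) (1 - t ^+ (N + i)) * (1 - t ^+ (N + m)))) => [N|].
  by rewrite big_ord_recr.
rewrite -[X in _ --> X]mulr1; apply: cvgM => //.
by rewrite -[X in _ --> X]subr0; apply: cvgB; [exact: cvg_cst|exact: tpow_cvg].
Qed.

Lemma cvg_complex (u : nat -> R) (l : R) : u @ \oo --> l ->
  (fun n => ((u n)%:C)%C : R[i]^o) @ \oo --> ((l%:C)%C : R[i]^o).
Proof.
move=> ul; apply/cvg_nmP => e e0.
have /cvgrPdist_lt /(_ e e0) [N _ hN] := ul; exists N => n Nn.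
by rewrite -rmorphB nmR distrC; exact: hN.
Qed.

(* The expansion of [alpha^n alpha^*n] in powers of [x] turns [haar_xn] into a
   recursion determining the moments of [x]. *)
Lemma haar_moment_xn n : h (cpow x n) = ((haar_moment n)%:C)%C.
Proof.
elim/ltn_ind: n => n IH.
case: (posnP n) => [->|n0].
  by rewrite haar1 /haar_moment expr1 divff// -[t]expr1 one_sub_t.
have [d [e dn]] := aa'_pow_poly G n.
(* The recursion can be solved for the [n]-th moment because its leading coefficient has absolute
   value at most [t < 1]. *)
have d1 : d n != 1.
  rewrite lt_eqF// dn; apply: (le_lt_trans (ler_norm _)); rewrite normr_prod.
  case: n n0 {IH d e dn} => // n _.
  rewrite big_ord_recl /=.
  have le1 (r : seq 'I_n) : \prod_(i <- r) `|- q ^+ (2 * (bump 0 i).+1)| <= 1.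
    elim: r => [|i r IH]; rewrite ?big_nil// big_cons.
    apply: mulr_ile1; rewrite ?normr_ge0 ?prodr_ge0// normrN q2n ger0_norm ?q2k_le1//.
    by apply: exprn_ge0; exact: ltW q2_gt0.
  apply: (le_lt_trans (ler_piMr _ (le1 _))); first exact: normr_ge0.
  by rewrite normrN muln1 ger0_norm ?q2_lt1// ltW// q2_gt0.
have eh : h (cpow x n) = \sum_(k < n.+1) ((d k)%:C)%C * h (cpow x k).
  by rewrite {1}haar_xn e haar_sum; apply: eq_bigr => k _; rewrite haarZ.
(* The expansion in powers of [x] holds for the truncated sums, and comparing limits gives the
   recursion for the explicit moments. *)
have em : haar_moment n = \sum_(k < n.+1) d k * haar_moment k.
  apply: (cvg_unique _ (@haar_sum_aan_cvg n)) => //.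
  apply: (cvg_seq_eq (u := fun N => \sum_(j < n.+1) d j * \sum_(0 <= k < N) wt_k k * t ^+ (k * j))).
    move=> N; apply: (@complexI R); rewrite -haar_sum_aan e rmorph_sum /=.
    have hs : forall (r : seq 'I_n.+1) F, haar_sumN N (\sum_(k <- r) F k) = \sum_(k <- r) haar_sumN N (F k).
      move=> r F; apply: (big_morph (haar_sumN N)) => [y z|].
        by have := haar_sumN_lin N 1 y z; rewrite scale1r mul1r.
      by have := haar_sumN_lin N (-1) 0 0; rewrite scaler0 addr0 mulN1r addNr.
    rewrite hs; apply: eq_bigr => k _; rewrite rmorphM /= -haar_sum_xn.
    have := haar_sumN_lin N ((d k)%:C)%C (cpow x k) 0; rewrite addr0 => ->.
    by have := haar_sumN_lin N (-1) 0 0; rewrite scaler0 addr0 mulN1r addNr => ->; rewrite addr0.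
  have key : forall r : seq 'I_n.+1,
      (fun N => \sum_(j <- r) d j * \sum_(0 <= k < N) wt_k k * t ^+ (k * j)) @ \oo -->
      \sum_(j <- r) d j * haar_moment j.
    elim=> [|j r IHr].
      by rewrite big_nil; apply: (cvg_seq_eq (u := cst (0 : R))) => [N|]; [rewrite big_nil|exact: cvg_cst].
    rewrite big_cons; apply: (cvg_seq_eq (u := fun N => d j * (\sum_(0 <= k < N) wt_k k * t ^+ (k * j)) +
       \sum_(j <- r) d j * \sum_(0 <= k < N) wt_k k * t ^+ (k * j))) => [N|]; first by rewrite big_cons.
    by apply: cvgD => //; apply: cvgMr; exact: haar_sum_xn_cvg.
  exact: key.
have d1C : 1 - ((d n)%:C)%C != 0 :> C.
  by rewrite -(rmorph1 (real_complex R)) -rmorphB fmorph_eq0 subr_eq0 eq_sym.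
apply: (mulfI d1C); rewrite !mulrBl !mul1r {1}eh {1}em !big_ord_recr /= rmorphD !rmorphM !addrK rmorph_sum /=.
by apply: eq_bigr => k _; rewrite IH// [in RHS]rmorphM.
Qed.

(* [h y = (1 - q^2) sum_k q^(2k) int <phi_k, psi2 la y phi_k> dla]. *)
Lemma haar_formula y : haar_cvg y.
Proof.
have h0 : haar_cvg 0.
  have e N : haar_sumN N 0 = 0.
    by have := haar_sumN_lin N (-1) 0 0; rewrite scaler0 addr0 mulN1r addNr.
  rewrite /haar_cvg [h 0](lin0 haar_lin); apply: (cvg_seq_eq (u := cst (0 : R[i]^o))) => [N|]; first by rewrite e.
  exact: cvg_cst.
have hx n : haar_cvg (cpow x n).
  rewrite /haar_cvg haar_moment_xn; apply: (cvg_seq_eq _ (cvg_complex (@haar_sum_xn_cvg n))) => N.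
  by rewrite haar_sum_xn.
move: y; apply: (total_ind (S := @words R q G)); last exact: words_total.
- exact: h0.
- exact: haar_cvg_lin.
- move=> y /closure_nm cy; apply/cvg_nmP => e e0.
  have [hl [K K0 hK]] := haar_bf.
  have K5 : 0 < K + 5 by lra.
  have d0 : 0 < e / (K + 5) / 2 by rewrite !divr_gt0.
  have [z hz yz] := cy _ d0.
  have e2 : 0 < e / 2 by rewrite divr_gt0.
  have /cvg_nmP /(_ _ e2) [N hN] := hz; exists N => n Nn.
  have s1 : nm (haar_sumN n y - haar_sumN n z) <= 4 * nm (y - z).
    have := haar_sumN_nm n (y - z); rewrite -[y - z]addrC -scaleN1r haar_sumN_lin mulN1r.
    by rewrite [X in nm X <= _]addrC.
  have s2 : nm (h z - h y) <= K * nm (y - z).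
    by rewrite nmB -[h y - h z](linB hl); exact: hK.
  have s3 := hN n Nn.
  apply: le_lt_trans (nmBD (haar_sumN n z) _ _) _.
  have := nmBD (h z) (haar_sumN n z) (h y) => s4.
  have : nm (y - z) * (K + 5) < e / 2.
    by rewrite -ltr_pdivlMr// mulrAC.
  have := nm_ge0 (y - z) => p0; nra.
- move=> _ [n [i [j ->]]].
  (* If a weight is nonzero, then either the power of [la] integrates to 0 or the shift is nonzero
     and leaves no diagonal entry. *)
  have zero : wwt i != 0 \/ wwt j != 0 -> haar_cvg (wcoef i j).
    move=> ne; have hw : h (wcoef i j) = 0 by case: ne; [exact: haar_weight_l|exact: haar_weight_r].
    rewrite /haar_cvg hw; apply: (cvg_seq_eq (u := cst (0 : R[i]^o))) => [N|]; last exact: cvg_cst.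
    rewrite /haar_sumN big1// => k _; have [s [u [r [e1 e2 hr]]]] := psi2_wcoef i j.
    rewrite (_ : diag_mean k _ = 0) ?mulr0//.
    rewrite /diag_mean (_ : (fun la => _) = fun la : circle R =>
      (r k * dotp (phi k) (phiz (k%:Z - s))) * (la : C) ^ u); last first.
      by apply/funext => la; have := hr la k%:Z; rewrite /= => ->; rewrite dotpZr; ring.
    rewrite cintZ; last exact: bmeas_circleZ.
    case: (eqVneq u 0) => [u0|un]; last by rewrite cint_circleZ// mulr0.
    have s0 : s != 0 by apply/eqP => s0; case: ne => /eqP; apply; lia.
    rewrite (_ : dotp _ _ = 0) ?mulr0 ?mul0r//.
    case E : (k%:Z - s) => [m|m] /=; last by rewrite dotp0r.
    by rewrite phi_orth; case: eqVneq => // km; exfalso; lia.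
  case: (eqVneq (wwt i) 0) => [wi|]; last by move=> ?; apply: zero; left.
  case: (eqVneq (wwt j) 0) => [wj|]; last by move=> ?; apply: zero; right.
  have := @wcoef_zero_weight R q q0 G n i j wi wj; move: (wcoef i j); apply: lspan_ind.
  + exact: h0.
  + exact: haar_cvg_lin.
  + by move=> _ [m ->]; exact: hx.
Qed.

Arguments haar_formula y : clear implicits.

Definition pl_term y k la : R := wt_k k * nm (psi2 la y (phi k)) ^+ 2.

Lemma psi2_nm2 y k la : ((nm (psi2 la y (phi k)) ^+ 2)%:C)%C =
  dotp (phi k) (psi2 la (adj y ** y) (phi k)).
Proof.
have [_ _ _ pM _] := psi2_rep la.
by rewrite pM (rep_adjE _ _ _ (psi2_rep la)) dotpxx.
Qed.

Lemma measurable_psi2_nm2 y k :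
  measurable_fun setT (fun la => nm (psi2 la y (phi k)) ^+ 2).
Proof.
have [h1 _] := psi2_cmeas k k (adj y ** y).
have e : (fun la => nm (psi2 la y (phi k)) ^+ 2) =
    (fun la => complex.Re (dotp (phi k) (psi2 la (adj y ** y) (phi k)))).
  by apply/funext => la; rewrite -psi2_nm2.
by rewrite e.
Qed.

(** The trace formula at [adj y ** y], with sum and integral exchanged by positivity. This is the
    isometry of the transform before it is phrased with Hilbert-Schmidt norms. *)
Lemma haar_int y :
  (\int[circ]_la \sum_(0 <= k <oo) (pl_term y k la)%:E = (nm (Lam L y) ^+ 2)%:E)%E.
Proof.
have m1 k : measurable_fun setT (fun la => pl_term y k la).
  by apply: measurable_funM; [exact: measurable_cst|exact: measurable_psi2_nm2].
have p0 k la : 0 <= pl_term y k la by rewrite mulr_ge0 ?wt_ge0 ?sqr_ge0.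
rewrite integral_nneseries//; last 2 first.
- by move=> k; apply/measurable_EFinP.
- by move=> k la _; rewrite lee_fin.
have e k : (\int[circ]_la (pl_term y k la)%:E =
    (wt_k k * complex.Re (diag_mean k (adj y ** y)))%:E)%E.
  rewrite (eq_integral (fun la => ((wt_k k)%:E * (nm (psi2 la y (phi k)) ^+ 2)%:E)%E))//.
  rewrite ge0_integralZl_EFin//; last 3 first.
  - by move=> la _; rewrite lee_fin sqr_ge0.
  - by apply/measurable_EFinP; exact: measurable_psi2_nm2.
  - exact: wt_ge0.
  rewrite cint_real; last 3 first.
  - exact: measurable_psi2_nm2.
  - by move=> la; exact: sqr_ge0.
  - exists ((2 * nm y) ^+ 2) => la; rewrite ler_pXn2r ?nnegrE ?mulr_ge0 ?nm_ge0//; exact: psi2_nm.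
  rewrite -EFinM; congr ((_ * complex.Re _)%:E); rewrite /diag_mean; congr cint.
  by apply/funext => la; exact: psi2_nm2.
under eq_eseriesr do rewrite e.
apply: nneseries_cvg; have := haar_formula (adj y ** y); rewrite /haar_cvg -Lam_dotp dotpxx => hl.
apply/cvgrPdist_lt => e' e0; have /cvg_nmP /(_ e' e0) [N hN] := hl; exists N => // n Nn.
rewrite distrC; apply: le_lt_trans (hN n Nn).
have -> : \sum_(0 <= k < n) wt_k k * complex.Re (diag_mean k (adj y ** y)) =
    complex.Re (haar_sumN n (adj y ** y)).
  rewrite /haar_sumN (big_morph (@complex.Re R) (@ReD R) (erefl _)).
  by apply: eq_bigr => k _; rewrite RmulC.
rewrite -[X in `|_ - X|]/(complex.Re (((nm (Lam L y) ^+ 2)%:C)%C)) -ReB; exact: nmRe.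
Qed.

(** * The KMS relation and the modular conjugation *)

Local Notation abs_s := ((((Num.sqrt `|q|)%:C)%C : C)).

Lemma abs_s_neq0 : abs_s != 0.
Proof.
rewrite -(rmorph0 (real_complex R)) (inj_eq (@complexI R)) gt_eqF//.
by rewrite sqrtr_gt0 normr_gt0.
Qed.

Lemma abs_s4 : abs_s ^+ 4 = (t%:C)%C.
Proof.
rewrite -rmorphXn /= (_ : 4%N = (2 * 2)%N)// exprM sqr_sqrtr//.
by rewrite real_normK ?num_real.
Qed.

(** The offset by one accommodates [alpha], which lowers the basis index, so that truncated sums
    match only after a shift. *)
Lemma haar_cvg_eq y z (k : C) :
  (forall N, haar_sumN N.+1 y = k * haar_sumN N z) -> h y = k * h z.
Proof.
move=> e; have hz := haar_formula z.
apply: (@cvg_uniq R (R[i]^o) (fun N => haar_sumN N.+1 y)).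
  by have := haar_formula y; rewrite /haar_cvg -cvg_shiftS.
apply/cvg_nmP => e' e0; have e1 : 0 < e' / (nm k + 1) by rewrite divr_gt0// ltr_wpDl// nm_ge0.
have /cvg_nmP /(_ _ e1) [N hN] := hz; exists N => n /hN hn.
rewrite e -mulrBr nmM; apply: (@le_lt_trans _ _ ((nm k + 1) * nm (haar_sumN n z - h z))).
  by rewrite ler_wpM2r ?nm_ge0// lerDl.
by rewrite mulrC -ltr_pdivlMr// ltr_wpDl// nm_ge0.
Qed.

(** Moving [alpha] to the other side of a diagonal entry lowers [k + 1] to [k], and the masses
    satisfy [wt_k (k + 1) = t wt_k k]; the term at 0 vanishes since [alpha phi_0 = 0]. *)
Lemma kms_a y : h (y ** a) = (t%:C)%C * h (a ** y).
Proof.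
apply: haar_cvg_eq => N.
rewrite /haar_sumN big_nat_recl//= (_ : diag_mean 0 _ = 0); last first.
  rewrite /diag_mean -[RHS](cint_cst circ); congr cint; apply/funext => la.
  have [lb _ _ pM _] := psi2_rep la.
  by rewrite pM psi2_a scaler0 (lin0 (bl_lin (lb y))) dotp0r.
rewrite mulr0 add0r mulr_sumr; apply: eq_bigr => k _.
have -> : diag_mean k.+1 (y ** a) = diag_mean k (a ** y).
  rewrite /diag_mean; congr cint; apply/funext => la.
  have [lb _ _ pM _] := psi2_rep la; rewrite !pM psi2_a (rep_blZ _ _ _ (psi2_rep la)).
  rewrite (rep_adjE' _ _ _ (psi2_rep la)) psi2_a' dotpZr dotpZl.
  by rewrite conj_real.
by rewrite mulrA -rmorphM /wt_k [t ^+ k.+1]exprS; congr ((_%:C)%C * _); ring.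
Qed.

Lemma kms_c y : h (y ** c) = h (c ** y).
Proof.
apply: (@cvg_uniq R (R[i]^o) (fun N => haar_sumN N (y ** c))); first exact: haar_formula.
apply: cvg_seq_eq (haar_formula (c ** y)) => N; apply: eq_bigr => k _; congr (_ * _).
rewrite /diag_mean; congr cint; apply/funext => la.
have [lb _ _ pM _] := psi2_rep la; rewrite !pM psi2_c (rep_blZ _ _ _ (psi2_rep la)).
rewrite (rep_adjE' c _ _ (psi2_rep la)) psi2_c' dotpZr dotpZl.
by rewrite rmorphM /= conjCK conj_real.
Qed.

Lemma kms_c' y : h (y ** adj c) = h (adj c ** y).
Proof.
by rewrite -[LHS]conjCK -haar_adj adjM adjK -kms_c -haar_adj adjM adjK.
Qed.

(** The scalar is displayed as a square because its root is the scalar of the modular conjugation in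
    [J_Lam]. *)
Lemma kms_fund y i j : h (y ** fund i j) =
  (abs_s ^ (fund_wt i + fund_wt j)) ^+ 2 * h (fund i j ** y).
Proof.
rewrite /fund /fund_wt; case: (I2P i) => ->; case: (I2P j) => -> /=.
- rewrite kms_a; congr (_ * _); by rewrite -abs_s4 (_ : 1 + 1 = 2%:Z)// -exprnP -exprM.
- by rewrite subrr expr0z expr1n mul1r cmulZr cmulZl !haarZ kms_c'.
- by rewrite addNr expr0z expr1n mul1r kms_c.
- have t0 : ((t%:C)%C : C) != 0 by rewrite -abs_s4 expf_neq0 ?abs_s_neq0.
  have e : h (a ** adj y) = (t%:C)%C^-1 * h (adj y ** a) by rewrite kms_a mulKf.
  rewrite -[h (y ** _)]conjCK -haar_adj adjM adjK e rmorphM /= fmorphV /= conj_real.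
  rewrite -haar_adj adjM adjK; congr (_ * _).
  by rewrite (_ : (-1 - 1)%R = - (2 : int))// -exprnN exprVn -exprM abs_s4.
Qed.

Lemma kms n (i j : widx n) y : h (y ** wcoef i j) =
  (abs_s ^ (wwt i + wwt j)) ^+ 2 * h (wcoef i j ** y).
Proof.
elim: n i j y => [|n IH] i j y /=.
  by rewrite cmul1l cmul1r addr0 expr0z expr1n mul1r.
rewrite cmulA IH cmulA kms_fund mulrA -exprMn -expfzDr ?abs_s_neq0//.
by rewrite cmulA; congr ((_ ^ _) ^+ 2 * _); ring.
Qed.

(** On words of nonzero weight both values are 0; the remaining words are polynomials in [x], which
    the unitary antipode fixes. *)
Lemma haar_Ra y : h (uantip L y) = h y.
Proof.
have RP := uantipP L; have bR := Ra_bl RP.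
have [hl [K K0 hK]] := haar_bf.
move: y; apply: (total_ind (S := @words R q G)); last exact: words_total.
- by rewrite (lin0 (bl_lin bR)).
- by move=> k y z hy hz; rewrite (bl_lin bR) haarD haarZ hy hz haarD haarZ.
- move=> y /closure_seq [u hu uy].
  apply: (@cvg_uniq R (R[i]^o) (fun n => h (u n))).
    apply: (@cvg_seq_eq (R[i]^o) (fun n => h (uantip L (u n)))) => [N|]; first exact: hu.
    by apply: (bounded_functional_cvg haar_bf); exact: bl_cvg.
  exact: (bounded_functional_cvg haar_bf).
move=> _ [n [i [j ->]]].
have zero : wwt i != 0 \/ wwt j != 0 -> h (uantip L (wcoef i j)) = h (wcoef i j).
  move=> ne; rewrite (Ra_wcoef q0 RP) haarZ haar_adj.
  have -> : h (wcoef j i) = 0 by case: ne; [exact: haar_weight_r|exact: haar_weight_l].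
  have -> : h (wcoef i j) = 0 by case: ne; [exact: haar_weight_l|exact: haar_weight_r].
  by rewrite conjC0 mulr0.
case: (eqVneq (wwt i) 0) => [wi|]; last by move=> ?; apply: zero; left.
case: (eqVneq (wwt j) 0) => [wj|]; last by move=> ?; apply: zero; right.
by rewrite (Ra_xspan q0 RP)//; exact: wcoef_zero_weight.
Qed.

Local Notation J := (@modJ R q G L).

Lemma J_semi k v w : J (k *: v + w) = Num.conj k *: J v + J w.
Proof. by case: (modJP L) => -[]. Qed.
Lemma J_dotp v w : dotp (J v) (J w) = dotp w v.
Proof. by case: (modJP L) => -[]. Qed.
Lemma J_K : involutive J. Proof. by case: (modJP L) => -[]. Qed.
Lemma J0 : J 0 = 0.
Proof. by have := J_semi (-1) 0 0; rewrite scaler0 addr0 rmorphN rmorph1 scaleN1r addNr. Qed.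
Lemma JZ k v : J (k *: v) = Num.conj k *: J v.
Proof. by rewrite -[k *: v]addr0 J_semi J0 addr0. Qed.
Lemma JD v w : J (v + w) = J v + J w.
Proof. by rewrite -[v]scale1r J_semi rmorph1 !scale1r. Qed.
Lemma JB v w : J (v - w) = J v - J w.
Proof. by rewrite JD -scaleN1r JZ rmorphN rmorph1 scaleN1r. Qed.
Lemma J_nm v : nm (J v) = nm v.
Proof.
apply/eqP; rewrite -(eqrXn2 (_ : 0 < 2)%N) ?nm_ge0//; apply/eqP.
by apply: (@complexI R); rewrite -!dotpxx J_dotp.
Qed.
Lemma J_cvg (u : nat -> L2 L) v : u @ \oo --> v -> (fun n => J (u n)) @ \oo --> J v.
Proof.
move=> /cvg_nm uv; apply/cvg_nm; apply: cvg_seq_eq uv => n.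
by rewrite -JB J_nm.
Qed.

(* [Lam u] is an eigenvector of the square root [P] of the modular operator:
   for [w = P x - k x] one has [P w = - k w], so [w = 0] by positivity. *)
Lemma J_Lam n (i j : widx n) :
  J (Lam L (wcoef i j)) = (abs_s ^ (wwt i + wwt j)) *: Lam L (adj (wcoef i j)).
Proof.
have [_ [P [[_ Psa _ Ppos] graph]]] := modJP L.
set u := wcoef i j; set k := abs_s ^ _.
have k0 : k != 0 by rewrite expfz_neq0 ?abs_s_neq0.
have kR : exists2 r : R, 0 < r & k = (r%:C)%C.
  exists (Num.sqrt `|q| ^ (wwt i + wwt j)); first by rewrite exprz_gt0// sqrtr_gt0 normr_gt0.
  by rewrite rmorphXz// unitfE gt_eqF// sqrtr_gt0 normr_gt0.
have [r r0 kr] := kR.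
have kJ : Num.conj k = k by rewrite kr conj_real.
have graph_of z : P (Lam L z, J (Lam L (adj z))).
  have : closure [set p : L2 L * L2 L | exists a, p = (Lam L a, Lam L (adj a))] (Lam L z, Lam L (adj z)).
    by apply: subset_closure; exists z.
  by rewrite graph => -[y [Py /= ->]]; rewrite J_K.
set x0 := Lam L u; set y0 := J (Lam L (adj u)).
have P1 : P (x0, y0) := graph_of u.
(* Tested against the graph of [P], the KMS relation says [P y0 = k^-2 x0], that is,
   [P (P x0) = k^-2 x0]. *)
have P2 : P (y0, k^-2 *: x0).
  apply/Psa => p p' Pp.
  have : [set p | exists y, P (p.1, y) /\ p.2 = J y] (p, J p') by exists p'.
  rewrite -graph => /closure_seq [s hs sp].
  have s1 : (fun n => (s n).1) @ \oo --> p by apply: cvg_comp sp _; exact: cvg_fst.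
  have s2 : (fun n => (s n).2) @ \oo --> J p' by apply: cvg_comp sp _; exact: cvg_snd.
  have -> : dotp y0 p' = dotp (J p') (Lam L (adj u)) by rewrite -[p' in LHS]J_K J_dotp.
  apply: (cvg_uniq (dotp_cvg s2 (cvg_cst _))).
  apply: cvg_seq_eq (dotp_cvg (cvg_cst _) s1) => m /=.
  have [z ->] := hs m; rewrite /= dotpZl !Lam_dotp adjK.
  rewrite -[h (z ** adj u)]conjCK -haar_adj adjM adjK.
  have e := kms i j (adj z); rewrite -/u -/k in e.
  rewrite -[h (u ** _)](mulKf (expf_neq0 2 k0)) -e rmorphM /= !fmorphV !rmorphXn /= kJ.
  by rewrite -haar_adj adjM adjK.
pose w := y0 - k^-1 *: x0.
have Pw : P (w, - k^-1 *: w).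
  apply/Psa => p p' Pp; have /Psa e1 := P1; have /Psa e2 := P2.
  rewrite /w dotpBl dotpZl (e1 _ _ Pp) (e2 _ _ Pp) !dotpZl dotpBl dotpZl.
  rewrite rmorphN !fmorphV rmorphXn /= kJ; field; done.
have w0 : w = 0.
  apply/eqP/negP => /negP wn; have := Ppos _ _ Pw wn.
  rewrite dotpZr dotpxx kr -fmorphV -rmorphN -rmorphM /=.
  rewrite -[X in X < _]/((0%:C)%C) ltcR mulNr oppr_gt0 ltNge mulr_ge0// ?sqr_ge0//.
  by rewrite invr_ge0 ltW.
have e : y0 = k^-1 *: x0 by apply/eqP; rewrite -subr_eq0 -/w w0.
have := congr1 (fun v => J (k *: v)) e.
by rewrite scalerA divff// scale1r /= JZ kJ /y0 J_K.
Qed.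

(** * The isometry and the closure of its graph *)

Definition dinv_wt k : R := Num.sqrt (1 - t) * `|q| ^+ k.

Lemma dinv_wt_sq k : dinv_wt k ^+ 2 = wt_k k.
Proof.
have h : 0 <= 1 - t by rewrite subr_ge0 ltW// q2_lt1.
by rewrite exprMn sqr_sqrtr// -exprM mulnC exprM real_normK ?num_real.
Qed.

Lemma dinv_wt_gt0 k : 0 < dinv_wt k.
Proof. by rewrite mulr_gt0// ?sqrtr_gt0 ?subr_gt0 ?q2_lt1// exprn_gt0// normr_gt0. Qed.

Lemma dinv_wt_le1 k : `|dinv_wt k| <= 1.
Proof.
rewrite ger0_norm ?(ltW (dinv_wt_gt0 k))// -(ler_pXn2r (_ : 0 < 2)%N) ?nnegrE ?(ltW (dinv_wt_gt0 k))//.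
rewrite dinv_wt_sq expr1n mulr_ile1 ?q2k_le1// ?subr_ge0 ?(ltW q2_lt1)//.
  by apply: exprn_ge0; exact: ltW q2_gt0.
by rewrite gerBl ltW// q2_gt0.
Qed.

(** [D^-1] as a bounded operator; [Irr_D_dinv] relates it to the graph of [D]. *)
Definition dinv : H2 -> H2 := sval (cid (diag_op phi_basis ler01 dinv_wt_le1)).

Lemma dinvP : [/\ bounded_linear dinv,
  forall (k : nat) v, dotp (phi k) (dinv v) = ((dinv_wt k)%:C)%C * dotp (phi k) v &
  forall v, nm (dinv v) <= 1 * nm v].
Proof. exact: svalP (cid (diag_op phi_basis ler01 dinv_wt_le1)). Qed.

Lemma dinv_bl : bounded_linear dinv. Proof. by case: dinvP. Qed.

Lemma dinv_phi k : dinv (phi k) = ((dinv_wt k)%:C)%C *: phi k.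
Proof.
apply: (onb_ext phi_basis) => j; have [_ h _] := dinvP.
rewrite h dotpZr phi_orth; case: eqVneq => [->//|_]; by rewrite !mulr0.
Qed.

Definition Q0 (y : G) : circle R -> H2 -> H2 := fun la v => psi2 la y (dinv v).
Local Notation hsf := (hsfield phi circ).
Local Notation hn := (hsn phi circ).

Lemma psi2_bl la y : bounded_linear (psi2 la y). Proof. by case: (psi2_rep la). Qed.

Lemma Q0_hs y la : hs_norm2 phi (Q0 y la) = (\sum_(0 <= k <oo) (pl_term y k la)%:E)%E.
Proof.
rewrite hsE; apply: eq_eseriesr => k _; rewrite /Q0 dinv_phi (rep_blZ _ _ _ (psi2_rep la)).
by rewrite nmZ exprMn nmR /pl_term -dinv_wt_sq real_normK ?num_real.
Qed.

Lemma Q0_hsI y : hsI phi circ (Q0 y) = ((nm (Lam L y) ^+ 2)%:E)%E.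
Proof.
by rewrite -haar_int /hsI; apply: eq_integral => la _; exact: Q0_hs.
Qed.

Lemma Q0_hsfield y : hsf (Q0 y).
Proof.
split=> [la|n m|]; last by rewrite Q0_hsI ltry.
  split; first exact: (bl_comp (psi2_bl la y) dinv_bl).
  rewrite Q0_hs; apply: (@le_lt_trans _ _ ((2 * nm y) ^+ 2)%:E); last exact: ltry.
  apply: nneseries_le_bound => [k|n]; first by rewrite mulr_ge0 ?wt_ge0 ?sqr_ge0.
  apply: (@le_trans _ _ (\sum_(0 <= k < n) wt_k k * (2 * nm y) ^+ 2)).
    apply: ler_sum => k _; rewrite ler_wpM2l ?wt_ge0// ler_pXn2r ?nnegrE ?mulr_ge0 ?nm_ge0//.
    exact: psi2_nm.
  rewrite -mulr_suml wt_sum ler_piMl ?sqr_ge0// gerBl exprn_ge0// ltW//; exact: q2_gt0.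
rewrite (_ : (fun la => _) = fun la => ((dinv_wt m)%:C)%C * dotp (phi n) (psi2 la y (phi m))).
  by apply: cmeasZ; exact: psi2_cmeas.
by apply/funext => la; rewrite /Q0 dinv_phi (rep_blZ _ _ _ (psi2_rep la)) dotpZr.
Qed.

Lemma Q0_hsn y : hn (Q0 y) = nm (Lam L y).
Proof. by rewrite /hsn Q0_hsI /= sqrtr_sqr ger0_norm ?nm_ge0. Qed.

Lemma Q0_lin k y z : Q0 (k *: y + z) = fun la v => k *: Q0 y la v + Q0 z la v.
Proof.
by apply: field_ext => la v; rewrite /Q0 (repD _ _ _ (psi2_rep la)) (repZ _ _ _ (psi2_rep la)).
Qed.

(* [rel xi T] says that the field [T] is the image of [xi] under the closure
   of the isometry [Lam y |-> Q0 y]. *)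
Definition rel (xi : L2 L) (T : circle R -> H2 -> H2) := hsf T /\
  forall e : R, 0 < e -> exists y, nm (Lam L y - xi) <= e /\ hn (fun la v => Q0 y la v - T la v) <= e.

Lemma hsn_self T : hsf T -> hn (fun la v => T la v - T la v) = 0.
Proof.
move=> hT; rewrite (_ : (fun la v => _) = fun _ _ => 0); first exact: hsn0.
by apply: field_ext => la v; rewrite subrr.
Qed.

Lemma rel_Lam y : rel (Lam L y) (Q0 y).
Proof.
split=> [|e e0]; first exact: Q0_hsfield.
exists y; rewrite subrr nm0 (hsn_self (Q0_hsfield y)); split; exact: ltW.
Qed.

Lemma rel_lin k xi eta T S : rel xi T -> rel eta S ->
  rel (k *: xi + eta) (fun la v => k *: T la v + S la v).
Proof.
move=> [hT aT] [hS aS]; split=> [|e e0]; first exact: hsfield_lin.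
have k1 : 0 < nm k + 1 by rewrite ltr_wpDl// nm_ge0.
have e1 : 0 < e / 2 / (nm k + 1) by rewrite !divr_gt0.
have e2 : 0 < e / 2 by rewrite divr_gt0.
have [y [y1 y2]] := aT _ e1; have [z [z1 z2]] := aS _ e2.
have ke : nm k * (e / 2 / (nm k + 1)) <= e / 2.
  by rewrite mulrA ler_pdivrMr// mulrC ler_wpM2l ?(ltW e2)// lerDl.
exists (k *: y + z); split.
  rewrite Lam_lin opprD addrACA -scalerBr.
  apply: le_trans (nmD _ _) _; rewrite nmZ [leRHS](splitr e); apply: lerD => //.
  by apply: le_trans ke; rewrite ler_wpM2l ?nm_ge0.
rewrite Q0_lin (_ : (fun la v => _) = fun la v => k *: (Q0 y la v - T la v) + (Q0 z la v - S la v)).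
  have h1 := hsfieldB phi_basis (Q0_hsfield y) hT; have h2 := hsfieldB phi_basis (Q0_hsfield z) hS.
  apply: le_trans (hsnD phi_basis (hsfieldZ phi_basis k h1) h2) _.
  rewrite hsnZ// [leRHS](splitr e); apply: lerD => //.
  by apply: le_trans ke; rewrite ler_wpM2l ?nm_ge0.
by apply: field_ext => la v; rewrite scalerBr opprD addrACA.
Qed.

Lemma rel_nm xi T : rel xi T -> hn T = nm xi.
Proof.
move=> [hT aT]; apply/eqP; rewrite eq_le; apply/andP; split; apply/ler_addgt0Pr => e e0;
  have e2 : 0 < e / 2 by rewrite divr_gt0.
- have [y [y1 y2]] := aT _ e2.
  apply: le_trans (hsn_dist phi_basis hT (Q0_hsfield y)) _; rewrite Q0_hsn hsnBC.
  have := nmD (Lam L y - xi) xi; rewrite subrK; lra.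
- have [y [y1 y2]] := aT _ e2.
  have := hsn_dist phi_basis (Q0_hsfield y) hT; rewrite Q0_hsn => h.
  have := nmD (xi - Lam L y) (Lam L y); rewrite subrK nmB; lra.
Qed.

Lemma rel_clos xi T : hsf T ->
  (forall e : R, 0 < e -> exists eta S, [/\ rel eta S, nm (eta - xi) <= e &
     hn (fun la v => S la v - T la v) <= e]) -> rel xi T.
Proof.
move=> hT h; split=> // e e0; have e2 : 0 < e / 2 by rewrite divr_gt0.
have [eta [S [[hS aS] h1 h2]]] := h _ e2; have [y [y1 y2]] := aS _ e2.
exists y; split.
  by apply: le_trans (nmBD eta _ _) _; lra.
by apply: le_trans (hsnBD phi_basis (Q0_hsfield y) hS hT) _; lra.
Qed.

Lemma relB xi eta T S : rel xi T -> rel eta S -> rel (xi - eta) (fun la v => T la v - S la v).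
Proof.
move=> hT hS; have := rel_lin (-1) hS hT; rewrite scaleN1r addrC.
congr rel; apply: field_ext => la v; by rewrite scaleN1r addrC.
Qed.

Lemma rel_uniq xi T S : rel xi T -> rel xi S -> {ae circ, forall la, forall v, T la v = S la v}.
Proof.
move=> hT hS; apply: (hsn_ae_eq phi_basis hT.1 hS.1).
by rewrite (rel_nm (relB hT hS)) subrr nm0.
Qed.

Lemma rel_inj xi eta T : rel xi T -> rel eta T -> xi = eta.
Proof.
move=> h1 h2; apply/eqP; rewrite -subr_eq0 -nm_eq0 -(rel_nm (relB h1 h2)).
by rewrite (hsn_self h1.1).
Qed.

(** Both [N] and [F] are Lipschitz, so a correspondence that holds on the vectors [Lam y] passes to
    the closed graph. *)
Lemma rel_op (N : L2 L -> L2 L) (F : (circle R -> H2 -> H2) -> circle R -> H2 -> H2) (K : R) :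
  (forall y, rel (N (Lam L y)) (F (Q0 y))) ->
  (forall xi eta, nm (N xi - N eta) <= K * nm (xi - eta)) ->
  (forall T, hsf T -> hsf (F T)) ->
  (forall T S, hsf T -> hsf S -> hn (fun la v => F T la v - F S la v) <= K * hn (fun la v => T la v - S la v)) ->
  forall xi T, rel xi T -> rel (N xi) (F T).
Proof.
move=> h0 h1 h2 h3 xi T [hT aT]; apply: rel_clos; first exact: h2.
move=> e e0; pose K' := `|K| + 1.
have K0 : 0 < K' by rewrite ltr_wpDl.
have KK : K <= K' by apply: le_trans (ler_norm _) _; rewrite lerDl.
have [y [y1 y2]] := aT (e / K') (divr_gt0 e0 K0).
have le_e (r : R) : 0 <= r -> r <= e / K' -> K * r <= e.
  move=> r0 re; apply: (@le_trans _ _ (K' * (e / K'))).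
    by apply: (@le_trans _ _ (K' * r)); [rewrite ler_wpM2r|rewrite ler_wpM2l// ltW].
  by rewrite mulrC divfK// gt_eqF.
exists (N (Lam L y)), (F (Q0 y)); split; first exact: h0.
- by apply: le_trans (h1 _ _) _; apply: le_e => //; exact: nm_ge0.
- apply: le_trans (h3 _ _ (Q0_hsfield y) hT) _; apply: le_e => //; exact: hsn_ge0.
Qed.

Lemma half_small (e : R) : 0 < e -> exists n, 3 * 2^-1 ^+ n <= e.
Proof.
move=> e0; have h : (fun n => 2^-1 ^+ n) @ \oo --> (0 : R).
  by apply: cvg_geo0; [rewrite invr_ge0|rewrite invf_lt1// ltr1n].
have e3 : 0 < e / 3 by rewrite divr_gt0.
have /cvgrPdist_lt /(_ _ e3) [N _ hN] := h; exists N.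
have := hN N (leqnn N); rewrite sub0r normrN ger0_norm ?exprn_ge0 ?invr_ge0//; lra.
Qed.

Lemma rel_ex xi : exists T, rel xi T.
Proof.
(* The rate [8^-n / 2] makes consecutive approximants differ by at most [8^-n], as
   [hsfield_complete] requires. *)
have app n : exists y, nm (Lam L y - xi) <= 2^-1 * 8^-1 ^+ n.
  have : closure (range (Lam L)) xi by rewrite Lam_dense.
  move=> /closure_nm /(_ (2^-1 * 8^-1 ^+ n)) [|_ [y _ <-] h].
    by rewrite mulr_gt0 ?exprn_gt0 ?invr_gt0.
  by exists y; rewrite nmB ltW.
have [y hy] := choice app.
have fast n : hn (fun la v => Q0 (y n.+1) la v - Q0 (y n) la v) <= 8^-1 ^+ n.
  have -> : (fun la v => Q0 (y n.+1) la v - Q0 (y n) la v) = Q0 (-1 *: y n + y n.+1).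
    by rewrite Q0_lin; apply: field_ext => la v; rewrite scaleN1r addrC.
  rewrite Q0_hsn Lam_lin scaleN1r addrC; apply: le_trans (nmBD xi _ _) _.
  have p : 0 <= 8^-1 ^+ n :> R by rewrite exprn_ge0// invr_ge0.
  have h1 := hy n; have h2 := hy n.+1; rewrite nmB in h1.
  have h3 : 8^-1 ^+ n.+1 = 8^-1 * 8^-1 ^+ n :> R by rewrite exprS.
  rewrite h3 in h2; lra.
have [T hT lim] := hsfield_complete phi_basis (fun n => Q0_hsfield (y n)) fast.
exists T; split=> // e e0.
have [n hn1] := half_small e0.
exists (y n); split; last exact: le_trans (lim n) hn1.
apply: le_trans (hy n) _; apply: le_trans hn1.
have h8 : 8^-1 ^+ n <= 2^-1 ^+ n :> R.
  by apply: lerXn2r; rewrite ?nnegrE ?invr_ge0// lef_pV2 ?posrE// ler_nat.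
have p : 0 <= 2^-1 ^+ n :> R by rewrite exprn_ge0// invr_ge0.
by move: h8 p; set u := 8^-1 ^+ n; set w := 2^-1 ^+ n; lra.
Qed.

Lemma lreg_nm y v w : nm (lreg L y v - lreg L y w) <= 2 * nm y * nm (v - w).
Proof.
have rp := lreg_rep; have [lb _ _ _ _] := rp.
by rewrite -(linB (bl_lin (lb y))); exact: rep_nm.
Qed.

Lemma psi_l_hsfield y T : hsf T -> hsf (fun la v => psi2 la y (T la v)) /\
  hn (fun la v => psi2 la y (T la v)) <= 2 * nm y * hn T.
Proof.
move=> hT; apply: (hsfield_mul_l phi_basis (A := fun la => psi2 la y)) => //.
- by rewrite mulr_ge0 ?nm_ge0.
- by move=> la; exact: psi2_bl.
- by move=> la v; exact: rep_nm (psi2_rep la).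
- by move=> n m; exact: psi2_cmeas.
Qed.

Lemma psi_r_hsfield y T : hsf T -> hsf (fun la v => T la (psi2 la y v)) /\
  hn (fun la v => T la (psi2 la y v)) <= 2 * nm y * hn T.
Proof.
move=> hT; apply: (hsfield_mul_r phi_basis (B := fun la => psi2 la y) (Bs := fun la => psi2 la (adj y))) => //.
- by rewrite mulr_ge0 ?nm_ge0.
- by move=> la; exact: psi2_bl.
- by move=> la v w; rewrite (rep_adjE' _ _ _ (psi2_rep la)).
- by move=> la v; apply: le_trans (rep_nm _ _ (psi2_rep la)) _; rewrite nm_adj.
- by move=> n m; exact: psi2_cmeas.
Qed.

Lemma rel_left y xi T : rel xi T -> rel (lreg L y xi) (fun la v => psi2 la y (T la v)).
Proof.
apply: (rel_op (F := fun T la v => psi2 la y (T la v)) (K := 2 * nm y)).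
- move=> z; rewrite lreg_Lam (_ : (fun la v => _) = Q0 (y ** z)); first exact: rel_Lam.
  by apply: field_ext => la v; rewrite /Q0; have [_ _ _ -> _] := psi2_rep la.
- by move=> v w; exact: lreg_nm.
- by move=> S hS; case: (psi_l_hsfield y hS).
- move=> S U hS hU; have [_] := psi_l_hsfield y (hsfieldB phi_basis hS hU).
  rewrite (_ : (fun la v => psi2 la y _) = fun la v => psi2 la y (S la v) - psi2 la y (U la v))//.
  by apply: field_ext => la v; rewrite (linB (bl_lin (psi2_bl la y))).
Qed.

(** * Right multiplication through the modular conjugation *)

Definition rreg (y : G) (xi : L2 L) : L2 L := J (lreg L (adj y) (J xi)).

Lemma rreg_nm y v w : nm (rreg y v - rreg y w) <= 2 * nm y * nm (v - w).
Proof.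
by rewrite /rreg -JB J_nm; apply: le_trans (lreg_nm _ _ _) _; rewrite nm_adj -JB J_nm.
Qed.

Lemma rreg_lin y k v w : rreg y (k *: v + w) = k *: rreg y v + rreg y w.
Proof.
have [lb _ _ _ _] := lreg_rep.
by rewrite /rreg J_semi (bl_lin (lb _)) J_semi conjCK.
Qed.

Lemma rreg_lin_r k y z v : rreg (k *: y + z) v = k *: rreg y v + rreg z v.
Proof.
have [_ lp _ _ _] := lreg_rep.
by rewrite /rreg adjD adjZ lp J_semi conjCK.
Qed.

Lemma wcoef_mul n m (i j : widx n) (k l : widx m) : exists p (r s : widx p),
  [/\ (wcoef i j : G) ** wcoef k l = wcoef r s, wwt r = wwt i + wwt k & wwt s = wwt j + wwt l].
Proof.
elim: n i j => [|n IH] i j /=.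
  by exists m, k, l; rewrite cmul1l !add0r.
have [p [r [s [e h1 h2]]]] := IH i.2 j.2.
by exists p.+1, (i.1, r), (j.1, s); rewrite /= -e cmulA h1 h2 !addrA.
Qed.

Lemma Lam_bl : bounded_linear (Lam L).
Proof.
apply/blP; split; first exact: Lam_lin.
exists 2 => // z; rewrite -Q0_hsn; apply: hsn_le; first by rewrite mulr_ge0 ?nm_ge0.
rewrite Q0_hsI lee_fin ler_pXn2r ?nnegrE ?mulr_ge0 ?nm_ge0//.
rewrite -[z]cmul1r -lreg_Lam; apply: le_trans (rep_nm _ _ lreg_rep) _.
have -> : nm (Lam L cone) = 1.
  apply/eqP; rewrite -(eqrXn2 (_ : 0 < 2)%N) ?nm_ge0// expr1n; apply/eqP.
  by apply: (@complexI R); rewrite -dotpxx Lam_dotp adj1 cmul1l haar1.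
by rewrite mulr1 cmul1r.
Qed.

(** When [y] is a word too, [J_Lam] applies to it and to the product; as weights add up under
    products, only the scalar of the right factor remains. *)
Lemma rreg_wcoef n (i j : widx n) y : rreg (wcoef i j) (Lam L y) =
  (abs_s ^ (wwt i + wwt j))^-1 *: Lam L (y ** wcoef i j).
Proof.
have abR m : Num.conj (abs_s ^ m) = abs_s ^ m.
  by rewrite -(rmorphXz (real_complex R)) ?conj_real// unitfE gt_eqF// sqrtr_gt0 normr_gt0.
have abne m : abs_s ^ m != 0 by rewrite expfz_neq0 ?abs_s_neq0.
set b := wcoef i j; set k := (_ ^ _)^-1.
have bl1 : bounded_linear (fun y => rreg b (Lam L y)).
  apply: bl_comp Lam_bl; apply/blP; split; first by move=> l u w; exact: rreg_lin.
  exists (2 * nm b); first by rewrite mulr_ge0 ?nm_ge0.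
  by move=> v; have := rreg_nm b v 0; rewrite /rreg J0 (lin0 (bl_lin _)) ?J0 ?subr0//; case: lreg_rep.
have bl2 : bounded_linear (fun y => k *: Lam L (y ** b)).
  have /blP[l2 [K K0 hK]] := bl_comp Lam_bl (cmul_bl_l b).
  apply/blP; split; first by move=> l u w; rewrite l2 scalerDr !scalerA mulrC.
  exists (nm k * K); first by rewrite mulr_ge0 ?nm_ge0.
  by move=> v; rewrite nmZ -mulrA ler_wpM2l ?nm_ge0.
apply: (bl_eq_total bl1 bl2 (@words_total R q q0 G)) => _ [m [r [s ->]]].
have [p [r' [s' [e e1 e2]]]] := wcoef_mul r s i j.
have eb : wcoef r s ** b = wcoef r' s' := e.
rewrite /rreg J_Lam (rep_blZ _ _ _ lreg_rep) lreg_Lam -adjM eb JZ abR.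
have -> : Lam L (adj (wcoef r' s')) = (abs_s ^ (wwt r' + wwt s'))^-1 *: J (Lam L (wcoef r' s')).
  by rewrite J_Lam scalerA mulVf ?scale1r.
rewrite JZ J_K scalerA fmorphV /= abR; congr (_ *: _).
have -> : abs_s ^ (wwt r' + wwt s') = abs_s ^ (wwt r + wwt s) * abs_s ^ (wwt i + wwt j).
  by rewrite e1 e2 addrACA expfzDr ?abs_s_neq0.
by rewrite invfM mulrA divff ?mul1r.
Qed.

(** A word shifts the basis by [s], and the eigenvalues of [D^-1] are geometric of ratio [|q|].
    Since [wwt i + wwt j = 2 s], the resulting scalar is the one in [rreg_wcoef]. *)
Lemma dinv_wcoef n (i j : widx n) la v :
  dinv (psi2 la (wcoef i j) v) = (abs_s ^ (wwt i + wwt j))^-1 *: psi2 la (wcoef i j) (dinv v).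
Proof.
set k := (_ ^ _)^-1.
have bl1 : bounded_linear (fun v => dinv (psi2 la (wcoef i j) v)).
  exact: bl_comp dinv_bl (psi2_bl la _).
have bl2 : bounded_linear (fun v => k *: psi2 la (wcoef i j) (dinv v)).
  have /blP[l2 [K K0 hK]] := bl_comp (psi2_bl la (wcoef i j)) dinv_bl.
  apply/blP; split; first by move=> l u w; rewrite l2 scalerDr !scalerA mulrC.
  exists (nm k * K); first by rewrite mulr_ge0 ?nm_ge0.
  by move=> u; rewrite nmZ -mulrA ler_wpM2l ?nm_ge0.
have [_ tot] := phi_basis.
apply: (bl_eq_total bl1 bl2 tot) => _ [m _ <-].
have [s [u [r [h1 h2 hr]]]] := psi2_wcoef i j; have := hr la m%:Z; rewrite /= => e.
rewrite dinv_phi (rep_blZ _ _ _ (psi2_rep la)) e (linZ (bl_lin dinv_bl)) !scalerA.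
case E : (m%:Z - s) => [p|p] /=; last by rewrite (lin0 (bl_lin dinv_bl)) !scaler0.
rewrite dinv_phi scalerA; congr (_ *: _).
have hk : k = ((`|q| ^ (- s))%:C)%C.
  have ha : `|q| \is a GRing.unit by rewrite unitfE normr_eq0.
  rewrite /k h1 h2 (_ : s - u + (s + u) = s + s); last by ring.
  rewrite expfzDr ?abs_s_neq0// -expfzMl -rmorphM -expr2 sqr_sqrtr//.
  by rewrite -invr_expz fmorphV rmorphXz.
have -> : dinv_wt p = `|q| ^ (- s) * dinv_wt m.
  rewrite /dinv_wt mulrCA; congr (_ * _); rewrite !exprnP -expfzDr ?normr_eq0//.
  by congr (_ ^ _); rewrite -E addrC.
rewrite (rmorphM (real_complex R) (`|q| ^ (- s)) (dinv_wt m)) /= -hk; ring.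
Qed.

Lemma rel_right_word n (i j : widx n) xi T : rel xi T ->
  rel (rreg (wcoef i j) xi) (fun la v => T la (psi2 la (wcoef i j) v)).
Proof.
set b := wcoef i j.
apply: (rel_op (F := fun T la v => T la (psi2 la b v)) (K := 2 * nm b)).
- move=> z; rewrite rreg_wcoef.
  rewrite (_ : (fun la v => _) = fun la v => (abs_s ^ (wwt i + wwt j))^-1 *: Q0 (z ** b) la v).
    have := rel_lin (abs_s ^ (wwt i + wwt j))^-1 (rel_Lam (z ** b)) (rel_Lam 0).
    rewrite (lin0 Lam_lin) addr0; congr rel; apply: field_ext => la v.
    by rewrite /Q0 (rep0 _ (psi2_rep la)) addr0.
  apply: field_ext => la v; rewrite /Q0 dinv_wcoef (rep_blZ _ _ _ (psi2_rep la)).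
  by have [_ _ _ -> _] := psi2_rep la.
- by move=> v w; exact: rreg_nm.
- by move=> S hS; case: (psi_r_hsfield b hS).
- by move=> S U hS hU; case: (psi_r_hsfield b (hsfieldB phi_basis hS hU)).
Qed.

(** With [xi] and [T] fixed, both sides are linear and continuous in the algebra element, so words
    suffice. *)
Lemma rel_right b xi T : rel xi T -> rel (rreg b xi) (fun la v => T la (psi2 la b v)).
Proof.
move=> rT; have [hT _] := rT; move: b.
have blT la : bounded_linear (T la) by have [h _ _] := hT; case: (h la).
have step k y z : rel (rreg y xi) (fun la v => T la (psi2 la y v)) ->
    rel (rreg z xi) (fun la v => T la (psi2 la z v)) ->
    rel (rreg (k *: y + z) xi) (fun la v => T la (psi2 la (k *: y + z) v)).
  move=> hy hz; rewrite rreg_lin_r; have := rel_lin k hy hz; congr rel.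
  apply: field_ext => la v; rewrite (repD _ _ _ (psi2_rep la)) (repZ _ _ _ (psi2_rep la)).
  by rewrite -(bl_lin (blT la)).
have word y : words y -> rel (rreg y xi) (fun la v => T la (psi2 la y v)).
  by move=> [n [i [j ->]]]; exact: rel_right_word.
move=> b; pose PP : set G := fun b => rel (rreg b xi) (fun la v => T la (psi2 la b v)).
suff h : (forall z, closure PP z -> PP z) /\ PP 0.
  exact: (@total_ind R G (@words R q G) PP h.2 step h.1 word (@words_total R q q0 G) b).
move: b => _; split; last first.
- have := step (-1) _ _ (word _ (words1 G)) (word _ (words1 G)).
  by rewrite (_ : -1 *: cone + cone = 0 :> G)// scaleN1r addNr.
- move=> y /closure_nm cy; apply: rel_clos; first by case: (psi_r_hsfield y hT).
  move=> e e0; pose K := 2 * (nm xi + 1).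
  have K0 : 0 < K by rewrite mulr_gt0// ltr_wpDl// nm_ge0.
  have [z hz yz] := cy _ (divr_gt0 e0 K0).
  have bnd : 2 * nm (y - z) * nm xi <= e.
    have := ltW yz; rewrite ler_pdivlMr// /K => h; have := nm_ge0 (y - z); lra.
  exists (rreg z xi), (fun la v => T la (psi2 la z v)); split => //.
  + have -> : rreg z xi - rreg y xi = rreg (z - y) xi.
      by rewrite [LHS]addrC -[- rreg y xi]scaleN1r -rreg_lin_r scaleN1r addrC.
    apply: le_trans bnd; rewrite nmB.
    have := rreg_nm (z - y) xi 0; rewrite /rreg J0 (lin0 (bl_lin _)) ?J0 ?subr0 1?nmB//.
    by case: lreg_rep.
  + have [_ h] := psi_r_hsfield (z - y) hT; rewrite (rel_nm rT) in h.
    apply: le_trans bnd; rewrite nmB; apply: le_trans h.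
    rewrite (_ : (fun la v => T la (psi2 la (z - y) v)) =
      fun la v => T la (psi2 la z v) - T la (psi2 la y v))//.
    apply: field_ext => la v; rewrite -(linB (bl_lin (blT la))) (repD _ _ _ (psi2_rep la)).
    by rewrite -[- y]scaleN1r (repZ _ _ _ (psi2_rep la)) scaleN1r.
Qed.

(** * Surjectivity of the transform *)

Definition in_image T := exists xi, rel xi T.
Local Notation E := (elem phi).

(** The transform is isometric, so the preimages of a geometrically convergent sequence of fields
    converge in [L2 L]. *)
Lemma in_image_clos T : hsf T ->
  (forall e : R, 0 < e -> exists S, in_image S /\ hn (fun la v => S la v - T la v) <= e) -> in_image T.
Proof.
move=> hT h.
have p n : 0 < 2^-1 ^+ n :> R by rewrite exprn_gt0// invr_gt0.
have app n : exists xiS : L2 L * (circle R -> H2 -> H2), rel xiS.1 xiS.2 /\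
    hn (fun la v => xiS.2 la v - T la v) <= 2^-1 ^+ n.
  by have [S [[xi rS] hS]] := h _ (p n); exists (xi, S).
have [s hs] := choice app.
have [|||l _ hl] := @geo_complete R (L2 L) (fun n => (s n).1) 2 2^-1; rewrite ?invr_ge0//.
- by rewrite invf_lt1// ltr1n.
- move=> n; have [r1 h1] := hs n; have [r2 h2] := hs n.+1.
  rewrite -(rel_nm (relB r2 r1)); apply: le_trans (hsnBD phi_basis r2.1 hT r1.1) _.
  rewrite exprS in h2; rewrite hsnBC in h1; have pn := p n.
  apply: (@le_trans _ _ (2^-1 * 2^-1 ^+ n + 2^-1 ^+ n)); first exact: lerD.
  have aux (w : R) : 0 < w -> 2^-1 * w + w <= 2 * w by move=> w0; lra.
  exact: aux.
exists l; apply: rel_clos => // e e0.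
have [n hn1] := half_small (divr_gt0 e0 (ltr0n _ 2)).
have [r1 h1] := hs n; exists (s n).1, (s n).2; split => //; have := p n => pn.
- rewrite nmB; apply: le_trans (hl n) _.
  have -> : (1 - 2^-1)^-1 = 2 :> R by field.
  by move: hn1 pn; set u := 2^-1 ^+ n => hn1 pn; lra.
- by apply: le_trans h1 _; move: hn1 pn; set u := 2^-1 ^+ n => hn1 pn; lra.
Qed.

Lemma in_image_lin k T S : in_image T -> in_image S -> in_image (fun la v => k *: T la v + S la v).
Proof. by move=> [xi h1] [eta h2]; exists (k *: xi + eta); exact: rel_lin. Qed.

Lemma in_image0 : in_image (fun _ _ => 0).
Proof.
exists (Lam L 0); have := rel_Lam 0; congr rel; apply: field_ext => la v.
by rewrite /Q0 (rep0 _ (psi2_rep la)).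
Qed.

Lemma in_imageZ k T : in_image T -> in_image (fun la v => k *: T la v).
Proof.
move=> h; have := in_image_lin k h in_image0; congr in_image; apply: field_ext => la v.
by rewrite addr0.
Qed.

Lemma L2n_cst (k : C) : (L2n circ (fun=> k) < +oo)%E.
Proof.
apply: le_lt_trans (ltry (nm k ^+ 2)); apply: L2n_bounded => //; exact: cmeas_cst.
Qed.

(* [x^n] converges strongly to the projection onto the kernel of [1 - x]. *)
Lemma in_image_elem00 : in_image (E 0%N 0%N (fun=> 1)).
Proof.
have hE : hsf (E 0%N 0%N (fun=> 1)).
  by apply: (elem_hsfield phi_basis); [exact: cmeas_cst|exact: L2n_cst].
apply: in_image_clos => // e e0.
(* Dividing by the eigenvalue at [phi 0] makes the difference vanish there; on [phi k] with [k >= 1]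
   its norm is [s0^-1 t^(k n) dinv_wt k], at most [s0^-1 t^n dinv_wt k]. *)
pose s0 := dinv_wt 0; have s00 : 0 < s0 := dinv_wt_gt0 0.
have lim : (fun n => s0^-1 * t ^+ n) @ \oo --> (0 : R).
  rewrite -[X in _ --> X](mulr0 s0^-1); apply: cvgMr; apply: cvg_geo0; first exact: ltW q2_gt0.
  exact: q2_lt1.
have /cvgrPdist_lt /(_ e e0) [n _ hn1] := lim; have := hn1 n (leqnn n).
have p0 : 0 <= s0^-1 * t ^+ n.
  by rewrite mulr_ge0 ?invr_ge0 ?(ltW s00)// exprn_ge0// ltW// q2_gt0.
rewrite sub0r normrN ger0_norm// => hne.
have hQ := hsfieldZ phi_basis ((s0^-1)%:C)%C (Q0_hsfield (cpow x n)).
exists (fun la v => ((s0^-1)%:C)%C *: Q0 (cpow x n) la v); split.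
  by apply: in_imageZ; exists (Lam L (cpow x n)); exact: rel_Lam.
apply: (le_trans _ (ltW hne)); apply: hsn_le => //.
have [_ mD _] := hsfieldB phi_basis hQ hE.
apply: (@le_trans _ _ (\int[circ]_la (cst ((s0^-1 * t ^+ n) ^+ 2)%:E la))%E); last first.
  by rewrite integral_cst//= probability_setT mule1.
apply: ge0_le_integral => //.
- by move=> la _; exact: hs_ge0.
- exact: (mfield_hs phi_basis mD).
move=> la _; rewrite hsE; apply: nneseries_le_bound => [k|N]; first exact: sqr_ge0.
apply: (@le_trans _ _ (\sum_(0 <= k < N) wt_k k * (s0^-1 * t ^+ n) ^+ 2)); last first.
  rewrite -mulr_suml wt_sum ler_piMl ?sqr_ge0// gerBl exprn_ge0// ltW//; exact: q2_gt0.
apply: ler_sum => k _; rewrite /Q0 dinv_phi (rep_blZ _ _ _ (psi2_rep la)) psi2_xn /elem phi_orth.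
case: k => [|k].
  rewrite mul0n expr0 scale1r mulr1 scale1r scalerA -rmorphM mulVf ?gt_eqF// scale1r subrr nm0 expr0n.
  by rewrite mulr_ge0 ?wt_ge0 ?sqr_ge0.
rewrite mul1r scale0r subr0 !scalerA -!rmorphM nmZ (nm_b phi_basis) mulr1 nmR.
rewrite ger0_norm; last first.
  rewrite !mulr_ge0 ?invr_ge0 ?(ltW s00) ?(ltW (dinv_wt_gt0 _))// exprn_ge0// ltW//; exact: q2_gt0.
rewrite -dinv_wt_sq -exprMn ler_pXn2r ?nnegrE; last 2 first.
- rewrite !mulr_ge0 ?invr_ge0 ?(ltW s00) ?(ltW (dinv_wt_gt0 _))// exprn_ge0// ltW//; exact: q2_gt0.
- by rewrite mulr_ge0// ltW// dinv_wt_gt0.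
rewrite [leRHS]mulrCA mulrA ler_wpM2l ?mulr_ge0 ?invr_ge0 ?(ltW s00) ?(ltW (dinv_wt_gt0 _))//.
by rewrite mulSn exprD ler_piMr ?q2k_le1// exprn_ge0// ltW// q2_gt0.
by [].
Qed.

Lemma sqrt_t_neq0 k : ((Num.sqrt (1 - t ^+ k.+1))%:C)%C != 0 :> C.
Proof.
rewrite -(rmorph0 (real_complex R)) (inj_eq (@complexI R)) gt_eqF// sqrtr_gt0 subr_gt0.
by rewrite exprn_ilt1 ?q2_lt1// ltW// q2_gt0.
Qed.

Lemma in_image_left y T : in_image T -> in_image (fun la v => psi2 la y (T la v)).
Proof. by move=> [xi h1]; exists (lreg L y xi); exact: rel_left. Qed.

Lemma in_image_right y T : in_image T -> in_image (fun la v => T la (psi2 la y v)).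
Proof. by move=> [xi h1]; exists (rreg y xi); exact: rel_right. Qed.

Lemma elem_lin j k l (f g : circle R -> C) :
  E j k (fun la => l * f la + g la) = fun la v => l *: E j k f la v + E j k g la v.
Proof. by apply: field_ext => la v; rewrite /elem scalerA -scalerDl mulrDl mulrA. Qed.

Lemma elem_c j k f : (fun la v => psi2 la c (E j k f la v)) =
  fun la v => ((q ^+ j)%:C)%C *: E j k (fun la : circle R => (la : C) * f la) la v.
Proof.
apply: field_ext => la v; rewrite /elem (rep_blZ _ _ _ (psi2_rep la)) psi2_c !scalerA.
by congr (_ *: _); ring.
Qed.

Lemma elem_c' j k f : (fun la v => psi2 la (adj c) (E j k f la v)) =
  fun la v => ((q ^+ j)%:C)%C *: E j k (fun la : circle R => Num.conj (la : C) * f la) la v.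
Proof.
apply: field_ext => la v; rewrite /elem (rep_blZ _ _ _ (psi2_rep la)) psi2_c' !scalerA.
by congr (_ *: _); ring.
Qed.

Lemma qX_neq0 j : ((q ^+ j)%:C)%C != 0 :> C.
Proof. by rewrite -(rmorph0 (real_complex R)) (inj_eq (@complexI R)) expf_neq0. Qed.

Lemma elem_trig_step j k g l (f : circle R -> C) : l != 0 ->
  g = (fun la v => l *: E j k f la v) -> E j k f = fun la v => l^-1 *: g la v.
Proof.
by move=> l0 ->; apply: field_ext => la v; rewrite scalerA mulVf// scale1r.
Qed.

Section ImageInd.
Variable M : set (circle R -> H2 -> H2).
Hypothesis M00 : M (E 0%N 0%N (fun=> 1)).
Hypothesis M_lin : forall k T S, M T -> M S -> M (fun la v => k *: T la v + S la v).
Hypothesis M_left : forall y T, M T -> M (fun la v => psi2 la y (T la v)).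
Hypothesis M_right : forall y T, M T -> M (fun la v => T la (psi2 la y v)).
Hypothesis M_clos : forall T, hsf T -> (forall e : R, 0 < e ->
  exists S, [/\ M S, hsf S & hn (fun la v => S la v - T la v) <= e]) -> M T.

Let M_0 : M (fun _ _ => 0).
Proof.
have := M_lin (-1) M00 M00; congr M; apply: field_ext => la v.
by rewrite scaleN1r addNr.
Qed.

Let MZ k T : M T -> M (fun la v => k *: T la v).
Proof.
move=> h; have := M_lin k h M_0; congr M; apply: field_ext => la v.
by rewrite addr0.
Qed.

(** As [adj alpha] raises the basis vectors, left multiplication by it raises the row index, and
    right multiplication by [alpha] raises the column index. *)
Let M_elem_cst j k : M (E j k (fun=> 1)).
Proof.
elim: k j => [|k IH] j; last first.
  have := MZ (((Num.sqrt (1 - t ^+ k.+1))%:C)%C)^-1 (M_right a (IH j)).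
  congr M; apply: field_ext => la v; rewrite /elem (rep_adjE' _ _ _ (psi2_rep la)) psi2_a'.
  by rewrite dotpZl conj_real scalerA !mul1r mulKf// sqrt_t_neq0.
elim: j => [|j IH]; first exact: M00.
have := MZ (((Num.sqrt (1 - t ^+ j.+1))%:C)%C)^-1 (M_left (adj a) IH).
congr M; apply: field_ext => la v; rewrite /elem (rep_blZ _ _ _ (psi2_rep la)) psi2_a'.
by rewrite !scalerA; congr (_ *: _); have := sqrt_t_neq0 j; move=> ?; field.
Qed.

Let M_elem_trig f : trig f -> forall j k, M (E j k f).
Proof.
elim=> [|l g p _ hg _ hp|g _ hg|g _ hg] j k; first exact: M_elem_cst.
- by rewrite elem_lin; apply: M_lin.
- by rewrite (elem_trig_step (qX_neq0 j) (elem_c j k g)); apply: MZ; exact: M_left.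
- by rewrite (elem_trig_step (qX_neq0 j) (elem_c' j k g)); apply: MZ; exact: M_left.
Qed.

Let M_elem j k f : cmeasurable f -> (L2n circ f < +oo)%E -> M (E j k f).
Proof.
move=> mf fi; have [_ af] := trig_dense mf fi.
have hf := elem_hsfield phi_basis j k mf fi.
apply: M_clos => // e e0; have e2 : 0 < e ^+ 2 by rewrite exprn_gt0.
have [p tp hp] := af _ e2; exists (E j k p); split; first exact: M_elem_trig.
  apply: (elem_hsfield phi_basis); first exact: trig_cmeas.
  have [mp [B hB]] := trig_bmeas tp.
  by apply: le_lt_trans (ltry (B ^+ 2)); exact: L2n_bounded.
rewrite hsnBC; apply: hsn_le; first exact: ltW.
apply: le_trans hp; rewrite -(elem_hsI phi_basis circ j k) le_eqVlt; apply/orP; left; apply/eqP.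
rewrite (_ : (fun la => f la - p la) = fun la => -1 * p la + f la).
  by rewrite elem_lin; congr hsI; apply: field_ext => la v; rewrite scaleN1r addrC.
by apply/funext => la; rewrite mulN1r addrC.
Qed.

(** The class [M] is left general because it is used twice: for the range of the transform, and for
    the fields on which a central operator acts as a multiplier. *)
Lemma image_ind T : hsf T -> M T.
Proof.
apply: (hsfield_ind phi_basis).
- exact: M_0.
- move=> S U hS hU; have := M_lin 1 hS hU; congr M; apply: field_ext => la v.
  by rewrite scale1r.
- move=> S hS h; apply: (M_clos hS) => e e0; have [U [hU hU' h1]] := h e e0.
  by exists U; split; [exact: hU|exact: hU'|rewrite hsnBC].
- exact: M_elem.
Qed.

End ImageInd.

Lemma rel_surj T : hsf T -> in_image T.
Proof.
apply: image_ind.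
- exact: in_image_elem00.
- exact: in_image_lin.
- exact: in_image_left.
- exact: in_image_right.
- move=> S hS h; apply: in_image_clos => // e e0; have [U [hU _ h1]] := h e e0.
  by exists U.
Qed.

(** * The Kac-Takesaki operator and its right slices *)

Local Notation W := (@WG R q G L).
Local Notation Wadj := (@WGadj R q G L).
Local Notation JJ := (@modJJ R q G L).
Local Notation "v *t w" := (tens L v w) (at level 40).

Lemma L2_ind (PP : set (L2 L)) : PP 0 ->
  (forall k v w, PP v -> PP w -> PP (k *: v + w)) -> (forall v, closure PP v -> PP v) ->
  (forall n (i j : widx n), PP (Lam L (wcoef i j))) -> forall v, PP v.
Proof.
move=> P0 PD Pc Pw v; apply: (Pc).
have h y : PP (Lam L y).
  apply: (@total_ind R G (@words R q G) (fun y => PP (Lam L y))); last exact: words_total.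
  - by rewrite (lin0 Lam_lin).
  - by move=> k z z' hz hz'; rewrite Lam_lin; exact: PD.
  - move=> z /closure_seq [u hu uz]; apply: (Pc); apply: seq_closure hu _; exact: bl_cvg Lam_bl uz.
  - by move=> _ [n [i [j ->]]].
have : closure (range (Lam L)) v by rewrite Lam_dense.
by apply: closure_subset => _ [y _ <-].
Qed.

Lemma tens_nm v w : nm (v *t w) = nm v * nm w.
Proof.
apply/eqP; rewrite -(eqrXn2 (_ : 0 < 2)%N) ?mulr_ge0 ?nm_ge0//; apply/eqP.
apply: (@complexI R); have [_ _ h _] := tensP L.
by rewrite -dotpxx h !dotpxx -rmorphM exprMn.
Qed.

Lemma tens_linl w : linear (fun v => v *t w). Proof. by case: (tensP L). Qed.
Lemma tens_linr v : linear (fun w => v *t w). Proof. by case: (tensP L). Qed.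

Lemma tens_cvgl (u : nat -> L2 L) v w : u @ \oo --> v -> (fun n => u n *t w) @ \oo --> v *t w.
Proof.
move=> /cvg_nm uv; apply/cvg_nm; apply: (cvg_seq_eq (u := fun n => nm (u n - v) * nm w)) => [n|].
  by rewrite -tens_nm -(linB (tens_linl w)).
by rewrite -(mul0r (nm w)); apply: cvgMl.
Qed.

Lemma W_lin : linear W. Proof. by have [[]] := WGP L. Qed.
Lemma W_dotp v w : dotp (W v) (W w) = dotp v w. Proof. by have [[]] := WGP L. Qed.

Lemma W_cvg (u : nat -> L2L2 L) v : u @ \oo --> v -> (fun n => W (u n)) @ \oo --> W v.
Proof.
move=> /cvg_nm uv; apply/cvg_nm; apply: cvg_seq_eq uv => n; rewrite -(linB W_lin).
apply/eqP; rewrite -(eqrXn2 (_ : 0 < 2)%N) ?nm_ge0//; apply/eqP.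
by apply: (@complexI R); rewrite -!dotpxx W_dotp.
Qed.

(** The flip in [dual_kac_takesaki] exchanges the legs, so the second leg of the comultiplication
    appears first. *)
Lemma W_comult (I : finType) (f g : I -> G) y z :
  comult y = \sum_l leg1 (f l) ** leg2 (g l) ->
  W (Lam L y *t Lam L z) = \sum_l Lam L (g l) *t Lam L (f l ** z).
Proof.
move=> e; have [_ [LL [fl [bLL LLE [lfl _ _] flE WE]]]] := WGP L.
have [[_ _ l1M _] _ comm _ _] := tens_algP G.
rewrite WE e cmul_suml (lin_sum (bl_lin bLL)) (lin_sum lfl); apply: eq_bigr => l _.
by rewrite -cmulA -comm cmulA -l1M LLE flE.
Qed.

Lemma W_wcoef n (i j : widx n) z : W (Lam L (wcoef i j) *t Lam L z) =
  \sum_k Lam L (wcoef k j) *t Lam L (wcoef i k ** z).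
Proof. by apply: W_comult; exact: wcoef_comult. Qed.

Lemma W_adj_wcoef n (i j : widx n) z : W (Lam L (adj (wcoef i j)) *t Lam L z) =
  \sum_k Lam L (adj (wcoef k j)) *t Lam L (adj (wcoef i k) ** z).
Proof.
apply: W_comult; have [_ _ _ DA] := comult_hom G.
have [[_ _ _ l1A] [_ _ _ l2A] comm _ _] := tens_algP G.
rewrite DA wcoef_comult adj_sum; apply: eq_bigr => k _.
by rewrite adjM -l1A -l2A comm.
Qed.

Lemma abs_s_conj m : Num.conj (abs_s ^ m) = abs_s ^ m.
Proof.
by rewrite -(rmorphXz (real_complex R)) ?conj_real// unitfE gt_eqF// sqrtr_gt0 normr_gt0.
Qed.

(** Instead of computing the adjoint of [W], a preimage is exhibited. By [J_Lam] its vectors are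
    adjoint coefficients; applying [W] produces a double sum, which the unitarity relation
    [wcoef_unit] collapses to [l = i]. *)
Lemma W_J_preimage n (i j : widx n) z :
  W (\sum_k J (Lam L (wcoef k j)) *t Lam L (abs_s ^ (wwt i - wwt k) *: (wcoef k i ** z))) =
  J (Lam L (wcoef i j)) *t Lam L z.
Proof.
rewrite (lin_sum W_lin).
under eq_bigr => k _.
  rewrite J_Lam (linZ Lam_lin) (linZ (tens_linl _)) (linZ (tens_linr _)).
  rewrite !(linZ W_lin) W_adj_wcoef scalerA scaler_sumr.
  over.
rewrite exchange_big /=.
transitivity (\sum_l J (Lam L (wcoef l j)) *t Lam L
    (\sum_k (abs_s ^ (wwt i - wwt l)) *: (adj (wcoef k l) ** wcoef k i ** z))).
  apply: eq_bigr => l _; rewrite (lin_sum Lam_lin) (lin_sum (tens_linr _)); apply: eq_bigr => k _.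
  rewrite J_Lam (linZ (tens_linl _)) (linZ Lam_lin) (linZ (tens_linr _)) scalerA cmulA.
  by rewrite -!expfzDr ?abs_s_neq0//; congr (_ ^ _ *: _); ring.
rewrite (bigD1 i)//= [X in _ + X]big1 ?addr0 => [|l li].
  congr (_ *t Lam L _); rewrite -scaler_sumr -cmul_suml wcoef_unit// eqxx subrr expr0z scale1r.
  by rewrite scale1r cmul1l.
rewrite -scaler_sumr -cmul_suml wcoef_unit// (negbTE li) scale0r cmul0l scaler0.
by rewrite (lin0 Lam_lin) (lin0 (tens_linr _)).
Qed.

Lemma haar_Ra3 y1 y2 y3 :
  h (uantip L y1 ** y2 ** uantip L y3) = h (y3 ** uantip L y2 ** y1).
Proof.
have RP := uantipP L.
by rewrite -haar_Ra !(RaM RP) !(RaK RP) cmulA.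
Qed.

(* The right leg of [W] intertwines the conjugations through the unitary
   antipode; on matrix coefficients this is [W_J_preimage]. *)
Lemma W_JJ k v z1 z2 :
  dotp (J k *t Lam L z2) (W (J v *t Lam L z1)) =
  dotp (v *t Lam L (adj (uantip L z1))) (W (k *t Lam L (adj (uantip L z2)))).
Proof.
have RP := uantipP L; have [_ _ td _] := tensP L.
move: k; apply: L2_ind.
- by rewrite J0 !(lin0 (tens_linl _)) (lin0 W_lin) dotp0l dotp0r.
- move=> l k k' hk hk'.
  rewrite J_semi !(tens_linl _) W_lin dotpDl dotpDr dotpZl dotpZr conjCK hk hk'//.
- move=> k /closure_seq [u hu uk].
  apply: (@cvg_uniq R (R[i]^o) (fun n => dotp (J (u n) *t Lam L z2) (W (J v *t Lam L z1)))).
    by apply: dotp_cvg; [apply: tens_cvgl; exact: J_cvg|exact: cvg_cst].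
  rewrite (_ : (fun n => _) = (fun n => dotp (v *t Lam L (adj (uantip L z1)))
     (W (u n *t Lam L (adj (uantip L z2)))))); last by apply/funext => n; exact: hu.
  by apply: dotp_cvg; [exact: cvg_cst|apply: W_cvg; exact: tens_cvgl].
move=> n i j; rewrite -W_J_preimage W_dotp W_wcoef dotp_suml dotp_sumr.
apply: eq_bigr => k _; rewrite !td J_dotp; congr (_ * _).
rewrite !Lam_dotp adjK adjZ abs_s_conj cmulZl haarZ adjM.
rewrite -(Ra_adj RP z2) cmulA haar_Ra3 (Ra_wcoef q0 RP) cmulZr cmulZl haarZ.
by [].
Qed.

(** The comparison is made on the dense vectors [J (Lam z)]: there [W_JJ] turns the entries of [Y]
    into entries of left multiplication by [lamG om], and [haar_Ra3] identifies these with the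
    entries of [rreg]. *)
Lemma right_slice om Y : is_slice (tens L) om (fun z => JJ (Wadj (JJ z))) Y ->
  forall v, Y v = rreg (uantip L (lamG L om)) v.
Proof.
move=> [bY sY]; set y := lamG L om; have RP := uantipP L.
have [_ sW] := @lamGP R q G L om; have [[JJs JJd JJK] JJt] := @modJJP R q G L.
have JJadj z z' : dotp z (JJ z') = dotp z' (JJ z) by rewrite -[z in LHS]JJK JJd.
have key z1 z2 : dotp (J (Lam L z1)) (Y (J (Lam L z2))) =
    dotp (J (Lam L z1)) (rreg (uantip L y) (J (Lam L z2))).
  have h1 := sY (J (Lam L z1)) (J (Lam L z2)).
  have h2 := sW (Lam L (adj (uantip L z1))) (Lam L (adj (uantip L z2))).
  rewrite -/y in h2.
  have e : (fun m => dotp (bra om m *t J (Lam L z1)) (JJ (Wadj (JJ (ket om m *t J (Lam L z2)))))) =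
      fun m => dotp (bra om m *t Lam L (adj (uantip L z1))) (W (ket om m *t Lam L (adj (uantip L z2)))).
    apply/funext => m; rewrite JJadj !JJt !J_K -(@WGadjP R q G L) W_JJ//.
  rewrite e in h1; rewrite (cvg_uniq h1 h2) lreg_Lam Lam_dotp adjK.
  rewrite /rreg J_dotp J_K lreg_Lam Lam_dotp adjM adjK -(Ra_adj RP z2) cmulA haar_Ra3.
  by [].
have J_dense (PP : set (L2 L)) : (forall v, closure PP v -> PP v) -> (forall z, PP (J (Lam L z))) -> forall v, PP v.
  move=> Pc PJ v; apply: (Pc); have : closure (range (Lam L)) (J v) by rewrite Lam_dense.
  move=> /closure_seq [u hu uv]; rewrite -[v]J_K.
  apply: seq_closure (_ : forall n, PP (J (u n))) _; last exact: J_cvg.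
  by move=> n; have [z _ <-] := hu n.
have brr : bounded_linear (rreg (uantip L y)).
  apply/blP; split; first by move=> l u w; exact: rreg_lin.
  exists (2 * nm (uantip L y)); first by rewrite mulr_ge0 ?nm_ge0.
  move=> v; have := rreg_nm (uantip L y) v 0.
  by rewrite /rreg J0 (lin0 (bl_lin _)) ?J0 ?subr0//; case: lreg_rep.
apply: (J_dense) => [v /closure_seq [u hu uv]|z2].
  have h1 := bl_cvg bY uv; have h2 := bl_cvg brr uv; apply: cvg_uniq h1 _.
  by apply: cvg_seq_eq h2 => n /=; rewrite hu.
apply: dotp_ext => v0.
pose PP : set (L2 L) := fun v => dotp v (Y (J (Lam L z2))) = dotp v (rreg (uantip L y) (J (Lam L z2))).
have hc v : closure PP v -> PP v.
  move=> /closure_seq [u hu uv]; rewrite /PP.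
  apply: (@cvg_uniq R (R[i]^o) (fun n => dotp (u n) (Y (J (Lam L z2))))).
    by apply: dotp_cvg => //; exact: cvg_cst.
  rewrite (_ : (fun n => _) = (fun n => dotp (u n) (rreg (uantip L y) (J (Lam L z2))))).
    by apply: dotp_cvg => //; exact: cvg_cst.
  by apply/funext => n; exact: hu.
exact: (J_dense PP hc (fun z1 => key z1 z2) v0).
Qed.

(** * Central operators as multipliers *)

Lemma hsn_ae T : hsf T -> {ae circ, forall la, forall v, T la v = 0} -> hn T = 0.
Proof.
move=> [_ mT _] h; rewrite /hsn.
have -> : hsI phi circ T = 0%E.
  rewrite /hsI (ae_eq_integral (cst 0%E)) ?integral0//.
    exact: (mfield_hs phi_basis mT).
  by apply: filterS h => la hla _; rewrite hsE eseries0// => n _ _; rewrite hla nm0 expr0n.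
by rewrite sqrtr0.
Qed.

Lemma rel_ae xi T S : rel xi T -> hsf S -> {ae circ, forall la, forall v, T la v = S la v} -> rel xi S.
Proof.
move=> rT hS h; apply: rel_clos => // e e0; exists xi, T; split=> //.
  by rewrite subrr nm0 ltW.
have -> : hn (fun la v => T la v - S la v) = 0; last exact: ltW.
apply: hsn_ae; first exact: (hsfieldB phi_basis rT.1 hS).
by apply: filterS h => la hla v; rewrite hla subrr.
Qed.

(** Here [ni] is the norm of an indicator and [D] bounds the error of replacing it by a
    trigonometric polynomial. With [D = 0] the inequalities give [ni <= K / (K + 1) * ni], which
    forces [ni = 0]; the constants account for [D]. *)
Lemma multiplier_ineq (K e ni u v w p D : R) : 0 <= K -> 0 < e ->
  ni <= u + v -> v <= D -> u <= (K + 1)^-1 * w -> w <= K * p -> p <= ni + D ->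
  D <= e / (2 * (K + 1)) -> ni <= e.
Proof.
move=> K0 e0 h1 h2 h3 h4 h5 h6.
have K1 : 0 < K + 1 by rewrite ltr_wpDl.
have h7 : (K + 1) * ni <= K * (ni + D) + (K + 1) * D.
  have h8 : u + v <= (K + 1)^-1 * (K * (ni + D)) + D.
    apply: lerD => //; apply: le_trans h3 _; rewrite ler_wpM2l ?invr_ge0 ?(ltW K1)//.
    by apply: le_trans h4 _; rewrite ler_wpM2l.
  have := ler_wpM2l (ltW K1) (le_trans h1 h8).
  by rewrite mulrDr mulVKf ?gt_eqF.
have h9 : ni <= (2 * K + 1) * D by move: h7; rewrite !mulrDl !mulrDr !mul1r; lra.
apply: le_trans h9 _; apply: (@le_trans _ _ ((2 * (K + 1)) * (e / (2 * (K + 1))))); last first.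
  by rewrite mulrC divfK// gt_eqF// mulr_gt0.
apply: (@le_trans _ _ ((2 * K + 1) * (e / (2 * (K + 1))))).
  by rewrite ler_wpM2l// addr_ge0// mulr_ge0.
rewrite ler_wpM2r ?divr_ge0 ?(ltW e0) ?mulr_ge0 ?(ltW K1)//; lra.
Qed.

Section Center.
Variable z : L2 L -> L2 L.
Hypothesis z_in : Linfty L z.
Hypothesis z_comm : commutant (Linfty L) z.

Let bz : bounded_linear z. Proof. by case: z_in. Qed.

Lemma rreg_bl y : bounded_linear (rreg y).
Proof.
apply/blP; split; first by move=> l u w; exact: rreg_lin.
exists (2 * nm y); first by rewrite mulr_ge0 ?nm_ge0.
move=> v; have := rreg_nm y v 0.
by rewrite /rreg J0 (lin0 (bl_lin _)) ?J0 ?subr0//; case: lreg_rep.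
Qed.

Let z_lreg y v : z (lreg L y v) = lreg L y (z v).
Proof.
case: z_comm => _; apply; split; first by have [h _ _ _ _] := lreg_rep; exact: h.
by move=> T [_ hT] w; rewrite hT//; exists y.
Qed.

(** [rreg y] lies in the commutant of the left multiplications: on fields the two multiplications
    commute, and [rel_inj] transports this back to [L2 L]. *)
Let z_rreg y v : z (rreg y v) = rreg y (z v).
Proof.
case: z_in => _; apply; split; first exact: rreg_bl.
move=> _ [b _ <-] w; have [T rT] := rel_ex w.
by apply: (rel_inj (rel_right y (rel_left b rT))); exact: (rel_left b (rel_right y rT)).
Qed.

Let e00 : {xi | rel xi (E 0%N 0%N (fun=> 1))}.
Proof. exact: cid in_image_elem00. Qed.
Let eta := sval e00.
Let eta_rel : rel eta (E 0%N 0%N (fun=> 1)) := svalP e00.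

(* [z eta] is fixed by left and right multiplication by [x], whose only fixed
   vector is [phi 0]. *)
Let z_eta : exists f, [/\ cmeasurable f, (L2n circ f < +oo)%E & rel (z eta) (E 0%N 0%N f)].
Proof.
have [S rS] := rel_ex (z eta).
have [hS mS iS] := rS.1.
pose f la := dotp (phi 0%N) (S la (phi 0%N)).
have mf : cmeasurable f by exact: mS.
have fi : (L2n circ f < +oo)%E.
  apply: le_lt_trans iS; apply: ge0_le_integral => //.
  - by move=> la _; rewrite lee_fin sqr_ge0.
  - exact: mnm2.
  - exact: (mfield_hs phi_basis).
  - by move=> la _; exact: hs_entry.
exists f; split; [exact: mf|exact: fi|apply: (rel_ae rS (elem_hsfield phi_basis 0%N 0%N mf fi))].
have l1 : lreg L x eta = eta.
  have e1 : (fun la v => psi2 la x (E 0%N 0%N (fun=> 1) la v)) = E 0%N 0%N (fun=> 1).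
    by apply: field_ext => la v; rewrite /elem (rep_blZ _ _ _ (psi2_rep la)) psi2_x expr0 scale1r.
  have := rel_left x eta_rel; rewrite e1 => h1; exact: rel_inj h1 eta_rel.
have r1 : rreg x eta = eta.
  have e1 : (fun la v => E 0%N 0%N (fun=> 1) la (psi2 la x v)) = E 0%N 0%N (fun=> 1).
    by apply: field_ext => la v; rewrite /elem (rep_adjE' _ _ _ (psi2_rep la)) adj_x psi2_x expr0 scale1r.
  have := rel_right x eta_rel; rewrite e1 => h1; exact: rel_inj h1 eta_rel.
have := rel_left x rS; rewrite -z_lreg l1 => hl.
have := rel_right x rS; rewrite -z_rreg r1 => hr.
have al := rel_uniq hl rS; have ar := rel_uniq hr rS.
move: al ar; apply: filterS2 => la hla hra v.
have tk k : (0 < k)%N -> ((t ^+ k)%:C)%C != 1 :> C.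
  move=> k0; rewrite -(rmorph1 (real_complex R)) (inj_eq (@complexI R)) lt_eqF//.
  by rewrite exprn_ilt1 ?q2_lt1// -?lt0n// ltW// q2_gt0.
have [bS fS] := hS la; have [_ tot] := phi_basis.
have bE : bounded_linear (E 0%N 0%N f la) by have [h _ _] := elem_hsfield phi_basis 0%N 0%N mf fi; case: (h la).
apply: (bl_eq_b bS bE tot) => k; apply: (onb_ext phi_basis) => j.
rewrite /elem dotpZr !phi_orth.
case: k => [|k]; last first.
  have := hra (phi k.+1); rewrite psi2_x (linZ (bl_lin bS)) => /eqP.
  rewrite -subr_eq0 -[X in _ - X]scale1r -scalerBl scaler_eq0 subr_eq0 (negbTE (tk _ _))//= => /eqP ->.
  by rewrite dotp0r mulr0 mul0r.
case: j => [|j]; first by rewrite eqxx !mulr1.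
have := congr1 (dotp (phi j.+1)) (hla (phi 0%N)).
rewrite (rep_adjE' _ _ _ (psi2_rep la)) adj_x psi2_x dotpZl conj_real => /eqP.
rewrite -subr_eq0 -[X in _ - X]mul1r -mulrBl mulf_eq0 subr_eq0 (negbTE (tk _ _))//= => /eqP ->.
by rewrite mulr0.
Qed.

Let trig_fin p f : trig p -> cmeasurable f -> (L2n circ f < +oo)%E ->
  cmeasurable (fun la => p la * f la) /\ (L2n circ (fun la => p la * f la)%R < +oo)%E.
Proof.
move=> tp mf fi; have [mp [B hB]] := trig_bmeas tp.
have mpf : cmeasurable (fun la => p la * f la) by exact: cmeasM.
split=> //; apply: le_lt_trans (L2n_le circ (K := B ^+ 2) _ mpf mf _) _.
- exact: sqr_ge0.
- move=> la; rewrite nmM exprMn ler_wpM2r ?sqr_ge0// ler_pXn2r ?nnegrE ?nm_ge0//.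
  exact: le_trans (nm_ge0 _) (hB la).
- by rewrite lte_mul_pinfty// lee_fin sqr_ge0.
Qed.

(** On row 0 left multiplication by [gamma] is multiplication by [la], because [q^0 = 1], and [z]
    commutes with left multiplications. *)
Let z_trig f p : cmeasurable f -> (L2n circ f < +oo)%E -> rel (z eta) (E 0%N 0%N f) -> trig p ->
  exists xi, rel xi (E 0%N 0%N p) /\ rel (z xi) (E 0%N 0%N (fun la => p la * f la)).
Proof.
move=> mf fi rf; elim=> [|l g p' _ [xi [h1 h2]] _ [xi' [h1' h2']]|g _ [xi [h1 h2]]|g _ [xi [h1 h2]]].
- exists eta; split; first exact: eta_rel.
  have e1 : (fun la => 1 * f la) = f by apply/funext => la; rewrite mul1r.
  rewrite e1; exact: rf.
- exists (l *: xi + xi'); split; first by rewrite elem_lin; exact: rel_lin.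
  rewrite (bl_lin bz) (_ : (fun la => _) = fun la => l * (g la * f la) + p' la * f la).
    by rewrite elem_lin; exact: rel_lin.
  by apply/funext => la; rewrite mulrDl mulrA.
- have q1 : ((q ^+ 0)%:C)%C = 1 :> C by rewrite expr0.
  exists (lreg L c xi); split.
    have := rel_left c h1; rewrite elem_c q1; congr rel; apply: field_ext => la v.
    by rewrite scale1r.
  rewrite z_lreg; have := rel_left c h2; rewrite elem_c q1; congr rel; apply: field_ext => la v.
  by rewrite scale1r /elem mulrA.
- have q1 : ((q ^+ 0)%:C)%C = 1 :> C by rewrite expr0.
  exists (lreg L (adj c) xi); split.
    have := rel_left (adj c) h1; rewrite elem_c' q1; congr rel; apply: field_ext => la v.
    by rewrite scale1r.
  rewrite z_lreg; have := rel_left (adj c) h2; rewrite elem_c' q1; congr rel; apply: field_ext => la v.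
  by rewrite scale1r /elem mulrA.
Qed.

Let N2E f : cmeasurable f -> (L2n circ f < +oo)%E -> (L2n circ f = (hn (E 0%N 0%N f) ^+ 2)%:E)%E.
Proof. by move=> mf fi; rewrite -hsIE elem_hsI. Qed.

(* The multiplier [f] satisfies [|p f| <= K |p|] in L2 for trigonometric [p];
   approximating the indicator of [|f| > K + 1] shows that this set is null. *)
Let f_bounded f : cmeasurable f -> (L2n circ f < +oo)%E -> rel (z eta) (E 0%N 0%N f) ->
  exists2 K : R, 0 <= K & {ae circ, forall la, nm (f la) <= K}.
Proof.
move=> mf fi rf; have [K K0 hK] := bl_bound bz.
exists (K + 1); first by rewrite addr_ge0.
pose B := [set la | K + 1 < nm (f la)].
have mB : measurable B.
  have -> : B = [set la | ((K + 1) ^+ 2)%:E < (nm (f la) ^+ 2)%:E]%E.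
    apply/seteqP; split => la /=; rewrite lte_fin ltr_pXn2r ?nnegrE ?nm_ge0 ?addr_ge0//.
  by rewrite -[X in measurable X]setTI; exact: emeasurable_fun_o_infty measurableT (mnm2 mf) _.
pose i := (fun la => ((\1_B la)%:C)%C : C).
have mi : cmeasurable i by apply: cmeas_real; exact: measurable_indic.
have nmi la : nm (i la) = (la \in B)%:R by rewrite /i nmR indicE ger0_norm.
have ile la : nm (i la) <= 1 by rewrite nmi; case: (la \in B).
have ifin g : cmeasurable g -> (L2n circ g < +oo)%E ->
    cmeasurable (fun la => g la * i la) /\ (L2n circ (fun la => g la * i la)%R < +oo)%E.
  move=> mg gf; have mgi : cmeasurable (fun la => g la * i la) by exact: cmeasM.
  split=> //; apply: le_lt_trans (L2n_le circ (K := 1) _ mgi mg _) _ => //.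
    by move=> la; rewrite nmM mul1r exprMn ler_piMr ?sqr_ge0// exprn_ile1 ?nm_ge0.
  by rewrite mul1e.
have if1 : (L2n circ i < +oo)%E.
  by apply: le_lt_trans (ltry (1 ^+ 2)); exact: L2n_bounded.
pose n2 g := hn (E 0%N 0%N g).
have n2le g g' (k : R) : 0 <= k -> cmeasurable g -> (L2n circ g < +oo)%E -> cmeasurable g' -> (L2n circ g' < +oo)%E ->
    (forall la, nm (g la) <= k * nm (g' la)) -> n2 g <= k * n2 g'.
  move=> k0 mg gf mg' gf' h; apply: hsn_le; first by rewrite mulr_ge0 ?hsn_ge0.
  rewrite (elem_hsI phi_basis circ 0%N 0%N g) exprMn EFinM -(N2E mg' gf').
  apply: (L2n_le circ (sqr_ge0 k) mg mg').
  by move=> la; rewrite -exprMn ler_pXn2r ?nnegrE ?mulr_ge0 ?nm_ge0.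
have n2D g g' : cmeasurable g -> (L2n circ g < +oo)%E -> cmeasurable g' -> (L2n circ g' < +oo)%E ->
    n2 (fun la => g la + g' la) <= n2 g + n2 g'.
  move=> mg gf mg' gf'.
  rewrite /n2 (_ : E 0%N 0%N (fun la => g la + g' la) = fun la v => E 0%N 0%N g la v + E 0%N 0%N g' la v).
    by apply: hsnD => //; exact: elem_hsfield.
  by apply: field_ext => la v; rewrite /elem mulrDl scalerDl.
have n2i : n2 i = 0.
  apply/eqP; rewrite eq_le hsn_ge0 andbT; apply/ler_addgt0Pr => e e0; rewrite add0r.
  pose K' := K + 1; have K'0 : 0 < K' by rewrite ltr_wpDl.
  pose d := e / (2 * K').
  have d0 : 0 < d by rewrite divr_gt0// mulr_gt0.
  have [_ ai] := trig_dense mi if1.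
  have d2 : 0 < d ^+ 2 by rewrite exprn_gt0.
  have [p tp hp] := ai _ d2.
  have mp := trig_cmeas tp.
  have [mp1 pf] := trig_fin tp (@cmeas_cst _ _ (circle R) 1) (L2n_cst 1).
  have pf1 : (L2n circ p < +oo)%E.
    by move: pf; congr (L2n circ _ < _)%E; apply/funext => la; rewrite mulr1.
  have mip : cmeasurable (fun la => i la - p la) by exact: cmeasB.
  have ipf : (L2n circ (fun la => i la - p la)%R < +oo)%E := le_lt_trans hp (ltry _).
  have nip : n2 (fun la => i la - p la) <= d.
    by apply: hsn_le; [exact: ltW|rewrite elem_hsI].
  have [mpi pif] := ifin _ mp pf1.
  have [mipi ipif] := ifin _ mip ipf.
  have [mpf pff] := trig_fin tp mf fi.
  have s1 : n2 i <= n2 (fun la => p la * i la) + n2 (fun la => (i la - p la) * i la).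
    apply: le_trans (n2D _ _ mpi pif mipi ipif); rewrite /n2 le_eqVlt; apply/orP; left; apply/eqP.
    congr (hn (E _ _ _)); apply/funext => la; rewrite -mulrDl addrC subrK.
    by rewrite /i -rmorphM indicE; case: (la \in B); rewrite ?mulr1 ?mulr0.
  have s2 : n2 (fun la => (i la - p la) * i la) <= 1 * n2 (fun la => i la - p la).
    by apply: n2le => // la; rewrite nmM mul1r ler_piMr ?nm_ge0.
  have s3 : n2 (fun la => p la * i la) <= K'^-1 * n2 (fun la => p la * f la).
    apply: n2le => //; first by rewrite invr_ge0 ltW.
    move=> la; rewrite !nmM [leRHS]mulrCA ler_wpM2l ?nm_ge0// nmi.
    case: (boolP (la \in B)) => [|_] /=; last by rewrite mulr_ge0 ?nm_ge0 ?invr_ge0 ?(ltW K'0).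
    by rewrite inE => /ltW h; rewrite mulrC ler_pdivlMr// mul1r.
  have s4 : n2 (fun la => p la * f la) <= K * n2 p.
    have [xi [r1 r2]] := z_trig mf fi rf tp.
    by rewrite /n2 (rel_nm r1) (rel_nm r2).
  have s5 : n2 p <= n2 i + n2 (fun la => i la - p la).
    rewrite (_ : n2 p = n2 (fun la => i la + -1 * (i la - p la))); last first.
      congr (hn (E _ _ _)); apply/funext => la; by rewrite mulN1r opprB addrC subrK.
    have mN : cmeasurable (fun la => -1 * (i la - p la)) by exact: cmeasZ.
    have nN la : nm (-1 * (i la - p la)) = nm (i la - p la) by rewrite mulN1r nmN.
    have fN : (L2n circ (fun la => -1 * (i la - p la))%R < +oo)%E.
      apply: le_lt_trans (L2n_le circ (K := 1) _ mN mip _) _ => //.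
        by move=> la; rewrite nN mul1r.
      by rewrite mul1e.
    apply: le_trans (n2D _ _ mi if1 mN fN) _; rewrite lerD2l -[leRHS]mul1r.
    by apply: n2le => // la; rewrite nN mul1r.
  rewrite mul1r in s2; exact: multiplier_ineq K0 e0 s1 s2 s3 s4 s5 nip.
exists B; split => //; last by move=> la /= /negP; rewrite -ltNge.
have : (L2n circ i = 0)%E by rewrite N2E// -/(n2 i) n2i expr0n.
rewrite /L2n (eq_integral (fun la => (\1_B la)%:E)).
  by rewrite integral_indic// setIT.
by move=> la _; rewrite nmi indicE -natrX; case: (la \in B).
Qed.

(** The function found at the matrix unit is first set to 0 on a null set, so as to be bounded
    everywhere. The fields on which [z] multiplies by it then form a class to which [image_ind]
    applies. *)
Lemma center_multiplier : exists (f : circle R -> C) (K : R), [/\ cmeasurable f,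
  forall la, nm (f la) <= K &
  forall xi T, rel xi T -> rel (z xi) (fun la v => f la *: T la v)].
Proof.
have [f0 [mf0 fi0 rf0]] := z_eta.
have [K K0 aeK] := f_bounded mf0 fi0 rf0.
pose f la := if nm (f0 la) <= K then f0 la else 0.
have fK la : nm (f la) <= K by rewrite /f; case: ifP => // _; rewrite nm0.
have mf : cmeasurable f.
  pose B := [set la | nm (f0 la) <= K].
  have mB : measurable B.
    have -> : B = [set la | (nm (f0 la) ^+ 2)%:E <= (K ^+ 2)%:E]%E.
      by apply/seteqP; split => la /=; rewrite lee_fin ler_pXn2r ?nnegrE ?nm_ge0.
    by rewrite -[X in measurable X]setTI; exact: emeasurable_fun_infty_c measurableT (mnm2 mf0) _.
  rewrite (_ : f = fun la => ((\1_B la)%:C)%C * f0 la).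
    by apply: cmeasM => //; apply: cmeas_real; exact: measurable_indic.
  apply/funext => la; rewrite /f indicE.
  have -> : (la \in B) = (nm (f0 la) <= K) by apply/idP/idP; rewrite inE.
  by case: (_ <= _); rewrite ?mul1r ?mul0r.
have fi : (L2n circ f < +oo)%E by apply: le_lt_trans (ltry (K ^+ 2)); exact: L2n_bounded.
have rf : rel (z eta) (E 0%N 0%N f).
  apply: rel_ae rf0 (elem_hsfield phi_basis _ _ mf fi) _.
  by apply: filterS aeK => la hla v; rewrite /elem /f hla.
have fT T : hsf T -> hsf (fun la v => f la *: T la v) /\ hn (fun la v => f la *: T la v) <= K * hn T.
  move=> hT; apply: (hsfield_mul_l phi_basis (A := fun la v => f la *: v)) => //.
  - move=> la; apply/blP; split; first by move=> k u v; rewrite scalerDr !scalerA mulrC.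
    by exists K => // v; rewrite nmZ ler_wpM2r ?nm_ge0.
  - by move=> la v; rewrite nmZ ler_wpM2r ?nm_ge0.
  - move=> n m; rewrite (_ : (fun la => _) = fun la => dotp (phi n) (phi m) * f la).
      exact: cmeasZ.
    by apply/funext => la; rewrite dotpZr mulrC.
have main T : hsf T -> exists2 xi, rel xi T & rel (z xi) (fun la v => f la *: T la v).
  apply: (image_ind (M := fun T => exists2 xi, rel xi T & rel (z xi) (fun la v => f la *: T la v))).
  - exists eta; first exact: eta_rel.
    have e1 : (fun la v => f la *: E 0%N 0%N (fun=> 1) la v) = E 0%N 0%N f.
      by apply: field_ext => la v; rewrite /elem scalerA mul1r.
    rewrite e1; exact: rf.
  - move=> k S U [xi h1 h2] [xi' h1' h2']; exists (k *: xi + xi'); first exact: rel_lin.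
    rewrite (bl_lin bz); have := rel_lin k h2 h2'; congr rel; apply: field_ext => la v.
    by rewrite scalerDr !scalerA mulrC.
  - move=> y S [xi h1 h2]; exists (lreg L y xi); first exact: rel_left.
    rewrite z_lreg; have := rel_left y h2; congr rel; apply: field_ext => la v.
    by rewrite (rep_blZ _ _ _ (psi2_rep la)).
  - move=> y S [xi h1 h2]; exists (rreg y xi); first exact: rel_right.
    by rewrite z_rreg; exact: (rel_right y h2).
  - move=> S hS h; have [xi rS] := rel_surj hS; exists xi; first exact: rS.
    apply: rel_clos; first by case: (fT _ hS).
    have [Kz Kz0 hKz] := bl_bound bz.
    move=> e e0; pose K' := K + Kz + 1.
    have K'0 : 0 < K' by rewrite ltr_wpDl// addr_ge0.
    have [U [[xi' h1 h2] hU hUS]] := h (e / K') (divr_gt0 e0 K'0).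
    have le_e (r k : R) : 0 <= k -> k <= K' -> r <= e / K' -> k * r <= e.
      move=> k0 kK rK; apply: (@le_trans _ _ (k * (e / K'))); first by rewrite ler_wpM2l.
      by rewrite mulrA ler_pdivrMr// mulrC ler_wpM2l// ltW.
    exists (z xi'), (fun la v => f la *: U la v); split; first exact: h2.
    + rewrite -(linB (bl_lin bz)); apply: le_trans (hKz _) _; apply: le_e => //.
        by rewrite /K' -addrA addrCA lerDl addr_ge0.
      by rewrite -(rel_nm (relB h1 rS)).
    + have [_ h3] := fT _ (hsfieldB phi_basis hU hS).
      rewrite (_ : (fun la v => _) = fun la v => f la *: (U la v - S la v)).
        apply: le_trans h3 _; apply: le_e => //.
        by rewrite /K' -addrA lerDl addr_ge0.
      by apply: field_ext => la v; rewrite scalerBr.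
exists f, K; split; [exact: mf|exact: fK|move=> xi T rT]; have [xi' h1 h2] := main T rT.1.
by rewrite (rel_inj rT h1); exact: h2.
Qed.

End Center.

(** * Assembling the Plancherel data *)

Definition field_of (xi : L2 L) : circle R -> H2 -> H2 := sval (cid (rel_ex xi)).
Lemma field_ofP xi : rel xi (field_of xi). Proof. exact: svalP (cid (rel_ex xi)). Qed.

(** [field_of] chooses a representative for each vector separately, so algebraic identities hold
    only almost everywhere. *)
Definition Qmap (xi : L2 L) (x : Irr R) : Irr_space H1 H2 x -> Irr_space H1 H2 x :=
  match x with inl _ => fun _ => 0 | inr la => field_of xi la end.

Local Notation mu := (@Plancherel_measure R).
Local Notation e_ := (Irr_basis one phi).
Hypothesis one_span : forall v : H1, exists c : R[i], v = c *: one.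

Lemma hs_zero (H : hilbertType R) (b : nat -> H) : hs_norm2 b (fun _ => 0) = 0%E.
Proof. by rewrite hsE eseries0// => n _ _; rewrite nm0 expr0n. Qed.

Lemma bl_zero (H : hilbertType R) : bounded_linear (fun _ : H => 0 : H).
Proof.
by apply/blP; split; [move=> k u v; rewrite scaler0 addr0|exists 0 => // v; rewrite nm0 mul0r].
Qed.

Lemma Qmap_int xi : (\int[mu]_x hs_norm2 (fun n => e_ n x) (Qmap xi (x := x)) =
  (complex.Re (`|xi| ^+ 2))%:E)%E.
Proof.
have [[hT mT iT] _] := field_ofP xi.
rewrite ge0_int_Irr; last 2 first.
- apply: measurable_Irr; last exact: (mfield_hs phi_basis mT).
  by rewrite /=; under eq_fun do rewrite hs_zero; exact: measurable_cst.
- by move=> x; exact: hs_ge0.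
by rewrite ReX2 -(rel_nm (field_ofP xi)) -(hsIE iT).
Qed.

Lemma Qmap_direct xi : hs_direct_integral mu e_ (Qmap xi).
Proof.
have [[hT mT iT] _] := field_ofP xi; split.
- move=> [rho|la] /=; last exact: hT.
  by split; [exact: bl_zero|rewrite hs_zero].
- move=> n m; apply: cmeas_Irr; last exact: mT.
  by rewrite /=; under eq_fun do rewrite dotp0r; exact: cmeas_cst.
- by rewrite Qmap_int ltry.
Qed.

Lemma Qmap_ae xi T : rel xi T -> {ae circ, forall la, forall v, Qmap xi (x := inr la) v = T la v}.
Proof. by move=> rT; exact: rel_uniq (field_ofP xi) rT. Qed.

(** Expresses the norm on a one-dimensional fibre through a single matrix entry. This gives the
    measurability over the first circle that [Qmap_onto] needs to restrict the integral to the
    second. *)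
Lemma Irr_hs_inl (rho : circle R) (S : H1 -> H1) : linear S ->
  hs_norm2 (fun n => e_ n (inl rho)) S = (nm (dotp one (S one)) ^+ 2)%:E.
Proof.
move=> lS; have [k hk] := one_span (S one).
have -> : nm (dotp one (S one)) = nm (S one).
  rewrite hk dotpZr dotpxx nmZ nmM; congr (_ * _).
  have n1 : nm one = 1 by rewrite /nm one_norm.
  by rewrite n1 expr1n nm1.
rewrite hsE; apply: nneseries_cvg; apply: cvg_near_cst; exists 1%N => // n /= n0.
case: n n0 => // n _; rewrite big_nat_recl//= big1 ?addr0// => i _.
by rewrite (lin0 lS) nm0 expr0n.
Qed.

Lemma Qmap_onto T : hs_direct_integral mu e_ T -> exists xi, ae_eq_field mu (Qmap xi) T.
Proof.
move=> [hT mT iT].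
have hT2 : hsf (fun la => T (inr la)).
  have mT2 : mfield phi (fun la => T (inr la)).
    by move=> n m; exact: (cmeas_inr (mT n m)).
  split; [by move=> la; exact: (hT (inr la))|exact: mT2|].
  move: iT; rewrite ge0_int_Irr//; last by move=> x; exact: hs_ge0.
  apply: measurable_Irr; last exact: (mfield_hs phi_basis mT2).
  rewrite (_ : (fun z => _) = fun z : circle R => (nm (dotp one (T (inl z) one)) ^+ 2)%:E).
    by apply/measurable_EFinP; apply: cmeas_nm2; exact: (cmeas_inl (mT 0%N 0%N)).
  apply/funext => z; apply: Irr_hs_inl; have [bT _] := hT (inl z); exact: bl_lin bT.
have [xi rT] := rel_surj hT2; exists xi.
by apply: ae_Irr; exact: Qmap_ae rT.
Qed.

Lemma Qmap_lin k xi eta : ae_eq_field mu (Qmap (k *: xi + eta))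
  (fun x v => k *: Qmap xi v + Qmap eta v).
Proof.
apply: ae_Irr; apply: Qmap_ae; exact: rel_lin (field_ofP xi) (field_ofP eta).
Qed.

Lemma Irr_D_dinv la v w : @Irr_D R q H1 H2 phi (inr la) (v, w) -> dinv w = v.
Proof.
move=> h; apply: (onb_ext phi_basis) => k; have [_ hd _] := dinvP.
rewrite hd (h k) /= mulrA -rmorphM.
have -> : dinv_wt k * ((Num.sqrt (1 - t))^-1 * `|q| ^- k) = 1.
  have s0 : Num.sqrt (1 - t) != 0 by rewrite gt_eqF// sqrtr_gt0 subr_gt0 q2_lt1.
  have k0 : `|q| ^+ k != 0 by rewrite expf_neq0// normr_eq0.
  by rewrite /dinv_wt mulrACA !divff ?mulr1.
by rewrite rmorph1 mul1r.
Qed.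

Lemma Qmap_formula y : {ae mu, forall x,
  hs_mul_inv (fun n => e_ n x) (Irr_D q phi x) (Irr_rep psi1 psi2 x y) (Qmap (Lam L y) (x := x))}.
Proof.
apply: ae_Irr; apply: filterS (Qmap_ae (rel_Lam y)) => la h; split.
  by have [hT _ _] := Qmap_direct (Lam L y); exact: hT (inr la).
by move=> v w hD; rewrite h /Q0 (Irr_D_dinv hD).
Qed.

Lemma Irr_D_positive x : strictly_positive_selfadjoint (Irr_D q phi x : set (Irr_space H1 H2 x * Irr_space H1 H2 x)).
Proof.
case: x => [rho|la]; first exact: identity_positive.
apply: (diag_positive phi_basis) => k.
by rewrite mulr_gt0 ?invr_gt0 ?exprn_gt0 ?normr_gt0// sqrtr_gt0 subr_gt0 q2_lt1.
Qed.

Lemma Irr_D_measurable : measurable_positive_field e_ (Irr_D q phi).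
Proof.
(* The resolvent [(1 + D)^-1] is diagonal with entries [1 / (1 + d k)]. It is the same in all fibres
   of a circle, so its matrix entries are constant there. *)
pose d k : R := (Num.sqrt (1 - t))^-1 * `|q| ^- k.
have d0 k : 0 < d k.
  by rewrite mulr_gt0 ?invr_gt0 ?exprn_gt0 ?normr_gt0// sqrtr_gt0 subr_gt0 q2_lt1.
have r1 k : `|(1 + d k)^-1| <= 1.
  rewrite ger0_norm ?invr_ge0 ?addr_ge0 ?(ltW (d0 k))// invf_le1 ?lerDl ?(ltW (d0 k))//.
  by rewrite addr_gt0.
have [r [_ hr _]] := diag_op phi_basis ler01 r1.
exists (fun x => match x return Irr_space H1 H2 x -> Irr_space H1 H2 x with
  inl _ => fun v => (2^-1 : C) *: v | inr _ => r end); split.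
  move=> [rho|la] v.
    rewrite /= -[X in X - _]scale1r -scalerBl; congr (_ *: _).
    by rewrite [X in X - _](splitr 1) div1r addrK.
  move=> k; rewrite /= dotpBr hr -[X in X - _]mul1r -mulrBl mulrA -rmorphM -(rmorph1 (real_complex R)) -rmorphB.
  congr ((_%:C)%C * _); rewrite -/(d k); have := d0 k => dk.
  by field; rewrite gt_eqF// addr_gt0.
move=> n m; apply: cmeas_Irr.
- exact: (@cmeas_cst _ _ (circle R) (dotp (e_ n (inl point)) ((2^-1 : C) *: e_ m (inl point)))).
- exact: (@cmeas_cst _ _ (circle R) (dotp (phi n) (r (phi m)))).
Qed.

Lemma Irr_field : measurable_hilbert_field e_.
Proof.
have n1 : dotp one one = 1 by rewrite dotpxx /nm one_norm expr1n.
split.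
- move=> n m; apply: cmeas_Irr.
    exact: (@cmeas_cst _ _ (circle R) (dotp (e_ n (inl point)) (e_ m (inl point)))).
  exact: (@cmeas_cst _ _ (circle R) (dotp (phi n) (phi m))).
- move=> [rho|la] n m nm_; last by rewrite /= phi_orth (negbTE nm_).
  rewrite /=; case: n nm_ => [|n]; case: m => [|m] //= _; by rewrite ?dotp0l ?dotp0r.
- move=> [rho|la] n /=; first by case: n => [|n] /=; [right|left].
  by right; rewrite nmE (nm_b phi_basis).
- move=> [rho|la]; last by case: phi_basis.
  apply/seteqP; split=> // v _; apply: subset_closure; have [k ->] := one_span v.
  by apply: lspanZ; apply: lspan_of; exists 0%N.
Qed.

Lemma Irr_rep_measurable y : measurable_operator_field e_ (fun x => Irr_rep psi1 psi2 x y).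
Proof.
move=> n m; apply: cmeas_Irr; last exact: psi2_cmeas.
by case: n => [|n]; case: m => [|m] /=; exact: psi1_cmeas.
Qed.

Lemma Qmap_plancherel : represents_spectrum (Irr_rep psi1 psi2) ->
  plancherel_data mu e_ (Irr_rep psi1 psi2) (Irr_D q phi) Qmap.
Proof.
move=> IrrP; split.
- exact: Plancherel_standard.
- exact: IrrP.
- exact: Irr_field.
- exact: Irr_rep_measurable.
- exact: Irr_D_positive.
- exact: Irr_D_measurable.
- split; [exact: Qmap_direct|exact: Qmap_lin|exact: Qmap_int|exact: Qmap_onto].
- by move=> om; exact: Qmap_formula.
- by move=> om xi; apply: ae_Irr; apply: Qmap_ae; exact: rel_left (field_ofP xi).
- move=> om Y sY xi; apply: ae_Irr; rewrite (right_slice sY xi).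
  by apply: Qmap_ae; exact: rel_right (field_ofP xi).
- move=> z z1 z2; have [f [K [mf fK hf]]] := center_multiplier z1 z2.
  (* The multiplier is extended by 0 to the null circle. *)
  exists (fun x : Irr R => if x is inr la then f la else 0); split.
  + by apply: cmeas_Irr; [exact: cmeas_cst|exact: mf].
  + exists ((K%:C)%C) => -[rho|la]; last by rewrite nmE lecR; exact: fK.
    have [rho0] : exists rho : circle R, True by exists rho.
    by rewrite normr0 -[X in X <= _]/((0%:C)%C) lecR => _; apply: le_trans (fK rho); exact: nm_ge0.
  + by move=> xi; apply: ae_Irr; apply: Qmap_ae; exact: hf (field_ofP xi).
Qed.

End HaarState.

Theorem proposition7p2 (R : realType) (q : R)
    (q_gtN1 : -1 < q) (q_lt1 : q < 1) (q_neq0 : q != 0)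
    (G : SUq2 q) (L : dual_data G)
    (H1 H2 : hilbertType R) (one : H1) (phi : nat -> H2)
    (one_norm : `|one| = 1) (one_span : forall v : H1, exists c : R[i], v = c *: one)
    (phi_basis : orthonormal_basis phi)
    (psi1 : circle R -> G -> H1 -> H1) (psi2 : circle R -> G -> H2 -> H2)
    (psi1P : forall rho, is_psi1 rho (psi1 rho))
    (psi2P : forall la, is_psi2 phi la (psi2 la))
    (IrrP : represents_spectrum (Irr_rep psi1 psi2)) :
  exists Q : L2 L -> forall x : Irr R, Irr_space H1 H2 x -> Irr_space H1 H2 x,
    (forall a : G, {ae (@Plancherel_measure R), forall x,
       hs_mul_inv (fun n => Irr_basis one phi n x) (Irr_D q phi x)
         (Irr_rep psi1 psi2 x a) (Q (Lam L a) x)}) /\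
    plancherel_data (@Plancherel_measure R) (Irr_basis one phi)
      (Irr_rep psi1 psi2) (Irr_D q phi) Q.
Proof.
eexists; split; last exact: (Qmap_plancherel q_gtN1 q_lt1 q_neq0 L one_norm phi_basis psi1P psi2P one_span IrrP).
by move=> y; apply: Qmap_formula.
Qed.
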